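(* Let $\mathsf{D}(x)=\frac{1}{1-x^2}$, $\mathsf{O}_1(x)=\frac{x}{1-x^2}$ and $\mathsf{S}(x)=\sum_{k\ge 12}\dim S_k\,x^k$, and define the coefficients $e_{k,d}$ by $$\sum_{k,d\geq0} e_{k,d}\, x^k y^d=\frac{1}{1-\mathsf{D}(x)\mathsf{O}_1(x)\,y+\mathsf{D}(x)\Big(\sum_{k\ge 4}(\dim M_k)^2x^k\Big)y^2-\mathsf{D}(x)\,x\,\mathsf{S}(x)\,y^3}.$$ Then $$\dim \mathcal{U}(\mathrm{BEKMA})_{k,d}=e_{k,d}\qquad\text{for } d=1,2 \text{ and all } k\ge 0.$$
   Context: $M_k$ and $S_k$ are the spaces of modular forms, resp. cusp forms, of weight $k$ for $\mathrm{SL}_2(\mathbb{Z})$. **Bimoulds.** $\mathrm{BARI}^{\mathrm{pol}}$ is the $\mathbb{Q}$-vector space of sequences $M=(M_d)_{d\ge 1}$ with $M_d=M_d\binom{u_1,\ldots,u_d}{v_1,\ldots,v_d}\in\mathbb{Q}[u_1,v_1,\ldots,u_d,v_d]$ and only finitely many $M_d$ nonzero (set $M_0=0$). Put $w_i=\binom{u_i}{v_i}$, $w=(w_1,\ldots,w_d)$. $M$ is homogeneous of depth $d$ if $M_d$ is its only nonzero component, and homogeneous of weight $k$ if each $M_d$ is homogeneous of degree $k-d$. **Flexions.** For consecutive blocks $w=abc$ define: $\lceil c$ is $c$ with the sum of all $u$'s of $b$ added to the first $u$ of $c$; $a\rceil$ is $a$ with the sum of all $u$'s of $b$ added to the last $u$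 of $a$; $b\rfloor$ is $b$ with the first $v$ of $c$ subtracted from every $v$ of $b$; $\lfloor b$ is $b$ with the last $v$ of $a$ subtracted from every $v$ of $b$. If the relevant neighbouring block is empty, nothing is changed. **The ari bracket.** $mu(A,B)(w_1,\ldots,w_d)=\sum_{j=0}^d A(w_1,\ldots,w_j)B(w_{j+1},\ldots,w_d)$, $lu(A,B)=mu(A,B)-mu(B,A)$, $$arit(B)(A)(w)=\sum_{w=abc,\ b,c\ne\emptyset}A(a\lceil c)B(b\rfloor)-\sum_{w=abc,\ a,b\neq\emptyset}A(a\rceil c)B(\lfloor b),$$ $$ari(A,B)=arit(B)(A)-arit(A)(B)+lu(A,B).$$ $(\mathrm{BARI}^{\mathrm{pol}},ari)$ is a Lie algebra, bigraded by weight and depth. **BEKMA.** Let $\delta(A)\binom{u_1,\ldots,u_d}{v_1,\ldots,v_d}=(u_1v_1+\cdots+u_dv_d)A\binom{u_1,\ldots,u_d}{v_1,\ldots,v_d}$. Let $\xi_{1,0}=(1,0,0,\ldots)$ and, for $n\ge1$, $\xi_{2n+1,0}=(u_1^{2n}+v_1^{2n},0,0,\ldots)$ (all concentrated in depth $1$). $\mathrm{BEKMA}$ is the Lie subalgebra of $(\mathrm{BARI}^{\mathrm{pol}},ari)$ generated by all $\delta^m(\xi_{2n+1,0})$, $m,n\ge0$. $\mathcal{U}(\mathrm{BEKMA})$ is its universal enveloping algebra over $\mathbb{Q}$ with the induced bigrading, and $\mathcal{U}(\mathrm{BEKMA})_{k,d}$ its component of weight $k$ and depth $d$. *)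

(* Defs.v *)
From HB Require Import structures.
From mathcomp Require Import all_boot all_order all_algebra.
From mathcomp Require Import all_classical all_reals all_analysis.
From mathcomp Require Import Rstruct Rstruct_topology complex.
(* The notations of multinomials are incompatible with those of
   mathcomp-analysis, hence mpoly n R for {mpoly R[n]}, etc. *)
From mathcomp Require Import -(notations) monalg.
From mathcomp Require Import -(notations) mpoly.

Set Implicit Arguments.
Unset Strict Implicit.
Unset Printing Implicit Defensive.

Import Order.TTheory GRing.Theory Num.Theory numFieldNormedType.Exports.
Local Open Scope classical_set_scope.
Local Open Scope ring_scope.

(* The image of the subspace S of V in the quotient space V / I has
   dimension n. *)
Definition has_dim_mod (K : fieldType) (V : lmodType K) (I S : set V)
    (n : nat) : Prop :=
  exists b : 'I_n -> V,
    [/\ forall i, S (b i),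
        forall c : 'I_n -> K, I (\sum_i c i *: b i) -> forall i, c i = 0
      & forall v, S v -> exists c : 'I_n -> K, I (v - \sum_i c i *: b i)].

Definition has_dim (K : fieldType) (V : lmodType K) (S : set V) (n : nat) :=
  has_dim_mod [set 0] S n.

(* 0 when S is infinite-dimensional *)
Definition dimension (K : fieldType) (V : lmodType K) (S : set V) : nat :=
  xget 0%N [set n | has_dim S n].

Definition C : numClosedFieldType := complex Rdefinitions.R.

Definition upper_half_plane : set C := [set z | 0 < complex.Im z].

Definition cexp (z : C) : C :=
  Complex (expR (complex.Re z) * cos (complex.Im z))
          (expR (complex.Re z) * sin (complex.Im z)).

(* exp (2 i pi z) *)
Definition nome (z : C) : C := cexp (Complex 0 (2 * pi) * z).

(* Functions on the upper half-plane are represented by their extension by 0,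
   which makes the representation unique. a is the sequence of Fourier
   coefficients of f, so that its existence is holomorphy at infinity. *)
Definition modular_form_with (k : nat) (f : C -> C) (a : nat -> C) : Prop :=
  [/\ forall z, ~ upper_half_plane z -> f z = 0,
      forall z, upper_half_plane z -> derivable (f : C^o -> C^o) z 1,
      forall g : 'M[int]_2, \det g = 1 -> forall z, upper_half_plane z ->
        f (((g 0 0)%:~R * z + (g 0 1)%:~R) / ((g 1 0)%:~R * z + (g 1 1)%:~R))
        = ((g 1 0)%:~R * z + (g 1 1)%:~R) ^+ k * f z
    & forall z, upper_half_plane z ->
        (fun N => \sum_(n < N) a n * nome z ^+ n) @ \oo --> f z].

Definition modular_forms (k : nat) : set (C -> C) :=
  [set f | exists a, modular_form_with k f a].

Definition cusp_forms (k : nat) : set (C -> C) :=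
  [set f | exists2 a, modular_form_with k f a & a 0%N = 0].

Definition dimM (k : nat) : nat := dimension (modular_forms k).
Definition dimS (k : nat) : nat := dimension (cusp_forms k).

(* F k d is the coefficient of x^k y^d *)
Definition pseries := nat -> nat -> int.

Definition psone : pseries := fun k d => ((k == 0) && (d == 0))%N%:R.
Definition psx : pseries := fun k d => ((k == 1) && (d == 0))%N%:R.
Definition psy : pseries := fun k d => ((k == 0) && (d == 1))%N%:R.
Definition psadd (F G : pseries) : pseries := fun k d => F k d + G k d.
Definition psopp (F : pseries) : pseries := fun k d => - F k d.
Definition psmul (F G : pseries) : pseries := fun k d =>
  \sum_(i < k.+1) \sum_(j < d.+1) F i j * G (k - i)%N (d - j)%N.

Declare Scope pseries_scope.
Delimit Scope pseries_scope with PS.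
Bind Scope pseries_scope with pseries.
Notation "1" := psone : pseries_scope.
Notation "F + G" := (psadd F G) : pseries_scope.
Notation "F - G" := (psadd F (psopp G)) : pseries_scope.
Notation "F * G" := (psmul F G) : pseries_scope.

Definition psexp (F : pseries) (n : nat) : pseries := iter n (psmul F) psone.
Notation "F ^+ n" := (psexp F n) : pseries_scope.

(* 1 / F as the geometric series of 1 - F, for F with constant term 1 *)
Definition psinv (F : pseries) : pseries :=
  fun k d => \sum_(n < (k + d).+1) ((1 - F) ^+ n)%PS k d.

Lemma psexp_vanish (G : pseries) n k d :
  G 0%N 0%N = 0 -> (k + d < n)%N -> (G ^+ n)%PS k d = 0.
Proof.
move=> G0; elim: n k d => // n IHn k d kdn.
rewrite [LHS]/(psmul G (psexp G n) k d) /psmul big1// => i _.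
rewrite big1// => j _.
have [ij0|ij0] := posnP (i + j)%N.
  by move/eqP: ij0; rewrite addn_eq0 => /andP[/eqP-> /eqP->]; rewrite G0 mul0r.
rewrite IHn ?mulr0//.
have ik : (i <= k)%N by rewrite -ltnS.
have jd : (j <= d)%N by rewrite -ltnS.
rewrite -(ltn_add2r (i + j)) addnACA !subnK//.
by apply: leq_trans kdn _; rewrite -addn1 leq_add2l.
Qed.

Lemma psmulV (F : pseries) : F 0%N 0%N = 1 -> (F * psinv F)%PS = psone.
Proof.
move=> F1; apply/funext => k; apply/funext => d.
pose G : pseries := (1 - F)%PS.
have G0 : G 0%N 0%N = 0 by rewrite /G /psadd /psopp F1 subrr.
transitivity (\sum_(n < (k + d).+1) psmul F (psexp G n) k d).
  rewrite /psmul exchange_big/=; under [RHS]eq_bigr do rewrite exchange_big/=.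
  rewrite [RHS]exchange_big/=; apply: eq_bigr => j _.
  rewrite [RHS]exchange_big/=; apply: eq_bigr => i _.
  rewrite -mulr_sumr; congr (_ * _); rewrite /psinv -/G.
  have ij : ((k - i + (d - j)).+1 <= (k + d).+1)%N.
    by rewrite ltnS leq_add ?leq_subr.
  rewrite (big_ord_widen _ (fun n => psexp G n (k - i)%N (d - j)%N) ij).
  rewrite [RHS](bigID (fun n : 'I__ => (n < (k - i + (d - j)).+1)%N))/=.
  rewrite [X in _ = _ + X]big1 ?addr0// => n; rewrite -leqNgt => nij.
  exact: psexp_vanish.
have FG n : psmul F (psexp G n) k d = psexp G n k d - psexp G n.+1 k d.
  have -> : psexp G n k d = psmul psone (psexp G n) k d.
    rewrite /psmul !big_ord_recl/= !big1 ?addr0.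
    - by rewrite mul1r !subn0.
    - by move=> i _; rewrite big1// => j _; rewrite mul0r.
    - by move=> i _; rewrite mul0r.
  rewrite -[psexp G n.+1]/(psmul G (psexp G n)) /psmul -sumrB.
  apply: eq_bigr => i _; rewrite -sumrB; apply: eq_bigr => j _.
  by rewrite -mulrBl /G /psadd /psopp opprB addrC subrK.
under eq_bigr do rewrite FG.
rewrite -(big_mkord xpredT (fun n => psexp G n k d - psexp G n.+1 k d)).
rewrite (telescope_sumr_eq (fun n => - psexp G n k d))// => [|n _].
  by rewrite psexp_vanish// oppr0 add0r opprK.
by rewrite opprK addrC.
Qed.

Definition serD : pseries := psinv (1 - psx ^+ 2).
Definition serO1 : pseries := psx * serD.
Definition serM2 : pseries :=
  fun k d => if (4 <= k)%N && (d == 0)%N then ((dimM k) ^ 2)%N%:Z else 0.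
Definition serS : pseries :=
  fun k d => if (12 <= k)%N && (d == 0)%N then (dimS k)%:Z else 0.

Definition e_coef : pseries :=
  psinv (1 - serD * serO1 * psy + serD * serM2 * psy ^+ 2
           - serD * psx * serS * psy ^+ 3).

(* The first d variables of mpoly (d + d) rat are u_1, ..., u_d and the last d
   ones are v_1, ..., v_d. *)
Definition uvar (d : nat) (i : 'I_d) : mpoly (d + d) rat :=
  mpolyX rat (mnm1 (lshift d i)).
Definition vvar (d : nat) (i : 'I_d) : mpoly (d + d) rat :=
  mpolyX rat (mnm1 (rshift d i)).

Definition bimould : Type := forall d : nat, mpoly (d + d) rat.

HB.instance Definition _ := gen_eqMixin bimould.
HB.instance Definition _ := gen_choiceMixin bimould.

Section BimouldModule.
Implicit Types (A B : bimould) (c : rat).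

Definition bm_zero : bimould := fun d => 0.
Definition bm_opp A : bimould := fun d => - A d.
Definition bm_add A B : bimould := fun d => A d + B d.
Definition bm_scale c A : bimould := fun d => c *: A d.

Lemma bimouldP A B : (forall d, A d = B d) -> A = B.
Proof. exact: functional_extensionality_dep. Qed.

Fact bm_addA : associative bm_add.
Proof. by move=> A B D; apply: bimouldP => d; exact: addrA. Qed.
Fact bm_addC : commutative bm_add.
Proof. by move=> A B; apply: bimouldP => d; exact: addrC. Qed.
Fact bm_add0 : left_id bm_zero bm_add.
Proof. by move=> A; apply: bimouldP => d; exact: add0r. Qed.
Fact bm_addN : left_inverse bm_zero bm_opp bm_add.
Proof. by move=> A; apply: bimouldP => d; exact: addNr. Qed.

HB.instance Definition _ :=
  GRing.isZmodule.Build bimould bm_addA bm_addC bm_add0 bm_addN.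

Fact bm_scaleA a b A : bm_scale a (bm_scale b A) = bm_scale (a * b) A.
Proof. by apply: bimouldP => d; exact: scalerA. Qed.
Fact bm_scale1 : left_id 1 bm_scale.
Proof. by move=> A; apply: bimouldP => d; exact: scale1r. Qed.
Fact bm_scaleDr : right_distributive bm_scale +%R.
Proof. by move=> c A B; apply: bimouldP => d; exact: scalerDr. Qed.
Fact bm_scaleDl A : {morph bm_scale^~ A : a b / a + b}.
Proof. by move=> a b; apply: bimouldP => d; exact: scalerDl. Qed.

HB.instance Definition _ := GRing.Zmodule_isLmodule.Build rat bimould
  bm_scaleA bm_scale1 bm_scaleDr bm_scaleDl.

End BimouldModule.

Section Flexions.
Variable n : nat.
Local Notation P := (mpoly n rat).
Implicit Types a b c w : seq (P * P).

Definition usum b : P := \sum_(x <- b) x.1.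

Definition add_first_u (s : P) c :=
  if c is x :: c' then (x.1 + s, x.2) :: c' else [::].

Definition add_last_u (s : P) a := rev (add_first_u s (rev a)).

Definition sub_v (s : P) b := [seq (x.1, x.2 - s) | x <- b].

(* lceil b c = "⌈c", rceil a b = "a⌉", rfloor b c = "b⌋", lfloor a b = "⌊b" *)
Definition lceil b c := add_first_u (usum b) c.
Definition rceil a b := add_last_u (usum b) a.
Definition rfloor b c := sub_v (head (0, 0) c).2 b.
Definition lfloor a b := sub_v (last (0, 0) a).2 b.

(* A(w): substitution of the letters of w in the component of A of depth
   size w *)
Definition bm_eval (A : bimould) w : P :=
  comp_mpoly
    (mktuple (fun i : 'I_(size w + size w) =>
       match fintype.split i with
       | inl j => (nth (0, 0) w j).1
       | inr j => (nth (0, 0) w j).2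
       end))
    (A (size w)).

(* In the sums below, w = abc with a = take i w, b = block i j w and
   c = drop j w. *)
Definition block (i j : nat) w := drop i (take j w).

Definition mu_at (A B : bimould) w : P :=
  \sum_(j < (size w).+1) bm_eval A (take j w) * bm_eval B (drop j w).

Definition arit_at (B A : bimould) w : P :=
  \sum_(i < (size w).+1) \sum_(j < (size w).+1 | (i < j < size w)%N)
    bm_eval A (take i w ++ lceil (block i j w) (drop j w))
    * bm_eval B (rfloor (block i j w) (drop j w))
  - \sum_(i < (size w).+1) \sum_(j < (size w).+1 | (0 < i < j)%N)
    bm_eval A (rceil (take i w) (block i j w) ++ drop j w)
    * bm_eval B (lfloor (take i w) (block i j w)).

End Flexions.

(* (w_1, ..., w_d) *)
Definition gword (d : nat) : seq (mpoly (d + d) rat * mpoly (d + d) rat) :=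
  [seq (uvar i, vvar i) | i <- enum 'I_d].

Definition bm_mu (A B : bimould) : bimould := fun d => mu_at A B (gword d).
Definition bm_lu (A B : bimould) : bimould := bm_mu A B - bm_mu B A.
Definition bm_arit (B A : bimould) : bimould := fun d => arit_at B A (gword d).
Definition bm_ari (A B : bimould) : bimould :=
  bm_arit B A - bm_arit A B + bm_lu A B.

Definition bm_delta (A : bimould) : bimould :=
  fun d => (\sum_(i < d) uvar i * vvar i) * A d.

Definition bari : {pred bimould} := fun M =>
  `[< M 0%N = 0 /\ exists N, forall d, (N <= d)%N -> M d = 0 >].

Lemma bariP (M : bimould) :
  reflect (M 0%N = 0 /\ exists N, forall d, (N <= d)%N -> M d = 0)
          (M \in bari).
Proof. exact: asboolP. Qed.

Fact bari_submod_closed : submod_closed bari.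
Proof.
split=> [|c A B /bariP[A0 [N AN]] /bariP[B0 [N' BN]]].
  by apply/bariP; split => //; exists 0%N.
apply/bariP; split.
  by rewrite -[LHS]/(c *: A 0%N + B 0%N) A0 B0 scaler0 addr0.
exists (maxn N N') => d; rewrite geq_max => /andP[Nd N'd].
by rewrite -[LHS]/(c *: A d + B d) AN// BN// scaler0 addr0.
Qed.

HB.instance Definition _ :=
  GRing.isSubmodClosed.Build rat bimould bari bari_submod_closed.

Record BARI : Type := MkBARI { bari_val :> bimould; _ : bari_val \in bari }.

HB.instance Definition _ := [isSub for bari_val].
HB.instance Definition _ := [Choice of BARI by <:].
HB.instance Definition _ := [SubChoice_isSubLmodule of BARI by <:].

Section Closure.

Lemma size_gword d : size (gword d) = d.
Proof. by rewrite size_map size_enum_ord. Qed.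

Lemma size_lceil n (b c : seq (mpoly n rat * mpoly n rat)) :
  size (lceil b c) = size c.
Proof. by case: c. Qed.

Lemma size_rceil n (a b : seq (mpoly n rat * mpoly n rat)) :
  size (rceil a b) = size a.
Proof.
rewrite /rceil /add_last_u size_rev -[RHS]size_rev.
by case: (rev a).
Qed.

Lemma size_sub_v n s (b : seq (mpoly n rat * mpoly n rat)) :
  size (sub_v s b) = size b.
Proof. exact: size_map. Qed.

Lemma bm_eval0 n (A : bimould) (w : seq (mpoly n rat * mpoly n rat)) :
  A (size w) = 0 -> bm_eval A w = 0.
Proof. by rewrite /bm_eval => ->; rewrite comp_mpoly0. Qed.

Lemma bm_evalM0 n (A B : bimould) N N'
    (w w' : seq (mpoly n rat * mpoly n rat)) :
  (forall d, (N <= d)%N -> A d = 0) -> (forall d, (N' <= d)%N -> B d = 0) ->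
  (N + N' <= size w + size w')%N -> bm_eval A w * bm_eval B w' = 0.
Proof.
move=> AN BN ww'.
have [/AN/bm_eval0-> | wN] := leqP N (size w); first by rewrite mul0r.
have [/BN/bm_eval0-> | w'N] := leqP N' (size w'); first by rewrite mulr0.
have := leq_add wN (ltnW w'N); rewrite addSn => /(leq_ltn_trans ww').
by rewrite ltnn.
Qed.

Lemma size_block n i j (w : seq (mpoly n rat * mpoly n rat)) :
  (j <= size w)%N -> size (block i j w) = (j - i)%N.
Proof. by move=> jw; rewrite size_drop size_takel. Qed.

Lemma bm_mu_bari (A B : BARI) : bm_mu A B \in bari.
Proof.
case: A B => A /= /bariP[A0 [N AN]] [B /= /bariP[B0 [N' BN]]].
apply/bariP; split.
  rewrite /bm_mu /mu_at size_gword big1// => j _.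
  by rewrite bm_eval0 ?mul0r// size_take size_gword; case: ltnP => //; case: j => -[].
exists (N + N')%N => d Nd; rewrite /bm_mu /mu_at size_gword big1// => j _.
apply: (bm_evalM0 AN BN); apply: leq_trans Nd _.
by rewrite -size_cat cat_take_drop size_gword.
Qed.

Lemma bm_arit_bari (A B : BARI) : bm_arit B A \in bari.
Proof.
case: A B => A /= /bariP[A0 [N AN]] [B /= /bariP[B0 [N' BN]]].
apply/bariP; split.
  rewrite /bm_arit /arit_at size_gword !big1 ?subr0// => i _.
    by apply: big1 => j; case: i => -[].
  by apply: big1 => j; rewrite ltn0 andbF.
exists (N + N')%N => d Nd; rewrite /bm_arit /arit_at size_gword.
rewrite !big1 ?subr0// => i _; apply: big1 => j /andP[ij jd]; last first;
    apply: (bm_evalM0 AN BN); apply: leq_trans Nd _.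
- have jd' : (j <= size (gword d))%N by rewrite size_gword ltnW.
  rewrite size_cat size_lceil size_sub_v size_block// size_drop size_gword.
  rewrite size_takel; last exact: leq_trans (ltnW ij) jd'.
  by rewrite addnAC subnKC ?(ltnW ij)// subnKC// ltnW.
- have jd' : (j <= size (gword d))%N by rewrite size_gword -ltnS.
  rewrite size_cat size_rceil size_sub_v size_block// size_drop size_gword.
  rewrite size_takel; last exact: leq_trans (ltnW jd) jd'.
  by rewrite addnAC subnKC ?(ltnW jd)// subnKC// -ltnS.
Qed.

Lemma bm_ari_bari (A B : BARI) : bm_ari A B \in bari.
Proof.
by rewrite /bm_ari /bm_lu rpredD// rpredB// ?bm_arit_bari// bm_mu_bari.
Qed.

Lemma bm_delta_bari (A : BARI) : bm_delta A \in bari.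
Proof.
case: A => A /= /bariP[A0 [N AN]]; apply/bariP; split.
  by rewrite /bm_delta A0 mulr0.
by exists N => d Nd; rewrite /bm_delta AN// mulr0.
Qed.

End Closure.

Definition ari (A B : BARI) : BARI := MkBARI (bm_ari_bari A B).
Definition delta (A : BARI) : BARI := MkBARI (bm_delta_bari A).

(* M is homogeneous of weight k and of depth d; the component of depth i is
   homogeneous of degree k - i, hence zero when i > k. *)
Definition bihomogeneous (k d : nat) (M : BARI) : Prop :=
  (forall i, i <> d -> bari_val M i = 0)
  /\ (forall i, {in msupp (bari_val M i), forall m, (mdeg m + i)%N = k}).

(* xi_poly n and xi n correspond to xi_{2n+1,0}, which is not u^0 + v^0 = 2 for
   n = 0. *)
Definition xi_poly (n : nat) : mpoly (1 + 1) rat :=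
  if n is 0 then 1 else uvar ord0 ^+ (2 * n) + vvar ord0 ^+ (2 * n).

Definition bm_xi (n : nat) : bimould :=
  fun d => match d with 1 => xi_poly n | _ => 0 end.

Lemma bm_xi_bari n : bm_xi n \in bari.
Proof. by apply/bariP; split=> //; exists 2%N => -[|[]]. Qed.

Definition xi (n : nat) : BARI := MkBARI (bm_xi_bari n).

Inductive in_bekma : BARI -> Prop :=
| in_bekma_gen m n : in_bekma (iter m delta (xi n))
| in_bekma_zero : in_bekma 0
| in_bekma_lin c A B : in_bekma A -> in_bekma B -> in_bekma (c *: A + B)
| in_bekma_ari A B : in_bekma A -> in_bekma B -> in_bekma (ari A B).

Definition bekma : {pred BARI} := fun M => `[< in_bekma M >].

Fact bekma_submod_closed : submod_closed bekma.
Proof.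
split=> [|c A B /asboolP hA /asboolP hB]; apply/asboolP.
  exact: in_bekma_zero.
exact: in_bekma_lin.
Qed.

HB.instance Definition _ :=
  GRing.isSubmodClosed.Build rat BARI bekma bekma_submod_closed.

Record BEKMA : Type := MkBEKMA { bekma_val :> BARI; _ : bekma_val \in bekma }.

HB.instance Definition _ := [isSub for bekma_val].
HB.instance Definition _ := [Choice of BEKMA by <:].
HB.instance Definition _ := [SubChoice_isSubLmodule of BEKMA by <:].

Lemma bekma_ari_closed (A B : BEKMA) : ari A B \in bekma.
Proof.
by apply/asboolP/in_bekma_ari; apply/asboolP; [case: A | case: B].
Qed.

Definition bekma_bracket (A B : BEKMA) : BEKMA :=
  MkBEKMA (bekma_ari_closed A B).

Section Enveloping.
Variables (L : lmodType rat) (bracket : L -> L -> L).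

(* the free associative algebra on the set L *)
Definition free_alg : lalgType rat := malg (fmonom L) rat.

Definition letter (x : L) : free_alg := mkmalgU (fmu x) 1.

(* The two-sided ideal I such that free_alg / I is the universal enveloping
   algebra of L: the relations letter_lin turn free_alg into the tensor
   algebra of the vector space L. *)
Inductive enveloping_ideal : set free_alg :=
| letter_lin c x y :
    enveloping_ideal (letter (c *: x + y) - (c *: letter x + letter y))
| letter_bracket x y :
    enveloping_ideal
      (letter x * letter y - letter y * letter x - letter (bracket x y))
| ideal_add p q :
    enveloping_ideal p -> enveloping_ideal q -> enveloping_ideal (p + q)
| ideal_mul p q r : enveloping_ideal q -> enveloping_ideal (p * q * r).

Variable homogeneous : nat -> nat -> set L.

(* The image in free_alg / I of the subspace below is the component of weight
   k and depth d for the bigrading induced by that of L. *)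
Inductive enveloping_graded : nat -> nat -> set free_alg :=
| graded_one : enveloping_graded 0 0 1
| graded_letter k d x :
    homogeneous k d x -> enveloping_graded k d (letter x)
| graded_mul k d k' d' p q :
    enveloping_graded k d p -> enveloping_graded k' d' q ->
    enveloping_graded (k + k') (d + d') (p * q)
| graded_zero k d : enveloping_graded k d 0
| graded_lin k d c p q :
    enveloping_graded k d p -> enveloping_graded k d q ->
    enveloping_graded k d (c *: p + q).

Definition has_dim_enveloping (k d n : nat) : Prop :=
  has_dim_mod enveloping_ideal (enveloping_graded k d) n.

End Enveloping.

(* dim U(BEKMA)_{k,d} = n *)
Definition has_dim_U_BEKMA (k d n : nat) : Prop :=
  has_dim_enveloping bekma_bracket
    (fun k d (M : BEKMA) => bihomogeneous k d M) k d n.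

(* Main.v *)
(** In depth 1 the dimensions count the generators delta^m(xi_{2n+1,0}). In depth
    2 the enveloping algebra is spanned by the words X Y in the generators,
    and sending X Y to its symmetrization and half of its bracket identifies
    the relations with the antisymmetric F in the span of the products X(w1)
    Y(w2) such that F + F.T + F.T^2 = 0 for the substitution T of order 3 that
    occurs in the ari bracket. In terms of the matrix Z = [[v2, v1], [u1,
    -u2]] the symmetries of F are left and right multiplications of Z by
    unimodular matrices and transposition. Modulo det Z, a form of degree N is
    tr (M D rho_N(Z)) for a unique matrix M, D being diagonal with binomial
    entries, and the conditions on F say that M is symmetric with rows in the
    spaces of even and odd period polynomials of degree N; as these have
    dimensions p - 1 and p in some order for p = dim M_{N+2}, such M form a
    space of dimension p^2. The forms divisible by det Z reproduce the problem
    in degree N - 2, which accounts for the factor 1 / (1 - x^2) in front of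
    the sum of (dim M_k)^2 x^k.

    The dimensions of the spaces of period polynomials are traces of
    idempotents. For dim M_k, a cusp form of weight k < 12 vanishes by
    Schwarz's lemma and reduction theory; the second Rankin-Cohen bracket of
    Delta with itself has weight 28 and vanishes to high order at infinity, so
    it is a multiple of E_4 Delta^2, which shows that Delta has no zeros;
    Eisenstein series come from Lipschitz' formula. *)

From HB Require Import structures.
From mathcomp Require Import all_boot all_order all_algebra.
From mathcomp Require Import Rstruct Rstruct_topology.
From mathcomp Require Import -(notations) monalg.
From mathcomp Require Import -(notations) mpoly.
From mathcomp Require Import all_classical all_reals all_analysis.
From mathcomp Require Import complex.
From mathcomp Require Import ring lra zify.
From mathcomp Require cyclic separable cyclotomic.
Require Import Defs.

Set Implicit Arguments.
Unset Strict Implicit.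
Unset Printing Implicit Defensive.

Import Order.TTheory GRing.Theory Num.Theory numFieldNormedType.Exports.
Local Open Scope classical_set_scope.
Local Open Scope ring_scope.

(** The valence formula, which rests on contour integration, is avoided: all function theory is that
    of power series on the open unit disc, where averages over roots of unity replace Cauchy's
    integral formula. For dim M_k it suffices that a form without constant term can be divided by
    Delta, so Delta / q must have no zero in the disc and its reciprocal must converge in the whole
    disc. The vanishing theorem behind this asks for an order m at infinity with 5 k < 51 m, where
    51/5 = 4 * 3 * 17/20 comes from pi >= 3 and the height 17/20 in reduction theory; weight 28 and
    order 3 satisfy it. In depth 2 the enveloping ideal might a priori contain more than the visible
    relations. Instead of the Poincare-Birkhoff-Witt theorem, an explicit homomorphism from the free
    algebra to an algebra Q + P1 + P2 kills the ideal and still separates words as far as needed. As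
    e_{k,1} counts generators, e_{k,2} is the number of pairs of generators of total weight k minus
    a coefficient of D times the series of squares, which therefore has to be the dimension of the
    space of relations. *)

(** * Sequences and series of complex numbers *)

Section ComplexSequences.
Variable R : realType.
Local Notation C := (complex R).
Implicit Types (z w l : C) (u v a : nat -> C) (b : nat -> R).

(** The norm [|z|] is itself an element of [C]; a modulus with values in [R] gives access to suprema
    and to real arithmetic. *)
Definition nm (z : C) : R := Normc.normc z.

Lemma nmE z : `|z| = (nm z)%:C%C.
Proof. by []. Qed.

Lemma nm_ge0 z : 0 <= nm z.
Proof. by rewrite -lecR -nmE normr_ge0. Qed.

Lemma nm0 : nm 0 = 0. Proof. exact: Normc.normc0. Qed.
Lemma nm1 : nm 1 = 1. Proof. exact: Normc.normc1. Qed.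
Lemma nmM z w : nm (z * w) = nm z * nm w.
Proof. exact: Normc.normcM. Qed.
Lemma nmV z : nm z^-1 = (nm z)^-1.
Proof. exact: Normc.normcV. Qed.
Lemma nmN z : nm (- z) = nm z.
Proof. by apply: (@complexI R); rewrite -!nmE normrN. Qed.
Lemma nmX z n : nm (z ^+ n) = nm z ^+ n.
Proof. by elim: n => [|n IHn]; rewrite ?nm1// !exprS nmM IHn. Qed.
Lemma nmD z w : nm (z + w) <= nm z + nm w.
Proof. by rewrite -lecR rmorphD/= -!nmE ler_normD. Qed.
Lemma nm_eq0 z : (nm z == 0) = (z == 0).
Proof.
apply/eqP/eqP => [|->]; last exact: nm0.
exact: Normc.eq0_normc.
Qed.
Lemma nm_gt0 z : (0 < nm z) = (z != 0).
Proof. by rewrite lt_neqAle nm_ge0 andbT eq_sym nm_eq0. Qed.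
Lemma nm_real (x : R) : nm x%:C%C = `|x|.
Proof. by rewrite /nm /= expr0n addr0 sqrtr_sqr. Qed.
Lemma nm_nat n : nm n%:R = n%:R.
Proof. by rewrite -(rmorph_nat (real_complex R)) nm_real normr_nat. Qed.
Lemma nm_sum I (r : seq I) P (F : I -> C) :
  nm (\sum_(i <- r | P i) F i) <= \sum_(i <- r | P i) nm (F i).
Proof.
elim/big_rec2: _ => [|i x y _ h]; first by rewrite nm0.
by apply: le_trans (nmD _ _) _; rewrite lerD2l.
Qed.
Lemma nm_prod I (r : seq I) P (F : I -> C) :
  nm (\prod_(i <- r | P i) F i) = \prod_(i <- r | P i) nm (F i).
Proof. by elim/big_rec2: _ => [|i x y _ <-]; rewrite ?nm1// nmM. Qed.

Lemma nm_Re z : `|complex.Re z| <= nm z.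
Proof. by have := normc_ge_Re z; rewrite nmE lecR. Qed.
Lemma nm_Im z : `|complex.Im z| <= nm z.
Proof.
have := nm_Re (z * 'i%C); rewrite ReiNIm normrN nmM => /le_trans; apply.
by rewrite /nm /= expr0n /= add0r expr1n sqrtr1 mulr1.
Qed.
Lemma nm_ReIm z : nm z <= `|complex.Re z| + `|complex.Im z|.
Proof.
rewrite {1}(complexE z); apply: le_trans (nmD _ _) _.
rewrite nmM !nm_real lerD2l.
by rewrite /nm /= expr0n /= add0r expr1n sqrtr1 mul1r.
Qed.
Lemma nm_sqr z : nm z ^+ 2 = complex.Re z ^+ 2 + complex.Im z ^+ 2.
Proof. by case: z => x y; rewrite /nm/= sqr_sqrtr// addr_ge0// sqr_ge0. Qed.

(** Elementary limits, compared with filter convergence only in [cvg_cv]. *)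
Definition cv u l := forall e : R, 0 < e ->
  exists N, forall n, (N <= n)%N -> nm (u n - l) < e.

Lemma cv_unique u l l' : cv u l -> cv u l' -> l = l'.
Proof.
move=> ul ul'; apply/eqP; rewrite -subr_eq0 -nm_eq0; apply/negPn/negP => ne0.
have e0 : 0 < nm (l - l') / 2 by rewrite divr_gt0// lt_neqAle nm_ge0 eq_sym ne0.
have [N hN] := ul _ e0; have [N' hN'] := ul' _ e0.
have := hN (maxn N N') (leq_maxl _ _); have := hN' (maxn N N') (leq_maxr _ _).
set x := u _ => h1 h2.
have : nm (l - l') <= nm (x - l) + nm (x - l').
  have -> : l - l' = (x - l') - (x - l) by ring.
  by apply: le_trans (nmD _ _) _; rewrite nmN addrC.
by lra.
Qed.

Lemma cv_cst l : cv (fun=> l) l.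
Proof. by move=> e e0; exists 0%N => n _; rewrite subrr nm0. Qed.

Lemma cv_near u v l : (exists N, forall n, (N <= n)%N -> u n = v n) ->
  cv u l -> cv v l.
Proof.
move=> [N uv] ul e /ul[N' h]; exists (maxn N N') => n.
by rewrite geq_max => /andP[/uv <- /h].
Qed.

Lemma cvD u v l l' : cv u l -> cv v l' -> cv (fun n => u n + v n) (l + l').
Proof.
move=> ul vl' e e0; have e2 : 0 < e / 2 by lra.
have [N hN] := ul _ e2; have [N' hN'] := vl' _ e2.
exists (maxn N N') => n; rewrite geq_max => /andP[/hN h /hN' h'].
have -> : u n + v n - (l + l') = (u n - l) + (v n - l') by ring.
by have := nmD (u n - l) (v n - l'); lra.
Qed.

Lemma cv_bound u l : cv u l -> exists N (B : R), 0 < B /\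
  forall n, (N <= n)%N -> nm (u n) <= B.
Proof.
move=> /(_ 1 ltr01)[N hN]; exists N, (nm l + 1); split.
  by rewrite ltr_wpDl// nm_ge0.
move=> n /hN h; have := nmD (u n - l) l; rewrite subrK; lra.
Qed.

Lemma cv0M u v : cv u 0 -> (exists N (B : R), 0 < B /\
  forall n, (N <= n)%N -> nm (v n) <= B) -> cv (fun n => u n * v n) 0.
Proof.
move=> u0 [N [B [B0 hB]]] e e0; have [N' hN'] := u0 (e / B) (divr_gt0 e0 B0).
exists (maxn N N') => n; rewrite geq_max => /andP[/hB h /hN' h'].
rewrite !subr0 in h' *; rewrite nmM -(divfK (lt0r_neq0 B0) e).
apply: le_lt_trans (ler_wpM2l (nm_ge0 _) h) _.
by rewrite ltr_pM2r.
Qed.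

Lemma cv_sub u l : cv u l <-> cv (fun n => u n - l) 0.
Proof.
by split=> h e /h[N hN]; exists N => n /hN; rewrite subr0.
Qed.

Lemma cv_sub0 u l : cv u l -> cv (fun n => u n - l) 0.
Proof. by move/cv_sub. Qed.

Lemma cvM u v l l' : cv u l -> cv v l' -> cv (fun n => u n * v n) (l * l').
Proof.
move=> ul vl'; apply/cv_sub.
have h1 : cv (fun n => (u n - l) * v n) 0.
  by apply: cv0M; [exact: cv_sub0 | exact: cv_bound vl'].
have h2 : cv (fun n => (v n - l') * l) 0.
  apply: cv0M; first exact: cv_sub0.
  by exists 0%N, (nm l + 1); split=> [|n _]; have := nm_ge0 l; lra.
have := cvD h1 h2; rewrite addr0; apply: cv_near; exists 0%N => n _; ring.
Qed.

Lemma cvZ u l c : cv u l -> cv (fun n => c * u n) (c * l).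
Proof. by apply: cvM; exact: cv_cst. Qed.

Lemma cvX u l k : cv u l -> cv (fun n => u n ^+ k) (l ^+ k).
Proof.
move=> ul; elim: k => [|k IHk]; first exact: cv_cst.
rewrite exprS; apply: cv_near (cvM ul IHk).
by exists 0%N => n _; rewrite exprS.
Qed.

Lemma cvV u l : l != 0 -> cv u l -> cv (fun n => (u n)^-1) l^-1.
Proof.
move=> l0 ul; apply/cv_sub.
have nl0 : 0 < nm l by rewrite nm_gt0.
have [N hN] := ul (nm l / 2) (divr_gt0 nl0 (ltr0Sn _ 1)).
have ge2 n : (N <= n)%N -> nm l / 2 <= nm (u n).
  move=> /hN h; have := nmD (u n) (- (u n - l)); rewrite nmN.
  have -> : u n - (u n - l) = l by ring.
  by lra.
have h : cv (fun n => (u n - l) * - ((u n)^-1 / l)) 0.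
  apply: cv0M; first exact: cv_sub0.
  exists N, ((nm l / 2)^-1 / nm l); split=> [|n Nn].
    by rewrite divr_gt0// invr_gt0 divr_gt0.
  rewrite nmN nmM !nmV ler_wpM2r ?invr_ge0 ?nm_ge0//.
  rewrite lef_pV2 ?ge2// posrE ?divr_gt0//.
  by apply: lt_le_trans (ge2 _ Nn); rewrite divr_gt0.
apply: cv_near h; exists N => n Nn.
have un0 : u n != 0.
  by rewrite -nm_gt0; apply: lt_le_trans (ge2 _ Nn); rewrite divr_gt0.
by field; rewrite l0 un0.
Qed.

Lemma cv_nm_le u l (B : R) : cv u l ->
  (exists N, forall n, (N <= n)%N -> nm (u n) <= B) -> nm l <= B.
Proof.
move=> ul [N hB]; apply/ler_addgt0Pr => e e0.
have [N' hN'] := ul _ e0.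
have h := hB (maxn N N') (leq_maxl _ _).
have h' := hN' (maxn N N') (leq_maxr _ _).
have := nmD (u (maxn N N')) (- (u (maxn N N') - l)); rewrite nmN opprB addrC subrK.
by lra.
Qed.

Lemma cv_sum I (r : seq I) (F : I -> nat -> C) (G : I -> C) :
  (forall i, cv (F i) (G i)) ->
  cv (fun n => \sum_(i <- r) F i n) (\sum_(i <- r) G i).
Proof.
move=> FG; elim: r => [|i r IHr].
  rewrite big_nil; apply: cv_near (cv_cst 0).
  by exists 0%N => n _; rewrite big_nil.
rewrite big_cons; apply: cv_near (cvD (FG i) IHr).
by exists 0%N => n _; rewrite big_cons.
Qed.

Lemma cv_squeeze u (b : nat -> R) : (forall n, nm (u n) <= b n) ->
  (forall e : R, 0 < e -> exists N, forall n, (N <= n)%N -> b n < e) -> cv u 0.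
Proof.
move=> ub b0 e /b0[N hN]; exists N => n /hN; rewrite subr0.
exact: le_lt_trans.
Qed.

Definition partial a : nat -> C := fun N => \sum_(n < N) a n.

Definition summ b :=
  (forall n, 0 <= b n) /\ exists B : R, forall N, \sum_(n < N) b n <= B.

(** A partial sum within [e] of the supremum of all partial sums leaves less than [e] to every later
    block. *)
Lemma summ_tail b : summ b -> forall e : R, 0 < e ->
  exists N, forall M, (N <= M)%N -> \sum_(N <= n < M) b n < e.
Proof.
move=> [b0 [B hB]] e e0.
pose S := [set x | exists N, x = \sum_(n < N) b n].
have supS : has_sup S.
  split; first by exists (\sum_(n < 0) b n), 0%N.
  by exists B => _ [N ->].
have [_ [N ->] hN] := sup_adherent e0 supS.
exists N => M NM.
have : \sum_(n < M) b n <= sup S by apply: ub_le_sup (supS.2) _ _; exists M.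
rewrite -(big_mkord xpredT b) (big_cat_nat (n:=N))//= big_mkord.
by lra.
Qed.

Lemma big_nat_ordB (F : nat -> C) N M : (N <= M)%N ->
  \sum_(N <= n < M) F n = \sum_(n < M) F n - \sum_(n < N) F n.
Proof.
move=> NM; rewrite -!(big_mkord xpredT F) [in RHS](big_cat_nat (n:=N))//=.
by rewrite addrAC subrr add0r.
Qed.

Lemma ler_sum_nm (F : nat -> C) b N M :
  (forall n, nm (F n) <= b n) ->
  nm (\sum_(N <= n < M) F n) <= \sum_(N <= n < M) b n.
Proof.
by move=> Fb; apply: le_trans (nm_sum _ _ _) _; apply: ler_sum.
Qed.

Lemma real_cauchy (x : nat -> R) :
  (forall e : R, 0 < e -> exists N, forall M, (N <= M)%N -> `|x M - x N| < e) ->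
  exists l : R, forall e : R, 0 < e -> exists N, forall n, (N <= n)%N -> `|x n - l| < e.
Proof.
move=> xC.
have : cvgn x.
  apply/cauchy_cvgP/cauchy_exP => e /xC[N hN]; exists (x N); exists N => // n /= Nn.
  by rewrite /ball /= distrC; apply: hN.
move=> /cvgrPdist_lt h; exists (limn x) => e /h[N _ hN]; exists N => n /hN /=.
by rewrite distrC.
Qed.

Lemma summ_cv a : summ (fun n => nm (a n)) -> exists l, cv (partial a) l.
Proof.
move=> /summ_tail aC.
have tl e : 0 < e -> exists N, forall M, (N <= M)%N -> nm (partial a M - partial a N) < e.
  move=> /aC[N hN]; exists N => M NM; rewrite /partial -big_nat_ordB//.
  by apply: le_lt_trans (hN _ NM); apply: ler_sum_nm.
have [|x hx] := @real_cauchy (fun N => complex.Re (partial a N)).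
  move=> e /tl[N hN]; exists N => M /hN; apply: le_lt_trans.
  by have := nm_Re (partial a M - partial a N); rewrite raddfB.
have [|y hy] := @real_cauchy (fun N => complex.Im (partial a N)).
  move=> e /tl[N hN]; exists N => M /hN; apply: le_lt_trans.
  by have := nm_Im (partial a M - partial a N); rewrite raddfB.
exists (Complex x y) => e e0; have e2 : 0 < e / 2 by lra.
have [N hN] := hx _ e2; have [N' hN'] := hy _ e2.
exists (maxn N N') => n; rewrite geq_max => /andP[/hN h /hN' h'].
by apply: le_lt_trans (nm_ReIm _) _; rewrite !raddfB/=; lra.
Qed.

Lemma summ_le b b' : (forall n, 0 <= b n <= b' n) -> summ b' -> summ b.
Proof.
move=> h [_ [B hB]]; split=> [n|]; first by case/andP: (h n).
exists B => N; apply: le_trans (hB N); apply: ler_sum => i _.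
by case/andP: (h i).
Qed.

Lemma summZ b (c : R) : 0 <= c -> summ b -> summ (fun n => c * b n).
Proof.
move=> c0 [b0 [B hB]]; split=> [n|]; first exact: mulr_ge0.
by exists (c * B) => N; rewrite -mulr_sumr ler_wpM2l.
Qed.

(** Dominated convergence for sums whose length grows with the parameter: a fixed head converges
    term by term, and the rest of both sums together is below twice a tail of [b]. *)
Lemma tannery (s : nat -> nat -> C) (t : nat -> C) b l : summ b ->
  (forall N n, (n < N)%N -> nm (s N n) <= b n) ->
  (forall n, cv (s ^~ n) (t n)) -> cv (partial t) l ->
  cv (fun N => \sum_(n < N) s N n) l.
Proof.
move=> bS sb st tl; apply/cv_sub.
have tb n : nm (t n) <= b n.
  by apply: cv_nm_le (st n) _; exists n.+1 => N; apply: sb.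
suff h : cv (fun N => \sum_(n < N) s N n - partial t N) 0.
  move/cv_sub: tl => /(cvD h); rewrite addr0; apply: cv_near.
  by exists 0%N => n _; rewrite addrA subrK.
move=> e e0; have e4 : 0 < e / 4 by lra.
have [K hK] := summ_tail bS e4.
have : cv (fun N => \sum_(n < K) (s N n - t n)) 0.
  have := @cv_sum _ (index_enum 'I_K) (fun i N => s N i - t i) (fun=> 0).
  by rewrite big1//; apply => i; apply: cv_sub0.
move=> /(_ _ e4)[N hN]; exists (maxn N K) => n; rewrite geq_max => /andP[Nn Kn].
rewrite subr0 /partial -sumrB -(big_mkord xpredT (fun i => s n i - t i)).
rewrite (big_cat_nat (n:=K))//= big_mkord.
apply: le_lt_trans (nmD _ _) _.
have h1 := hN _ Nn; rewrite subr0 in h1.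
suff : nm (\sum_(K <= i < n) (s n i - t i)) <= 2 * \sum_(K <= i < n) b i.
  by have := hK _ Kn; lra.
apply: le_trans (nm_sum _ _ _) _; rewrite mulr_sumr !big_nat.
apply: ler_sum => i /andP[_ ni].
apply: le_trans (nmD _ _) _; rewrite nmN.
by have := tb i; have := sb _ _ ni; lra.
Qed.

Lemma cv_partial_summ_tail a b l N : summ b -> (forall n, nm (a n) <= b n) ->
  cv (partial a) l -> forall B : R, (forall M, (N <= M)%N -> \sum_(N <= n < M) b n <= B) ->
  nm (l - partial a N) <= B.
Proof.
move=> bS ab al B hB; apply: (@cv_nm_le (fun M => partial a M - partial a N)).
  by apply: cvD al (cv_cst _).
exists N => M NM; rewrite /partial -big_nat_ordB//.
by apply: le_trans (hB _ NM); apply: ler_sum_nm.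
Qed.

Lemma geo_sum_le (r : R) N M : 0 <= r < 1 -> \sum_(N <= n < M) r ^+ n <= r ^+ N / (1 - r).
Proof.
move=> /andP[r0 r1]; have r10 : 0 < 1 - r by lra.
have [NM|MN] := leqP N M; last first.
  by rewrite (big_geq (ltnW MN)) divr_ge0 ?exprn_ge0// ltW.
rewrite ler_pdivlMr// -(subnKC NM) mulr_suml.
rewrite (eq_bigr (fun i => - (r ^+ i.+1 - r ^+ i))); last by move=> i _; rewrite exprS; ring.
rewrite sumrN telescope_sumr ?leq_addr// opprB lerBlDr lerDl.
exact: exprn_ge0.
Qed.

Lemma summ_geo (r : R) : 0 <= r < 1 -> summ (fun n => r ^+ n).
Proof.
move=> r01; split=> [n|]; first by rewrite exprn_ge0//; case/andP: r01.
by exists (r ^+ 0 / (1 - r)) => N; rewrite -(big_mkord xpredT (fun n => r ^+ n)) geo_sum_le.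
Qed.

Lemma expr_lt_eps (r e : R) : 0 <= r < 1 -> 0 < e ->
  exists N, forall n, (N <= n)%N -> r ^+ n < e.
Proof.
move=> r01; have r0 : 0 <= r by case/andP: r01.
move: r01 => /summ_geo/summ_tail h e0; have [N hN] := h _ e0.
exists N => n Nn; have := hN n.+1 (leqW Nn); apply: le_lt_trans.
rewrite big_nat_recr//= lerDr sumr_ge0// => i _.
exact: exprn_ge0.
Qed.

End ComplexSequences.

Arguments nm {R} z : simpl never.

(** * Power series on the open unit disc *)

Section UnitDisc.
Variable R : realType.
Local Notation C := (complex R).
Implicit Types (z w q h : C) (a : nat -> C).

(* power series converging in the unit disc *)
Definition opd a := forall r : R, 0 <= r < 1 ->
  exists M : R, forall n, nm (a n) * r ^+ n <= M.

(** The default 0 is the value where the series diverges; for [opd a] and [nm q < 1] it is a genuine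
    sum by [ev_cv]. *)
Definition ev a q : C := xget 0 [set l | cv (partial (fun n => a n * q ^+ n)) l].

(** Among the [n.+1] terms 1, r, ..., r^n of the geometric series the last one is the smallest. *)
Lemma lerS_geo (r : R) n : 0 <= r < 1 -> n.+1%:R * r ^+ n <= (1 - r)^-1.
Proof.
move=> r01; have /andP[r0 r1] := r01.
apply: (@le_trans _ _ (\sum_(0 <= i < n.+1) r ^+ i)).
  have -> : n.+1%:R * r ^+ n = \sum_(i < n.+1) r ^+ n by rewrite sumr_const card_ord mulr_natl.
  rewrite big_mkord; apply: ler_sum => i _.
  by rewrite ler_wiXn2l// ?ltW// -ltnS ltn_ord.
by apply: le_trans (geo_sum_le 0 n.+1 r01) _; rewrite expr0 mul1r.
Qed.

Lemma opd_between (r : R) : 0 <= r < 1 -> exists2 r' : R, 0 < r' < 1 & 0 <= r / r' < 1.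
Proof.
move=> /andP[r0 r1]; exists ((r + 1) / 2); first by apply/andP; split; lra.
rewrite divr_ge0//=; last by lra.
by rewrite ltr_pdivrMr; lra.
Qed.

(** Boundedness of the terms at a larger radius r' < 1 becomes geometric decay with ratio r / r' at
    the radius r. *)
Lemma opd_geo a (r : R) : opd a -> 0 <= r < 1 -> exists (M s : R),
  [/\ 0 <= M, 0 <= s < 1 & forall n, nm (a n) * r ^+ n <= M * s ^+ n].
Proof.
move=> aO /opd_between[r' /andP[r'0 r'1] h].
have [|M hM] := aO r'; first by rewrite (ltW r'0) r'1.
exists M, (r / r'); split=> // [|n].
  by apply: le_trans (hM 0%N); rewrite mulr_ge0 ?nm_ge0// exprn_ge0// ltW.
rewrite expr_div_n mulrA ler_pdivlMr ?exprn_gt0// mulrAC ler_wpM2r//.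
by apply: exprn_ge0; case/andP: h; rewrite pmulr_lge0 ?invr_gt0.
Qed.

Lemma opd_summ_nm a (r : R) : opd a -> 0 <= r < 1 -> summ (fun n => nm (a n) * r ^+ n).
Proof.
move=> /opd_geo h r01; have [M [s [M0 s01 hM]]] := h _ r01.
apply: summ_le (summZ M0 (summ_geo s01)) => n; rewrite hM mulr_ge0 ?nm_ge0//.
by rewrite exprn_ge0//; case/andP: r01.
Qed.

Lemma opd_summ a q : opd a -> nm q < 1 -> summ (fun n => nm (a n * q ^+ n)).
Proof.
move=> aO q1; have := @opd_summ_nm a (nm q) aO; rewrite q1 nm_ge0 => /(_ isT).
by apply: summ_le => n; rewrite nmM nmX mulr_ge0 ?exprn_ge0 ?nm_ge0//=.
Qed.

Lemma ev_eq a q l : cv (partial (fun n => a n * q ^+ n)) l -> ev a q = l.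
Proof.
move=> h; rewrite /ev; case: xgetP => [x _ hx|/(_ l)//].
exact: cv_unique hx h.
Qed.

Lemma ev_cv a q : opd a -> nm q < 1 -> cv (partial (fun n => a n * q ^+ n)) (ev a q).
Proof. by move=> aO /(opd_summ aO)/summ_cv[l hl]; rewrite (ev_eq hl). Qed.

(** Abel's lemma. From some index on, a term is the difference of two partial sums within 1 of the
    limit, hence below 2; [M0] takes care of the earlier terms. The point 0 is excluded because
    [qexp] omits it. *)
Lemma cv_opd a : (forall q, 0 < nm q < 1 ->
  exists l, cv (partial (fun n => a n * q ^+ n)) l) -> opd a.
Proof.
move=> ha r /opd_between[r' /andP[r'0 r'1] h].
have nr' : nm r'%:C%C = r' by rewrite nm_real gtr0_norm.
have [|l hl] := ha r'%:C%C; first by rewrite nr' r'0.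
have r0 : 0 <= r by case/andP: h; rewrite pmulr_lge0 ?invr_gt0.
have rr' : r <= r' by case/andP: h => _ /ltW; rewrite ler_pdivrMr// mul1r.
have [N hN] := hl 1 ltr01.
pose M0 := \sum_(n < N) nm (a n) * r' ^+ n.
exists (M0 + 2) => n.
apply: (@le_trans _ _ (nm (a n) * r' ^+ n)).
  by rewrite ler_wpM2l ?nm_ge0// lerXn2r// nnegrE// ltW.
have M00 : 0 <= M0 by apply: sumr_ge0 => i _; rewrite mulr_ge0 ?nm_ge0 ?exprn_ge0// ltW.
have [Nn|nN] := leqP N n.
  have := hN n Nn; have := hN n.+1 (leqW Nn); rewrite /partial big_ord_recr/=.
  set S := \sum_(_ < _) _ => h1 h2.
  have -> : nm (a n) * r' ^+ n = nm (a n * r'%:C%C ^+ n) by rewrite nmM nmX nr'.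
  have := nmD (S + a n * r'%:C%C ^+ n - l) (- (S - l)); rewrite nmN.
  have -> : S + a n * r'%:C%C ^+ n - l - (S - l) = a n * r'%:C%C ^+ n by ring.
  lra.
apply: (@le_trans _ _ M0); last by lra.
rewrite /M0 (bigD1 (Ordinal nN))//= lerDl sumr_ge0// => i _.
by rewrite mulr_ge0 ?nm_ge0 ?exprn_ge0// ltW.
Qed.

Lemma opd_bounded a (M : R) : (forall n, nm (a n) <= M) -> opd a.
Proof.
move=> aM r /andP[r0 r1]; exists M => n.
rewrite -[leRHS]mulr1 ler_pM ?nm_ge0 ?exprn_ge0//.
by rewrite exprn_ile1// ltW.
Qed.

Lemma opdD a b : opd a -> opd b -> opd (fun n => a n + b n).
Proof.
move=> aO bO r r01; have [M hM] := aO r r01; have [M' hM'] := bO r r01.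
exists (M + M') => n; apply: le_trans (lerD (hM n) (hM' n)).
rewrite -mulrDl ler_wpM2r ?nmD// exprn_ge0//; by case/andP: r01.
Qed.

Lemma opdZ a (c : C) : opd a -> opd (fun n => c * a n).
Proof.
move=> aO r r01; have [M hM] := aO r r01; exists (nm c * M) => n.
by rewrite nmM -mulrA ler_wpM2l ?nm_ge0.
Qed.

Lemma evD a b q : opd a -> opd b -> nm q < 1 ->
  ev (fun n => a n + b n) q = ev a q + ev b q.
Proof.
move=> aO bO q1; apply: ev_eq; apply: cv_near (cvD (ev_cv aO q1) (ev_cv bO q1)).
by exists 0%N => n _; rewrite /partial -big_split; apply: eq_bigr => i _; rewrite mulrDl.
Qed.

Lemma evZ a (c : C) q : opd a -> nm q < 1 -> ev (fun n => c * a n) q = c * ev a q.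
Proof.
move=> aO q1; apply: ev_eq; apply: cv_near (cvZ c (ev_cv aO q1)).
by exists 0%N => n _; rewrite /partial mulr_sumr; apply: eq_bigr => i _; rewrite mulrA.
Qed.

Definition cprod a b : nat -> C := fun n => \sum_(i < n.+1) a i * b (n - i)%N.

Lemma opdM a b : opd a -> opd b -> opd (cprod a b).
Proof.
move=> aO bO r r01; have [r0 r1] := andP r01.
have [M [s [M0 s01 hM]]] := opd_geo aO r01.
have [M' [s' [M'0 s'01 hM']]] := opd_geo bO r01.
pose t := Num.max s s'.
have t01 : 0 <= t < 1.
  by move: s01 s'01; rewrite /t le_max gt_max => /andP[-> ->] /andP[_ ->].
exists (M * M' * (1 - t)^-1) => n; rewrite /cprod.
apply: (@le_trans _ _ (M * M' * (n.+1%:R * t ^+ n))); last first.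
  by rewrite ler_wpM2l ?mulr_ge0// lerS_geo.
have tE x : 0 <= x -> x <= t -> forall k, x ^+ k <= t ^+ k.
  by move=> x0 xt k; rewrite lerXn2r// nnegrE//; case/andP: t01.
rewrite mulrCA -[n.+1 in leRHS]card_ord -sumr_const mulr_suml.
apply: le_trans (ler_wpM2r (exprn_ge0 _ r0) (nm_sum _ _ _)) _.
rewrite mulr_suml; apply: ler_sum => i _.
rewrite mul1r nmM.
have -> : nm (a i) * nm (b (n - i)%N) * r ^+ n =
    (nm (a i) * r ^+ i) * (nm (b (n - i)%N) * r ^+ (n - i)).
  have -> : r ^+ n = r ^+ i * r ^+ (n - i) by rewrite -exprD subnKC// -ltnS ltn_ord.
  ring.
have -> : M * M' * t ^+ n = (M * t ^+ i) * (M' * t ^+ (n - i)).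
  have -> : t ^+ n = t ^+ i * t ^+ (n - i) by rewrite -exprD subnKC// -ltnS ltn_ord.
  ring.
apply: ler_pM; rewrite ?mulr_ge0 ?nm_ge0 ?exprn_ge0//.
  apply: le_trans (hM _) _; rewrite ler_wpM2l// tE//; first by case/andP: s01.
  by rewrite /t le_max lexx.
apply: le_trans (hM' _) _; rewrite ler_wpM2l// tE//; first by case/andP: s'01.
by rewrite /t le_max lexx orbT.
Qed.

Lemma sum_triangle (F : nat -> nat -> C) N :
  \sum_(n < N) \sum_(i < n.+1) F i (n - i)%N = \sum_(i < N) \sum_(j < N - i) F i j.
Proof.
elim: N => [|N IHN]; first by rewrite !big_ord0.
rewrite big_ord_recr/= IHN [RHS]big_ord_recr/= subSnn big_ord1.
rewrite [\sum_(i < N.+1) _]big_ord_recr/= subnn addrA; congr (_ + _).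
rewrite -big_split/=; apply: eq_bigr => i _.
by rewrite subSn ?big_ord_recr// ltnW.
Qed.

(** Mertens' theorem: the partial sums of the product are sums of [A i] times a partial sum of [B],
    so that [tannery] applies with a multiple of [nm (A i)] as majorant. *)
Lemma evM a b q : opd a -> opd b -> nm q < 1 -> ev (cprod a b) q = ev a q * ev b q.
Proof.
move=> aO bO q1; apply: ev_eq.
pose A n := a n * q ^+ n; pose B n := b n * q ^+ n.
have aS := opd_summ aO q1; have bS := opd_summ bO q1.
have [_ [K hK]] := bS.
have K0 : 0 <= K by have := hK 0%N; rewrite big_ord0.
have -> : partial (fun n => cprod a b n * q ^+ n) =
   (fun N => \sum_(i < N) (A i * \sum_(j < N - i) B j)).
  apply/funext => N; under [RHS]eq_bigr do rewrite mulr_sumr.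
  rewrite -(sum_triangle (fun i j => A i * B j)); apply: eq_bigr => n _.
  rewrite /cprod mulr_suml; apply: eq_bigr => i _.
  rewrite /A /B; have -> : q ^+ n = q ^+ i * q ^+ (n - i).
    by rewrite -exprD subnKC// -ltnS ltn_ord.
  ring.
apply: (@tannery R (fun N i => A i * \sum_(j < N - i) B j) (fun n => A n * ev b q) (fun n => K * nm (A n))).
- exact: summZ.
- move=> N n _; rewrite nmM mulrC ler_wpM2r ?nm_ge0//.
  exact: le_trans (nm_sum _ _ _) (hK _).
- move=> n; apply: cvZ => e e0; have [N hN] := ev_cv bO q1 e0.
  by exists (N + n)%N => m Nm; apply: hN; rewrite leq_subRL; lia.
- apply: cv_near (cvM (ev_cv aO q1) (@cv_cst _ (ev b q))).
  by exists 0%N => N _; rewrite /partial mulr_suml.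
Qed.

Lemma ev_coef0 a q : (forall n, a n = 0) -> ev a q = 0.
Proof.
move=> a0; apply: ev_eq; apply: cv_near (@cv_cst _ 0).
by exists 0%N => N _; rewrite /partial big1// => i _; rewrite a0 mul0r.
Qed.

Definition cone : nat -> C := fun n => (n == 0%N)%:R.
Lemma opd_cone : opd cone.
Proof. by apply: (@opd_bounded _ 1) => n; rewrite nm_nat; case: eqP => _; rewrite ?ler01. Qed.
Lemma ev_cone q : ev cone q = 1.
Proof.
apply: ev_eq; apply: cv_near (@cv_cst _ 1).
exists 1%N => -[//|N] _; rewrite /partial big_ord_recl big1 ?addr0 ?mulr1// => i _.
by rewrite /cone/= mul0r.
Qed.

Lemma opd_shift a m : opd a -> opd (fun n => a (n + m)%N).
Proof.
move=> aO r /opd_between[r' /andP[r'0 r'1] /andP[h0 h1]].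
have r0 : 0 <= r by move: h0; rewrite pmulr_lge0 ?invr_gt0.
have rr' : r <= r' by move/ltW: h1; rewrite ler_pdivrMr// mul1r.
have [|M hM] := aO r'; first by rewrite (ltW r'0) r'1.
exists (M / r' ^+ m) => n.
rewrite ler_pdivlMr ?exprn_gt0//; apply: le_trans (hM (n + m)%N).
rewrite exprD -mulrA ler_wpM2l ?nm_ge0// ler_wpM2r ?exprn_ge0 ?(ltW r'0)//.
by rewrite lerXn2r// nnegrE// ltW.
Qed.

Lemma ev_shift a m q : opd a -> nm q < 1 -> (forall n, (n < m)%N -> a n = 0) ->
  ev a q = q ^+ m * ev (fun n => a (n + m)%N) q.
Proof.
move=> aO q1 a0; apply: ev_eq => e e0.
have [N hN] := cvZ (q ^+ m) (ev_cv (opd_shift m aO) q1) e0.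
exists (N + m)%N => n Nn; have -> : n = (m + (n - m))%N by lia.
rewrite /partial big_split_ord/= big1 ?add0r; last first.
  by move=> i _; rewrite a0 ?mul0r.
have -> : \sum_(i < n - m) a (m + i)%N * q ^+ (m + i) =
    q ^+ m * \sum_(i < n - m) a (i + m)%N * q ^+ i.
  by rewrite mulr_sumr; apply: eq_bigr => i _; rewrite exprD addnC; ring.
by apply: hN; lia.
Qed.

Lemma nm_ev_le a q (B : R) : opd a -> nm q < 1 ->
  (forall N, \sum_(n < N) nm (a n) * nm q ^+ n <= B) -> nm (ev a q) <= B.
Proof.
move=> aO q1 hB; apply: cv_nm_le (ev_cv aO q1) _; exists 0%N => N _.
apply: le_trans (nm_sum _ _ _) _; apply: le_trans (hB N).
by apply: ler_sum => i _; rewrite nmM nmX.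
Qed.

End UnitDisc.

(** * Cauchy's estimates and Schwarz's lemma *)

Section CauchyEstimate.
Variable R : realType.
Local Notation C := (complex R).
Implicit Types (z w q h : C) (a : nat -> C).

Lemma prim_root_complex n : (n > 0)%N -> exists z : C, n.-primitive_root z.
Proof.
pose p : {poly C} := 'X^n - 1; have [r Dp] := closed_field_poly_normal p.
move=> n_gt0; rewrite (monicP _) ?monicXnsubC // scale1r in Dp.
have rn1 : all n.-unity_root r by apply/allP=> z; rewrite -root_prod_XsubC -Dp.
have sz_r : (n < (size r).+1)%N.
  by rewrite -(size_prod_XsubC r id) -Dp size_XnsubC.
have [|z] := hasP (cyclic.has_prim_root n_gt0 rn1 _ sz_r); last by exists z.
by rewrite -separable.separable_prod_XsubC -Dp cyclotomic.separable_Xn_sub_1 // pnatr_eq0 -lt0n.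
Qed.

Lemma nm_prim_root n (z : C) : n.-primitive_root z -> nm z = 1.
Proof.
move=> zp; have n0 := prim_order_gt0 zp.
have := congr1 (@nm R) (prim_expr_order zp); rewrite nmX nm1 => h.
apply/eqP; rewrite -(pexpr_eq1 n0) ?nm_ge0//; exact/eqP.
Qed.

Lemma sum_prim_root n (z : C) k : n.-primitive_root z ->
  \sum_(j < n) (z ^+ k) ^+ j = (if (n %| k)%N then n%:R else 0).
Proof.
move=> zp; case: ifPn => [nk|nk].
  rewrite (eq_bigr (fun=> 1)) ?sumr_const ?card_ord// => j _.
  by rewrite (eqP (_ : z ^+ k == 1)) ?expr1n// -(prim_order_dvd zp).
have zk : z ^+ k - 1 != 0 by rewrite subr_eq0 -(prim_order_dvd zp).
have := subrX1 (z ^+ k) n; rewrite exprAC (prim_expr_order zp) expr1n subrr.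
by move=> /esym/eqP; rewrite mulf_eq0 (negPf zk) /= => /eqP.
Qed.

(** The mean over the N-th roots of unity, weighted by z^(j (N - n)), plays the role of Cauchy's
    integral: it isolates the coefficient [n] exactly because all exponents are below [N]. *)
Lemma poly_coef_estimate (a : nat -> C) N (q0 : C) (B : R) n : (n < N)%N ->
  (forall q, nm q = nm q0 -> nm (\sum_(i < N) a i * q ^+ i) <= B) ->
  nm (a n) * nm q0 ^+ n <= B.
Proof.
move=> nN hB; have N0 : (0 < N)%N by exact: leq_ltn_trans nN.
have [z zp] := prim_root_complex N0; have z1 := nm_prim_root zp.
have z0 : z != 0 by rewrite -nm_gt0 z1.
have E : \sum_(j < N) (\sum_(i < N) a i * (q0 * z ^+ j) ^+ i) * z ^+ (j * (N - n)) =
   N%:R * (a n * q0 ^+ n).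
  under eq_bigr do rewrite mulr_suml.
  rewrite exchange_big (bigD1 (Ordinal nN))//= [X in _ + X]big1 ?addr0.
    rewrite (eq_bigr (fun j : 'I_N => (a n * q0 ^+ n) * (z ^+ N) ^+ j)).
      by rewrite -mulr_sumr sum_prim_root// dvdnn mulrC.
    move=> j _; rewrite exprMn -!exprM mulrA -mulrA -exprD; congr (_ * z ^+ _).
    by rewrite -mulnDr subnKC 1?mulnC// ltnW.
  move=> i /eqP ni.
  rewrite (eq_bigr (fun j : 'I_N => (a i * q0 ^+ i) * (z ^+ (i + (N - n))) ^+ j)).
    rewrite -mulr_sumr sum_prim_root//; case: ifPn => [|_]; last by rewrite mulr0.
    move=> /dvdnP[k hk]; exfalso; apply: ni; apply/val_inj => /=.
    have := ltn_ord i; case: k hk => [|[|k]]; nia.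
  move=> j _; rewrite exprMn -!exprM mulrA -mulrA -exprD; congr (_ * z ^+ _).
  by rewrite -mulnDr mulnC.
have := congr1 (@nm R) E; rewrite nmM nm_nat => h.
have : N%:R * nm (a n * q0 ^+ n) <= N%:R * B.
  rewrite -h; apply: le_trans (nm_sum _ _ _) _.
  have -> : N%:R * B = \sum_(j < N) B by rewrite sumr_const card_ord mulr_natl.
  apply: ler_sum => j _; rewrite nmM nmX z1 expr1n mulr1; apply: hB.
  by rewrite nmM nmX z1 expr1n mulr1.
by rewrite ler_pM2l ?ltr0n// nmM nmX.
Qed.

Lemma ev_tail a (r e : R) : opd a -> 0 <= r < 1 -> 0 < e -> exists N, forall M q,
  (N <= M)%N -> nm q <= r -> nm (ev a q - \sum_(i < M) a i * q ^+ i) <= e.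
Proof.
move=> aO r01 e0; have aS := opd_summ_nm aO r01.
have [N hN] := summ_tail aS e0; exists N => M q NM qr.
have q1 : nm q < 1 by apply: le_lt_trans qr _; case/andP: r01.
apply: (cv_partial_summ_tail aS _ (ev_cv aO q1)).
  by move=> n; rewrite nmM nmX ler_wpM2l ?nm_ge0// lerXn2r// nnegrE ?nm_ge0//; case/andP: r01.
move=> K MK; apply: ltW; apply: le_lt_trans (hN K (leq_trans NM MK)).
rewrite [leRHS](big_cat_nat (n:=M))//= lerDr sumr_ge0// => i _.
by rewrite mulr_ge0 ?nm_ge0// exprn_ge0//; case/andP: r01.
Qed.

(** Truncations converge uniformly on the circle, so they satisfy the polynomial estimate with
    [B + e] for every [e > 0]. *)
Lemma cauchy_estimate a (q0 : C) (B : R) n : opd a -> nm q0 < 1 ->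
  (forall q, nm q = nm q0 -> nm (ev a q) <= B) -> nm (a n) * nm q0 ^+ n <= B.
Proof.
move=> aO q01 hB; apply/ler_addgt0Pr => e e0.
have r01 : 0 <= nm q0 < 1 by rewrite nm_ge0.
have [N hN] := ev_tail aO r01 e0.
apply: (@poly_coef_estimate a (maxn N n.+1)); first exact: leq_maxr.
move=> q qE; have := hN (maxn N n.+1) q (leq_maxl _ _); rewrite qE lexx => /(_ isT).
set S := \sum_(_ < _) _ => h; have := hB q qE.
have := nmD (ev a q) (- (ev a q - S)); rewrite nmN opprB addrC subrK; lra.
Qed.

(** The Cauchy estimate with bound 0. *)
Lemma ev_coef_uniq a (r : R) : opd a -> 0 < r < 1 ->
  (forall q, nm q = r -> ev a q = 0) -> forall n, a n = 0.
Proof.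
move=> aO /andP[r0 r1] h n; apply/eqP; rewrite -nm_eq0.
have nr : nm r%:C%C = r by rewrite nm_real gtr0_norm.
have := @cauchy_estimate a r%:C%C 0 n aO; rewrite nr => /(_ r1).
have hh : forall q : C, nm q = r -> nm (ev a q) <= 0 by move=> q /h ->; rewrite nm0.
move=> /(_ hh); rewrite pmulr_lle0 ?exprn_gt0// => a0.
by rewrite eq_le a0 nm_ge0.
Qed.

Definition cpow a k : nat -> C := iter k (cprod a) (@cone R).

Lemma opd_cpow a k : opd a -> opd (cpow a k).
Proof. by move=> aO; elim: k => [|k IHk]; [exact: opd_cone | exact: opdM]. Qed.

Lemma ev_cpow a k q : opd a -> nm q < 1 -> ev (cpow a k) q = ev a q ^+ k.
Proof.
move=> aO q1; elim: k => [|k IHk]; first by rewrite ev_cone.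
by rewrite /cpow iterS evM ?IHk ?exprS//; exact: opd_cpow.
Qed.

Lemma cprod_order a b m m' : (forall n, (n < m)%N -> a n = 0) ->
  (forall n, (n < m')%N -> b n = 0) -> forall n, (n < m + m')%N -> cprod a b n = 0.
Proof.
move=> a0 b0 n nm; rewrite /cprod big1// => i _.
have [im|mi] := ltnP i m; first by rewrite a0 ?mul0r.
by rewrite b0 ?mulr0//; have := ltn_ord i; lia.
Qed.

Lemma cpow_order a m k : (forall n, (n < m)%N -> a n = 0) ->
  forall n, (n < k * m)%N -> cpow a k n = 0.
Proof.
by move=> a0; elim: k => // k IHk n; rewrite mulSn; apply: cprod_order.
Qed.

(** If y < x, then (y / x)^N tends to 0, while the hypothesis keeps K (y / x)^N at least 1. *)
Lemma exprn_le_bound (x y K : R) : 0 <= x -> 0 <= y ->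
  (forall n, x ^+ n <= K * y ^+ n) -> x <= y.
Proof.
move=> x0 y0 h; rewrite leNgt; apply/negP => yx.
have xp : 0 < x by apply: le_lt_trans yx.
have r01 : 0 <= y / x < 1 by rewrite divr_ge0//= ltr_pdivrMr// mul1r.
have K1 : 0 < K + 1 by have := h 0%N; rewrite !expr0 mulr1; lra.
have e0 : 0 < (K + 1)^-1 by rewrite invr_gt0.
have [N /(_ N (leqnn _))] := expr_lt_eps r01 e0.
rewrite expr_div_n ltr_pdivrMr ?exprn_gt0// mulrC ltr_pdivlMr// => h1.
have := h N; have : 0 <= y ^+ N by rewrite exprn_ge0.
by nra.
Qed.

(* Schwarz's lemma: by the Cauchy estimates it holds for all powers of the
   series up to a constant factor, which disappears in the limit. *)
Lemma schwarz a m (q Q : C) (B : R) : opd a -> (forall n, (n < m)%N -> a n = 0) ->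
  nm q < nm Q -> nm Q < 1 -> (forall q', nm q' = nm Q -> nm (ev a q') <= B) ->
  nm (ev a q) <= (nm q / nm Q) ^+ m * B.
Proof.
move=> aO a0 qQ Q1 hB.
have Q0 : 0 < nm Q by apply: le_lt_trans qQ; rewrite nm_ge0.
have q1 : nm q < 1 by apply: lt_trans Q1.
have B0 : 0 <= B by apply: le_trans (hB Q erefl); rewrite nm_ge0.
set s := nm q / nm Q.
have s01 : 0 <= s < 1 by rewrite divr_ge0 ?nm_ge0//= ltr_pdivrMr// mul1r.
have s0 : 0 <= s by case/andP: s01.
apply: (@exprn_le_bound _ _ (1 - s)^-1); rewrite ?nm_ge0 ?mulr_ge0 ?exprn_ge0// => k.
rewrite -nmX -ev_cpow//; have cO := opd_cpow k aO.
apply: nm_ev_le => // N.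
apply: (@le_trans _ _ (\sum_(k * m <= n < N) B ^+ k * s ^+ n)).
  have bd n : nm (cpow a k n) * nm q ^+ n <= B ^+ k * s ^+ n.
    rewrite /s expr_div_n mulrA ler_pdivlMr ?exprn_gt0// mulrAC ler_wpM2r ?exprn_ge0 ?nm_ge0//.
    apply: cauchy_estimate => // q' q'Q; rewrite ev_cpow// ?q'Q// nmX lerXn2r ?nnegrE ?nm_ge0//.
    exact: hB.
  have [kN|Nk] := leqP (k * m) N.
    rewrite -(big_mkord xpredT (fun n => nm (cpow a k n) * nm q ^+ n)).
    rewrite (big_cat_nat (n:=k * m))//= big_nat big1 ?add0r; last first.
      by move=> i /= ikm; rewrite (cpow_order a0)// nm0 mul0r.
    by apply: ler_sum.
  rewrite big1 ?sumr_ge0// => [n _|i _]; first by rewrite mulr_ge0// exprn_ge0.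
  by rewrite (cpow_order a0) ?nm0 ?mul0r//; apply: ltn_trans Nk.
rewrite -mulr_sumr exprMn -exprM [X in _ <= X](_ : _ = B ^+ k * (s ^+ (k * m) / (1 - s))); last first.
  by rewrite mulnC; ring.
by rewrite ler_wpM2l ?exprn_ge0// geo_sum_le.
Qed.

End CauchyEstimate.

(** * Estimates for sine, cosine and the exponential; the map z -> exp (2 i pi z) *)

Section Trigonometry.
Variable R : realType.
Local Notation C := (complex R).
Implicit Types (x y t : R) (z w h : C).

Lemma ge0_of_derive (f df : R -> R) : (forall x, is_derive x 1 f (df x)) ->
  (forall x, 0 <= x -> 0 <= df x) -> f 0 = 0 -> forall x, 0 <= x -> 0 <= f x.
Proof.
move=> fd df0 f0 x; rewrite le_eqVlt => /predU1P[<-|x0]; first by rewrite f0.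
have [|c /itvP cx] := @MVT R f df 0 x x0 (fun x _ => fd x).
  apply: derivable_within_continuous => y _.
  by have [] := fd y.
rewrite f0 !subr0 => ->; rewrite mulr_ge0 ?(ltW x0)// df0//.
by rewrite cx.
Qed.

Lemma sin_le_id x : 0 <= x -> sin x <= x.
Proof.
move=> x0; rewrite -subr_ge0.
apply: (@ge0_of_derive (fun x => x - sin x) (fun x => 1 - cos x)) => //.
by rewrite sin0 subr0.
Qed.

Lemma abs_sin_le x : `|sin x| <= `|x|.
Proof.
wlog x0 : x / 0 <= x.
  move=> H; have [/H//|/ltW x0] := leP 0 x.
  by have := H (- x); rewrite oppr_ge0 sinN !normrN; apply.
rewrite [leRHS]ger0_norm// ler_norml sin_le_id// andbT.
rewrite -subr_ge0 opprK.
apply: (@ge0_of_derive (fun x => sin x + x) (fun x => cos x + 1)) => //.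
by rewrite sin0 addr0.
Qed.

Lemma cos_ge_quad x : 1 - x ^+ 2 / 2 <= cos x.
Proof.
have xE : x = (x / 2) *+ 2 by rewrite mulr2n; lra.
rewrite {2}xE cos_mulr2n; have := cos2Dsin2 (x / 2).
have : sin (x / 2) ^+ 2 <= (x / 2) ^+ 2.
  by rewrite -ler_sqrt ?sqr_ge0// !sqrtr_sqr abs_sin_le.
move: (cos _) (sin _) => c s h1 h2.
have -> : c ^+ 2 = 1 - s ^+ 2 by lra.
have h3 : (x / 2) ^+ 2 = x ^+ 2 / 4 by field.
by move: h1; rewrite h3 -[(1 - s ^+ 2) *+ 2]mulr_natr; lra.
Qed.

Lemma sin_ge_cubic x : 0 <= x -> x - x ^+ 3 / 6 <= sin x.
Proof.
move=> x0; rewrite -subr_ge0.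
apply: (@ge0_of_derive (fun x => sin x - (x - x ^+ 3 / 6)) (fun x => cos x - (1 - x ^+ 2 / 2))) => //.
- move=> y; apply: is_derive_eq; rewrite /GRing.scale/= !mulr1 mulr0; lra.
- by move=> y _; rewrite subr_ge0 cos_ge_quad.
- by rewrite sin0; lra.
Qed.

Lemma abs_sinB_le x : `|sin x - x| <= `|x| ^+ 3 / 6.
Proof.
wlog x0 : x / 0 <= x.
  move=> H; have [/H//|/ltW x0] := leP 0 x.
  by have := H (- x); rewrite oppr_ge0 sinN -opprD !normrN; apply.
rewrite (ger0_norm x0) distrC ger0_norm; last by rewrite subr_ge0 sin_le_id.
by have := sin_ge_cubic x0; lra.
Qed.

Lemma pi_lt4 : pi < 4 :> R.
Proof. by have := @pihalf_lt2 R; lra. Qed.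

(** The number s = sin (pi/6) equals cos (pi/3) = 1 - 2 s^2, hence is 1/2, and it is at most
    pi/6. *)
Lemma pi_ge3 : 3 <= pi :> R.
Proof.
pose c := cos (pi / 3 : R); pose s := sin (pi / 6 : R).
have pi0 := @pi_gt0 R.
have sE : s = c.
  rewrite /s /c; have -> : pi / 6 = pi / 2 - pi / 3 :> R by lra.
  by rewrite sinB sin_pihalf cos_pihalf; lra.
have cE : c = 1 - 2 * s ^+ 2.
  rewrite /c; have -> : pi / 3 = (pi / 6) *+ 2 :> R by rewrite mulr2n; lra.
  rewrite cos_mulr2n cos2sin2 -/s; rewrite !mulr2n; lra.
have s0 : 0 < s by apply: sin_gt0_pi; apply/andP; split; lra.
have s2 : s = 1 / 2.
  have sq : s = 1 - 2 * s ^+ 2 by rewrite {1}sE.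
  have : (s + 1) * (2 * s - 1) = 0.
    have -> : (s + 1) * (2 * s - 1) = 2 * s ^+ 2 + s - 1 by ring.
    by lra.
  move/eqP; rewrite mulf_eq0 => /orP[/eqP|/eqP]; lra.
have : s <= pi / 6 by apply: sin_le_id; lra.
lra.
Qed.

Lemma expRB_quad x : `|x| <= 1 / 2 -> `|expR x - 1 - x| <= 2 * x ^+ 2.
Proof.
rewrite ler_norml => /andP[x1 x2].
have h1 := expR_ge1Dx x; have h2 := expR_ge1Dx (- x).
have h3 : expR x * expR (- x) = 1 by rewrite -expRD subrr expR0.
have h4 := expR_gt0 x.
rewrite ger0_norm; last by lra.
have : expR x * (1 - x) <= 1 by rewrite -h3 ler_pM2l//; lra.
nra.
Qed.

(** The formula of [cexp] over an arbitrary [realType], so that [nome] and [qexp] are convertible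
    once [R] is instantiated. *)
Definition cexpo (z : C) : C :=
  Complex (expR (complex.Re z) * cos (complex.Im z))
          (expR (complex.Re z) * sin (complex.Im z)).

Lemma cexpoD z w : cexpo (z + w) = cexpo z * cexpo w.
Proof.
case: z w => [a b] [c d]; apply/eqP; rewrite eq_complex /=.
rewrite expRD cosD sinD; apply/andP; split; apply/eqP; ring.
Qed.

Lemma cexpo0 : cexpo 0 = 1.
Proof. by apply/eqP; rewrite eq_complex /= expR0 cos0 sin0 mulr0 mulr1 !eqxx. Qed.

Lemma cexpoMn z n : cexpo (z *+ n) = cexpo z ^+ n.
Proof. by elim: n => [|n IHn]; rewrite ?cexpo0// mulrS cexpoD IHn exprS. Qed.

Lemma nm_cexpo z : nm (cexpo z) = expR (complex.Re z).
Proof.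
by rewrite /nm /cexpo /= !exprMn -mulrDr cos2Dsin2 mulr1 sqrtr_sqr ger0_norm// expR_ge0.
Qed.

Lemma cexpo_neq0 z : cexpo z != 0.
Proof. by rewrite -nm_gt0 nm_cexpo expR_gt0. Qed.

Lemma cexpoN z : cexpo (- z) = (cexpo z)^-1.
Proof.
apply: (mulfI (cexpo_neq0 z)); rewrite -cexpoD subrr cexpo0 mulfV//.
exact: cexpo_neq0.
Qed.

(** Differentiability of the exponential at 0. The real contributions [e1], [b1], [b2] and [b3] add
    up to 6, so the constant 10 leaves room. *)
Lemma cexpo_quad h : nm h <= 1 / 2 -> nm (cexpo h - 1 - h) <= 10 * nm h ^+ 2.
Proof.
case: h => x y hle; set h := Complex x y in hle *.
have hx : `|x| <= nm h by exact: (nm_Re h).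
have hy : `|y| <= nm h by exact: (nm_Im h).
have hp := nm_ge0 h; set n := nm h in hle hx hy hp *.
apply: le_trans (nm_ReIm _) _ => /=.
have -> : expR x * cos y - 1 - x = (expR x - 1 - x) + expR x * (cos y - 1) by ring.
have -> : expR x * sin y - 0 - y = expR x * (sin y - y) + ((expR x - 1 - x) + x) * y by ring.
have e1 : `|expR x - 1 - x| <= 2 * n ^+ 2.
  apply: le_trans (expRB_quad (le_trans hx hle)) _.
  by rewrite ler_pM2l// -real_normK ?num_real// lerXn2r// nnegrE.
have e2 : `|cos y - 1| <= n ^+ 2 / 2.
  rewrite distrC ger0_norm ?subr_ge0 ?cos_le1//.
  have := cos_ge_quad y; have : y ^+ 2 <= n ^+ 2.
    by rewrite -real_normK ?num_real// lerXn2r// nnegrE.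
  lra.
have e3 : `|sin y - y| <= n ^+ 2 / 2.
  apply: le_trans (abs_sinB_le y) _.
  have : `|y| ^+ 3 <= n ^+ 3 by rewrite lerXn2r// nnegrE.
  by nra.
have e4 : `|expR x| <= 2.
  rewrite ger0_norm ?expR_ge0//; have := expRB_quad (le_trans hx hle).
  rewrite ler_norml => /andP[_]; move: hx; rewrite ler_norml => /andP[].
  by have := sqr_ge0 x; nra.
have b1 : `|expR x * (cos y - 1)| <= n ^+ 2.
  rewrite normrM; apply: le_trans (ler_pM _ _ e4 e2) _ => //; lra.
have b2 : `|expR x * (sin y - y)| <= n ^+ 2.
  rewrite normrM; apply: le_trans (ler_pM _ _ e4 e3) _ => //; lra.
have b3 : `|(expR x - 1 - x + x) * y| <= 2 * n ^+ 2.
  rewrite normrM.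
  have b4 : `|expR x - 1 - x + x| <= 2 * n.
    apply: le_trans (ler_normD _ _) _; nra.
  by apply: le_trans (ler_pM _ _ b4 hy) _ => //; lra.
have := sqr_ge0 n; have := ler_normD (expR x - 1 - x) (expR x * (cos y - 1)).
have := ler_normD (expR x * (sin y - y)) ((expR x - 1 - x + x) * y).
lra.
Qed.

Definition qexp z : C := cexpo (Complex 0 (2 * pi) * z).

Lemma qexpD z w : qexp (z + w) = qexp z * qexp w.
Proof. by rewrite /qexp mulrDr cexpoD. Qed.

Lemma qexpMn z n : qexp (z *+ n) = qexp z ^+ n.
Proof. by rewrite /qexp mulrnAr cexpoMn. Qed.

Lemma qexp1 : qexp 1 = 1.
Proof.
rewrite /qexp mulr1 /cexpo /= expR0 !mul1r.
have -> : 2 * pi = pi *+ 2 :> R by rewrite mulr2n; ring.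
by rewrite cos2pi sin2pi.
Qed.

Lemma nm_qexp z : nm (qexp z) = expR (- (2 * pi * complex.Im z)).
Proof. by case: z => x y; rewrite /qexp nm_cexpo /=; congr expR; ring. Qed.

Lemma qexp_neq0 z : qexp z != 0. Proof. exact: cexpo_neq0. Qed.

Lemma nm_qexp_lt1 z : 0 < complex.Im z -> nm (qexp z) < 1.
Proof. by move=> z0; rewrite nm_qexp -expR0 ltr_expR oppr_lt0 !mulr_gt0// pi_gt0. Qed.

Lemma polar_unit (z : C) : nm z = 1 -> exists x : R, z = qexp (Complex x 0).
Proof.
case: z => a b n1; have := nm_sqr (Complex a b); rewrite n1 /= expr1n => ab.
have pi0 := @pi_gt0 R.
have a1 : -1 <= a <= 1 by apply/andP; split; nra.
have cE : cos (acos a) = a by rewrite acosK.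
have sE : sin (acos a) ^+ 2 = b ^+ 2 by rewrite sin2cos2 cE; lra.
have qE x : qexp (Complex x 0) = Complex (cos (2 * pi * x)) (sin (2 * pi * x)).
  by rewrite /qexp /cexpo /= !mul0r !mulr0 subr0 add0r expR0 !mul1r.
have [sb|sb] : sin (acos a) = b \/ sin (acos a) = - b.
  have /eqP := sE; rewrite eqf_sqr => /orP[/eqP|/eqP]; by [left|right].
- exists (acos a / (2 * pi)); rewrite qE mulrC divfK; last by rewrite mulf_neq0// gt_eqF.
  by rewrite cE sb.
- exists (- acos a / (2 * pi)); rewrite qE mulrC divfK; last by rewrite mulf_neq0// gt_eqF.
  by rewrite cosN sinN cE sb opprK.
Qed.

(** Horizontal lines of the upper half-plane cover the circles around 0; in this way bounds on the
    half-plane become hypotheses of Cauchy's and Schwarz's lemmas. *)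
Lemma qexp_surj (q : C) : 0 < nm q < 1 -> exists z, 0 < complex.Im z /\ qexp z = q.
Proof.
move=> /andP[q0 q1]; have pi0 := @pi_gt0 R.
have [x hx] : exists x : R, q / (nm q)%:C%C = qexp (Complex x 0).
  apply: polar_unit; rewrite nmM nmV nm_real gtr0_norm// divff// gt_eqF//.
pose y := - ln (nm q) / (2 * pi).
exists (Complex x y); split=> /=.
  by rewrite /y divr_gt0 ?mulr_gt0// oppr_gt0 ln_lt0// q0 q1.
have -> : Complex x y = Complex x 0 + Complex 0 y.
  by apply/eqP; rewrite eq_complex /= addr0 add0r !eqxx.
rewrite qexpD -hx.
have -> : qexp (Complex 0 y) = (nm q)%:C%C.
  rewrite /qexp /cexpo /= !mul0r mulr0 addr0 cos0 sin0 mulr0 mulr1.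
  have -> : 0 - 2 * pi * y = ln (nm q).
    by rewrite /y sub0r mulrC divfK ?opprK// mulf_neq0// gt_eqF.
  by rewrite lnK// posrE.
rewrite divfK//; rewrite -nm_gt0 nm_real gtr0_norm//.
Qed.

End Trigonometry.

(** * Reduction theory and vanishing of forms of high order at infinity *)

Section Vanishing.
Variable R : realType.
Local Notation C := (complex R).
Implicit Types (z w q h : C) (a : nat -> C) (x y : R).

Lemma qexp_int (n : int) : qexp (n%:~R : C) = 1.
Proof.
case: n => n; first by rewrite -pmulrn qexpMn qexp1 expr1n.
rewrite NegzE mulrNz /qexp mulrN cexpoN -[X in X^-1]/(qexp _) -pmulrn qexpMn.
by rewrite qexp1 expr1n invr1.
Qed.

Lemma Im_intr (n : int) : complex.Im (n%:~R : C) = 0.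
Proof. by rewrite -(rmorph_int (real_complex R)). Qed.

Lemma Re_intr (n : int) : complex.Re (n%:~R : C) = n%:~R.
Proof. by rewrite -(rmorph_int (real_complex R)). Qed.

Lemma Im_inv z : complex.Im (- z^-1) = complex.Im z / nm z ^+ 2.
Proof.
case: z => x y; rewrite nm_sqr /= opprK; congr (_ / _).
Qed.

Lemma Im_gt0_neq0 z : 0 < complex.Im z -> z != 0.
Proof. by apply: contraTneq => -> /=; rewrite ltxx. Qed.

Lemma Im_inv_gt0 z : 0 < complex.Im z -> 0 < complex.Im (- z^-1).
Proof.
by move=> z0; rewrite Im_inv divr_gt0// exprn_gt0// nm_gt0 Im_gt0_neq0.
Qed.

(* 17/20 is slightly less than the height sqrt 3 / 2 of the usual fundamental
   domain, so that each inversion multiplies the height by a definite factor. *)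
Lemma reduction (A : Type) (F : C -> A) :
  (forall z (n : int), 0 < complex.Im z -> F (z + n%:~R) = F z) ->
  (forall z, 0 < complex.Im z -> F (- z^-1) = F z) ->
  forall z, 0 < complex.Im z -> exists2 w, 17 / 20 <= complex.Im w & F w = F z.
Proof.
(* 389/400 = (1/2)^2 + (17/20)^2 bounds |w|^2 for a translated point below the height 17/20, so that
   inversion divides its height by at most this number. *)
move=> FT FS z z0; pose c : R := 389 / 400.
have c01 : 0 <= c < 1 by rewrite /c; apply/andP; split; lra.
(* [N] bounds the number of inversions that are still needed and serves as induction measure. *)
have [N hN] : exists N, 17 / 20 * c ^+ N <= complex.Im z.
  have [N /(_ N (leqnn _)) h] := expr_lt_eps c01 z0; exists N.
  by have : 0 <= c ^+ N; [rewrite exprn_ge0//; case/andP: c01 | lra].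
elim: N z z0 hN => [|N IHN] z z0 hN.
  by exists z => //; rewrite expr0 mulr1 in hN.
pose n := - Num.floor (complex.Re z + 1 / 2).
pose w := z + n%:~R.
have wI : complex.Im w = complex.Im z by rewrite /w raddfD/= Im_intr addr0.
have w0 : 0 < complex.Im w by rewrite wI.
have wR : `|complex.Re w| <= 1 / 2.
  rewrite /w raddfD/= Re_intr /n mulrNz ler_norml.
  have := Num.Theory.floor_le (complex.Re z + 1 / 2).
  have := Num.Theory.lt_succ_floor (complex.Re z + 1 / 2).
  by rewrite intrD; move=> h1 h2; apply/andP; split; lra.
have [ge|lt] := leP (17 / 20) (complex.Im w); first by exists w => //; exact: FT.
have nw : nm w ^+ 2 <= c.
  rewrite nm_sqr -(real_normK (num_real (complex.Re w))) /c.
  move: wR lt w0; move: `|_| (normr_ge0 (complex.Re w)) (complex.Im w) => u u0 v *; nra.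
have nw0 : 0 < nm w ^+ 2 by rewrite exprn_gt0// nm_gt0 Im_gt0_neq0.
have [|w' w'1 w'2] := IHN (- w^-1) (Im_inv_gt0 w0).
  rewrite Im_inv ler_pdivlMr//; apply: le_trans _ _; last by rewrite wI; exact: hN.
  have cN : 0 <= c ^+ N by rewrite exprn_ge0//; case/andP: c01.
  have -> : 17 / 20 * c ^+ N.+1 = 17 / 20 * c ^+ N * c by rewrite exprSr; ring.
  apply: ler_wpM2l nw.
  by rewrite mulr_ge0//; lra.
by exists w' => //; rewrite w'2 FS// FT.
Qed.

(** This gives the finiteness of the supremum in [vanishing]: y^k is at most k! exp y, and 4 pi m >=
    1. *)
Lemma exp_poly_bound (k m : nat) : (0 < m)%N -> exists B : R, forall y, 0 <= y ->
  y ^+ k * expR (- (4 * pi * m%:R * y)) <= B.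
Proof.
move=> m0; exists (k`!%:R) => y y0.
have h1 : y ^+ k <= k`!%:R * expR y.
  case: k => [|k].
    by rewrite expr0 mul1r; have := expR_ge1Dx y; lra.
  have := expR_ge1Dxn k y0; have f0 : 0 < (k.+1)`!%:R :> R by rewrite ltr0n fact_gt0.
  by rewrite -ler_pdivrMl// [_^-1 * _]mulrC; lra.
have h2 : expR (- (4 * pi * m%:R * y)) <= expR (- y).
  rewrite ler_expR lerN2; have m1 : 1 <= m%:R :> R by rewrite ler1n.
  have p3 := @pi_ge3 R.
  have : 1 <= 4 * pi * m%:R :> R by nra.
  by move=> h; rewrite -{1}[y]mul1r ler_wpM2r.
apply: (@le_trans _ _ ((k`!%:R * expR y) * expR (- y))).
  by rewrite ler_pM ?exprn_ge0 ?expR_ge0.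
by rewrite -mulrA -expRD subrr expR0 mulr1.
Qed.

(** Lowering the height from y to l y costs the factor l^(-k) and gains exp (- 4 pi m (1 - l) y).
    Since 1 / l <= exp ((1 - l) / l) and 4 pi y >= 4 * 3 * 17/20 = 51/5, the product is at most exp
    ((1 - l) (k / l - 51 m / 5)), below 1 as soon as l exceeds 5 k / (51 m). *)
Lemma contraction_factor (k m : nat) : k%:R < 51 / 5 * m%:R :> R ->
  exists l t : R, [/\ 0 < l < 1, 0 <= t < 1 &
   forall y, 17 / 20 <= y ->
     (l^-1) ^+ k * expR (- (4 * pi * m%:R * ((1 - l) * y))) <= t].
Proof.
move=> km; set mm := 51 / 5 * m%:R in km.
have k0 : 0 <= k%:R :> R by [].
have mm0 : 0 < mm by apply: le_lt_trans km.
pose l : R := (k%:R / mm + 1) / 2.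
have kmm : k%:R / mm < 1 by rewrite ltr_pdivrMr// mul1r.
have kmm0 : 0 <= k%:R / mm by rewrite divr_ge0// ltW.
have l01 : 0 < l < 1 by rewrite /l; apply/andP; split; lra.
have [l0 l1] := andP l01.
have kl : k%:R / l < mm.
  by rewrite ltr_pdivrMr// mulrC -ltr_pdivrMr// /l; lra.
exists l, (expR ((1 - l) * (k%:R / l - mm))); split=> //.
  rewrite expR_ge0 -[X in _ < X]expR0 ltr_expR /=.
  by rewrite pmulr_rlt0; lra.
move=> y hy; apply: (@le_trans _ _ (expR ((1 - l) / l) ^+ k * expR (- ((1 - l) * mm)))).
  rewrite ler_pM ?exprn_ge0 ?invr_ge0 ?(ltW l0) ?expR_ge0//.
    rewrite lerXn2r ?nnegrE ?invr_ge0 ?expR_ge0 ?(ltW l0)//.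
    rewrite [leLHS](_ : _ = 1 + (1 - l) / l).
      exact: expR_ge1Dx.
    by rewrite mulrBl divff ?gt_eqF// mul1r addrC subrK.
  have -> : 4 * pi * m%:R * ((1 - l) * y) = (1 - l) * (4 * pi * m%:R * y) by ring.
  rewrite ler_expR lerN2 ler_wpM2l//; first by lra.
  rewrite /mm; have p3 := @pi_ge3 R; have m0 : 0 <= m%:R :> R by [].
  have : 51 / 5 <= 4 * pi * y by nra.
  by move: (m%:R) m0 => M M0 *; nra.
rewrite -expRM_natl -expRD ler_expR le_eqVlt; apply/orP; left; apply/eqP.
by field; rewrite gt_eqF//.
Qed.

Lemma ev_decay a m (r : R) : opd a -> (forall n, (n < m)%N -> a n = 0) -> 0 <= r < 1 ->
  exists K, 0 <= K /\ forall q, nm q <= r -> nm (ev a q) <= K * nm q ^+ m.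
Proof.
move=> aO a0 r01; have bO := opd_shift m aO.
have [_ [K hK]] := opd_summ_nm bO r01.
have K0 : 0 <= K by have := hK 0%N; rewrite big_ord0.
exists K; split=> // q qr; have q1 : nm q < 1 by apply: le_lt_trans qr _; case/andP: r01.
rewrite (ev_shift aO q1 a0) nmM nmX mulrC ler_wpM2r ?exprn_ge0 ?nm_ge0//.
apply: nm_ev_le => // N; apply: le_trans (hK N); apply: ler_sum => i _.
by rewrite ler_wpM2l ?nm_ge0// lerXn2r ?nnegrE ?nm_ge0//; case/andP: r01.
Qed.

(* The invariant function |f|^2 y^k is bounded by its supremum over y >= 17/20;
   there, Schwarz's lemma multiplies its supremum by a factor < 1. *)
Theorem vanishing a (k m : nat) : opd a -> (forall n, (n < m)%N -> a n = 0) ->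
  (forall z, 0 < complex.Im z -> ev a (qexp (- z^-1)) = z ^+ k * ev a (qexp z)) ->
  (5 * k < 51 * m)%N -> forall n, a n = 0.
Proof.
move=> aO a0 aS km; pose H z : R := nm (ev a (qexp z)) ^+ 2 * complex.Im z ^+ k.
have m0 : (0 < m)%N by case: m km {a0} => //; rewrite muln0.
have km' : k%:R < 51 / 5 * m%:R :> R.
  have : (5 * k)%:R < (51 * m)%:R :> R by rewrite ltr_nat.
  by rewrite !natrM; lra.
have HT z (n : int) : 0 < complex.Im z -> H (z + n%:~R) = H z.
  by move=> _; rewrite /H qexpD qexp_int mulr1 raddfD/= Im_intr addr0.
have HS z : 0 < complex.Im z -> H (- z^-1) = H z.
  move=> z0; rewrite /H aS// Im_inv nmM nmX expr_div_n exprMn -!exprM.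
  by rewrite [(k * 2)%N]mulnC; field; rewrite expf_neq0// nm_eq0 Im_gt0_neq0.
have red := reduction HT HS.
pose y0 : R := 17 / 20.
pose Q : R := expR (- (2 * pi * y0)).
have pi0 := @pi_gt0 R.
have Q01 : 0 <= Q < 1.
  rewrite /Q expR_ge0 -expR0 ltr_expR oppr_lt0 !mulr_gt0//; rewrite /y0; lra.
have [K [K0 hK]] := ev_decay aO a0 Q01.
have [B hB] := exp_poly_bound k m0.
have Hbd z : 0 < complex.Im z -> H z <= K ^+ 2 * B.
  move=> /red[w w0 <-]; set y := complex.Im w in w0 *.
  have y00 : 0 <= y by lra.
  have qw : nm (qexp w) <= Q.
    by rewrite nm_qexp ler_expR lerN2 ler_pM2l ?mulr_gt0.
  apply: (@le_trans _ _ ((K * nm (qexp w) ^+ m) ^+ 2 * y ^+ k)).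
    rewrite /H ler_wpM2r ?exprn_ge0// lerXn2r ?nnegrE ?nm_ge0 ?hK//.
    by rewrite mulr_ge0 ?exprn_ge0 ?nm_ge0.
  rewrite exprMn -mulrA ler_wpM2l ?sqr_ge0//.
  apply: le_trans (hB y y00).
  rewrite mulrC ler_wpM2l ?exprn_ge0// nm_qexp -exprM -expRM_natl ler_expR.
  by rewrite natrM /y; lra.
pose S := [set x | exists2 z, 0 < complex.Im z & x = H z].
have iI : 0 < complex.Im ('i%C : C) by rewrite /= ltr01.
have supS : has_sup S.
  split; first by exists (H 'i%C), 'i%C.
  by exists (K ^+ 2 * B) => _ [z z0 ->]; exact: Hbd.
set M := sup S.
have HM z : 0 < complex.Im z -> H z <= M.
  by move=> z0; apply: ub_le_sup supS.2 _ _; exists z.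
have H0 z : 0 < complex.Im z -> 0 <= H z.
  by move=> z0; rewrite /H mulr_ge0 ?sqr_ge0// exprn_ge0// ltW.
have M0 : 0 <= M := le_trans (H0 _ iI) (HM _ iI).
have [l [t [/andP[l0 l1] /andP[t0 t1] hlt]]] := contraction_factor km'.
have Ht z : 0 < complex.Im z -> H z <= t * M.
  move=> /red[w w0 <-]; set y := complex.Im w in w0 *.
  have y00 : 0 < y by lra.
  (* Schwarz's lemma is applied on the larger circle belonging to the height l y. This height may
     lie below 17/20, but [HM] holds on the whole half-plane. *)
  pose Y := l * y; have Y0 : 0 < Y by rewrite mulr_gt0.
  have Yk0 : 0 < Y ^+ k by rewrite exprn_gt0.
  pose w' : C := Complex 0 Y.
  have nQ : nm (qexp w') = expR (- (2 * pi * Y)) by rewrite nm_qexp.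
  have nq : nm (qexp w) = expR (- (2 * pi * y)) by rewrite nm_qexp.
  have Yy : Y < y by rewrite /Y -{2}[y]mul1r ltr_pM2r.
  have bnd q' : nm q' = nm (qexp w') -> nm (ev a q') <= Num.sqrt (M / Y ^+ k).
    move=> q'E; have [|z' [z'0 z'q]] := @qexp_surj R q'.
      by rewrite q'E nm_gt0 qexp_neq0 nm_qexp_lt1.
    have z'Y : complex.Im z' = Y.
      have : expR (- (2 * pi * complex.Im z')) = expR (- (2 * pi * Y)).
        by rewrite -nm_qexp z'q q'E nQ.
      by move/expR_inj/oppr_inj/mulfI; apply; rewrite mulf_neq0// gt_eqF.
    rewrite -(ger0_norm (nm_ge0 _)) -sqrtr_sqr ler_sqrt ?divr_ge0 ?(ltW Yk0)//.
    by rewrite ler_pdivlMr// -z'q -z'Y; apply: HM.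
  have qQ : nm (qexp w) < nm (qexp w').
    by rewrite nq nQ ltr_expR ltrN2 ltr_pM2l ?mulr_gt0.
  have Q1 : nm (qexp w') < 1 by rewrite nm_qexp_lt1.
  have := schwarz aO a0 qQ Q1 bnd.
  set s := nm (qexp w) / nm (qexp w') => hs.
  apply: (@le_trans _ _ ((s ^+ m * Num.sqrt (M / Y ^+ k)) ^+ 2 * y ^+ k)).
    rewrite /H ler_wpM2r ?exprn_ge0 ?(ltW y00)//.
    rewrite lerXn2r ?nnegrE ?nm_ge0// mulr_ge0 ?sqrtr_ge0// exprn_ge0//.
    by rewrite divr_ge0 ?nm_ge0.
  rewrite exprMn sqr_sqrtr ?divr_ge0 ?(ltW Yk0)//.
  have sE : (s ^+ m) ^+ 2 = expR (- (4 * pi * m%:R * ((1 - l) * y))).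
    rewrite /s nq nQ -expRN -expRD -!expRM_natl; congr expR.
    by rewrite /Y; ring.
  rewrite sE; have -> : expR (- (4 * pi * m%:R * ((1 - l) * y))) * (M / Y ^+ k) * y ^+ k =
     (l^-1 ^+ k * expR (- (4 * pi * m%:R * ((1 - l) * y)))) * M.
    by rewrite /Y exprMn exprVn; field; rewrite !expf_neq0// gt_eqF.
  by rewrite ler_wpM2r// hlt.
have M00 : M = 0.
  apply/eqP; rewrite eq_le M0 andbT.
  have : M <= t * M by apply: ge_sup supS.1 _ => _ [z z0 ->]; exact: Ht.
  by nra.
apply: (@ev_coef_uniq _ _ (1 / 2) aO); first by apply/andP; split; lra.
move=> q qE; have [|z [z0 <-]] := @qexp_surj R q; first by rewrite qE; apply/andP; split; lra.
have : H z = 0 by apply/eqP; rewrite eq_le H0// andbT -M00 HM.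
move/eqP; rewrite mulf_eq0 expf_eq0/= nm_eq0 expf_eq0 => /orP[/eqP//|].
by rewrite gt_eqF// andbF.
Qed.

End Vanishing.

(** * Complex derivatives with quadratic remainder *)

Section Calculus.
Variable R : realType.
Local Notation C := (complex R).
Implicit Types (z w q h l : C) (a b : nat -> C) (f g : C -> C).

(* l is the derivative of f at z, with a quadratic remainder *)
Definition dl f z l := exists (M r : R), 0 < r /\
  forall h, nm h < r -> nm (f (z + h) - f z - l * h) <= M * nm h ^+ 2.

Lemma dl_ge0 f z l : dl f z l -> exists (M r : R), [/\ 0 <= M, 0 < r, r <= 1 &
  forall h, nm h < r -> nm (f (z + h) - f z - l * h) <= M * nm h ^+ 2].
Proof.
move=> [M [r [r0 H]]]; exists `|M|, (Num.min r 1); split=> //.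
- by rewrite lt_min r0 ltr01.
- by rewrite ge_min lexx orbT.
- move=> h; rewrite lt_min => /andP[/H h1 _]; apply: le_trans h1 _.
  by rewrite ler_wpM2r ?sqr_ge0// ler_norm.
Qed.

Lemma dl_lip f z l : dl f z l -> exists (M r : R), [/\ 0 <= M, 0 < r &
  forall h, nm h < r -> nm (f (z + h) - f z) <= M * nm h].
Proof.
move=> /dl_ge0[M [r [M0 r0 r1 H]]]; exists (M + nm l), r; split=> //.
  by rewrite addr_ge0 ?nm_ge0.
move=> h hr; have := H h hr; have := nmD (f (z + h) - f z - l * h) (l * h).
rewrite subrK nmM; have := nm_ge0 h.
have h1 : nm h <= 1 by apply: ltW; apply: lt_le_trans r1.
move=> h0; have h2 : nm h ^+ 2 <= nm h by nra.
by have := ler_wpM2l M0 h2; rewrite mulrDl; lra.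
Qed.

Lemma dl_cv f z l u : dl f z l -> cv u z -> cv (fun n => f (u n)) (f z).
Proof.
move=> /dl_lip[M [r [M0 r0 H]]] uz e e0.
have M1 : 0 < M + 1 by lra.
have er : 0 < Num.min r (e / (M + 1)) by rewrite lt_min r0 divr_gt0.
have [N hN] := uz _ er; exists N => n /hN; rewrite lt_min => /andP[h1 h2].
have -> : u n = z + (u n - z) by ring.
apply: le_lt_trans (H _ h1) _; move: h2; rewrite ltr_pdivlMr//.
by have := nm_ge0 (u n - z); nra.
Qed.

Lemma dl_unique f z l l' : dl f z l -> dl f z l' -> l = l'.
Proof.
move=> /dl_ge0[M [r [M0 r0 _ H]]] /dl_ge0[M' [r' [M'0 r'0 _ H']]].
apply/eqP; rewrite -subr_eq0 -nm_eq0; apply/negPn/negP => ne0.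
have e0 : 0 < nm (l - l') by rewrite lt_neqAle nm_ge0 eq_sym ne0.
set e := nm (l - l') in e0.
pose s := Num.min (Num.min r r') (e / (M + M' + 1)) / 2.
have MM : 0 < M + M' + 1 by lra.
have m0 : 0 < Num.min (Num.min r r') (e / (M + M' + 1)).
  by rewrite !lt_min r0 r'0 divr_gt0.
have s0 : 0 < s by rewrite /s; lra.
have sm : s < Num.min (Num.min r r') (e / (M + M' + 1)) by rewrite /s; lra.
move: sm; rewrite !lt_min => /andP[/andP[sr sr'] se].
have ns : nm s%:C%C = s by rewrite nm_real gtr0_norm.
have h1 := H s%:C%C; have h2 := H' s%:C%C; rewrite ns in h1 h2.
have := nmD (f (z + s%:C%C) - f z - l' * s%:C%C) (- (f (z + s%:C%C) - f z - l * s%:C%C)).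
have -> : f (z + s%:C%C) - f z - l' * s%:C%C + - (f (z + s%:C%C) - f z - l * s%:C%C) =
   (l - l') * s%:C%C by ring.
rewrite nmN nmM ns -/e; have := h1 sr; have := h2 sr'.
move: se; rewrite ltr_pdivlMr// => se h3 h4 h5.
have : e * s <= (M + M') * s ^+ 2 by lra.
have -> : (M + M') * s ^+ 2 = (s * (M + M')) * s by ring.
rewrite ler_pM2r//; lra.
Qed.

Lemma dl_ext f g z l : (exists r : R, 0 < r /\ forall h, nm h < r -> f (z + h) = g (z + h)) ->
  dl f z l -> dl g z l.
Proof.
move=> [r [r0 fg]] [M [s [s0 H]]]; exists M, (Num.min r s); split.
  by rewrite lt_min r0.
move=> h; rewrite lt_min => /andP[/fg <- /H]; rewrite -[g z](_ : f z = _)//.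
by have := fg 0; rewrite nm0 addr0; apply.
Qed.

Lemma dl_cst c z : dl (fun=> c) z 0.
Proof.
by exists 0, 1; split=> // h _; rewrite subrr mul0r subr0 nm0 mul0r.
Qed.

Lemma dl_id z : dl id z 1.
Proof.
exists 0, 1; split=> // h _.
by rewrite [_ - _ - _](_ : _ = 0) ?nm0 ?mul0r//; ring.
Qed.

Lemma dlD f g z l l' : dl f z l -> dl g z l' -> dl (fun z => f z + g z) z (l + l').
Proof.
move=> [M [r [r0 H]]] [M' [r' [r'0 H']]]; exists (M + M'), (Num.min r r').
split; first by rewrite lt_min r0.
move=> h; rewrite lt_min => /andP[/H h1 /H' h2].
have -> : f (z + h) + g (z + h) - (f z + g z) - (l + l') * h =
  (f (z + h) - f z - l * h) + (g (z + h) - g z - l' * h) by ring.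
by have := nmD (f (z + h) - f z - l * h) (g (z + h) - g z - l' * h); lra.
Qed.

Lemma dlM f g z l l' : dl f z l -> dl g z l' ->
  dl (fun z => f z * g z) z (l * g z + f z * l').
Proof.
move=> fl gl; have [K [s [K0 s0 L]]] := dl_lip gl.
move: fl gl => /dl_ge0[M [r [M0 r0 r1 H]]] /dl_ge0[M' [r' [M'0 r'0 r'1 H']]].
exists (M * (nm (g z) + K) + nm (f z) * M' + nm l * K), (Num.min s (Num.min r r')).
split; first by rewrite !lt_min s0 r0.
move=> h; rewrite !lt_min => /and3P[/L h3 hr hr'].
have h1 := H _ hr; have h2 := H' _ hr'.
have h4 : nm (g (z + h)) <= nm (g z) + K.
  have := nmD (g (z + h) - g z) (g z); rewrite subrK.
  have : nm h <= 1 by apply: ltW; apply: lt_le_trans hr r1.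
  by nra.
have -> : f (z + h) * g (z + h) - f z * g z - (l * g z + f z * l') * h =
  (f (z + h) - f z - l * h) * g (z + h) + f z * (g (z + h) - g z - l' * h) +
  l * (g (z + h) - g z) * h by ring.
apply: le_trans (nmD _ _) _; apply: le_trans (lerD (nmD _ _) (lexx _)) _.
rewrite !nmM !mulrDl; apply: lerD; last first.
  rewrite [nm l * K * _](_ : _ = nm l * (K * nm h) * nm h); last by ring.
  by rewrite ler_wpM2r ?nm_ge0// ler_wpM2l ?nm_ge0.
apply: lerD; last by rewrite -mulrA ler_wpM2l ?nm_ge0.
by rewrite mulrAC ler_pM ?nm_ge0.
Qed.

Lemma dl_comp f g z l l' : dl f z l -> dl g (f z) l' -> dl (fun z => g (f z)) z (l' * l).
Proof.
move=> fl gl; have [K [s [K0 s0 L]]] := dl_lip fl.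
move: fl gl => /dl_ge0[M [r [M0 r0 r1 H]]] /dl_ge0[M' [r' [M'0 r'0 r'1 H']]].
exists (M' * K ^+ 2 + nm l' * M), (Num.min s (Num.min r (r' / (K + 1)))).
have K1 : 0 < K + 1 by lra.
split; first by rewrite !lt_min s0 r0 divr_gt0.
move=> h; rewrite !lt_min => /and3P[/L h3 hr]; rewrite ltr_pdivlMr// => hr'.
have h1 := H _ hr; set k := f (z + h) - f z in h1 h3 *.
have kr : nm k < r' by have := nm_ge0 h; nra.
have -> : f (z + h) = f z + k by rewrite /k; ring.
have -> : g (f z + k) - g (f z) - l' * l * h =
  (g (f z + k) - g (f z) - l' * k) + l' * (k - l * h) by ring.
apply: le_trans (nmD _ _) _; rewrite mulrDl; apply: lerD.
  apply: le_trans (H' _ kr) _; rewrite -mulrA ler_wpM2l// -exprMn.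
  by rewrite lerXn2r ?nnegrE ?nm_ge0// mulr_ge0 ?nm_ge0.
by rewrite nmM -mulrA ler_wpM2l ?nm_ge0.
Qed.

Lemma dl_inv z : z != 0 -> dl (fun z => z^-1) z (- (z ^+ 2)^-1).
Proof.
move=> z0; have nz : 0 < nm z by rewrite nm_gt0.
exists (2 / nm z ^+ 3), (nm z / 2); split=> [|h hz]; first by rewrite divr_gt0.
have zh : nm z / 2 <= nm (z + h).
  have := nmD (z + h) (- h); rewrite nmN addrK; lra.
have zh0 : z + h != 0 by rewrite -nm_gt0; lra.
have -> : (z + h)^-1 - z^-1 - - (z ^+ 2)^-1 * h = h ^+ 2 / (z ^+ 2 * (z + h)).
  by field; rewrite z0 zh0.
rewrite nmM nmV nmM [nm (h ^+ 2)]nmX [nm (z ^+ 2)]nmX mulrC ler_wpM2r ?sqr_ge0//.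
rewrite -[leRHS]invrK lef_pV2 ?posrE ?invr_gt0 ?divr_gt0 ?mulr_gt0 ?exprn_gt0//; last by lra.
rewrite invf_div [nm z ^+ 3]exprSr -mulrA ler_wpM2l// exprn_ge0// ltW//.
Qed.

Lemma dlX z n : dl (fun z => z ^+ n) z (n%:R * z ^+ n.-1).
Proof.
elim: n => [|n IHn].
  by rewrite mul0r; apply: dl_ext (dl_cst 1 z); exists 1; split.
have -> : n.+1%:R * z ^+ n.+1.-1 = 1 * z ^+ n + z * (n%:R * z ^+ n.-1).
  by case: n {IHn} => [|n] /=; rewrite ?mul0r ?expr0 ?exprS -?[n.+2]addn1 ?natrD; ring.
apply: dl_ext (dlM (dl_id z) IHn); exists 1; split=> // h _.
by rewrite exprS.
Qed.

Lemma dl_cexpo z : dl (@cexpo R) z (cexpo z).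
Proof.
exists (nm (cexpo z) * 10), (1 / 2); split; first by lra.
move=> h /ltW/cexpo_quad hh; rewrite cexpoD.
have -> : cexpo z * cexpo h - cexpo z - cexpo z * h = cexpo z * (cexpo h - 1 - h) by ring.
by rewrite nmM -mulrA ler_wpM2l ?nm_ge0.
Qed.

Lemma dl_qexp z : dl (@qexp R) z (Complex 0 (2 * pi) * qexp z).
Proof.
have := dl_comp (dlM (dl_cst (Complex 0 (2 * pi)) z) (dl_id z)) (dl_cexpo _).
by rewrite mul0r add0r mulr1 [cexpo _ * _]mulrC.
Qed.

(** The operator q d/dq on coefficients, that is, (2 i pi)^-1 d/dz on functions of z. *)
Definition theta a : nat -> C := fun n => n%:R * a n.

Lemma opd_theta a : opd a -> opd (theta a).
Proof.
move=> aO r r01; have [M [s [M0 s01 hM]]] := opd_geo aO r01.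
exists (M * (1 - s)^-1) => n; rewrite nmM nm_nat -mulrA.
apply: (@le_trans _ _ (n%:R * (M * s ^+ n))); first by rewrite ler_wpM2l.
rewrite mulrCA ler_wpM2l//; apply: le_trans (lerS_geo n s01).
by rewrite ler_wpM2r ?ler_nat// exprn_ge0//; case/andP: s01.
Qed.

(** The Taylor remainder R_n of q^n satisfies R_(n+1) = (q + h) R_n + n h^2 q^(n-1). The factor r^2
    on the left avoids the exponent n - 2. *)
Lemma binomial_remainder q h (r : R) n : nm q + nm h <= r -> 
  r ^+ 2 * nm ((q + h) ^+ n - q ^+ n - n%:R * q ^+ n.-1 * h) <= n%:R ^+ 2 * nm h ^+ 2 * r ^+ n.
Proof.
move=> qh; have q0 := nm_ge0 q; have h0 := nm_ge0 h; have r0 : 0 <= r by lra.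
elim: n => [|n IHn].
  by rewrite !expr0 mul0r mul0r subrr subr0 nm0 mulr0 expr0n/= !mul0r.
pose T := (q + h) ^+ n - q ^+ n - n%:R * q ^+ n.-1 * h.
have -> : (q + h) ^+ n.+1 - q ^+ n.+1 - n.+1%:R * q ^+ n.+1.-1 * h =
    (q + h) * T + n%:R * h ^+ 2 * q ^+ n.-1.
  rewrite /T; case: n {IHn T} => [|n] /=; first by rewrite !expr0; ring.
  by rewrite !exprS -[n.+2]addn1 natrD; ring.
have e1 : nm ((q + h) * T) <= r * nm T.
  by rewrite nmM ler_wpM2r ?nm_ge0//; apply: le_trans (nmD _ _) qh.
have e2 : r ^+ 2 * nm (n%:R * h ^+ 2 * q ^+ n.-1) <= n%:R * nm h ^+ 2 * r ^+ n.+1.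
  case: n {IHn T e1} => [|n] /=; first by rewrite !mul0r nm0 mulr0.
  rewrite !nmM nm_nat !nmX [leRHS](_ : _ = r ^+ 2 * (n.+1%:R * nm h ^+ 2 * r ^+ n)); last first.
    by rewrite -[n.+2]addn2 exprD; ring.
  rewrite ler_wpM2l ?sqr_ge0// ler_wpM2l ?mulr_ge0 ?sqr_ge0//.
  by rewrite lerXn2r ?nnegrE//; lra.
apply: (@le_trans _ _ (r ^+ 2 * (r * nm T) + n%:R * nm h ^+ 2 * r ^+ n.+1)).
  apply: le_trans (ler_wpM2l (sqr_ge0 r) (nmD _ _)) _.
  by rewrite mulrDr lerD// ler_wpM2l ?sqr_ge0.
apply: (@le_trans _ _ (r * (n%:R ^+ 2 * nm h ^+ 2 * r ^+ n) + n%:R * nm h ^+ 2 * r ^+ n.+1)).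
  by rewrite lerD2r mulrCA ler_wpM2l.
rewrite [leLHS](_ : _ = (n%:R ^+ 2 + n%:R) * (nm h ^+ 2 * r ^+ n.+1)); last by rewrite [r ^+ n.+1]exprS; ring.
rewrite -mulrA ler_wpM2r ?mulr_ge0 ?sqr_ge0 ?exprn_ge0//.
rewrite -[n.+1]addn1 natrD; have : 0 <= n%:R :> R by [].
by nra.
Qed.

Definition deriv_seq a : nat -> C := fun n => theta a n.+1.

Lemma opd_deriv a : opd a -> opd (deriv_seq a).
Proof.
move=> aO; have := opd_shift 1 (opd_theta aO).
by move=> h r /h[M hM]; exists M => n; have := hM n; rewrite addn1.
Qed.

Lemma ev_theta a q : opd a -> nm q < 1 -> ev (theta a) q = q * ev (deriv_seq a) q.
Proof.
move=> aO q1; rewrite (@ev_shift _ _ 1%N)//; [|exact: opd_theta|]; last first.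
  by case=> // _; rewrite /theta mul0r.
have -> : (fun n => theta a (n + 1)%N) = deriv_seq a by apply/funext => n; rewrite addn1.
by [].
Qed.

(** Termwise differentiation: the remainders of the powers add up to at most |h|^2 / r^2 times the
    sum of n^2 |a n| r^n, finite for a radius r between |q| and 1. *)
Lemma dl_ev a q : opd a -> nm q < 1 -> dl (ev a) q (ev (deriv_seq a) q).
Proof.
move=> aO q1; have q0 := nm_ge0 q.
pose s := (1 - nm q) / 2; pose r := nm q + s.
have s0 : 0 < s by rewrite /s; lra.
have r0 : 0 < r by rewrite /r; lra.
have r01 : 0 <= r < 1 by rewrite ltW//= /r /s; lra.
have aS := opd_summ_nm (opd_theta (opd_theta aO)) r01.
have [_ [B hB]] := aS.
have r20 : 0 < r ^+ 2 by rewrite exprn_gt0.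
exists (B / r ^+ 2), s; split=> // h hs.
have qh : nm q + nm h <= r by rewrite /r; lra.
have qh1 : nm (q + h) < 1.
  by apply: le_lt_trans (nmD _ _) _; apply: le_lt_trans qh _; case/andP: r01.
have c1 := cvD (ev_cv aO qh1) (cvZ (-1) (ev_cv aO q1)).
have c2 := cvZ (- h) (ev_cv (opd_deriv aO) q1).
have -> : ev a (q + h) - ev a q - ev (deriv_seq a) q * h =
  (ev a (q + h) + -1 * ev a q) + - h * ev (deriv_seq a) q by rewrite mulN1r mulNr [h * _]mulrC.
pose T n : C := a n * ((q + h) ^+ n - q ^+ n - n%:R * q ^+ n.-1 * h).
apply: (@cv_nm_le _ (partial T)); last first.
  exists 0%N => N _; rewrite mulrAC ler_pdivlMr// mulrC.
  apply: le_trans (ler_wpM2l (ltW r20) (nm_sum _ _ _)) _; rewrite mulr_sumr.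
  apply: (@le_trans _ _ ((\sum_(n < N) nm (theta (theta a) n) * r ^+ n) * nm h ^+ 2)).
    rewrite mulr_suml; apply: ler_sum => n _; rewrite /T /theta !nmM nm_nat.
    rewrite mulrCA [leRHS](_ : _ = nm (a n) * (n%:R ^+ 2 * nm h ^+ 2 * r ^+ n)); last by ring.
    by rewrite ler_wpM2l ?nm_ge0// binomial_remainder.
  by rewrite ler_wpM2r ?sqr_ge0.
(* the partial sums of the derived series lag by one term *)
have c3 : cv (partial (fun n => n%:R * a n * q ^+ n.-1)) (ev (deriv_seq a) q).
  move=> e /(ev_cv (opd_deriv aO) q1)[N hN]; exists N.+1 => -[//|n] Nn.
  rewrite /partial big_ord_recl/= !mul0r add0r; exact: hN.
apply: cv_near (cvD c1 (cvZ (- h) c3)); exists 0%N => N _.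
rewrite /partial !mulr_sumr -!big_split; apply: eq_bigr => n _ /=.
by rewrite /T; ring.
Qed.

Lemma cv_inv_nat : cv (fun n => (n.+1%:R)^-1 : C) 0.
Proof.
move=> e e0; exists (Num.trunc e^-1).+1 => n hn; rewrite subr0 nmV nm_nat.
rewrite invf_plt ?posrE//; apply: lt_trans (Num.Theory.truncnS_gt _) _.
by rewrite ltr_nat ltnS.
Qed.

End Calculus.

(** * Derivatives of modular forms, the Rankin-Cohen bracket, and the zeros of Delta *)

Section RankinCohen.
Variable R : realType.
Local Notation C := (complex R).
Implicit Types (z w q h l : C) (a b : nat -> C) (f g : C -> C).
Local Notation kappa := (Complex 0 (2 * pi) : C).

(** Invariance under translations is built into [qexp], so only the inversion has to be
    prescribed. *)
Definition S_invariant (k : nat) (a : nat -> C) := forall z, 0 < complex.Im z ->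
  ev a (qexp (- z^-1)) = z ^+ k * ev a (qexp z).

Lemma kappa_neq0 : kappa != 0.
Proof. by rewrite eq_complex /= eqxx mulf_neq0// ?gt_eqF ?pi_gt0. Qed.

Lemma ev_derivE a q : opd a -> nm q < 1 -> q * ev (deriv_seq a) q = ev (theta a) q.
Proof. by move=> aO q1; rewrite ev_theta. Qed.

Lemma dl_ev_qexp a z : opd a -> 0 < complex.Im z ->
  dl (fun z => ev a (qexp z)) z (kappa * ev (theta a) (qexp z)).
Proof.
move=> aO z0; have := dl_comp (dl_qexp z) (dl_ev aO (nm_qexp_lt1 z0)).
by rewrite mulrCA [ev _ _ * _]mulrC ev_derivE// nm_qexp_lt1.
Qed.

Lemma Im_gt0_near z : 0 < complex.Im z -> forall h, nm h < complex.Im z ->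
  0 < complex.Im (z + h).
Proof.
move=> z0 h hz; rewrite raddfD/=; have := nm_Im h; rewrite ler_norml => /andP[+ _].
by lra.
Qed.

(** The chain rule for z -> - 1/z, whose derivative is z^-2, combined with uniqueness of
    derivatives. *)
Lemma dl_inv_eq f g z l l' : (forall w, 0 < complex.Im w -> f (- w^-1) = g w) ->
  0 < complex.Im z -> dl f (- z^-1) l -> dl g z l' -> l = z ^+ 2 * l'.
Proof.
move=> fg z0 fl gl; have z00 := Im_gt0_neq0 z0.
have h1 := dlM (dl_cst (-1) z) (dl_inv z00).
have <- : l * (z ^+ 2)^-1 = l'.
  apply: dl_unique _ gl; have h2 : dl (fun z => -1 * z^-1) z ((z ^+ 2)^-1).
    by move: h1; rewrite mul0r add0r mulN1r opprK.
  have h3 : dl f (-1 * z^-1) l by rewrite mulN1r.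
  have := dl_comp h2 h3; apply: dl_ext; exists (complex.Im z); split=> // h hz.
  by rewrite mulN1r fg// Im_gt0_near.
by rewrite mulrC divfK// expf_neq0.
Qed.

(** The transformation law differentiated once: the last term is the failure of the derivative to be
    modular. Writing the weight as [k.+1] lets the exponent in the derivative of z^(k+1) reduce. *)
Lemma theta_S k a : opd a -> S_invariant k.+1 a -> forall z, 0 < complex.Im z ->
  ev (theta a) (qexp (- z^-1)) =
  z ^+ k.+3 * ev (theta a) (qexp z) + k.+1%:R / kappa * z ^+ k.+2 * ev a (qexp z).
Proof.
move=> aO aS z z0; have k0 := kappa_neq0.
have h1 := dl_ev_qexp aO (Im_inv_gt0 z0).
have h2 := dlM (dlX z k.+1) (dl_ev_qexp aO z0).
have /= E := dl_inv_eq aS z0 h1 h2.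
apply: (mulfI k0); rewrite E !exprS; field; exact: k0.
Qed.

Lemma theta2_S k a : opd a -> S_invariant k.+1 a -> forall z, 0 < complex.Im z ->
  ev (theta (theta a)) (qexp (- z^-1)) =
  z ^+ k.+1 * (z ^+ 4 * ev (theta (theta a)) (qexp z)
  + 2 * k.+2%:R / kappa * z ^+ 3 * ev (theta a) (qexp z)
  + k.+1%:R * k.+2%:R / kappa ^+ 2 * z ^+ 2 * ev a (qexp z)).
Proof.
move=> aO aS z z0; have k0 := kappa_neq0; have tO := opd_theta aO.
have h1 := dl_ev_qexp tO (Im_inv_gt0 z0).
have h2 := dlD (dlM (dlX z k.+3) (dl_ev_qexp tO z0))
  (dlM (dlM (dl_cst (k.+1%:R / kappa) z) (dlX z k.+2)) (dl_ev_qexp aO z0)).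
have /= E := dl_inv_eq (theta_S aO aS) z0 h1 h2.
apply: (mulfI k0); rewrite E !exprS -[k.+3]addn1 -[k.+2]addn1 !natrD; field; exact: k0.
Qed.

Lemma opd_comb a b c (x y : C) : opd a -> opd b -> opd c ->
  opd (fun n => x * a n + (y * b n + c n)).
Proof. by move=> ? ? ?; apply: opdD; [apply: opdZ|apply: opdD => //; apply: opdZ]. Qed.

(* the second Rankin-Cohen bracket of d with itself, plus e d^2 *)
Definition bracket_seq (d e : nat -> C) : nat -> C := fun n =>
  12 * cprod d (theta (theta d)) n + (-13 * cprod (theta d) (theta d) n + cprod e (cprod d d) n).

Lemma opd_bracket d e : opd d -> opd e -> opd (bracket_seq d e).
Proof.
by move=> dO eO; apply: opd_comb; repeat (apply: opdM || apply: opd_theta).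
Qed.

Lemma ev_bracket d e q : opd d -> opd e -> nm q < 1 -> ev (bracket_seq d e) q =
  12 * ev d q * ev (theta (theta d)) q - 13 * ev (theta d) q ^+ 2 + ev e q * ev d q ^+ 2.
Proof.
move=> dO eO q1; have tO := opd_theta dO; have ttO := opd_theta tO.
have PO := opdM dO ttO; have QO := opdM tO tO.
have dd := opdM dO dO; have TO := opdM eO dd.
rewrite /bracket_seq (@evD _ (fun n => 12 * cprod d (theta (theta d)) n)
  (fun n => -13 * cprod (theta d) (theta d) n + cprod e (cprod d d) n))//;
  [|exact: opdZ|by apply: opdD => //; exact: opdZ].
rewrite (@evD _ (fun n => -13 * cprod (theta d) (theta d) n))//; last exact: opdZ.
by rewrite !evZ ?evM//; ring.
Qed.

(** The coefficients 12 and -13 are k and -(k + 1) for weight k = 12: they cancel the non-modular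
    terms of [theta_S] and [theta2_S], namely 12 * 26 = 13 * 24 and 12 * 156 = 13 * 144. *)
Lemma bracket_S d e : opd d -> opd e -> S_invariant 12 d -> S_invariant 4 e ->
  S_invariant 28 (bracket_seq d e).
Proof.
move=> dO eO dS eS z z0; have k0 := kappa_neq0.
have z1 := nm_qexp_lt1 z0; have z1' := nm_qexp_lt1 (Im_inv_gt0 z0).
rewrite !ev_bracket// dS// eS// (theta_S dO dS z0) (theta2_S dO dS z0).
move: (ev d _) (ev e _) (ev (theta d) _) (ev (theta (theta d)) _) => x y x1 x2.
have -> : forall n, z ^+ n.+4.+4.+4 = z ^+ 12 * z ^+ n by move=> n; rewrite -exprD.
by field; exact: k0.
Qed.

(** The coefficient of q^2 is 12 - 13 + 1 = 0; this is why E_4 Delta^2 is added with coefficient 1.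
    Order 3 is enough for [vanishing] in weight 28, because 5 * 28 < 51 * 3. *)
Lemma bracket_order d e : opd d -> opd e -> d 0%N = 0 -> d 1%N = 1 -> e 0%N = 1 ->
  forall n, (n < 3)%N -> bracket_seq d e n = 0.
Proof.
move=> dO eO d0 d1 e0 [|[|[|//]]] _; rewrite /bracket_seq /cprod /theta;
  rewrite !big_ord_recl !big_ord0 /= /bump /= ?addn0 ?add0n ?subn0 ?subnn ?subSS ?subn0 ?d0 ?d1 ?e0.
all: rewrite ?big_ord_recl ?big_ord0 /= ?d0 ?d1; ring.
Qed.

Lemma bracket_eq0 d e : opd d -> opd e -> S_invariant 12 d -> S_invariant 4 e ->
  d 0%N = 0 -> d 1%N = 1 -> e 0%N = 1 -> forall q, nm q < 1 ->
  12 * ev d q * ev (theta (theta d)) q - 13 * ev (theta d) q ^+ 2 + ev e q * ev d q ^+ 2 = 0.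
Proof.
move=> dO eO dS eS d0 d1 e0 q q1; rewrite -ev_bracket//.
apply: ev_coef0; apply: (@vanishing _ _ 28 3) => //.
- exact: opd_bracket.
- exact: bracket_order.
- exact: bracket_S.
Qed.

(** Multiplication by the linear polynomial x + y q. *)
Definition mulin (x y : C) b : nat -> C := fun n => x * b n + y * (if n is m.+1 then b m else 0).

Lemma opd_mulin x y b : opd b -> opd (mulin x y b).
Proof.
move=> bO; apply: opdD; apply: opdZ => // r r01; have [M hM] := bO r r01.
have [r0 r1] := andP r01.
exists (`|M|) => -[|n]; first by rewrite nm0 mul0r.
rewrite exprS mulrCA; apply: (@le_trans _ _ (1 * `|M|)); last by rewrite mul1r.
rewrite ler_pM ?mulr_ge0 ?nm_ge0 ?exprn_ge0 ?(ltW r1)//.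
by apply: le_trans (hM n) (ler_norm _).
Qed.

Lemma ev_mulin x y b q : opd b -> nm q < 1 -> ev (mulin x y b) q = (x + y * q) * ev b q.
Proof.
move=> bO q1; pose s : nat -> C := fun n => if n is m.+1 then b m else 0.
have sO : opd s.
  have := opd_mulin 0 1 bO; congr opd; apply/funext => n.
  by rewrite /mulin mul0r add0r mul1r.
have E : ev s q = q * ev b q.
  rewrite (@ev_shift _ _ 1%N)//; last by case.
  by rewrite expr1; congr (_ * ev _ _); apply/funext => n; rewrite addn1.
rewrite /mulin (@evD _ (fun n => x * b n) (fun n => y * s n))//; try exact: opdZ.
by rewrite !evZ// E; ring.
Qed.

Lemma opd_iter_mulin x y r b : opd b -> opd (iter r (mulin x y) b).
Proof. by move=> bO; elim: r => // r; apply: opd_mulin. Qed.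

Lemma ev_iter_mulin x y r b q : opd b -> nm q < 1 ->
  ev (iter r (mulin x y) b) q = (x + y * q) ^+ r * ev b q.
Proof.
move=> bO q1; elim: r => [|r IHr]; first by rewrite mul1r.
rewrite iterS ev_mulin ?IHr; [|exact: opd_iter_mulin|by []].
by rewrite exprS mulrA.
Qed.

(** Horner's scheme started at infinity: the coefficient n of the quotient is the sum over i of a (i
    + n + 1) q0^i, and [a 0] is accounted for because q0 is a zero. *)
Lemma synthetic_division a q0 : opd a -> nm q0 < 1 -> ev a q0 = 0 ->
  exists2 b, opd b & a = mulin (- q0) 1 b.
Proof.
move=> aO q01 a0; pose b n := ev (fun i => a (i + n.+1)%N) q0.
have aS n : ev (fun i => a (i + n)%N) q0 = a n + q0 * b n.
  pose c : nat -> C := fun i => a (i + n)%N.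
  have cO : opd c by exact: opd_shift.
  have -> : ev c q0 = a n + q0 * ev (fun i => c (i + 1)%N) q0.
    pose c' : nat -> C := fun i => if i is m.+1 then c m.+1 else 0.
    have c'O : opd c'.
      have := opd_mulin 0 1 (opd_shift 1 cO); congr opd; apply/funext => i.
      by rewrite /mulin mul0r add0r mul1r /c'; case: i => // i; rewrite addn1.
    transitivity (ev (fun i => a n * cone R i + c' i) q0).
      congr (ev _ _); apply/funext => -[|i]; rewrite /cone/= ?mulr1 ?addr0 ?mulr0 ?add0r//.
    rewrite (@evD _ (fun i => a n * cone R i) c')//; last first.
      by apply: opdZ; exact: opd_cone.
    rewrite evZ ?ev_cone ?mulr1//; last exact: opd_cone.
    rewrite (@ev_shift _ c' 1)//; last by case.
    have -> : (fun i => c' (i + 1)%N) = (fun i => c (i + 1)%N) by apply/funext => i; rewrite addn1.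
    by [].
  have -> : (fun i => c (i + 1)%N) = (fun i => a (i + n.+1)%N).
    by apply/funext => i; rewrite /c -addnA add1n.
  by [].
exists b; last first.
  apply/funext => -[|n]; rewrite /mulin ?mulr0 ?mul1r.
    have := aS 0%N; under eq_fun do rewrite addn0; rewrite a0 => E.
    by rewrite addr0 mulNr; apply/eqP; rewrite -addr_eq0 -E.
  rewrite [in LHS](_ : a n.+1 = b n - q0 * b n.+1); last by rewrite {1}/b aS addrK.
  by rewrite addrC mulNr.
move=> r1 r101.
(* The radius is enlarged so that it dominates |q0| and is positive; the tail defining [b n] is then
   at most [B / r ^+ n.+1]. *)
pose r := Num.max r1 (Num.max (nm q0) (1 / 2)).
have r01 : 0 <= r < 1.
  have [r0 r1'] := andP r101; rewrite /r le_max r0 !gt_max r1' q01 /=; lra.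
have r0 : 0 < r by rewrite /r !lt_max; apply/orP; right; apply/orP; right; lra.
have rq : nm q0 <= r by rewrite /r !le_max lexx orbT.
have [_ [B hB]] := opd_summ_nm aO r01.
exists (B / r) => n; apply: (@le_trans _ _ (nm (b n) * r ^+ n)).
  rewrite ler_wpM2l ?nm_ge0// lerXn2r// ?nnegrE; [by case/andP: r101|by rewrite ltW|].
  by rewrite /r le_max lexx.
rewrite -ler_pdivlMr ?exprn_gt0// -mulrA -invfM -exprS.
apply: nm_ev_le => //; first exact: opd_shift.
move=> N; rewrite ler_pdivlMr ?exprn_gt0// mulr_suml.
apply: le_trans (hB (n.+1 + N)%N); rewrite big_split_ord/= -[leLHS]add0r lerD//.
  by rewrite sumr_ge0// => i _; rewrite mulr_ge0 ?nm_ge0 ?exprn_ge0// ltW.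
apply: ler_sum => i _; rewrite [(n.+1 + i)%N]addnC exprD mulrA ler_wpM2r ?exprn_ge0 ?(ltW r0)//.
by rewrite ler_wpM2l ?nm_ge0// lerXn2r// nnegrE ?nm_ge0// ltW.
Qed.

Lemma ev_bounded a (r : R) : opd a -> 0 <= r < 1 -> exists B : R, forall q, nm q <= r -> nm (ev a q) <= B.
Proof.
move=> aO r01; have a0 : forall n, (n < 0)%N -> a n = 0 by [].
have [K [K0 hK]] := ev_decay aO a0 r01.
by exists K => q /hK; rewrite expr0 mulr1.
Qed.

(* The order is bounded as in Jensen's inequality: multiplication by
   (s^2 - conj(q0) q) / (q - q0) keeps absolute values on the circle |q| = s. *)
Lemma finite_order a q0 : opd a -> 0 < nm q0 < 1 -> a 0%N != 0 ->
  exists r b, [/\ opd b, a = iter r (mulin (- q0) 1) b & ev b q0 != 0].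
Proof.
move=> aO /andP[q00 q01] a0.
have nq : 0 <= nm q0 < 1 by rewrite nm_ge0.
have [s /andP[s0 s1] h0] := opd_between nq.
  have [/andP[t0 t1]] := h0; set t := nm q0 / s in t0 t1 h0.
  have s01 : 0 <= s < 1 by rewrite ltW.
  have [B hB] := ev_bounded aO s01.
    have key r b : opd b -> a = iter r (mulin (- q0) 1) b -> nm (a 0%N) <= `|B| * t ^+ r.
      move=> bO aE; pose c := iter r (mulin (s ^+ 2)%:C%C (- conjc q0)) b.
      have cO : opd c by exact: opd_iter_mulin.
      have nsC : nm s%:C%C = s by rewrite nm_real gtr0_norm.
      have := @cauchy_estimate _ c s%:C%C (s ^+ r * `|B|) 0 cO; rewrite nsC => /(_ s1).
      rewrite expr0 mulr1 => H.
      have {H} : nm (c 0%N) <= s ^+ r * `|B|.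
        apply: H => q qs; have q1 : nm q < 1 by rewrite qs.
        rewrite ev_iter_mulin// nmM nmX.
        have -> : nm ((s ^+ 2)%:C%C + - conjc q0 * q) = s * nm (- q0 + 1 * q).
          have -> : (s ^+ 2)%:C%C = q * conjc q.
            by rewrite -sqr_normc nmE qs -rmorphXn.
          have -> : q * conjc q + - conjc q0 * q = q * conjc (- q0 + 1 * q).
            by rewrite !rmorphD rmorphN !rmorphM rmorph1/=; ring.
          by rewrite nmM qs; congr (_ * _); apply: (@complexI R); rewrite -!nmE normcJ.
        rewrite exprMn -mulrA ler_wpM2l ?exprn_ge0 ?(ltW s0)//.
        rewrite -nmX -nmM -ev_iter_mulin// -aE.
        by apply: le_trans (hB q _) (ler_norm _); rewrite qs.
      have c0 x y n b' : iter n (mulin x y) b' 0%N = x ^+ n * b' 0%N.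
        by elim: n => [|n IHn]; rewrite ?mul1r// iterS {1}/mulin IHn mulr0 addr0 exprS mulrA.
      rewrite /c c0 aE c0 !nmM !nmX nmN nm_real ger0_norm ?sqr_ge0// -exprM mulnC exprM.
      have sr : 0 < s ^+ r by rewrite exprn_gt0.
      rewrite expr2 -mulrA ler_pM2l// => H.
      rewrite /t expr_div_n mulrCA ler_wpM2l ?exprn_ge0 ?nm_ge0//.
      by rewrite ler_pdivlMr// mulrC.
    have [N hN] : exists N, `|B| * t ^+ N < nm (a 0%N).
      have e0 : 0 < nm (a 0%N) / (`|B| + 1) by rewrite divr_gt0 ?nm_gt0// ltr_wpDl.
      have [N /(_ N (leqnn _)) h] := expr_lt_eps h0 e0; exists N.
      move: h; rewrite ltr_pdivlMr ?ltr_wpDl//; have : 0 <= t ^+ N by rewrite exprn_ge0.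
      by have := normr_ge0 B; nra.
    (* The bound [key] tends to 0 while [a 0] is nonzero, so divisibility by (q - q0)^n fails for
       some n; the order is the predecessor of the least such n. *)
    have ex : exists n, ~~ `[< exists2 b, opd b & a = iter n (mulin (- q0) 1) b >].
      exists N; apply/asboolPn => -[b bO /(key _ _ bO)]; rewrite leNgt hN//.
    have [[|n] /asboolPn nP minP] := ex_minnP ex; first by case: nP; exists a.
    have : `[< exists2 b, opd b & a = iter n (mulin (- q0) 1) b >].
      by apply/negPn/negP => /minP; rewrite ltnn.
    move=> /asboolP[b bO aE]; exists n, b; split=> //; apply/negP => /eqP b0.
    have [b' b'O bE] := synthetic_division bO q01 b0.
    by apply: nP; exists b' => //; rewrite iterSr -bE.
Qed.

Lemma ev_theta_mulin x y a q : opd a -> nm q < 1 ->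
  ev (theta (mulin x y a)) q = (x + y * q) * ev (theta a) q + y * q * ev a q.
Proof.
move=> aO q1; have tO := opd_theta aO.
have -> : theta (mulin x y a) = (fun n => mulin x y (theta a) n + y * mulin 0 1 a n).
  apply/funext => -[|n]; rewrite /mulin /theta ?mul0r ?mulr0 ?mul1r; first by ring.
  by rewrite -[n.+1]addn1 natrD; ring.
rewrite (@evD _ (mulin x y (theta a)) (fun n => y * mulin 0 1 a n))//;
  [|exact: opd_mulin|by apply: opdZ; exact: opd_mulin].
rewrite (@evZ _ (mulin 0 1 a))//; last exact: opd_mulin.
by rewrite !ev_mulin//; ring.
Qed.

(** Leibniz' rule for (q - q0)^r b, multiplied by q - q0 so that no exponent r - 1 appears. *)
Lemma ev_theta_iter r b q0 q : opd b -> nm q < 1 ->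
  (q - q0) * ev (theta (iter r (mulin (- q0) 1) b)) q =
  (q - q0) ^+ r * (r%:R * q * ev b q + (q - q0) * ev (theta b) q).
Proof.
move=> bO q1; elim: r => [|r IHr]; first by rewrite expr0; ring.
have aO := opd_iter_mulin (- q0) 1 r bO.
rewrite iterS ev_theta_mulin// mulrDr.
have -> : - q0 + 1 * q = q - q0 by ring.
rewrite IHr ev_iter_mulin//.
have -> : - q0 + 1 * q = q - q0 by ring.
by rewrite exprS -[r.+1]addn1 natrD; ring.
Qed.

Lemma ev_theta2_iter r b q0 q : opd b -> nm q < 1 ->
  (q - q0) ^+ 2 * ev (theta (theta (iter r (mulin (- q0) 1) b))) q =
  (q - q0) ^+ r * (r%:R * (r%:R - 1) * q ^+ 2 * ev b q +
    (q - q0) * (r%:R * q * (ev b q + 2 * ev (theta b) q) +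
      (q - q0) * ev (theta (theta b)) q)).
Proof.
move=> bO q1; elim: r => [|r IHr]; first by rewrite expr0; ring.
have aO := opd_iter_mulin (- q0) 1 r bO; rewrite iterS.
set a := iter r _ b in IHr aO *.
have tO := opd_theta aO.
have -> : theta (mulin (- q0) 1 a) =
    (fun n => mulin (- q0) 1 (theta a) n + mulin 0 1 a n).
  apply/funext => -[|n]; rewrite /mulin /theta ?mul0r ?mulr0 ?mul1r; first by ring.
  by rewrite -[n.+1]addn1 natrD; ring.
have -> : theta (fun n => mulin (- q0) 1 (theta a) n + mulin 0 1 a n) =
    (fun n => theta (mulin (- q0) 1 (theta a)) n + theta (mulin 0 1 a) n).
  by apply/funext => n; rewrite /theta mulrDr.
rewrite (@evD _ (theta (mulin (- q0) 1 (theta a))) (theta (mulin 0 1 a)))//;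
  [|by apply: opd_theta; exact: opd_mulin|by apply: opd_theta; exact: opd_mulin].
rewrite !ev_theta_mulin//.
have -> : - q0 + 1 * q = q - q0 by ring.
set t := q - q0 in IHr *.
have E1 : t * ev (theta a) q = t ^+ r * (r%:R * q * ev b q + t * ev (theta b) q).
  exact: ev_theta_iter.
have E0 : ev a q = t ^+ r * ev b q.
  by rewrite /a ev_iter_mulin//; congr (_ ^+ _ * _); rewrite /t; ring.
have -> : t ^+ 2 * (t * ev (theta (theta a)) q + 1 * q * ev (theta a) q +
   ((0 + 1 * q) * ev (theta a) q + 1 * q * ev a q)) =
   t * (t ^+ 2 * ev (theta (theta a)) q) + 2 * q * t * (t * ev (theta a) q) + t ^+ 2 * q * ev a q.
  by ring.
rewrite IHr E1 E0 [t ^+ r.+1]exprS -[r.+1]addn1 natrD; ring.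
Qed.

Definition ccv (u : nat -> C) := exists l, cv u l.
Lemma ccvD u v : ccv u -> ccv v -> ccv (fun n => u n + v n).
Proof. by move=> [l ul] [l' vl]; exists (l + l'); exact: cvD. Qed.
Lemma ccvM u v : ccv u -> ccv v -> ccv (fun n => u n * v n).
Proof. by move=> [l ul] [l' vl]; exists (l * l'); exact: cvM. Qed.
Lemma ccv_cst c : ccv (fun=> c).
Proof. by exists c; exact: cv_cst. Qed.

(** The expression is [Y] of [delta_neq0], built from binary sums and products only, so that the
    limit exists by structural recursion. *)
Lemma ccv_bracket_tail c t qn B B1 B2 E : ccv t -> ccv qn -> ccv B -> ccv B1 -> ccv B2 ->
  ccv E -> ccv (fun n => 12 * (B n * (t n * B n + (2 * (c * (qn n * B n) + t n * B1 n) +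
   (c * (qn n * (B n + 2 * B1 n)) + t n * B2 n)))) +
   ((-13) * (t n * ((B n + B1 n) * (B n + B1 n)) + 2 * (c * (qn n * (B n * (B n + B1 n))))) +
   E n * (t n * (B n * B n)))).
Proof.
move=> *; repeat lazymatch goal with
| |- ccv (fun n => @?f n + @?g n) => apply (@ccvD f g)
| |- ccv (fun n => @?f n * @?g n) => apply (@ccvM f g)
| |- ccv (fun n => ?f n) => assumption
| |- _ => apply ccv_cst
end.
Qed.

(* If d vanished to order r > 0 at q0, the lowest order term of the bracket
   at q0 would be - (r^2 + 12 r) times a nonzero constant. *)
Theorem delta_neq0 d e : opd d -> opd e -> S_invariant 12 d -> S_invariant 4 e ->
  d 0%N = 0 -> d 1%N = 1 -> e 0%N = 1 ->
  forall z, 0 < complex.Im z -> ev d (qexp z) != 0.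
Proof.
move=> dO eO dS eS d0 d1 e0 z z0; apply/negP => /eqP; set q0 := qexp z.
have q01 : nm q0 < 1 by exact: nm_qexp_lt1.
have q00 : q0 != 0 by exact: qexp_neq0.
have nq0 : 0 < nm q0 by rewrite nm_gt0.
(* [finite_order] asks for a nonzero constant term, hence the simple zero of [d] at q = 0 is split
   off first. *)
pose u : nat -> C := fun n => d (n + 1)%N.
have uO : opd u by exact: opd_shift.
have dE : d = mulin 0 1 u.
  by apply/funext => -[|n]; rewrite /mulin /u ?d0 ?addn1; ring.
rewrite {1}dE ev_mulin// add0r mul1r => /eqP; rewrite mulf_eq0 (negPf q00) /= => /eqP uq0.
have [|r [b [bO uE b0]]] := finite_order uO (introT andP (conj nq0 q01)).
  by rewrite /u add0n d1 oner_neq0.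
have r0 : (0 < r)%N.
  by case: r uE => // uE; move: b0; rewrite -[b]uE uq0 eqxx.
(* Half the distance from q0 to 0 and to the unit circle: the points q0 + t n stay in the punctured
   disc and differ from q0. *)
pose s := Num.min (nm q0) (1 - nm q0) / 2.
have s0 : 0 < s by rewrite /s divr_gt0// lt_min nq0 subr_gt0.
have [s1 s2] : s < nm q0 /\ s < 1 - nm q0.
  have h1 : Num.min (nm q0) (1 - nm q0) <= nm q0 by rewrite ge_min lexx.
  have h2 : Num.min (nm q0) (1 - nm q0) <= 1 - nm q0 by rewrite ge_min lexx orbT.
  by move: s0; rewrite /s; split; lra.
pose t n : C := s%:C%C * (n.+1%:R)^-1.
have tn0 n : t n != 0.
  by rewrite /t mulf_neq0 ?invr_eq0 ?pnatr_eq0// -nm_gt0 nm_real gtr0_norm.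
have tns n : nm (t n) <= s.
  rewrite /t nmM nmV nm_nat nm_real gtr0_norm// ler_pdivrMr//.
  by rewrite ler_peMr ?ler1n// ltW.
have t0 : cv t 0 by have := cvZ s%:C%C (@cv_inv_nat R); rewrite mulr0.
pose qn n := q0 + t n.
have qn0 : cv qn q0 by have := cvD (cv_cst q0) t0; rewrite addr0.
have qn1 n : nm (qn n) < 1 by have := nmD q0 (t n); have := tns n; rewrite /qn; lra.
have qnn0 n : qn n != 0.
  rewrite -nm_gt0; have := nmD (qn n) (- t n); rewrite nmN /qn addrK.
  by have := tns n; lra.
have cont a : opd a -> cv (fun n => ev a (qn n)) (ev a q0).
  by move=> aO; apply: dl_cv (dl_ev aO q01) qn0.
have b1O := opd_theta bO; have b2O := opd_theta b1O.
pose B n := ev b (qn n); pose B1 n := ev (theta b) (qn n).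
pose B2 n := ev (theta (theta b)) (qn n); pose E n := ev e (qn n).
pose c : C := r%:R.
(* Once the powers of q and t common to all terms are removed from the bracket, the terms without a
   further factor t are (12 r (r - 1) - 13 r^2) q^2 b^2 = - (r^2 + 12 r) q^2 b^2; [Y] is the
   cofactor of [t] in the others. *)
pose Y n := 12 * (B n * (t n * B n + (2 * (c * (qn n * B n) + t n * B1 n) +
   (c * (qn n * (B n + 2 * B1 n)) + t n * B2 n)))) +
   ((-13) * (t n * ((B n + B1 n) * (B n + B1 n)) + 2 * (c * (qn n * (B n * (B n + B1 n))))) +
   E n * (t n * (B n * B n))).
have key n : (c ^+ 2 + 12 * c) * (qn n ^+ 2 * B n ^+ 2) = t n * Y n.
  have := bracket_eq0 dO eO dS eS d0 d1 e0 (qn1 n); rewrite -/(E n).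
  have -> : ev d (qn n) = qn n * ev u (qn n) by rewrite {1}dE ev_mulin// add0r mul1r.
  have -> : ev (theta d) (qn n) = qn n * (ev u (qn n) + ev (theta u) (qn n)).
    by rewrite {1}dE ev_theta_mulin//; ring.
  have -> : ev (theta (theta d)) (qn n) =
      qn n * (ev u (qn n) + 2 * ev (theta u) (qn n) + ev (theta (theta u)) (qn n)).
    have := @ev_theta2_iter 1 u 0 (qn n) uO (qn1 n); rewrite oppr0 addr0 expr1 => h.
    rewrite {1}dE -[mulin 0 1 u]/(iter 1 (mulin 0 1) u).
    apply: (mulfI (_ : qn n ^+ 2 != 0)); first by rewrite expf_neq0.
    by rewrite h; ring.
  have tq : qn n - q0 = t n by rewrite /qn addrC addKr.
  have U0 : ev u (qn n) = t n ^+ r * B n.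
    by rewrite uE ev_iter_mulin// -tq; congr (_ ^+ _ * _); ring.
  have U1 : t n * ev (theta u) (qn n) = t n ^+ r * (c * qn n * B n + t n * B1 n).
    by rewrite uE -tq; apply: ev_theta_iter.
  have U2 : t n ^+ 2 * ev (theta (theta u)) (qn n) = t n ^+ r * (c * (c - 1) * qn n ^+ 2 * B n +
      t n * (c * qn n * (B n + 2 * B1 n) + t n * B2 n)).
    by rewrite uE -tq; apply: ev_theta2_iter.
  set v := ev u (qn n) in U0 *; set v1 := ev (theta u) (qn n) in U1 *.
  set v2 := ev (theta (theta u)) (qn n) in U2 *.
  move=> H.
  have : qn n ^+ 2 * (12 * v * (t n ^+ 2 * v + 2 * t n * (t n * v1) + t n ^+ 2 * v2)
     - 13 * (t n * v + t n * v1) ^+ 2 + E n * t n ^+ 2 * v ^+ 2) = 0.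
    by rewrite -[RHS](mulr0 (t n ^+ 2)) -H; ring.
  rewrite U1 U2 U0 => /eqP; rewrite mulf_eq0 expf_eq0 (negPf (qnn0 n)) andbF /=.
  set tr := t n ^+ r => /eqP H2.
  have tr0 : tr ^+ 2 != 0 by rewrite !expf_neq0.
  apply: (mulfI tr0); apply/eqP; rewrite -subr_eq0 -oppr_eq0 -H2 /Y; apply/eqP; ring.
have lim1 : cv (fun n => t n * Y n) 0.
  apply: (cv0M (v := Y) t0); suff [l hl] : ccv Y by exact: cv_bound hl.
  have cB : ccv B by exists (ev b q0); exact: cont.
  have cB1 : ccv B1 by exists (ev (theta b) q0); exact: cont.
  have cB2 : ccv B2 by exists (ev (theta (theta b)) q0); exact: cont.
  have cE : ccv E by exists (ev e q0); exact: cont.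
  have ct : ccv t by exists 0.
  have cq : ccv qn by exists q0.
  exact: ccv_bracket_tail.
have lim2 : cv (fun n => t n * Y n) ((c ^+ 2 + 12 * c) * (q0 ^+ 2 * ev b q0 ^+ 2)).
  have := cvZ (c ^+ 2 + 12 * c) (cvM (cvX 2 qn0) (cvX 2 (cont _ bO))).
  by apply: cv_near; exists 0%N => n _; rewrite -key.
have /eqP := cv_unique lim2 lim1.
have nz : q0 ^+ 2 * ev b q0 ^+ 2 != 0 by rewrite mulf_neq0// expf_neq0.
rewrite mulf_eq0 (negPf nz) orbF /c.
have -> : r%:R ^+ 2 + 12 * r%:R = (r ^ 2 + 12 * r)%:R :> C by rewrite natrD natrX natrM.
by rewrite pnatr_eq0 addn_eq0 muln_eq0 /= => /andP[_]; rewrite gtn_eqF.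
Qed.

End RankinCohen.

(** * Reciprocals of power series without zeros in the disc *)

Section Inversion.
Variable R : realType.
Local Notation C := (complex R).
Implicit Types (z w q h l : C) (a b : nat -> C).

Lemma ev_poly (p : {poly C}) q : ev (fun n => p`_n) q = p.[q].
Proof.
apply: ev_eq => e e0; exists (size p) => n sn; rewrite /partial horner_coef.
rewrite (big_ord_widen n (fun i => p`_i * q ^+ i) sn) [X in _ - X]big_mkcond /=.
rewrite -sumrB big1 ?nm0// => i _; case: ltnP => [_|h]; first by rewrite subrr.
by rewrite nth_default// mul0r subr0.
Qed.

Lemma opd_poly (p : {poly C}) : opd (fun n => p`_n).
Proof.
apply: (@opd_bounded _ _ (\sum_(i < size p) nm p`_i)) => n.
have [sn|ns] := leqP (size p) n.
  by rewrite nth_default// nm0 sumr_ge0// => i _; exact: nm_ge0.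
rewrite (bigD1 (Ordinal ns))//= lerDl sumr_ge0// => i _; exact: nm_ge0.
Qed.

Lemma opd_eq a b : opd a -> opd b -> (forall q, nm q < 1 -> ev a q = ev b q) ->
  a = b.
Proof.
move=> aO bO ab; apply/funext => n; apply/eqP; rewrite -subr_eq0; apply/eqP.
have bO' := opdZ (-1) bO.
have h01 : 0 < (1 / 2 : R) < 1 by apply/andP; split; lra.
have := ev_coef_uniq (opdD aO bO') h01 _ n; rewrite mulN1r; apply => q q2.
have q1 : nm q < 1 by rewrite q2; lra.
by rewrite (@evD _ a (fun n => -1 * b n))// evZ// ab// mulN1r subrr.
Qed.

(** The reciprocal of q - x has the coefficients - 1 / x^(n+1), bounded because |x| >= 1. *)
Lemma poly_inverse (s : seq C) : all (fun x => 1 <= nm x) s ->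
  exists2 b, opd b & forall q, nm q < 1 ->
    (\prod_(x <- s) ('X - x%:P)).[q] * ev b q = 1.
Proof.
elim: s => [|x s IHs] /=.
  by exists (@cone R); [exact: opd_cone|move=> q _; rewrite big_nil hornerC ev_cone mulr1].
move=> /andP[x1 /IHs[b bO bE]].
have x0 : x != 0 by rewrite -nm_gt0; lra.
pose g : nat -> C := fun n => - (x ^+ n.+1)^-1.
have gO : opd g.
  apply: (@opd_bounded _ _ 1) => n; rewrite nmN nmV nmX invf_le1 ?exprn_gt0//; last by lra.
  by rewrite exprn_ege1.
exists (cprod g b); first exact: opdM.
move=> q q1; rewrite big_cons hornerM evM// mulrACA bE// mulr1 hornerXsubC.
have -> : q - x = - x + 1 * q by ring.
rewrite -ev_mulin// -[RHS](@ev_cone _ q); congr (ev _ q); apply/funext => -[|n].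
  by rewrite /mulin /g /cone mulr0 addr0 expr1 mulNr mulrN opprK divff.
by rewrite /mulin /g /cone/= mul1r exprS; field; rewrite x0 expf_neq0.
Qed.

Lemma ev_cone_cprod a b : opd a -> opd b ->
  (forall q, nm q < 1 -> ev a q * ev b q = 1) -> cprod a b = @cone R.
Proof.
move=> aO bO ab; apply: opd_eq => [||q q1]; [exact: opdM|exact: opd_cone|].
by rewrite evM// ev_cone ab.
Qed.

(** The lower bound keeps the roots out of the closed disc, and on every circle inside it 1/p is at
    most 1/e. The resulting Cauchy estimate does not depend on the degree of [p]. *)
Lemma poly_inverse_bound (p : {poly C}) (e : R) : 0 < e ->
  (forall q, nm q <= 1 -> e <= nm p.[q]) ->
  exists b, cprod (fun n => p`_n) b = @cone R /\
    forall (r : R) n, 0 <= r < 1 -> nm (b n) * r ^+ n <= e^-1.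
Proof.
move=> e0 pe.
have [s sE] := closed_field_poly_normal p.
have p0 : lead_coef p != 0.
  rewrite lead_coef_eq0; apply/eqP => p0; have := pe 0; rewrite nm0 p0 horner0 nm0.
  by move=> /(_ ler01); lra.
have s1 : all (fun x => 1 <= nm x) s.
  apply/allP => x xs; rewrite leNgt; apply/negP => x1.
  have /eqP : p.[x] = 0.
    by apply/eqP; rewrite -/(root p x) sE rootZ// root_prod_XsubC.
  by have := pe x (ltW x1); rewrite -nm_eq0 => h /eqP h'; lra.
have [b bO bE] := poly_inverse s1.
have b'O := opdZ (lead_coef p)^-1 bO.
have E q : nm q < 1 -> p.[q] * ev (fun n => (lead_coef p)^-1 * b n) q = 1.
  by move=> q1; rewrite evZ// {1}sE hornerZ mulrACA divff// mul1r bE.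
exists (fun n => (lead_coef p)^-1 * b n); split.
  by apply: ev_cone_cprod => // [|q q1]; [exact: opd_poly|rewrite ev_poly E].
move=> r n r01; have [r0 r1] := andP r01.
have nr : nm r%:C%C = r by rewrite nm_real ger0_norm.
have := @cauchy_estimate _ _ r%:C%C e^-1 n b'O; rewrite nr; apply => // q qr.
have q1 : nm q < 1 by rewrite qr.
have := congr1 (@nm R) (E q q1); rewrite nmM nm1 => h.
have pq : 0 < nm p.[q] by apply: lt_le_trans e0 (pe q (ltW q1)).
rewrite -(mulKf (lt0r_neq0 pq) (nm (ev _ _))) h mulr1.
by rewrite lef_pV2 ?posrE// pe// ltW.
Qed.

(** The coefficients of a quotient are determined recursively, each by those of the data up to the
    same index. *)
Lemma cprod_uniq K a a' b b' : a 0%N != 0 -> (forall n, (n < K)%N -> a n = a' n) ->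
  (forall n, (n < K)%N -> cprod a b n = cprod a' b' n) ->
  forall n, (n < K)%N -> b n = b' n.
Proof.
move=> a0 aa ab n; elim/ltn_ind: n => n IHn nK.
have := ab n nK; rewrite /cprod !big_ord_recl /= !subn0 -aa ?(leq_ltn_trans _ nK)//.
under [in RHS]eq_bigr => i _.
  rewrite -aa; last by rewrite /bump /=; have := ltn_ord i; lia.
  rewrite -IHn; [|by rewrite /bump /=; have := ltn_ord i; lia|by rewrite /bump /=; have := ltn_ord i; lia].
  over.
by move/addIr; apply: mulfI.
Qed.

Lemma real_bounded_subseq (x : nat -> R) (B : R) : (forall n, `|x n| <= B) ->
  exists (f : nat -> nat) (l : R), (forall n, (n <= f n)%N) /\
   forall e : R, 0 < e -> exists N, forall n, (N <= n)%N -> `|x (f n) - l| < e.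
Proof.
move=> xB; have [|f finc] := @bolzano_weierstrass R x.
  exists B; split; first exact: num_real.
  by move=> y By n _ /=; apply: le_trans (xB n) (ltW By).
move=> /cvgrPdist_lt h; exists f, (limn (x \o f)); split.
  elim=> // n IHn; apply: leq_ltn_trans IHn _.
  by rewrite ltn_neqAle; have := finc n.+1 n; have := finc n n.+1; rewrite !leEnat ltnn leqnSn => -> h1; rewrite andbT; apply/negP => /eqP E; rewrite E leqnn in h1.
by move=> e /h[N _ hN]; exists N => n /hN /=; rewrite distrC.
Qed.

Lemma complex_bounded_subseq (u : nat -> C) (B : R) : (forall n, nm (u n) <= B) ->
  exists (f : nat -> nat) (l : C), (forall n, (n <= f n)%N) /\ cv (u \o f) l.
Proof.
move=> uB.
have [|f [x [fn hx]]] := @real_bounded_subseq (fun n => complex.Re (u n)) B.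
  by move=> n; apply: le_trans (nm_Re _) (uB n).
have [|g [y [gn hy]]] := @real_bounded_subseq (fun n => complex.Im (u (f n))) B.
  by move=> n; apply: le_trans (nm_Im _) (uB _).
exists (f \o g), (Complex x y); split=> [n|e e0] /=.
  by apply: leq_trans (gn n) (fn _).
have e2 : 0 < e / 2 by lra.
have [N hN] := hx _ e2; have [N' hN'] := hy _ e2.
exists (maxn N N') => n; rewrite geq_max => /andP[Nn N'n].
have h1 := hN _ (leq_trans Nn (gn n)); have h2 := hN' _ N'n.
by apply: le_lt_trans (nm_ReIm _) _; rewrite !raddfB/=; lra.
Qed.

(** Compactness of the closed disc: points at which the values tend to 0 would accumulate at a
    zero. *)
Lemma ev_lower_bound a (r : R) : opd a -> 0 <= r < 1 ->
  (forall q, nm q < 1 -> ev a q != 0) ->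
  exists2 e : R, 0 < e & forall q, nm q <= r -> e <= nm (ev a q).
Proof.
move=> aO /andP[r0 r1] a0; apply: contrapT => H.
have /choice[u hu] : forall n : nat, exists q, nm q <= r /\ nm (ev a q) <= (n.+1%:R)^-1.
  move=> n; apply: contrapT => hn; apply: H; exists (n.+1%:R)^-1; first by rewrite invr_gt0.
  move=> q qr; rewrite leNgt; apply/negP => h; apply: hn; exists q; split=> //.
  exact: ltW.
have [f [l [fn ul]]] := @complex_bounded_subseq u r (fun n => (hu n).1).
have lr : nm l <= r by apply: cv_nm_le ul _; exists 0%N => n _; exact: (hu _).1.
have l1 : nm l < 1 by exact: le_lt_trans r1.
have /negP := a0 _ l1; apply; apply/eqP.
apply: cv_unique (dl_cv (dl_ev aO l1) ul) _.
apply: (cv_squeeze (b := fun n => (n.+1%:R)^-1)) => [n|e e0].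
  apply: le_trans (hu (f n)).2 _; rewrite lef_pV2 ?posrE// ler_nat ltnS; exact: fn.
have [N hN] := cv_inv_nat e0; exists N => n /hN.
by rewrite subr0 nmV nm_nat.
Qed.

Lemma cprod_scale a b (s : C) n :
  cprod (fun n => a n * s ^+ n) (fun n => b n * s ^+ n) n = cprod a b n * s ^+ n.
Proof.
rewrite /cprod mulr_suml; apply: eq_bigr => i _.
have -> : s ^+ n = s ^+ i * s ^+ (n - i) by rewrite -exprD subnKC// -ltnS ltn_ord.
ring.
Qed.

(* The truncations of a are bounded away from 0 on a disc, hence split into
   linear factors without roots there; their inverses are bounded uniformly by
   the Cauchy estimates, and their coefficients stabilize. *)
Lemma truncated_inverse a (r : R) : opd a -> (forall q, nm q < 1 -> ev a q != 0) ->
  0 <= r < 1 -> exists B : R, forall K, exists b, (forall n, nm (b n) * r ^+ n <= B) /\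
    forall n, (n < K)%N -> cprod a b n = @cone R n.
Proof.
move=> aO a0 r01; have [s /andP[s0 s1] rs] := opd_between r01.
have s01 : 0 <= s < 1 by rewrite ltW.
have [e e0 he] := ev_lower_bound aO s01 a0.
have e2 : 0 < e / 2 by lra.
have [N hN] := ev_tail aO s01 e2.
exists ((e / 2)^-1) => K; pose M := maxn N K.
pose sC : C := s%:C%C; have sC0 : sC != 0 by rewrite -nm_gt0 nm_real gtr0_norm.
(* The rescaling turns the disc of radius [s] into the unit disc of [poly_inverse_bound]. *)
pose p : {poly C} := \poly_(i < M) (a i * sC ^+ i).
have pE q : p.[q] = \sum_(i < M) a i * (sC * q) ^+ i.
  by rewrite horner_poly; apply: eq_bigr => i _; rewrite exprMn; ring.
have [|b [bE bB]] := @poly_inverse_bound p (e / 2) e2.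
  move=> q q1; have sq : nm (sC * q) <= s.
    by rewrite nmM nm_real gtr0_norm// -{2}[s]mulr1 ler_pM2l.
  have := hN M _ (leq_maxl _ _) sq; rewrite -pE; have := he _ sq.
  have := nmD (ev a (sC * q) - p.[q]) p.[q]; rewrite subrK; lra.
exists (fun n => b n / sC ^+ n); split=> [n|n nK].
  rewrite nmM nmV nmX nm_real gtr0_norm// -mulrA mulrCA mulrC -mulrA -expr_div_n.
  by rewrite bB.
have sn : sC ^+ n != 0 by rewrite expf_neq0.
apply: (mulIf sn); rewrite -cprod_scale.
have -> : (fun n => b n / sC ^+ n * sC ^+ n) = b.
  by apply/funext => i; rewrite divfK// expf_neq0.
transitivity (cprod (fun i => p`_i) b n).
  apply: eq_bigr => i _; rewrite coef_poly ifT//; have := ltn_ord i.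
  by rewrite ltnS => h; apply: leq_ltn_trans h _; rewrite leq_max nK orbT.
by rewrite bE /cone; case: n nK sn => [|n] *; rewrite ?expr0 ?mulr1 //= mul0r.
Qed.

(** The coefficient n can be read off from every truncated inverse of length above n, so one and the
    same series inherits the bounds obtained at all radii. *)
Theorem opd_inverse a : opd a -> (forall q, nm q < 1 -> ev a q != 0) ->
  exists2 b, opd b & cprod a b = @cone R.
Proof.
move=> aO a0.
have a00 : a 0%N != 0.
  have := a0 0; rewrite nm0 => /(_ ltr01); congr (_ != 0).
  apply: ev_eq; apply: cv_near (cv_cst _); exists 1%N => -[//|n] _.
  rewrite /partial big_ord_recl expr0 mulr1 big1 ?addr0// => i _.
  by rewrite expr0n mulr0.
have z01 : 0 <= (0 : R) < 1 by rewrite lexx ltr01.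
(* Radius 0 suffices to produce the coefficients; their growth is bounded afterwards, radius by
   radius. *)
have [B /choice[g hg]] := truncated_inverse aO a0 z01.
pose b n := g n.+1 n.
have bg K n : (n < K)%N -> b n = g K n.
  move=> nK; apply: (@cprod_uniq n.+1 a a (g n.+1) (g K)) => // i ni.
  by rewrite (hg _).2// (hg _).2//; apply: leq_trans nK.
have abE : cprod a b = @cone R.
  apply/funext => n; rewrite -(hg n.+1).2//; apply: eq_bigr => i _.
  by rewrite (bg n.+1)// ltnS leq_subr.
exists b => // r r01; have [B' hB'] := truncated_inverse aO a0 r01.
exists B' => n; have [b' [b'B b'E]] := hB' n.+1.
rewrite (@cprod_uniq n.+1 a a b b')// => i ni.
by rewrite abE b'E.
Qed.

End Inversion.

(** * A finite form of Lipschitz' formula *)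

Section Lipschitz.
Variable R : realType.
Local Notation C := (complex R).
Local Notation kappa := (Complex 0 (2 * pi) : C).
Implicit Types (z w q : C) (a b : nat -> C).

Lemma opd_ones : opd (fun=> 1 : C).
Proof. by apply: (@opd_bounded _ _ 1) => n; rewrite nm1. Qed.

Lemma ev_ones q : nm q < 1 -> ev (fun=> 1) q = (1 - q)^-1.
Proof.
move=> q1; have q10 : 1 - q != 0.
  by apply/negP => /eqP /subr0_eq E; move: q1; rewrite -E nm1 ltxx.
apply: (mulfI q10); rewrite divff//.
have -> : 1 - q = 1 + (-1) * q by ring.
rewrite -ev_mulin//; last exact: opd_ones.
rewrite -[RHS](@ev_cone _ q); congr (ev _ q); apply/funext => -[|n];
  by rewrite /mulin /cone /=; ring.
Qed.

Definition geo_coef k : nat -> C := fun n => ('C(n + k, k))%:R.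

Lemma geo_coefS k : geo_coef k.+1 = cprod (geo_coef k) (fun=> 1).
Proof.
apply/funext => n; rewrite /cprod /geo_coef.
under eq_bigr do rewrite mulr1.
elim: n => [|n IHn]; first by rewrite big_ord1 !add0n !binn.
by rewrite big_ord_recr/= -IHn -natrD addSn binS addSn addnS addnC.
Qed.

Lemma opd_geo_coef k : opd (geo_coef k).
Proof.
elim: k => [|k IHk]; last by rewrite geo_coefS; apply: opdM => //; exact: opd_ones.
have -> : geo_coef 0 = (fun=> 1) by apply/funext => n; rewrite /geo_coef bin0.
exact: opd_ones.
Qed.

Lemma ev_geo_coef k q : nm q < 1 -> ev (geo_coef k) q = ((1 - q) ^+ k.+1)^-1.
Proof.
move=> q1; elim: k => [|k IHk].
  have -> : geo_coef 0 = (fun=> 1) by apply/funext => n; rewrite /geo_coef bin0.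
  by rewrite ev_ones// expr1.
rewrite geo_coefS evM ?IHk ?ev_ones//; [|exact: opd_geo_coef|exact: opd_ones].
by rewrite [in RHS]exprSr invfM mulrC.
Qed.

(** A polynomial in n of degree k with leading coefficient 1 / k!; in this form the limit n^k / k!
    after rescaling is visible. *)
Lemma geo_coef_prod k n : geo_coef k n * (k`!)%:R = \prod_(i < k) (n%:R + i.+1%:R).
Proof.
rewrite /geo_coef -natrM bin_ffact ffact_prod natr_prod.
rewrite [RHS](reindex_inj rev_ord_inj)/=; apply: eq_bigr => i _.
by rewrite -natrD; congr (_%:R); have := ltn_ord i; lia.
Qed.

Definition dilate N a : nat -> C := fun n => if (N %| n)%N then a (n %/ N)%N else 0.

Lemma sum_dilate N (F : nat -> C) L : (0 < N)%N ->
  \sum_(n < L * N) (if (N %| n)%N then F n else 0) = \sum_(l < L) F (l * N)%N.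
Proof.
move=> N0; elim: L => [|L IHL]; first by rewrite mul0n !big_ord0.
rewrite mulSn addnC big_split_ord/= IHL big_ord_recr/=; congr (_ + _).
rewrite (bigD1 (Ordinal N0))//= addn0 dvdn_mull// big1 ?addr0// => i /eqP i0.
rewrite dvdn_addr ?dvdn_mull// gtnNdvd// lt0n; apply/negP => /eqP i0'.
by apply: i0; apply/val_inj.
Qed.

Lemma opd_dilate N a : (0 < N)%N -> opd a -> opd (dilate N a).
Proof.
move=> N0 aO r r01; have [r0 r1] := andP r01.
have [M hM] := aO r r01; exists `|M| => n; rewrite /dilate.
case: ifP => [/dvdnP[l ->]|_]; last by rewrite nm0 mul0r.
rewrite mulnK//; apply: le_trans (ler_norm _); apply: le_trans (hM l).
by rewrite ler_wpM2l ?nm_ge0// ler_wiXn2l ?leq_pmulr// ltW.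
Qed.

Lemma ev_dilate N a q : (0 < N)%N -> opd (dilate N a) -> nm q < 1 ->
  ev a (q ^+ N) = ev (dilate N a) q.
Proof.
move=> N0 aO q1; apply: ev_eq => e e0.
have [K hK] := ev_cv aO q1 e0; exists K => L KL.
have := hK (L * N)%N (leq_trans KL (leq_pmulr _ N0)); congr (nm (_ - _) < e).
transitivity (\sum_(n < L * N) (if (N %| n)%N then a (n %/ N)%N * q ^+ n else 0)).
  by apply: eq_bigr => n _; rewrite /dilate; case: ifP => //; rewrite mul0r.
rewrite (@sum_dilate N (fun n => a (n %/ N)%N * q ^+ n))//; apply: eq_bigr => l _.
by rewrite mulnK// -exprM mulnC.
Qed.

(** The symmetric partial sum over |j| <= m, with j and - j paired so that its limit is that of an
    ordinary series. *)
Definition wsum m (f : int -> C) : C :=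
  f 0 + \sum_(i < m) (f (Posz i.+1) + f (- (Posz i.+1))).

Lemma wsum_ord m f : wsum m f = \sum_(j < m.*2.+1) f (j%:Z - m%:Z).
Proof.
elim: m f => [|m IHm] f; first by rewrite /wsum !big_ord1 big_ord0 addr0.
rewrite /wsum big_ord_recr/= addrA [f 0 + _]IHm doubleS.
rewrite [RHS]big_ord_recl [in RHS]big_ord_recr/= sub0r.
rewrite [f m.+1 + _]addrC [LHS]addrCA; congr (_ + (_ + _)).
  by apply: eq_bigr => i _; congr f; rewrite /bump; lia.
by congr f; rewrite /bump; lia.
Qed.

Lemma eq_wsum m f g : f =1 g -> wsum m f = wsum m g.
Proof. by move=> fg; rewrite /wsum fg; under eq_bigr do rewrite !fg. Qed.

Lemma wsumN m f : wsum m (fun j => f (- j)) = wsum m f.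
Proof.
rewrite /wsum oppr0; congr (_ + _); apply: eq_bigr => i _.
by rewrite opprK addrC.
Qed.

Lemma wsumZ m c f : c * wsum m f = wsum m (fun j => c * f j).
Proof.
rewrite /wsum mulrDr mulr_sumr; congr (_ + _); apply: eq_bigr => i _.
by rewrite mulrDr.
Qed.

Lemma wsum_sum m I (r : seq I) (F : I -> int -> C) :
  wsum m (fun j => \sum_(i <- r) F i j) = \sum_(i <- r) wsum m (F i).
Proof.
rewrite /wsum [RHS]big_split/=; congr (_ + _).
by rewrite [RHS]exchange_big/=; apply: eq_bigr => i _; rewrite big_split.
Qed.

Lemma exchange_wsum m m' (F : int -> int -> C) :
  wsum m (fun i => wsum m' (F i)) = wsum m' (fun j => wsum m (F^~ j)).
Proof.
rewrite !wsum_ord; under eq_bigr do rewrite wsum_ord.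
by rewrite exchange_big; apply: eq_bigr => j _; rewrite wsum_ord.
Qed.

Lemma cv_wsum m (F : int -> nat -> C) G : (forall j, cv (F j) (G j)) ->
  cv (fun n => wsum m (F^~ n)) (wsum m G).
Proof.
move=> FG; apply: cvD => //; apply: cv_sum => i; exact: cvD.
Qed.

Lemma qexpN (z : C) : qexp (- z) = (qexp z)^-1.
Proof. by rewrite /qexp mulrN cexpoN. Qed.

Lemma qexp_intM (z : C) (n : int) : qexp (z * n%:~R) = qexp z ^ n.
Proof.
case: n => n; first by rewrite -pmulrn mulr_natr qexpMn.
rewrite NegzE mulrNz mulrN -pmulrn mulr_natr.
by rewrite qexpN qexpMn exprnN.
Qed.

Lemma qexp_real (x : R) : qexp (Complex x 0) = Complex (cos (2 * pi * x)) (sin (2 * pi * x)).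
Proof. by rewrite /qexp /cexpo /= !mul0r !mulr0 subr0 add0r expR0 !mul1r. Qed.

Lemma qexp_frac_neq1 (i N : nat) : (0 < i < N)%N -> qexp (i%:R / N%:R : C) != 1.
Proof.
move=> /andP[i0 iN]; have N0 : (0 < N)%N by exact: ltn_trans iN.
have -> : i%:R / N%:R = Complex (i%:R / N%:R) 0 :> C.
  by rewrite complexr0 fmorph_div !rmorph_nat.
rewrite qexp_real eq_complex /= negb_and; apply/orP; left.
set x := i%:R / N%:R; have -> : 2 * pi * x = (pi * x) *+ 2 by rewrite mulr2n; ring.
rewrite cos_mulr2n cos2sin2.
have : 0 < sin (pi * x).
  have x0 : 0 < x by rewrite divr_gt0 ?ltr0n.
  have x1 : x < 1 by rewrite ltr_pdivrMr ?ltr0n// mul1r ltr_nat.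
  apply: sin_gt0_pi; rewrite mulr_gt0 ?pi_gt0//= -{2}[pi]mulr1 ltr_pM2l ?pi_gt0//.
move=> s0; rewrite lt_eqF//.
by have : 0 < sin (pi * x) ^+ 2; [rewrite exprn_gt0 | rewrite !mulr2n; lra].
Qed.

Lemma wsum_roots m (n : nat) : let N := m.*2.+1 in
  wsum m (fun j => qexp (j%:~R / N%:R : C) ^+ n) = (if (N %| n)%N then N%:R else 0).
Proof.
move=> N; have N0 : N%:R != 0 :> C by rewrite pnatr_eq0.
pose v := qexp (n%:R / N%:R : C).
have E j : qexp (j%:~R / N%:R : C) ^+ n = v ^ j.
  by rewrite -qexpMn /v -qexp_intM; congr qexp; rewrite -[LHS]mulr_natr; ring.
rewrite (eq_wsum m E) wsum_ord.
have v0 : v != 0 by exact: qexp_neq0.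
have E2 j : v ^ (j%:Z - m%:Z) = v ^- m * v ^+ j.
  by rewrite expfzDr// exprnN mulrC.
rewrite (eq_bigr (fun j : 'I_N => v ^- m * v ^+ j)); last by move=> j _; exact: E2.
rewrite -mulr_sumr; have vN : v ^+ N = 1.
  rewrite /v -qexpMn -[X in qexp X]mulr_natr divfK//.
  by have := @qexp_int R n; rewrite -pmulrn.
case: ifP => [/dvdnP[l nE]|nN].
  have v1 : v = 1.
    rewrite /v nE natrM mulfK//.
    by have := @qexp_int R l; rewrite -pmulrn.
  rewrite v1 expr1n invr1 mul1r.
  by under eq_bigr do rewrite expr1n; rewrite sumr_const card_ord.
have v1 : v - 1 != 0.
  rewrite subr_eq0 /v {1}(divn_eq n N) natrD mulrDl natrM mulfK// qexpD.
  have -> : qexp (n %/ N)%:R = 1 :> C.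
    by have := @qexp_int R (n %/ N)%N; rewrite -pmulrn.
  by rewrite mul1r qexp_frac_neq1// ltn_mod andbT lt0n -/(dvdn N n) nN.
have := subrX1 v N; rewrite vN subrr => /esym/eqP.
by rewrite mulf_eq0 (negPf v1)/= => /eqP ->; rewrite mulr0.
Qed.

(** Averaging the series of (1 - X)^-(k+1) over X times the N-th roots of unity keeps the exponents
    divisible by N. As N grows, N (1 - qexp ((w + j) / N)) tends to - 2 i pi (w + j), and the
    identity becomes Lipschitz' formula. *)
Lemma finite_lipschitz m k w : 0 < complex.Im w -> let N := m.*2.+1 in
  wsum m (fun j => ((N%:R * (1 - qexp ((w + j%:~R) / N%:R))) ^+ k.+1)^-1) =
  ev (fun l => geo_coef k (l * N)%N / N%:R ^+ k) (qexp w).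
Proof.
move=> w0 N; have N0 : N%:R != 0 :> C by rewrite pnatr_eq0.
have NR : (0 : R) < N%:R by rewrite ltr0n.
have WI j : complex.Im ((w + j%:~R) / N%:R) = complex.Im w / N%:R.
  have -> : (w + j%:~R) / N%:R = (w + j%:~R) * (N%:R^-1)%:C%C by rewrite fmorphV rmorph_nat.
  case: w {w0} => x y; rewrite -(rmorph_int (real_complex R)) /=; ring.
have Wj j : nm (qexp ((w + j%:~R) / N%:R)) < 1.
  by rewrite nm_qexp_lt1// WI divr_gt0.
pose X := qexp (w / N%:R).
have X1 : nm X < 1 by have := Wj 0; rewrite addr0.
have XE j : qexp ((w + j%:~R) / N%:R) = X * qexp (j%:~R / N%:R) by rewrite mulrDl qexpD.
have XN : X ^+ N = qexp w by rewrite /X -qexpMn -[X in qexp X]mulr_natr divfK.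
transitivity (N%:R ^- k.+1 * wsum m (fun j => ev (geo_coef k) (qexp ((w + j%:~R) / N%:R)))).
  by rewrite wsumZ; apply: eq_wsum => j; rewrite ev_geo_coef// exprMn invfM.
have -> : wsum m (fun j => ev (geo_coef k) (qexp ((w + j%:~R) / N%:R))) =
    N%:R * ev (dilate N (fun l => geo_coef k (l * N)%N)) X.
  have dO : opd (dilate N (fun l => geo_coef k (l * N)%N)).
    move=> r r01; have [M hM] := opd_geo_coef k r01; exists `|M| => n.
    apply: le_trans (ler_norm _); apply: le_trans (hM n).
    rewrite ler_wpM2r ?exprn_ge0//; first by case/andP: r01.
    by rewrite /dilate; case: ifP => [/dvdnP[l ->]|_]; rewrite ?mulnK ?nm0 ?nm_ge0.
  apply: cv_unique (cv_wsum m (fun j => ev_cv (opd_geo_coef k) (Wj j))) _.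
  apply: cv_near (cvZ _ (ev_cv dO X1)); exists 0%N => L _.
  rewrite /partial wsum_sum mulr_sumr; apply: eq_bigr => n _.
  transitivity (geo_coef k n * X ^+ n * wsum m (fun j => qexp (j%:~R / N%:R : C) ^+ n)).
    rewrite wsum_roots /dilate; case: ifP => [/dvdnP[l ->]|_]; last by rewrite !(mul0r, mulr0).
    by rewrite mulnK// mulrC.
  by rewrite wsumZ; apply: eq_wsum => j; rewrite XE exprMn mulrA.
have dO : opd (dilate N (fun l => geo_coef k (l * N)%N / N%:R ^+ k)).
  move=> r r01; have [M hM] := opd_geo_coef k r01; exists (`|M| * nm ((N%:R ^+ k)^-1)) => n.
  rewrite /dilate; case: ifP => [/dvdnP[l ->]|_]; last by rewrite nm0 mul0r mulr_ge0 ?nm_ge0.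
  rewrite mulnK// nmM mulrAC ler_wpM2r ?nm_ge0//.
  exact: le_trans (hM _) (ler_norm _).
rewrite -XN (ev_dilate _ dO)//.
have dO' : opd (dilate N (fun l => geo_coef k (l * N)%N)).
  have := opdZ (N%:R ^+ k) dO; congr opd; apply/funext => n; rewrite /dilate.
  by case: ifP => _; rewrite ?mulr0// mulrC divfK// expf_neq0.
have -> : dilate N (fun l => geo_coef k (l * N)%N / N%:R ^+ k) =
   (fun n => (N%:R ^+ k)^-1 * dilate N (fun l => geo_coef k (l * N)%N) n).
  by apply/funext => n; rewrite /dilate; case: ifP => _; rewrite ?mulr0// mulrC.
by rewrite evZ// exprS; field; rewrite N0 expf_neq0.
Qed.

End Lipschitz.

Arguments geo_coef {R} k n.

(** * Uniform estimates and the limit giving Lipschitz' formula *)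

Section Eisenstein.
Variable R : realType.
Local Notation C := (complex R).
Local Notation kappa := (Complex 0 (2 * pi) : C).
Implicit Types (z w q : C) (a b : nat -> C).

(** The real part bounds c z + t from below when |t| >= 2 c |Re z|, the imaginary part otherwise. *)
Lemma lin_lower z : 0 < complex.Im z -> exists2 e : R, 0 < e & forall c t : R, 0 <= c ->
  e * (c + `|t|) <= nm (c%:C%C * z + t%:C%C).
Proof.
case: z => x y /= y0.
pose e1 := y / (1 + 2 * `|x|); have x1 : 0 < 1 + 2 * `|x| by rewrite ltr_pwDl.
have e10 : 0 < e1 by rewrite divr_gt0.
pose e := Num.min (1 / 4) (Num.min (y / 2) e1).
have e0 : 0 < e by rewrite !lt_min e10 !divr_gt0.
have [h1 h2 h3] : [/\ e <= 1 / 4, e <= y / 2 & e <= e1].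
  by rewrite /e !ge_min !lexx !orbT.
exists e => // c t c0.
have -> : c%:C%C * Complex x y + t%:C%C = Complex (c * x + t) (c * y).
  by apply/eqP; rewrite eq_complex /= !mul0r addr0 subr0 addr0 !eqxx.
have nR := nm_Re (Complex (c * x + t) (c * y)).
have nI := nm_Im (Complex (c * x + t) (c * y)); rewrite /= in nR nI.
set n := nm _ in nR nI *.
have cy : c * y <= n by apply: le_trans nI; exact: ler_norm.
have t0 := normr_ge0 t; have nx := normr_ge0 x.
have [big|small] := leP (2 * (c * `|x|)) `|t|.
  have : `|t| - c * `|x| <= n.
    apply: le_trans nR; rewrite (_ : c * `|x| = `|c * x|); last by rewrite normrM ger0_norm.
    by have := ler_normB (c * x + t) (c * x); rewrite addrAC subrr add0r; lra.
  by nra.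
apply: (@le_trans _ _ (c * y)) => //.
apply: (@le_trans _ _ (e1 * (c + `|t|))); first by rewrite ler_wpM2r// addr_ge0.
rewrite /e1 mulrAC ler_pdivrMr// -mulrA [leRHS]mulrCA ler_pM2l//.
by rewrite mulrDr mulr1 lerD2l mulrCA ltW.
Qed.

(** The zeros of 1 - qexp are the integers, and |Re t| <= 3/5 stays away from all of them but 0. A
    bound above 1/2 leaves room for the real part of w in (w + j) / (2 m + 1). *)
Lemma one_sub_qexp_lower (Y : R) : exists2 c : R, 0 < c & forall t : C,
  0 < complex.Im t <= Y -> `|complex.Re t| <= 3 / 5 -> c * nm t <= nm (1 - qexp t).
Proof.
exists (expR (- (2 * pi * Y)) / 10); first by rewrite divr_gt0 ?expR_gt0.
case=> x y /= /andP[y0 yY] x35.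
have pi0 := @pi_gt0 R; have pi3 := @pi_ge3 R; have pi4 := @pi_lt4 R.
set A0 := expR _; have A00 : 0 < A0 by exact: expR_gt0.
pose A := expR (- (2 * pi * y)); have A01 : A0 <= A.
  by rewrite ler_expR lerN2 ler_pM2l ?mulr_gt0.
have A1 : 2 * pi * y * A <= 1 - A.
  have h1 := expR_ge1Dx (2 * pi * y).
  have h2 : A * expR (2 * pi * y) = 1 by rewrite -expRD addNr expR0.
  have : A * (1 + 2 * pi * y) <= 1 by rewrite -[leRHS]h2 ler_pM2l// expR_gt0.
  lra.
pose s := sin (pi * x).
have sx : x ^+ 2 / 100 <= s ^+ 2.
  have : `|x| / 10 <= `|s|.
    have := sin_ge_cubic (x := pi * `|x|); rewrite mulr_ge0 ?(ltW pi0)// => /(_ isT).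
    have -> : sin (pi * `|x|) = Num.sg x * s.
      by rewrite -sin_sg normrEsg mulrCA.
    have : Num.sg x * s <= `|s|.
      apply: le_trans (ler_norm _) _; rewrite normrM normr_sg.
      by case: (x == 0); rewrite /= ?mul0r ?mul1r.
    have u0 := normr_ge0 x; set u := `|x| in u0 x35 *.
    (* As pi < 4, the angle is at most 12/5, and (12/5)^2 < 6: the cubic bound on the sine keeps 1 -
       576/600 = 1/25 of the angle pi u, and 3/25 exceeds 1/10. *)
    have pu : (pi * u) ^+ 2 <= 576 / 100.
      have : pi * u <= 12 / 5 by nra.
      have : 0 <= pi * u by rewrite mulr_ge0// ltW.
      by nra.
    have -> : (pi * u) ^+ 3 = (pi * u) * (pi * u) ^+ 2 by rewrite exprS.
    have : 0 <= pi * u by rewrite mulr_ge0// ltW.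
    by nra.
  move=> h; rewrite -(real_normK (num_real x)) -(real_normK (num_real s)).
  by have := normr_ge0 x; nra.
have E : nm (1 - qexp (Complex x y)) ^+ 2 = (1 - A) ^+ 2 + 4 * A * s ^+ 2.
  rewrite nm_sqr /qexp /cexpo /=.
  have -> : 0 * x - 2 * pi * y = - (2 * pi * y) by ring.
  have -> : 0 * y + 2 * pi * x = (pi * x) *+ 2 by rewrite mulr2n; ring.
  rewrite -/A cos_mulr2n sin_mulr2n -/s !mulr2n.
  have := cos2Dsin2 (pi * x); rewrite -/s; move: (cos (pi * x)) => c cs.
  have c2 : c ^+ 2 = 1 - s ^+ 2 by rewrite -cs; ring.
  rewrite [LHS](_ : _ = (1 - A * (c ^+ 2 + c ^+ 2 - 1)) ^+ 2 + A ^+ 2 * (4 * (c ^+ 2 * s ^+ 2))); last by ring.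
  by rewrite c2; ring.
have A0' : 0 < A by exact: expR_gt0.
have A1' : A <= 1 by have : 0 <= 2 * pi * y * A; [rewrite !mulr_ge0 // ltW | lra].
rewrite -(ler_pXn2r (n := 2))// ?nnegrE ?nm_ge0 ?mulr_ge0 ?nm_ge0 ?divr_ge0 ?(ltW A00)//.
rewrite E exprMn nm_sqr /= expr_div_n.
have h1 : (2 * pi * y * A) ^+ 2 <= (1 - A) ^+ 2.
  by rewrite lerXn2r ?nnegrE// ?subr_ge0// !mulr_ge0 // ltW.
have h2 : A0 ^+ 2 <= A ^+ 2 by rewrite lerXn2r ?nnegrE// ltW.
have h3 : A ^+ 2 <= A by rewrite expr2 ler_piMr// ltW.
have y2 : 0 <= y ^+ 2 by exact: sqr_ge0.
have x2 : 0 <= x ^+ 2 by exact: sqr_ge0.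
have e1 : A0 ^+ 2 / 10 ^+ 2 * y ^+ 2 <= (1 - A) ^+ 2.
  apply: le_trans h1.
  have -> : (2 * pi * y * A) ^+ 2 = (2 * pi) ^+ 2 * (A ^+ 2 * y ^+ 2) by ring.
  have : A0 ^+ 2 * y ^+ 2 <= A ^+ 2 * y ^+ 2 by rewrite ler_wpM2r.
  have : 0 <= A ^+ 2 * y ^+ 2 by rewrite mulr_ge0// sqr_ge0.
  have : 1 <= (2 * pi) ^+ 2 :> R by nra.
  by nra.
have e2 : A0 ^+ 2 / 10 ^+ 2 * x ^+ 2 <= 4 * A * s ^+ 2.
  have : A0 ^+ 2 * x ^+ 2 <= A * x ^+ 2 by rewrite ler_wpM2r// (le_trans h2).
  have : A * (x ^+ 2 / 100) <= A * s ^+ 2 by rewrite ler_pM2l.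
  have : 0 <= A * s ^+ 2 by rewrite mulr_ge0 ?sqr_ge0// ltW.
  by lra.
by rewrite mulrDr; lra.
Qed.

Lemma summ_inv_sqr : summ (fun i => ((i.+1%:R : R) ^+ 2)^-1).
Proof.
split=> [n|]; first by rewrite invr_ge0 exprn_ge0.
exists 2 => N; suff : \sum_(n < N) ((n.+1%:R : R) ^+ 2)^-1 <= 2 - 2 * N.+1%:R^-1.
  by move=> h; apply: le_trans h _; rewrite gerBl mulr_ge0// invr_ge0.
elim: N => [|N IHN]; first by rewrite big_ord0 invr1 mulr1 subrr.
rewrite big_ord_recr/=; apply: le_trans (lerD IHN (lexx _)) _.
rewrite -[N.+2%:R]/(N.+1.+1%:R) -[N.+2]addn1 natrD.
have : 1 <= (N.+1%:R : R) by rewrite ler1n.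
move: (N.+1%:R : R) => n n1; have n0 : 0 < n by lra.
rewrite -subr_ge0 [X in 0 <= X](_ : _ = (n - 1) / (n ^+ 2 * (n + 1))); last first.
  by field; rewrite !gt_eqF//; lra.
by rewrite divr_ge0// ?mulr_ge0 ?sqr_ge0//; lra.
Qed.

(** Here the majorant holds only from some index on; replacing the earlier sums by 0 changes no
    limit. *)
Lemma tannery_ev (s : nat -> nat -> C) (t : nat -> C) (b0 : nat -> R) l : summ b0 ->
  (exists M, forall N n, (M <= N)%N -> (n < N)%N -> nm (s N n) <= b0 n) ->
  (forall n, cv (s ^~ n) (t n)) -> cv (partial t) l ->
  cv (fun N => \sum_(n < N) s N n) l.
Proof.
move=> bS [M sb] st tl.
pose s' N n := if (M <= N)%N then s N n else 0.
have := @tannery R s' t b0 l bS _ _ tl.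
have h1 N n : (n < N)%N -> nm (s' N n) <= b0 n.
  by rewrite /s'; case: ifP => [MN /sb->//|_ _]; rewrite nm0 bS.1.
have h2 n : cv (s' ^~ n) (t n).
  by apply: cv_near (st n); exists M => N MN; rewrite /s' MN.
move=> /(_ h1 h2); apply: cv_near; exists M => N MN.
by apply: eq_bigr => n _; rewrite /s' MN.
Qed.

Lemma cv_ev_dominated (A : nat -> nat -> C) a b q : opd b -> nm q < 1 ->
  (forall m n, nm (A m n) <= nm (b n)) -> (forall n, cv (A ^~ n) (a n)) ->
  cv (fun m => ev (A m) q) (ev a q).
Proof.
move=> bO q1 Ab Aa.
have opdle c : (forall n, nm (c n) <= nm (b n)) -> opd c.
  move=> cb r r01; have [M hM] := bO r r01; exists M => n; apply: le_trans (hM n).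
  by rewrite ler_wpM2r ?cb// exprn_ge0//; case/andP: r01.
have ab n : nm (a n) <= nm (b n) by apply: cv_nm_le (Aa n) _; exists 0%N => m _.
have bS := opd_summ bO q1.
have tail c : (forall n, nm (c n) <= nm (b n)) -> forall e : R, 0 < e -> exists N,
   nm (ev c q - partial (fun n => c n * q ^+ n) N) <= e.
  move=> cb e e0; have [N hN] := summ_tail bS e0; exists N.
  apply: (cv_partial_summ_tail bS _ (ev_cv (opdle _ cb) q1)).
    by move=> n; rewrite !nmM ler_wpM2r ?nm_ge0.
  by move=> M NM; apply: ltW; exact: hN.
move=> e e0; have e4 : 0 < e / 4 by lra.
have [N hN] := summ_tail bS e4.
have T c : (forall n, nm (c n) <= nm (b n)) ->
   nm (ev c q - partial (fun n => c n * q ^+ n) N) <= e / 4.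
  move=> cb; apply: (cv_partial_summ_tail bS _ (ev_cv (opdle _ cb) q1)).
    by move=> n; rewrite !nmM ler_wpM2r ?nm_ge0.
  by move=> M NM; apply: ltW; exact: hN.
have h : cv (fun m => partial (fun n => A m n * q ^+ n) N) (partial (fun n => a n * q ^+ n) N).
  by apply: cv_sum => i; apply: cvM => //; exact: cv_cst.
have [M hM] := h _ e4; exists M => m /hM h1.
have h2 := T _ ab; have h3 := T _ (Ab m).
set x := ev (A m) q in h3 *; set y := ev a q in h2 *.
set X := partial _ N in h1 h3; set Y := partial _ N in h1 h2.
have -> : x - y = (x - X) + (X - Y) + - (y - Y) by ring.
have := nmD ((x - X) + (X - Y)) (- (y - Y)); have := nmD (x - X) (X - Y).
by rewrite nmN; lra.
Qed.

(** The derivative of [qexp] at 0 is 2 i pi, taken along the increments t / N with N = 2 m + 1. *)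
Lemma cv_one_sub_qexp (t : C) :
  cv (fun m => m.*2.+1%:R * (1 - qexp (t / m.*2.+1%:R))) (- kappa * t).
Proof.
have [M [r [r0 H]]] := dl_qexp (0 : C).
have q0 : qexp (0 : C) = 1 by rewrite /qexp mulr0 cexpo0.
pose B : R := `|M| * nm t ^+ 2.
have B0 : 0 <= B by rewrite mulr_ge0 ?sqr_ge0.
move=> e e0.
have er : 0 < Num.min (r / (nm t + 1)) (e / (B + 1)).
  by rewrite lt_min !divr_gt0// ltr_wpDl// nm_ge0.
have [N hN] := cv_inv_nat er; exists N => m Nm.
set n := m.*2.+1; pose s : C := n%:R; have s0 : s != 0 by rewrite pnatr_eq0.
have := hN m.*2 (leq_trans Nm _); rewrite -addnn leq_addr => /(_ isT).
rewrite addnn -/n subr0 nmV nm_nat lt_min => /andP[h1 h2].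
have n0 : (0 : R) < n%:R by rewrite ltr0n.
have tr : nm (t / s) < r.
  move: h1; rewrite nmM nmV nm_nat ltr_pdivlMr; last by rewrite ltr_wpDl// nm_ge0.
  have : 0 <= (n%:R : R)^-1 by rewrite invr_ge0.
  by have := nm_ge0 t; nra.
have := H _ tr; rewrite add0r q0 mulr1 => h3.
have -> : s * (1 - qexp (t / s)) - - kappa * t = - s * (qexp (t / s) - 1 - kappa * (t / s)).
  by move: kappa (qexp _) => K Q; field.
rewrite nmM nmN nm_nat; apply: (@le_lt_trans _ _ (n%:R * (`|M| * nm (t / s) ^+ 2))).
  rewrite ler_wpM2l//; apply: le_trans h3 _.
  by rewrite ler_wpM2r ?sqr_ge0// ler_norm.
have -> : n%:R * (`|M| * nm (t / s) ^+ 2) = B * (n%:R)^-1 :> R.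
  by rewrite nmM nmV nm_nat /B; field; rewrite gt_eqF.
move: h2; rewrite ltr_pdivlMr; last by lra.
have : 0 < (n%:R : R)^-1 by rewrite invr_gt0.
by nra.
Qed.

Lemma inv_pow_le (x y : R) k : 0 < x -> x <= y -> (y ^+ k)^-1 <= (x ^+ k)^-1.
Proof.
move=> x0 xy; rewrite lef_pV2 ?posrE ?exprn_gt0//; last exact: lt_le_trans xy.
by rewrite lerXn2r ?nnegrE//; lra.
Qed.

Lemma inv_pow_sqr_le (x : R) k : 1 <= x -> (2 <= k)%N -> (x ^+ k)^-1 <= (x ^+ 2)^-1.
Proof.
move=> x1 k2; have x0 : 0 < x by lra.
by rewrite lef_pV2 ?posrE ?exprn_gt0// ler_weXn2l.
Qed.

Lemma intr_complex (j : int) : (j%:~R : R)%:C%C = j%:~R :> C.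
Proof. exact: rmorph_int. Qed.

Lemma norm_intS (i : nat) (j : int) : (j = Posz i.+1 \/ j = - Posz i.+1) ->
  `|(j%:~R : R)| = i.+1%:R.
Proof. by case=> ->; rewrite ?mulrNz ?normrN -pmulrn normr_nat. Qed.

(** The limits of the rescaled coefficients [geo_coef K (l * N) / N ^+ K] on the side of the
    q-series. *)
Definition pow_coef K : nat -> C := fun l => l%:R ^+ K / K`!%:R.

Lemma geo_coef_scaled K l N : (0 < N)%N ->
  geo_coef K (l * N) / N%:R ^+ K =
  (\prod_(i < K) (l%:R + i.+1%:R / N%:R)) / K`!%:R :> C.
Proof.
move=> N0; have Kf : K`!%:R != 0 :> C by rewrite pnatr_eq0 -lt0n fact_gt0.
have NC : N%:R != 0 :> C by rewrite pnatr_eq0 -lt0n.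
apply: (mulIf Kf); rewrite divfK// mulrAC geo_coef_prod.
apply: (mulIf (expf_neq0 K NC)); rewrite divfK ?expf_neq0//.
rewrite -[K in N%:R ^+ K]card_ord -prodr_const -big_split/=; apply: eq_bigr => i _.
by rewrite natrM; field.
Qed.

(** The sums [wsum m (T m)] have two limits: one through [finite_lipschitz] and the q-series, one
    termwise. Both passages to the limit are dominated, and the limits agree. *)
Theorem lipschitz K w : (0 < K)%N -> 0 < complex.Im w ->
  cv (fun m => wsum m (fun j => ((w + j%:~R) ^+ K.+1)^-1))
     ((- kappa) ^+ K.+1 * ev (pow_coef K) (qexp w)).
Proof.
move=> K0 w0; have q1 := nm_qexp_lt1 w0.
have k0 : - kappa != 0 by rewrite oppr_eq0 kappa_neq0.
pose T m j := ((m.*2.+1%:R * (1 - qexp ((w + j%:~R) / m.*2.+1%:R))) ^+ K.+1)^-1.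
pose T' (j : int) := ((- kappa * (w + j%:~R)) ^+ K.+1)^-1.
have wj j : w + j%:~R != 0.
  by apply: Im_gt0_neq0; rewrite raddfD/= Im_intr addr0.
have TT' j : cv (T ^~ j) (T' j).
  by apply: cvV; [rewrite expf_neq0// mulf_neq0|exact: cvX (cv_one_sub_qexp _)].
have rhs : cv (fun m => wsum m (T m)) (ev (pow_coef K) (qexp w)).
  have := @cv_ev_dominated (fun m l => geo_coef K (l * m.*2.+1) / m.*2.+1%:R ^+ K)
     (pow_coef K) (geo_coef K) (qexp w) (@opd_geo_coef R K) q1.
  have h1 m n : nm (geo_coef K (n * m.*2.+1) / m.*2.+1%:R ^+ K : C) <= nm (geo_coef K n : C).
    have Kf : K`!%:R != 0 :> C by rewrite pnatr_eq0 -lt0n fact_gt0.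
    rewrite geo_coef_scaled// -[geo_coef K n : C](mulfK Kf) geo_coef_prod.
    rewrite !nmM ler_wpM2r ?nm_ge0// !nm_prod; apply: ler_prod => i _.
    rewrite nm_ge0/= -natrD nm_nat; apply: le_trans (nmD _ _) _.
    rewrite nm_nat nmM nmV !nm_nat natrD lerD2l ler_pdivrMr ?ltr0n//.
    by rewrite ler_peMr// ler1n.
  have h2 n : cv (fun m => geo_coef K (n * m.*2.+1) / m.*2.+1%:R ^+ K : C) (pow_coef K n).
    have E : (fun m => geo_coef K (n * m.*2.+1) / m.*2.+1%:R ^+ K : C) =
       (fun m => (\prod_(i < K) (n%:R + i.+1%:R / m.*2.+1%:R)) * (K`!%:R)^-1 : C).
      by apply/funext => m; rewrite geo_coef_scaled.
    rewrite E /pow_coef; apply: cvM (cv_cst _).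
    have inv0 : cv (fun m => (m.*2.+1%:R)^-1 : C) 0.
      move=> e e0; have [N hN] := @cv_inv_nat R e e0; exists N => m Nm.
      by apply: hN; rewrite -addnn; apply: leq_trans Nm (leq_addr _ _).
    rewrite -[K in X in cv _ X]card_ord -prodr_const.
    elim: (index_enum _) => [|i r IHr].
      rewrite big_nil; apply: cv_near (cv_cst 1).
      by exists 0%N => m _; rewrite big_nil.
    rewrite big_cons; apply: (@cv_near _ (fun m => (n%:R + i.+1%:R / m.*2.+1%:R) *
       \prod_(i <- r) (n%:R + i.+1%:R / m.*2.+1%:R))).
      by exists 0%N => m _; rewrite big_cons.
    apply: cvM IHr; rewrite -[n%:R in X in cv _ X]addr0; apply: cvD (cv_cst _) _.
    by rewrite -[0](mulr0 i.+1%:R); apply: cvZ.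
  move=> /(_ h1 h2); apply: cv_near; exists 0%N => m _.
  by rewrite -finite_lipschitz.
have [e e0 he] := lin_lower w0.
have wlow i j : (j = Posz i.+1 \/ j = - Posz i.+1) -> e * i.+1%:R <= nm (w + j%:~R).
  move=> /norm_intS hj; have := he 1 j%:~R ler01; rewrite rmorph1 mul1r intr_complex hj.
  by apply: le_trans; rewrite ler_pM2l// ler_wpDl.
have [c c0 hc] := one_sub_qexp_lower (complex.Im w).
(* One constant for both the approximating terms [T] and their limits [T']. *)
pose ce := Num.min c (nm (- kappa)).
have ce0 : 0 < ce by rewrite lt_min c0 nm_gt0.
pose b i := 2 * ((ce * e) ^+ K.+1)^-1 * ((i.+1%:R : R) ^+ 2)^-1.
have bS : summ b.
  by apply: summZ summ_inv_sqr; rewrite mulr_ge0 ?invr_ge0 ?exprn_ge0// mulr_ge0// ltW.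
have pow_bound (x : C) i : ce * (e * i.+1%:R) <= nm x -> nm ((x ^+ K.+1)^-1) <=
    ((ce * e) ^+ K.+1)^-1 * ((i.+1%:R : R) ^+ 2)^-1.
  move=> h; rewrite nmV nmX; have i1 : 1 <= i.+1%:R :> R by rewrite ler1n.
  have p0 : 0 < ce * (e * i.+1%:R) by rewrite !mulr_gt0.
  apply: le_trans (inv_pow_le K.+1 p0 h) _.
  rewrite mulrA exprMn invfM; apply: ler_wpM2l; last exact: inv_pow_sqr_le.
  by rewrite invr_ge0 exprn_ge0// mulr_ge0// ltW.
have sT'S : summ (fun i => nm (T' (Posz i.+1) + T' (- Posz i.+1))).
  apply: (summ_le _ bS) => i; rewrite nm_ge0/=; apply: le_trans (nmD _ _) _.
  have B j : (j = Posz i.+1 \/ j = - Posz i.+1) -> nm (T' j) <=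
      ((ce * e) ^+ K.+1)^-1 * ((i.+1%:R : R) ^+ 2)^-1.
    move=> /wlow hj; apply: pow_bound; rewrite nmM ler_pM// ?(ltW ce0) ?mulr_ge0 ?(ltW e0)//.
    by rewrite /ce ge_min lexx orbT.
  apply: le_trans (lerD (B _ (or_introl erefl)) (B _ (or_intror erefl))) _.
  by rewrite /b -[X in _ <= X]mulrA [leRHS]mulr_natl mulr2n.
have [L hL] := summ_cv sT'S.
have lhs : cv (fun m => wsum m (T m)) (T' 0 + L).
  apply: cvD => //.
  apply: (@tannery_ev (fun m i => T m (Posz i.+1) + T m (- Posz i.+1)) _ b L bS _ _ hL); last first.
    by move=> i; exact: cvD.
  (* For m >= 5 |Re w| and |j| <= m, the real part of (w + j) / (2 m + 1) is at most 3/5 in absolute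
     value. *)
  exists (Num.trunc (5 * `|complex.Re w|)).+1 => m i hm im; apply: le_trans (nmD _ _) _.
  have m5 : 5 * `|complex.Re w| <= m%:R.
    apply: ltW; apply: lt_le_trans (Num.Theory.truncnS_gt _) _.
    by rewrite ler_nat.
  have B j : (j = Posz i.+1 \/ j = - Posz i.+1) -> nm (T m j) <=
      ((ce * e) ^+ K.+1)^-1 * ((i.+1%:R : R) ^+ 2)^-1.
    move=> hj; have nj := norm_intS hj; apply: pow_bound; rewrite nmM nm_nat.
    have N0 : (0 : R) < m.*2.+1%:R by rewrite ltr0n.
    have NE : (m.*2.+1%:R : R) = 2 * m%:R + 1 by rewrite -[m.*2.+1]addn1 natrD -mul2n natrM.
    have tE : (w + j%:~R) / m.*2.+1%:R = (m.*2.+1%:R^-1)%:C%C * (w + j%:~R).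
      by rewrite fmorphV rmorph_nat mulrC.
    have tI : complex.Im ((w + j%:~R) / m.*2.+1%:R) = complex.Im w / m.*2.+1%:R.
      rewrite tE; case: (w) => x y; rewrite -intr_complex /=; ring.
    have tR : complex.Re ((w + j%:~R) / m.*2.+1%:R) = (complex.Re w + j%:~R) / m.*2.+1%:R.
      rewrite tE; case: (w) => x y; rewrite -intr_complex /=; ring.
    have := hc ((w + j%:~R) / m.*2.+1%:R); rewrite tI tR.
    have a1 : 0 < complex.Im w / m.*2.+1%:R <= complex.Im w.
      rewrite divr_gt0//= ler_pdivrMr// ler_peMr ?ler1n// ltW//.
    have a2 : `|(complex.Re w + j%:~R) / m.*2.+1%:R| <= 3 / 5.
      rewrite normrM normfV (ger0_norm (ltW N0)) ler_pdivrMr//.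
      apply: le_trans (ler_normD _ _) _; rewrite nj NE.
      have : i.+1%:R <= m%:R :> R by rewrite ler_nat.
      by move: m5; move: (normr_ge0 (complex.Re w)); lra.
    move=> /(_ a1 a2) h.
    apply: (@le_trans _ _ (c * nm (w + j%:~R))).
      apply: ler_pM; rewrite ?(ltW ce0) ?mulr_ge0 ?(ltW e0)//; last exact: wlow.
      by rewrite /ce ge_min lexx.
    apply: le_trans (ler_wpM2l (ltW N0) h).
    by rewrite [nm (_ / _)]nmM nmV nm_nat mulrCA [m.*2.+1%:R * _]mulrC divfK ?gt_eqF.
  apply: le_trans (lerD (B _ (or_introl erefl)) (B _ (or_intror erefl))) _.
  by rewrite /b -[X in _ <= X]mulrA [leRHS]mulr_natl mulr2n.
have T'L : cv (fun m => wsum m T') (T' 0 + L) by apply: cvD hL; exact: cv_cst.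
have E := cv_unique lhs rhs.
have := cvZ ((- kappa) ^+ K.+1) T'L; rewrite E; apply: cv_near; exists 0%N => m _.
rewrite wsumZ; apply: eq_wsum => j; rewrite /T' exprMn invfM mulrA divff ?mul1r//.
exact: expf_neq0.
Qed.

End Eisenstein.

(** * Eisenstein series *)

Section EisensteinSeries.
Variable R : realType.
Local Notation C := (complex R).
Local Notation kappa := (Complex 0 (2 * pi) : C).
Implicit Types (z w q : C) (a b : nat -> C).

(* For c = d = 0 the summand is 0, the inverse of 0. *)
Definition lattice_sum k m z : C :=
  wsum m (fun c => wsum m (fun d => ((c%:~R * z + d%:~R) ^+ k)^-1)).

(** The box |c|, |d| <= m is symmetric in c and d, so the transformation law holds at every finite
    stage and no double series has to be rearranged. *)
Lemma lattice_sum_S k m z : z != 0 ->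
  lattice_sum k m (- z^-1) = z ^+ k * lattice_sum k m z.
Proof.
move=> z0; rewrite /lattice_sum wsumZ -[LHS]wsumN.
transitivity (wsum m (fun c => wsum m (fun d => z ^+ k * ((d%:~R * z + c%:~R) ^+ k)^-1))).
  apply: eq_wsum => c; apply: eq_wsum => d.
  have -> : (- c)%:~R * - z^-1 + d%:~R = (d%:~R * z + c%:~R) / z.
    by rewrite rmorphN/= mulrNN; field.
  by rewrite expr_div_n invf_div.
by rewrite exchange_wsum; apply: eq_wsum => c; rewrite wsumZ.
Qed.

Lemma wsum_even m f : f 0 = 0 -> (forall j, f (- j) = f j) ->
  wsum m f = \sum_(i < m) 2 * f (Posz i.+1) :> C.
Proof.
by move=> f0 fN; rewrite /wsum f0 add0r; apply: eq_bigr => i _; rewrite fN; ring.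
Qed.

(** The divisor sum sigma_K(n) / K!, with value 0 at n = 0. *)
Definition sigma_coef K : nat -> C := fun n => \sum_(i < n) dilate i.+1 (pow_coef R K) n.

Lemma nm_pow_coef K n : nm (pow_coef R K n) <= n%:R ^+ K.
Proof.
rewrite /pow_coef nmM nmX nmV !nm_nat ler_pdivrMr ?ltr0n ?fact_gt0//.
by rewrite ler_peMr ?exprn_ge0// ler1n fact_gt0.
Qed.

Lemma sum_dilate_bound K M n : (0 < K)%N ->
  nm (\sum_(i < M) dilate i.+1 (pow_coef R K) n) <= n%:R ^+ K.+1.
Proof.
move=> K0; case: n => [|n].
  rewrite big1 ?nm0 ?exprn_ge0// => i _; rewrite /dilate dvdn0 div0n /pow_coef.
  by rewrite expr0n gtn_eqF// mul0r.
have big M' : (n.+1 <= M')%N -> \sum_(i < M') dilate i.+1 (pow_coef R K) n.+1 =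
    \sum_(i < n.+1) dilate i.+1 (pow_coef R K) n.+1.
  move=> nM; rewrite (big_ord_widen M' (fun i => dilate i.+1 (pow_coef R K) n.+1) nM).
  rewrite [RHS]big_mkcond/=; apply: eq_bigr => i _; case: ifPn => //.
  by rewrite -leqNgt => ni; rewrite /dilate gtnNdvd.
have bd i : nm (dilate i.+1 (pow_coef R K) n.+1) <= n.+1%:R ^+ K.
  rewrite /dilate; case: ifP => _; last by rewrite nm0 exprn_ge0.
  apply: le_trans (nm_pow_coef _ _) _; rewrite lerXn2r ?nnegrE// ler_nat.
  exact: leq_div.
apply: (@le_trans _ _ (\sum_(i < n.+1) nm (dilate i.+1 (pow_coef R K) n.+1))).
  have [Mn|nM] := leqP M n.+1; last by rewrite big ?(ltnW nM)//; exact: nm_sum.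
  apply: le_trans (nm_sum _ _ _) _.
  rewrite (big_ord_widen n.+1 (fun i => nm (dilate i.+1 (pow_coef R K) n.+1)) Mn).
  rewrite [leLHS]big_mkcond/=; apply: ler_sum => i _; case: ifP => // _.
  exact: nm_ge0.
apply: (@le_trans _ _ (\sum_(i < n.+1) n.+1%:R ^+ K)); first by apply: ler_sum.
by rewrite sumr_const card_ord exprSr mulr_natr.
Qed.

Lemma opd_iter_theta K : opd (iter K (@theta R) (fun=> 1)).
Proof. by elim: K => [|K IHK]; [exact: opd_ones|exact: opd_theta]. Qed.

Lemma iter_theta_ones K n : iter K (@theta R) (fun=> 1) n = n%:R ^+ K.
Proof. by elim: K => //= K IHK; rewrite /theta IHK exprS. Qed.

(** The partial sums over i are power series whose n-th coefficient is constant from M = n on, and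
    n^(K+1) dominates all of them; hence the two summations may be exchanged. *)
Lemma lambert K q : (0 < K)%N -> nm q < 1 ->
  cv (partial (fun i => ev (pow_coef R K) (q ^+ i.+1))) (ev (sigma_coef K) q).
Proof.
move=> K0 q1.
have pO : opd (pow_coef R K).
  have := opdZ (K`!%:R)^-1 (opd_iter_theta K); congr opd; apply/funext => n.
  by rewrite iter_theta_ones mulrC.
have dO i := opd_dilate (ltn0Sn i) pO.
apply: (@cv_near _ (fun M => ev (fun n => \sum_(i < M) dilate i.+1 (pow_coef R K) n) q)).
  exists 0%N => M _; elim: M => [|M IHM].
    by rewrite /partial big_ord0 ev_coef0// => n; rewrite big_ord0.
  have -> : partial (fun i => ev (pow_coef R K) (q ^+ i.+1)) M.+1 =
     partial (fun i => ev (pow_coef R K) (q ^+ i.+1)) M + ev (pow_coef R K) (q ^+ M.+1).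
    by rewrite /partial big_ord_recr.
  rewrite -IHM (ev_dilate _ (dO M))//.
  rewrite -(@evD _ (fun n => \sum_(i < M) dilate i.+1 (pow_coef R K) n))//.
    by congr (ev _ q); apply/funext => n; rewrite big_ord_recr.
  move=> r r01; have [B hB] := opd_iter_theta K.+1 r01; exists B => n.
  apply: le_trans (hB n); rewrite ler_wpM2r ?exprn_ge0//; first by case/andP: r01.
  by rewrite iter_theta_ones nmX nm_nat sum_dilate_bound.
apply: (cv_ev_dominated (opd_iter_theta K.+1)) => // [m n|n].
  by rewrite iter_theta_ones nmX nm_nat sum_dilate_bound.
apply: cv_near (cv_cst _); exists n.+1 => M nM; rewrite /sigma_coef.
rewrite (big_ord_widen M (fun i => dilate i.+1 (pow_coef R K) n) (ltnW nM)).
rewrite big_mkcond/=; apply: eq_bigr => i _; case: ifPn => //.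
rewrite -leqNgt => ni; rewrite /dilate.
case: n {nM} ni => [|n] ni; last by rewrite gtnNdvd.
by rewrite dvdn0 div0n /pow_coef expr0n gtn_eqF// mul0r.
Qed.

Lemma opd_sigma K : (0 < K)%N -> opd (sigma_coef K).
Proof.
move=> K0 r r01; have [B hB] := opd_iter_theta K.+1 r01; exists B => n.
apply: le_trans (hB n); rewrite ler_wpM2r ?exprn_ge0//; first by case/andP: r01.
by rewrite iter_theta_ones nmX nm_nat sum_dilate_bound.
Qed.

(** The row c = 0 gives twice the zeta value at K + 1, and each pair of rows c, - c gives twice an
    instance of Lipschitz' formula. That the zeta value is real and positive is recorded for the
    sign of the first coefficient. *)
Lemma lattice_sum_cv K : (3 <= K)%N -> odd K -> exists2 zeta : R, 1 <= zeta &
  forall z, 0 < complex.Im z -> cv (fun m => lattice_sum K.+1 m z)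
    (2 * zeta%:C%C + 2 * ((- kappa) ^+ K.+1 * ev (sigma_coef K) (qexp z))).
Proof.
move=> K3 oK; have K0 : (0 < K)%N by apply: leq_trans K3.
pose Z i : C := (i.+1%:R ^+ K.+1)^-1.
have ZS : summ (fun i => nm (Z i)).
  apply: summ_le (@summ_inv_sqr R) => i; rewrite nm_ge0/= nmV nmX nm_nat.
  by rewrite inv_pow_sqr_le// ler1n.
have [L hL] := summ_cv ZS.
have ZE i : Z i = ((i.+1%:R ^+ K.+1)^-1 : R)%:C%C.
  by rewrite /Z fmorphV rmorphXn rmorph_nat.
have LE : L = (complex.Re L)%:C%C.
  apply: (cv_unique hL) => e e0; have [N hN] := hL e e0; exists N => n /hN.
  have -> : partial Z n = (\sum_(i < n) (i.+1%:R ^+ K.+1)^-1 : R)%:C%C.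
    by rewrite rmorph_sum; apply: eq_bigr => i _; rewrite ZE.
  apply: le_lt_trans; rewrite -rmorphB nm_real.
  by have := nm_Re ((\sum_(i < n) (i.+1%:R ^+ K.+1)^-1 : R)%:C%C - L); rewrite raddfB.
have L1 : 1 <= complex.Re L.
  rewrite -subr_ge0 leNgt; apply/negP => neg.
  have [N hN] := hL (1 - complex.Re L) (ltac:(lra)).
  have := hN N.+1 (leqnSn N); rewrite LE.
  have -> : partial Z N.+1 = (\sum_(i < N.+1) (i.+1%:R ^+ K.+1)^-1 : R)%:C%C.
    by rewrite rmorph_sum; apply: eq_bigr => i _; rewrite ZE.
  rewrite -rmorphB nm_real big_ord_recl/= expr1n invr1.
  have : 0 <= \sum_(i < N) ((bump 0 i).+1%:R ^+ K.+1)^-1 :> R.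
    by apply: sumr_ge0 => i _; rewrite invr_ge0 exprn_ge0.
  by rewrite ltr_norml => h /andP[_]; lra.
exists (complex.Re L) => // z z0; rewrite -LE.
have zi0 i : 0 < complex.Im (i.+1%:R * z).
  rewrite mulrC mulr_natr; have -> : complex.Im (z *+ i.+1) = complex.Im z *+ i.+1.
    by rewrite raddfMn.
  by rewrite pmulrn_lgt0.
pose s m w := wsum m (fun j => ((w + j%:~R) ^+ K.+1)^-1).
have evK : forall x : C, (- x) ^+ K.+1 = x ^+ K.+1.
  by move=> x; rewrite exprNn -signr_odd /= oK expr0 mul1r.
have latE m : lattice_sum K.+1 m z =
    \sum_(i < m) 2 * Z i + \sum_(i < m) 2 * s m (i.+1%:R * z).
  rewrite /lattice_sum /wsum -[X in X + _]/(wsum m (fun d => ((0%:~R * z + d%:~R) ^+ K.+1)^-1)).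
  congr (_ + _).
    rewrite wsum_even; last 2 first.
    - by rewrite mul0r add0r expr0n invr0.
    - by move=> j; rewrite !mul0r !add0r rmorphN/= evK.
    by apply: eq_bigr => i _; rewrite mul0r add0r /Z -pmulrn.
  apply: eq_bigr => i _.
  rewrite -[X in _ + X = _]/(wsum m (fun d => (((- Posz i.+1)%:~R * z + d%:~R) ^+ K.+1)^-1)).
  rewrite -[X in X + _ = _]/(wsum m (fun d => (((Posz i.+1)%:~R * z + d%:~R) ^+ K.+1)^-1)).
  rewrite -[X in _ + X]wsumN [X in _ + X](_ : _ = s m (i.+1%:R * z)).
    by rewrite -pmulrn /s; ring.
  apply: eq_wsum => j; rewrite !rmorphN/= -pmulrn.
  have -> : - i.+1%:R * z + - j%:~R = - (i.+1%:R * z + j%:~R) by ring.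
  by rewrite evK.
apply: (@cv_near _ (fun m => 2 * (\sum_(i < m) Z i) + 2 * \sum_(i < m) s m (i.+1%:R * z))).
  by exists 0%N => m _; rewrite latE !mulr_sumr.
apply: cvD; apply: cvZ => //.
have [e e0 he] := lin_lower z0.
have [S2 [_ hS]] : exists S2 : R, 0 <= S2 /\ forall N, \sum_(i < N) ((i.+1%:R : R) ^+ 2)^-1 <= S2.
  have [h0 [S2 hS]] := @summ_inv_sqr R; exists S2; split=> //.
  by have := hS 0%N; rewrite big_ord0.
pose E := (e ^+ K.+1)^-1.
have E0 : 0 < E by rewrite invr_gt0 exprn_gt0.
(* The exponent is at least 4 and (n + t)^2 >= n (1 + t) for n >= 1, which splits the bound into a
   product of two summable factors. *)
have tb i j : nm (((i.+1%:R * z + j%:~R) ^+ K.+1)^-1) <=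
   E * (((i.+1%:R : R) ^+ 2)^-1 * ((1 + `|(j%:~R : R)|) ^+ 2)^-1).
  have := he i.+1%:R j%:~R (ler0n _ _); rewrite rmorph_nat intr_complex => h.
  have j0 := normr_ge0 (j%:~R : R); have i1 : 1 <= i.+1%:R :> R by rewrite ler1n.
  rewrite nmV nmX; set t := `|_| in h j0 *; set n : R := i.+1%:R in h i1 *.
  have p0 : 0 < e * (n + t) by rewrite mulr_gt0//; lra.
  apply: le_trans (inv_pow_le K.+1 p0 h) _.
  rewrite exprMn invfM ler_pM2l// -invfM -exprMn.
  have nt : 1 <= n + t by lra.
  apply: (@le_trans _ _ (((n + t) ^+ 4)^-1)).
    by rewrite lef_pV2 ?posrE ?exprn_gt0 ?ler_weXn2l//; lra.
  rewrite lef_pV2 ?posrE ?exprn_gt0 ?mulr_gt0//; try lra.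
  rewrite (exprM (n + t) 2 2) lerXn2r ?nnegrE ?sqr_ge0 ?mulr_ge0//; try lra.
  by nra.
pose b i := E * (1 + 2 * S2) * ((i.+1%:R : R) ^+ 2)^-1.
have bS : summ b.
  apply: summZ (@summ_inv_sqr R); rewrite mulr_ge0 ?(ltW E0)//.
  by have := hS 0%N; rewrite big_ord0; lra.
apply: (@tannery R (fun m i => s m (i.+1%:R * z)) (fun i => (- kappa) ^+ K.+1 * ev (pow_coef R K) (qexp z ^+ i.+1)) b).
- exact: bS.
- move=> m i _; rewrite /s /wsum; apply: le_trans (nmD _ _) _.
  have tj j n : (j = Posz n.+1 \/ j = - Posz n.+1) ->
      nm (((i.+1%:R * z + j%:~R) ^+ K.+1)^-1) <= E * (((i.+1%:R : R) ^+ 2)^-1 * ((n.+1%:R) ^+ 2)^-1).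
    move=> hj; apply: le_trans (tb i j) _; rewrite (norm_intS _ hj).
    rewrite ler_pM2l// ler_pM2l ?invr_gt0 ?exprn_gt0//.
    by rewrite inv_pow_le ?ltr0n// lerDr.
  have t0 : nm (((i.+1%:R * z + 0%:~R) ^+ K.+1)^-1) <= E * ((i.+1%:R : R) ^+ 2)^-1.
    apply: le_trans (tb i 0) _.
    by rewrite (_ : 1 + `|0%:~R : R| = 1) ?expr1n ?invr1 ?mulr1// mulr0z normr0 addr0.
  have ts : nm (\sum_(n < m) (((i.+1%:R * z + (Posz n.+1)%:~R) ^+ K.+1)^-1 +
       ((i.+1%:R * z + (- Posz n.+1)%:~R) ^+ K.+1)^-1)) <=
      E * (((i.+1%:R : R) ^+ 2)^-1 * (2 * S2)).
    apply: le_trans (nm_sum _ _ _) _.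
    apply: (@le_trans _ _ (\sum_(n < m) (E * ((i.+1%:R : R) ^+ 2)^-1 * 2) * ((n.+1%:R) ^+ 2)^-1)).
      apply: ler_sum => n _; apply: le_trans (nmD _ _) _.
      apply: le_trans (lerD (tj _ n (or_introl erefl)) (tj _ n (or_intror erefl))) _.
      by rewrite le_eqVlt; apply/orP; left; apply/eqP; ring.
    rewrite -mulr_sumr -!mulrA ler_pM2l// ler_pM2l ?invr_gt0 ?exprn_gt0//.
    by rewrite ler_pM2l.
  apply: le_trans (lerD t0 ts) _.
  by rewrite /b le_eqVlt; apply/orP; left; apply/eqP; ring.
- move=> i; have -> : qexp z ^+ i.+1 = qexp (i.+1%:R * z) by rewrite mulr_natl qexpMn.
  exact: (lipschitz K0 (zi0 i)).
- apply: (@cv_near _ (fun N => (- kappa) ^+ K.+1 *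
     partial (fun i => ev (pow_coef R K) (qexp z ^+ i.+1)) N)).
    by exists 0%N => N _; rewrite /partial mulr_sumr.
  by apply: cvZ; apply: lambert => //; exact: nm_qexp_lt1.
Qed.

(** Of the coefficient of q only its sign relative to (- 2 i pi)^(K+1) is retained; [discriminant]
    needs no value of zeta. *)
Theorem eisenstein K : (3 <= K)%N -> odd K -> exists a (r : R),
  [/\ opd a, S_invariant K.+1 a, a 0%N = 1, 0 < r & a 1%N = r%:C%C * (- kappa) ^+ K.+1].
Proof.
move=> K3 oK; have K0 : (0 < K)%N by apply: leq_trans K3.
have [zeta z1 H] := lattice_sum_cv K3 oK.
have zC : 2 * zeta%:C%C != 0 :> C.
  by rewrite mulf_neq0 ?pnatr_eq0// -nm_gt0 nm_real normr_gt0; lra.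
pose c := (- kappa) ^+ K.+1 / zeta%:C%C.
have sO := opd_sigma K0.
exists (fun n => cone R n + c * sigma_coef K n), (zeta^-1 / K`!%:R); split.
- by apply: opdD; [exact: opd_cone|exact: opdZ].
- have [F FE FH] : exists2 F : C -> C,
      forall z, 0 < complex.Im z -> ev (fun n => cone R n + c * sigma_coef K n) (qexp z) =
        (2 * zeta%:C%C)^-1 * F z
      & forall z, 0 < complex.Im z -> cv (fun m => lattice_sum K.+1 m z) (F z).
    exists (fun z => 2 * zeta%:C%C + 2 * ((- kappa) ^+ K.+1 * ev (sigma_coef K) (qexp z))).
      move=> z z0; have q1 := nm_qexp_lt1 z0.
      rewrite (@evD _ (cone R))//; [|exact: opd_cone|exact: opdZ].
      rewrite evZ// ev_cone /c; move: ((- kappa) ^+ K.+1) => k; field.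
      by move: zC; rewrite mulf_eq0 negb_or => /andP[].
    exact: H.
  move=> z z0; have z0' := Im_inv_gt0 z0; rewrite (FE _ z0') (FE _ z0) mulrCA.
  congr (_ * _); apply: cv_unique (FH _ z0') _; apply: cv_near (cvZ _ (FH _ z0)).
  by exists 0%N => m _; rewrite lattice_sum_S// Im_gt0_neq0.
- by rewrite /cone /sigma_coef big_ord0 mulr0 addr0.
- by rewrite mulr_gt0 ?invr_gt0 ?ltr0n ?fact_gt0//; lra.
- rewrite /cone /sigma_coef big_ord1 add0r /dilate dvd1n divn1 /pow_coef expr1n mul1r /c.
  by rewrite rmorphM !fmorphV rmorph_nat/=; ring.
Qed.

End EisensteinSeries.

(** * Linear algebra of subspaces given as sets *)

Section Dimension.
Variable K : fieldType.
Implicit Types (V W : lmodType K).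

Definition lsub V (S : set V) := S 0 /\ forall c u v, S u -> S v -> S (c *: u + v).

Definition indep V n (b : 'I_n -> V) :=
  forall c : 'I_n -> K, \sum_i c i *: b i = 0 -> forall i, c i = 0.

Lemma lsub_sum V (S : set V) n (b : 'I_n -> V) (c : 'I_n -> K) : lsub S ->
  (forall i, S (b i)) -> S (\sum_i c i *: b i).
Proof.
move=> [S0 Sl] Sb; elim/big_ind: _ => // [u v Su Sv|i _].
  by have := Sl 1 u v Su Sv; rewrite scale1r.
by have := Sl (c i) (b i) 0 (Sb i) S0; rewrite addr0.
Qed.

Lemma indep_le_span V m n (b : 'I_m -> V) (b' : 'I_n -> V) :
  (forall i, exists c : 'I_n -> K, b i = \sum_j c j *: b' j) -> indep b -> (m <= n)%N.
Proof.
move=> /choice[A bA] bI; rewrite leqNgt; apply/negP => nm.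
pose M : 'M[K]_(m, n) := \matrix_(i, j) A i j.
have : kermx M != 0.
  by rewrite kermx_eq0 /row_free neq_ltn (leq_ltn_trans (rank_leq_col M) nm).
move=> /rowV0Pn[v /sub_kermxP vM v0]; case/negP: v0; apply/eqP/rowP => i.
rewrite mxE; apply: (bI (fun i => v 0 i)).
under eq_bigr => j _ do rewrite bA scaler_sumr.
rewrite exchange_big big1// => j _.
under eq_bigr => k _ do rewrite scalerA.
rewrite -scaler_suml; have /rowP/(_ j) := vM; rewrite !mxE.
by under eq_bigr do rewrite mxE; move=> ->; rewrite scale0r.
Qed.

Lemma has_dim_uniq V (S : set V) n m : has_dim S n -> has_dim S m -> n = m.
Proof.
move=> [b [Sb bI bS]] [b' [Sb' bI' bS']]; apply/eqP; rewrite eqn_leq; apply/andP; split.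
  apply: (indep_le_span (b := b) (b' := b')) => // i.
  by have [c /subr0_eq ->] := bS' _ (Sb i); exists c.
apply: (indep_le_span (b := b') (b' := b)) => // i.
by have [c /subr0_eq ->] := bS _ (Sb' i); exists c.
Qed.

Lemma dimension_eq V (S : set V) n : has_dim S n -> dimension S = n.
Proof.
move=> Sn; rewrite /dimension; case: xgetP => [m _ Sm|/(_ n)//].
exact: has_dim_uniq Sm Sn.
Qed.

Definition snoc (T : Type) m (b : 'I_m -> T) (v : T) : 'I_m.+1 -> T :=
  fun i => if unlift ord_max i is Some j then b j else v.

Lemma snoc_lift (T : Type) m (b : 'I_m -> T) v i : snoc b v (widen_ord (leqnSn m) i) = b i.
Proof.
have -> : widen_ord (leqnSn m) i = lift ord_max i by apply/val_inj; rewrite /= /bump leqNgt ltn_ord.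
by rewrite /snoc liftK.
Qed.

Lemma snoc_max (T : Type) m (b : 'I_m -> T) v : snoc b v ord_max = v.
Proof. by rewrite /snoc unlift_none. Qed.

(** An independent family of maximal length spans: adjoining any vector yields a relation in which
    this vector occurs. *)
Lemma has_dim_bounded V (S : set V) n : lsub S ->
  (forall m (b : 'I_m -> V), (forall i, S (b i)) -> indep b -> (m <= n)%N) ->
  exists2 m, (m <= n)%N & has_dim S m.
Proof.
move=> Sl bnd.
pose P m := `[< exists b : 'I_m -> V, (forall i, S (b i)) /\ indep b >].
have ex : exists m, P m.
  exists 0%N; apply/asboolP; exists (fun=> 0); split=> [[]//|c _ []//].
have Pn m : P m -> (m <= n)%N by move=> /asboolP[b [Sb bI]]; exact: bnd bI.
have [m /asboolP[b [Sb bI]] maxm] := ex_maxnP ex Pn.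
exists m; first by apply: (bnd _ b).
exists b; split=> // v Sv.
have : ~ indep (snoc b v).
  move=> sI; have : P m.+1.
    apply/asboolP; exists (snoc b v); split=> // i; rewrite /snoc.
    by case: unliftP.
  by move=> /maxm; rewrite ltnn.
move=> /existsNP[c /not_implyP[]]; rewrite big_ord_recr/=.
under eq_bigr do rewrite snoc_lift; rewrite snoc_max => c0 /existsNP[i ci].
have [v0|v0] := eqVneq (c ord_max) 0.
  exfalso; apply: ci; case: (unliftP ord_max i) => [j|] -> //.
  move: c0; rewrite v0 scale0r addr0 => /(bI (fun j => c (widen_ord (leqnSn m) j)))/(_ j).
  by congr (c _ = _); apply/val_inj; rewrite /= /bump leqNgt ltn_ord.
exists (fun j => - (c ord_max)^-1 * c (widen_ord (leqnSn m) j)).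
rewrite -[v in v - _](scalerK v0).
rewrite (eq_bigr (fun j => - (c ord_max)^-1 *: (c (widen_ord (leqnSn m) j) *: b j))); last first.
  by move=> j _; rewrite scalerA.
rewrite -scaler_sumr -(addr0_eq c0) scalerN scaleNr opprK.
exact: addNr.
Qed.

Lemma has_dim_span V (S : set V) n (b : 'I_n -> V) : lsub S ->
  (forall v, S v -> exists c : 'I_n -> K, v = \sum_i c i *: b i) ->
  exists2 m, (m <= n)%N & has_dim S m.
Proof.
move=> Sl bS; apply: has_dim_bounded => // m b' Sb' b'I.
by apply: indep_le_span b'I => i; exact: bS.
Qed.

Lemma has_dim0 V (S : set V) : S 0 -> (forall v, S v -> v = 0) -> has_dim S 0.
Proof.
move=> S0 h; exists (fun=> 0); split=> // [c _ []//|v /h ->].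
by exists (fun=> 0); rewrite big_ord0 subrr.
Qed.

Lemma has_dim1 V (S : set V) v0 : lsub S -> S v0 -> v0 != 0 ->
  (forall v, S v -> exists c, v = c *: v0) -> has_dim S 1.
Proof.
move=> Sl Sv0 v00 h; exists (fun=> v0); split=> // [c|v /h[c ->]].
  rewrite big_ord1 => /eqP; rewrite scaler_eq0 (negPf v00) orbF => /eqP c0 i.
  by rewrite ord1.
by exists (fun=> c); rewrite big_ord1 subrr.
Qed.

Section Maps.
Variables (V W : lmodType K) (f : V -> W).
Hypothesis fl : forall c u v, f (c *: u + v) = c *: f u + f v.

Lemma lin0 : f 0 = 0.
Proof. by have := fl (-1) 0 0; rewrite scaler0 addr0 scaleN1r addNr. Qed.

Lemma lin_sum n (c : 'I_n -> K) (b : 'I_n -> V) :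
  f (\sum_i c i *: b i) = \sum_i c i *: f (b i).
Proof.
elim/big_rec2: _ => [|i x y _ <-]; first exact: lin0.
exact: fl.
Qed.

Lemma linB u v : f (u - v) = f u - f v.
Proof. by rewrite addrC -scaleN1r fl scaleN1r addrC. Qed.

Lemma has_dim_inj (S : set V) n : has_dim S n -> lsub S ->
  (forall u, S u -> f u = 0 -> u = 0) -> has_dim [set w | exists2 u, S u & w = f u] n.
Proof.
move=> [b [Sb bI bS]] Sl finj; exists (f \o b); split=> [i|c /= h|w [u Su ->]] /=.
- by exists (b i).
- by apply: bI; apply: finj; [exact: lsub_sum|rewrite lin_sum].
- have [c /subr0_eq uE] := bS _ Su; exists c.
  by rewrite uE lin_sum subrr.
Qed.

Lemma lsub_im (S : set V) : lsub S -> lsub [set w | exists2 u, S u & w = f u].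
Proof.
move=> [S0 Sl]; split=> [|c _ _ [u Su ->] [v Sv ->]] /=.
  by exists 0; rewrite ?lin0.
by exists (c *: u + v); [exact: Sl|rewrite fl].
Qed.

Lemma rank_nullity (S : set V) a b : lsub S ->
  has_dim [set u | S u /\ f u = 0] a ->
  has_dim [set w | exists2 u, S u & w = f u] b -> has_dim S (a + b).
Proof.
move=> Sl [k [Sk kI kS]] [w [Sw wI wS]].
have /choice[p hp] : forall i, exists u, S u /\ w i = f u.
  by move=> i; have [u] := Sw i; exists u.
have Sp i : S (p i) by have [] := hp i.
have fp i : f (p i) = w i by have [_ ->] := hp i.
pose g (i : 'I_(a + b)) := match fintype.split i with inl j => k j | inr j => p j end.
have gl c : \sum_i c i *: g i =
   \sum_j c (lshift b j) *: k j + \sum_j c (rshift a j) *: p j.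
  rewrite big_split_ord /=; congr (_ + _); apply: eq_bigr => j _; congr (_ *: _).
    by rewrite /g (unsplitK (inl j : 'I_a + 'I_b)).
  by rewrite /g (unsplitK (inr j : 'I_a + 'I_b)).
have fk c : f (\sum_j c j *: k j) = 0.
  by rewrite lin_sum big1// => j _; rewrite (Sk j).2 scaler0.
have fD u v : f (u + v) = f u + f v by have := fl 1 u v; rewrite !scale1r.
exists g; split=> [i|c|v Sv].
- by rewrite /g; case: fintype.split => j //; exact: (Sk j).1.
- rewrite gl => h.
  have c2 : forall j, c (rshift a j) = 0.
    apply: wI; under eq_bigr do rewrite -fp.
    by rewrite -lin_sum; have := congr1 f h; rewrite fD fk add0r lin0.
  have c1 : forall j, c (lshift b j) = 0.
    apply: kI; move: h; rewrite [X in _ + X]big1 ?addr0// => j _.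
    by rewrite c2 scale0r.
  by move=> i; rewrite -(splitK i); case: fintype.split => j /=.
- have [c2 /subr0_eq h2] := wS (f v) (ex_intro2 _ _ v Sv erefl).
  pose v' := v - \sum_j c2 j *: p j.
  have fv' : f v' = 0.
    by rewrite /v' linB lin_sum h2; under [X in _ - X]eq_bigr do rewrite fp; rewrite subrr.
  have Sv' : S v'.
    rewrite /v' addrC -scaleN1r; apply: Sl.2 => //; exact: lsub_sum.
  have [c1 /subr0_eq h1] := kS v' (conj Sv' fv').
  exists (fun i => match fintype.split i with inl j => c1 j | inr j => c2 j end).
  rewrite gl [X in v - (X + _)](_ : _ = v'); last first.
    by rewrite h1; apply: eq_bigr => j _; rewrite (unsplitK (inl j : 'I_a + 'I_b)).
  rewrite [X in v - (_ + X)](_ : _ = \sum_j c2 j *: p j); last first.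
    by apply: eq_bigr => j _; rewrite (unsplitK (inr j : 'I_a + 'I_b)).
  by rewrite /v' subrK subrr.
Qed.

Lemma has_dim_im (S : set V) n a : lsub S -> has_dim S n ->
  has_dim [set u | S u /\ f u = 0] a ->
  exists2 b, has_dim [set w | exists2 u, S u & w = f u] b & n = (a + b)%N.
Proof.
move=> Sl Sn ka; have [b [Sb bI bS]] := Sn.
have [|m _ hm] := @has_dim_span _ [set w | exists2 u, S u & w = f u] n (f \o b) (lsub_im Sl).
  move=> _ [u Su ->]; have [c /subr0_eq ->] := bS _ Su; exists c.
  by rewrite lin_sum.
by exists m => //; apply: has_dim_uniq Sn (rank_nullity Sl ka hm).
Qed.

End Maps.

End Dimension.

(** * Dimensions of spaces of q-expansions *)

Section ModularDimension.
Variable R : realType.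
Local Notation C := (complex R).
Implicit Types (z w q : C) (a b d e : nat -> C).

(* q-expansions of modular forms of even weight k *)
Definition qforms (k : nat) : set (nat -> C) := [set a | opd a /\ S_invariant k a].

Lemma lsub_qforms k : lsub (qforms k).
Proof.
split.
  have O0 : opd (0 : nat -> C) by apply: (@opd_bounded _ _ 0) => n; rewrite nm0.
  by split=> // z z0; rewrite !ev_coef0// mulr0.
move=> c a b [aO aS] [bO bS]; have cO := opdZ c aO.
have E q : nm q < 1 -> ev (c *: a + b) q = c * ev a q + ev b q.
  by move=> q1; rewrite -evZ// -evD.
split; first exact: opdD.
by move=> z z0; rewrite !E ?nm_qexp_lt1 ?Im_inv_gt0// aS// bS//; ring.
Qed.

Lemma qformsM k l a b : qforms k a -> qforms l b -> qforms (k + l) (cprod a b).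
Proof.
move=> [aO aS] [bO bS]; split; first exact: opdM.
move=> z z0; rewrite !evM ?nm_qexp_lt1 ?Im_inv_gt0// aS// bS// exprD; ring.
Qed.

(** [vanishing] with order m = 1 asks for 5 k < 51. *)
Lemma qforms_cusp0 k a : (k < 11)%N -> qforms k a -> a 0%N = 0 -> a = 0.
Proof.
move=> k11 [aO aS] a0; apply/funext => n; apply: (@vanishing _ _ k 1) => //; last by lia.
by case.
Qed.

Lemma cone_qforms : qforms 0 (@cone R).
Proof. by split; [exact: opd_cone|move=> z _; rewrite !ev_cone mulr1]. Qed.

Lemma cprod0 a b : cprod a b 0%N = a 0%N * b 0%N.
Proof. by rewrite /cprod big_ord1. Qed.

Lemma cprod1 a b : cprod a b 1%N = a 0%N * b 1%N + a 1%N * b 0%N.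
Proof. by rewrite /cprod !big_ord_recl big_ord0 addr0. Qed.

Lemma kappa_pow4 : exists2 r : R, 0 < r & (- Complex 0 (2 * pi) : C) ^+ 4 = r%:C%C.
Proof.
exists ((2 * pi) ^+ 4); first by rewrite exprn_gt0// mulr_gt0// pi_gt0.
by rewrite !exprS expr0 mulr1; apply/eqP; rewrite eq_complex /=; apply/andP; split; apply/eqP; ring.
Qed.

Lemma kappa_pow6 : exists2 r : R, 0 < r & (- Complex 0 (2 * pi) : C) ^+ 6 = (- r)%:C%C.
Proof.
exists ((2 * pi) ^+ 6); first by rewrite exprn_gt0// mulr_gt0// pi_gt0.
by rewrite !exprS expr0 mulr1; apply/eqP; rewrite eq_complex /=; apply/andP; split; apply/eqP; ring.
Qed.

Lemma discriminant : exists d e4 e6, [/\ qforms 12 d, qforms 4 e4, qforms 6 e6,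
   [/\ e4 0%N = 1, e6 0%N = 1, d 0%N = 0 & d 1%N = 1] &
   exists c : C, forall q, nm q < 1 -> ev d q = c * (ev e4 q ^+ 3 - ev e6 q ^+ 2)].
Proof.
have [e4 [r4 [e4O e4S e40 r40 e41]]] := @eisenstein R 3 isT isT.
have [e6 [r6 [e6O e6S e60 r60 e61]]] := @eisenstein R 5 isT isT.
have [s4 s40 k4] := kappa_pow4; have [s6 s60 k6] := kappa_pow6.
(* The coefficient of q in E_4^3 - E_6^2, classically 1728. The first coefficients of E_4 and E_6
   have opposite signs, so both contributions are positive. *)
pose x : C := (3 * (r4 * s4) + 2 * (r6 * s6))%:C%C.
have x0 : x != 0.
  rewrite -nm_gt0 nm_real normr_gt0 gt_eqF// addr_gt0// !mulr_gt0//.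
have e4f : qforms 4 e4 by [].
have e6f : qforms 6 e6 by [].
pose p := cprod e4 (cprod e4 e4); pose s := cprod e6 e6.
have pf : qforms 12 p by apply: (qformsM e4f); exact: (qformsM e4f e4f).
have sf : qforms 12 s by exact: (qformsM e6f e6f).
pose d : nat -> C := x^-1 *: (- 1 *: s + p).
have df : qforms 12 d.
  have h := (lsub_qforms 12).2 (-1) s p sf pf.
  have := (lsub_qforms 12).2 x^-1 _ 0 h (lsub_qforms 12).1.
  by rewrite addr0.
have dE n : d n = x^-1 * (- 1 * s n + p n) by [].
exists d, e4, e6; split=> //.
  split=> //.
    by rewrite dE /s /p !cprod0 e40 e60; ring.
  rewrite dE /s /p !cprod1 !cprod0 e40 e60 e41 e61 k4 k6.
  apply: (mulfI x0); rewrite mulVKf// mulr1 /x !rmorphD/= !rmorphM/= !rmorph_nat rmorphN.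
  by ring.
exists x^-1 => q q1.
have O1 : opd (fun n => - 1 * s n) by apply: opdZ; exact: sf.1.
have O2 : opd (fun n => - 1 * s n + p n) by apply: opdD => //; exact: pf.1.
transitivity (ev (fun n => x^-1 * (-1 * s n + p n)) q) => //.
rewrite (@evZ _ (fun n => -1 * s n + p n))// (@evD _ (fun n => -1 * s n) p)//; last exact: pf.1.
rewrite (@evZ _ s)//; last exact: sf.1.
rewrite /s /p !evM//; last exact: opdM.
by ring.
Qed.

Lemma qforms_exists k : ~~ odd k -> (4 <= k)%N -> exists2 a, qforms k a & a 0%N = 1.
Proof.
have [d [e4 [e6 [_ e4f e6f [e40 e60 _ _] _]]]] := discriminant.
elim/ltn_ind: k => k IHk ok k4.
have [k8|k8] := ltnP k 8.
  have : (k == 4)%N || (k == 6)%N.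
    by case: k k4 k8 ok {IHk} => [|[|[|[|[|[|[|[|]]]]]]]].
  by case/orP => /eqP ->; [exists e4 | exists e6].
have [|||a af a0] := IHk (k - 4)%N; try lia.
exists (cprod e4 a); last by rewrite cprod0 e40 a0 mulr1.
by have := qformsM e4f af; rewrite subnKC.
Qed.

(** For a form f of weight 2 with constant term c, f^2 = c^2 E_4 and f^3 = c^3 E_6, since their
    differences have no constant term in weights 4 and 6. Were c nonzero, then E_4^3 = E_6^2, so
    that Delta would vanish. *)
Lemma qforms2 a : qforms 2 a -> a = 0.
Proof.
move=> af; have [d [e4 [e6 [df e4f e6f [e40 e60 d0 d1] [c hc]]]]] := discriminant.
apply: (qforms_cusp0 _ af) => //; apply/eqP/negPn/negP => a0.
have h4 : cprod a a = a 0%N ^+ 2 *: e4.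
  apply/eqP; rewrite -subr_eq0; apply/eqP.
  have f : qforms 4 (cprod a a - a 0%N ^+ 2 *: e4).
    have := (lsub_qforms 4).2 (- a 0%N ^+ 2) e4 _ e4f (qformsM af af).
    by rewrite scaleNr addrC.
  apply: (qforms_cusp0 _ f) => //.
  rewrite -[LHS]/(cprod a a 0%N - a 0%N ^+ 2 * e4 0%N) cprod0 e40; ring.
have h6 : cprod a (cprod a a) = a 0%N ^+ 3 *: e6.
  apply/eqP; rewrite -subr_eq0; apply/eqP.
  have f : qforms 6 (cprod a (cprod a a) - a 0%N ^+ 3 *: e6).
    have := (lsub_qforms 6).2 (- a 0%N ^+ 3) e6 _ e6f (qformsM af (qformsM af af)).
    by rewrite scaleNr addrC.
  apply: (qforms_cusp0 _ f) => //.
  rewrite -[LHS]/(cprod a (cprod a a) 0%N - a 0%N ^+ 3 * e6 0%N) !cprod0 e60; ring.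
have iI : 0 < complex.Im ('i%C : C) by rewrite /= ltr01.
have q1 := nm_qexp_lt1 iI; set q := qexp _ in q1.
have := delta_neq0 df.1 e4f.1 df.2 e4f.2 d0 d1 e40 iI; rewrite -/q hc// => /negP; apply.
have E4 : ev a q ^+ 2 = a 0%N ^+ 2 * ev e4 q.
  by rewrite expr2 -evM ?h4; [exact: evZ e4f.1 q1|exact: af.1|exact: af.1|].
have E6 : ev a q ^+ 3 = a 0%N ^+ 3 * ev e6 q.
  have cO := opdM af.1 af.1.
  rewrite exprS expr2 -(evM af.1 af.1 q1) -(evM af.1 cO q1) h6.
  exact: evZ e6f.1 q1.
have : a 0%N ^+ 6 * (ev e4 q ^+ 3 - ev e6 q ^+ 2) = 0.
  have -> : a 0%N ^+ 6 * (ev e4 q ^+ 3 - ev e6 q ^+ 2) =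
     (a 0%N ^+ 2 * ev e4 q) ^+ 3 - (a 0%N ^+ 3 * ev e6 q) ^+ 2 by ring.
  by rewrite -E4 -E6; ring.
move=> /eqP; rewrite mulf_eq0 expf_eq0 (negPf a0) andbF /= => /eqP ->.
by rewrite mulr0.
Qed.

(** Both series are divided by q. Then Delta / q has no zero in the disc, by [delta_neq0] outside 0
    and by [d 1 = 1] at 0, and [opd_inverse] provides its reciprocal. *)
Lemma qforms_divide k d e4 a : qforms 12 d -> qforms 4 e4 -> d 0%N = 0 -> d 1%N = 1 ->
  e4 0%N = 1 -> qforms (k + 12) a -> a 0%N = 0 -> exists2 b, qforms k b & a = cprod d b.
Proof.
move=> df ef d0 d1 e0 af a0.
pose d' : nat -> C := fun n => d (n + 1)%N.
pose a' : nat -> C := fun n => a (n + 1)%N.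
have dO' : opd d' by apply: opd_shift; exact: df.1.
have aO' : opd a' by apply: opd_shift; exact: af.1.
have dE q : nm q < 1 -> ev d q = q * ev d' q.
  by move=> q1; rewrite (@ev_shift _ d 1)//; [exact: df.1|case].
have aE q : nm q < 1 -> ev a q = q * ev a' q.
  by move=> q1; rewrite (@ev_shift _ a 1)//; [exact: af.1|case].
have d'0 q : nm q < 1 -> ev d' q != 0.
  move=> q1; have [q0|q0] := eqVneq q 0.
    rewrite q0; apply/negP => /eqP; rewrite (@ev_eq _ d' 0 1); first exact/eqP/oner_neq0.
    apply: cv_near (cv_cst 1); exists 1%N => -[//|n] _.
    rewrite /partial big_ord_recl expr0 mulr1 /d' d1 big1 ?addr0// => i _.
    by rewrite expr0n mulr0.
  have [|z [z0 qE]] := @qexp_surj R q; first by rewrite nm_gt0 q0.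
  have := delta_neq0 df.1 ef.1 df.2 ef.2 d0 d1 e0 z0; rewrite qE dE//.
  by rewrite mulf_eq0 negb_or => /andP[].
have [g gO gE] := opd_inverse dO' d'0.
have gE' q : nm q < 1 -> ev d' q * ev g q = 1 by move=> q1; rewrite -evM// gE ev_cone.
have bO : opd (cprod a' g) by exact: opdM.
have E q : nm q < 1 -> ev a q = ev d q * ev (cprod a' g) q.
  move=> q1; rewrite evM// dE// aE//.
  have -> : q * ev d' q * (ev a' q * ev g q) = (q * ev a' q) * (ev d' q * ev g q) by ring.
  by rewrite gE'// mulr1.
exists (cprod a' g); last first.
  apply: opd_eq => [||q q1]; [exact: af.1|by apply: opdM => //; exact: df.1|].
  by rewrite evM ?E//; exact: df.1.
split=> // z z0; have z0' := Im_inv_gt0 z0.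
have q1 := nm_qexp_lt1 z0; have q1' := nm_qexp_lt1 z0'.
have dz := delta_neq0 df.1 ef.1 df.2 ef.2 d0 d1 e0 z0.
have z12 : z ^+ 12 * ev d (qexp z) != 0 by rewrite mulf_neq0// expf_neq0// Im_gt0_neq0.
apply: (mulfI z12); rewrite -[in LHS]df.2// -E// af.2// E// exprD; ring.
Qed.

Definition dim_modular k : nat :=
  if odd k then 0 else (k %/ 12 + (k %% 12 != 2))%N.

(** For k other than 2 the constant term maps onto C; its kernel is 0 for k < 12 and the image of
    weight k - 12 under multiplication by Delta otherwise. *)
Lemma has_dim_qforms k : ~~ odd k -> has_dim (qforms k) (dim_modular k).
Proof.
have [d [e4 [e6 [df e4f e6f [e40 e60 d0 d1] [c hc]]]]] := discriminant.
elim/ltn_ind: k => k IHk ok.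
have [k2|k2] := eqVneq k 2.
  by rewrite k2 /=; apply: has_dim0 => [|a]; [exact: (lsub_qforms 2).1|exact: qforms2].
have [a af a0] : exists2 a, qforms k a & a 0%N = 1.
  case: (posnP k) => [->|k0]; first by exists (@cone R); [exact: cone_qforms|].
  apply: qforms_exists => //; case: k ok k2 k0 {IHk} => [|[|[|[|]]]]//.
pose f (a : nat -> C) : C^o := a 0%N.
have fl c' u v : f (c' *: u + v) = c' *: f u + f v by [].
have im1 : has_dim [set w | exists2 u, qforms k u & w = f u] 1.
  apply: (@has_dim1 _ _ _ (1 : C^o)).
  - exact: lsub_im (lsub_qforms k).
  - by exists a.
  - exact: oner_neq0.
  - by move=> v _; exists v; rewrite -[RHS]/(v * 1) mulr1.
suff [m hm mE] : exists2 m, has_dim [set u | qforms k u /\ f u = 0] m & dim_modular k = (m + 1)%N.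
  by rewrite mE; exact: rank_nullity (lsub_qforms k) hm im1.
have [k11|k12] := ltnP k 12.
  exists 0%N.
    apply: has_dim0 => [|u [uf u0]]; first by split=> //; exact: (lsub_qforms k).1.
    by apply: (qforms_cusp0 _ uf) => //; case: k k11 ok {IHk k2 a af a0 im1 uf} => [|[|[|[|[|[|[|[|[|[|[|[|]]]]]]]]]]]].
  rewrite /dim_modular (negPf ok) divn_small// modn_small// k2//.
have kE : (k - 12 + 12 = k)%N by rewrite subnK.
have ok' : ~~ odd (k - 12) by rewrite oddB// (negPf ok).
exists (dim_modular (k - 12)); last first.
  rewrite /dim_modular (negPf ok) (negPf ok') -{1 2}kE modnDr divnDr// divnn/=; lia.
have hk := IHk (k - 12)%N (ltac:(lia)) ok'.
have gl c' u v : cprod d (c' *: u + v) = c' *: cprod d u + cprod d v.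
  apply/funext => n; rewrite -[RHS]/(c' * cprod d u n + cprod d v n) /cprod mulr_sumr -big_split/=.
  by apply: eq_bigr => i _; rewrite -[(c' *: u + v) _]/(c' * u (n - i)%N + v (n - i)%N); ring.
have := has_dim_inj gl hk (lsub_qforms _) _.
have dz z : 0 < complex.Im z -> ev d (qexp z) != 0.
  exact: (delta_neq0 df.1 e4f.1 df.2 e4f.2 d0 d1 e40).
have ginj u : qforms (k - 12) u -> cprod d u = 0 -> u = 0.
  move=> uf du0; have h01 : 0 < (1 / 2 : R) < 1 by apply/andP; split; lra.
  apply/funext => n; apply: (ev_coef_uniq uf.1 h01) => q q2.
  have q1 : nm q < 1 by rewrite q2; lra.
  have [|z [z0 qE]] := @qexp_surj R q; first by rewrite q2 h01.
  have := evM df.1 uf.1 q1; rewrite du0 ev_coef0// => /esym/eqP.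
  by rewrite mulf_eq0 -{1}qE (negPf (dz _ z0)) => /eqP.
move=> /(_ ginj); congr has_dim; apply/seteqP; split=> [_ [u uf ->]|v [vf v0]] /=.
  split; last by rewrite /f cprod0 d0 mul0r.
  by have := qformsM df uf; rewrite addnC kE.
have vf' : qforms (k - 12 + 12) v by rewrite kE.
by have [b bf ->] := qforms_divide df e4f d0 d1 e40 vf' v0; exists b.
Qed.

End ModularDimension.

(** * From q-expansions to modular forms on the upper half-plane *)

Section ModularForms.
Local Notation RR := Rdefinitions.R.
Local Notation C := Defs.C.
Implicit Types (z w q : C) (a b : nat -> C) (f : C -> C).

Lemma gt0_complex_real (e : C) : 0 < e -> exists2 x : RR, 0 < x & e = x%:C%C.
Proof.
move=> e0; have /complex_realP[x xE] : (e : complex RR) \is Num.real by rewrite gtr0_real.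
by exists x => //; move: e0; rewrite xE ltcR.
Qed.

Lemma cvg_cv (u : nat -> C) (l : C) : u @ \oo --> l <-> cv (u : nat -> complex RR) l.
Proof.
split.
  move=> /cvgrPdist_lt h e e0; have [|N _ hN] := h (e%:C%C); first by rewrite ltcR.
  exists N => n Nn; have := hN n Nn; rewrite /= distrC nmE ltcR; exact.
move=> h; apply/cvgrPdist_lt => _ /gt0_complex_real[x x0 ->].
have [N hN] := h x x0; exists N => // n Nn /=.
by rewrite distrC; have := hN n Nn; rewrite -ltcR -nmE.
Qed.

Definition qform_fun a : C -> C := fun z =>
  if 0 < complex.Im z then ev (a : nat -> complex RR) (qexp z) else 0.

Lemma det2 (A : comRingType) (g : 'M[A]_2) :
  \det g = g 0 0 * g 1 1 - g 0 1 * g 1 0.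
Proof.
rewrite (expand_det_row _ 0) !big_ord_recl big_ord0 /cofactor !det_mx11 !mxE /=.
rewrite expr0 expr1 mul1r addr0 mulN1r mulrN.
by congr (_ * g _ _ - g _ _ * g _ _); apply/val_inj.
Qed.

(** Every q with 0 < |q| < 1 is some [qexp z], so pointwise convergence of the Fourier series
    already makes its coefficients [opd]. *)
Lemma modular_form_qform k f a : modular_form_with k f a ->
  qforms k (a : nat -> complex RR) /\ f = qform_fun a.
Proof.
move=> [f0 _ fS fq].
have cva z : 0 < complex.Im z -> cv (partial (fun n => (a n : complex RR) * qexp z ^+ n)) (f z).
  by move=> /fq/cvg_cv.
have aO : opd (a : nat -> complex RR).
  apply: cv_opd => q q01; have [z [z0 <-]] := qexp_surj q01.
  by exists (f z); exact: cva.
have fE z : 0 < complex.Im z -> f z = ev (a : nat -> complex RR) (qexp z).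
  by move=> /cva/ev_eq.
split; last first.
  apply/funext => z; rewrite /qform_fun; case: ifPn => [/fE//|z0].
  by apply: f0; exact/negP.
split=> // z z0; rewrite -!fE//; last exact: Im_inv_gt0.
pose g : 'M[int]_2 := \matrix_(i, j) if i == 0 then (if j == 0 then 0 else -1)
   else (if j == 0 then 1 else 0).
have := fS g _ z z0; rewrite det2 !mxE /= => /(_ erefl).
by rewrite mulr0z mul0r add0r mulr1z mul1r addr0 mulrN1z mulN1r.
Qed.

Lemma modular_form_odd k f a : odd k -> modular_form_with k f a -> f = (0 : C -> C).
Proof.
move=> ok [f0 _ fS _]; apply/funext => z.
have [z0|/negP/f0//] := boolP (0 < complex.Im z).
pose g : 'M[int]_2 := \matrix_(i, j) if i == j then -1 else 0.
have := fS g _ z z0; rewrite det2 !mxE /= => /(_ erefl).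
rewrite !mulr0z mul0r !mulrN1z addr0 add0r mulN1r invrN invr1 mulrN1 opprK -signr_odd ok expr1 mulN1r.
by move=> /eqP; rewrite -addr_eq0 -mulr2n mulrn_eq0 => /orP[//|/eqP].
Qed.

Section Invariance.
Variables (k : nat) (a : nat -> complex RR).
Hypotheses (ek : ~~ odd k) (ak : qforms k a).

Let f : complex RR -> complex RR := fun z => ev a (qexp z).

(** The nonvanishing of the denominator and the positivity of the imaginary part are carried along,
    since composing transformations needs both. *)
Definition modular_at (p q r s : int) := forall z : complex RR, 0 < complex.Im z ->
  [/\ r%:~R * z + s%:~R != 0,
      0 < complex.Im ((p%:~R * z + q%:~R) / (r%:~R * z + s%:~R))
    & f ((p%:~R * z + q%:~R) / (r%:~R * z + s%:~R)) = (r%:~R * z + s%:~R) ^+ k * f z].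

Lemma modular_at_upper (p q s : int) : p * s = 1 -> modular_at p q 0 s.
Proof.
move=> ps z z0.
have T (n : int) w : f (w + n%:~R) = f w by rewrite /f qexpD qexp_int mulr1.
have [[-> ->]|[-> ->]] : p = 1 /\ s = 1 \/ p = -1 /\ s = -1.
  have := congr1 absz ps; rewrite abszM => /eqP; rewrite muln_eq1 => /andP[/eqP p1 /eqP s1].
  by lia.
  rewrite mulr0z mul0r add0r mulr1z oner_neq0 expr1n !mul1r divr1 T; split=> //.
  by rewrite raddfD /= Im_intr addr0.
rewrite mulr0z mul0r add0r mulrN1z oppr_eq0 oner_neq0 -signr_odd (negbTE ek) mul1r.
rewrite mulN1r invrN invr1 mulrN1 opprD opprK -mulrNz T; split=> //.
by rewrite raddfD /= Im_intr addr0.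
Qed.

Lemma modular_at_T (p q r s n : int) : modular_at p (q - p * n) r (s - r * n) ->
  modular_at p q r s.
Proof.
move=> h z z0; have := h (z + n%:~R).
have -> : f (z + n%:~R) = f z by rewrite /f qexpD qexp_int mulr1.
have E (x y : int) : x%:~R * (z + n%:~R) + (y - x * n)%:~R = x%:~R * z + y%:~R.
  by rewrite intrB intrM; ring.
by rewrite !E; apply; rewrite raddfD /= Im_intr addr0.
Qed.

Lemma modular_at_S (p q r s : int) : modular_at (- q) p (- s) r -> modular_at p q r s.
Proof.
move=> h z z0; have [n0 i0 fE] := h (- z^-1) (Im_inv_gt0 z0).
have zn := Im_gt0_neq0 z0.
have E (x y : int) : (- y)%:~R * (- z^-1) + x%:~R = (x%:~R * z + y%:~R) / z.
  by rewrite intrN; field.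
move: n0 i0 fE; rewrite !E mulf_eq0 invr_eq0 (negbTE zn) orbF => n0.
have cancel_z (x y : complex RR) : y != 0 -> (x / z) / (y / z) = x / y.
  by move=> y0; field; rewrite zn y0.
rewrite !(cancel_z _ _ n0).
have -> : f (- z^-1) = z ^+ k * f z by have [_ /(_ z z0)] := ak.
move=> i0 ->; split=> //.
by rewrite expr_div_n -mulrA mulKf// expf_neq0.
Qed.

(** Euclid's algorithm on the lower row: a translation reduces s modulo r, the inversion exchanges
    the two up to sign, and |r| decreases. *)
Lemma modular_at_SL2 (p q r s : int) : p * s - q * r = 1 -> modular_at p q r s.
Proof.
have [n] := ubnP `|r|%N; elim: n => // n IH in p q r s * => rn det.
have [r0|r0] := eqVneq r 0.
  by move: det; rewrite r0 mulr0 subr0; exact: modular_at_upper.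
apply: (@modular_at_T _ _ _ _ (s %/ r)%Z); apply: modular_at_S.
have sr := divz_eq s r; have m0 := modz_ge0 s r0; have m1 := ltz_mod s r0.
have sE : s - r * (s %/ r)%Z = (s %% r)%Z by rewrite {1}sr; ring.
apply: IH; last by rewrite -det; ring.
rewrite sE; lia.
Qed.

End Invariance.

Lemma dl_derivable f z l : dl (f : complex RR -> complex RR) z l ->
  derivable (f : C^o -> C^o) z 1.
Proof.
move=> /dl_ge0[M [r [M0 r0 _ H]]]; apply/cvg_ex; exists l.
apply/cvgrPdist_lt => _ /gt0_complex_real[e e0 ->].
have d0 : 0 < Num.min r (e / (M + 1)).
  by rewrite lt_min r0 divr_gt0//; lra.
near=> h.
have h0 : h != 0 by near: h; exact: nbhs_dnbhs_neq.
have : `|h| < (Num.min r (e / (M + 1)))%:C%C.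
  by near: h; apply: dnbhs0_lt; rewrite ltcR.
rewrite nmE ltcR lt_min => /andP[hr he] /=.
have {}H := H h hr.
have -> : l - h^-1 *: (f (h *: 1 + z) - f z) = - (h^-1 * (f (z + h) - f z - l * h)).
  rewrite [h *: 1]mulr1 [h + z]addrC [h^-1 *: _]/(h^-1 * _).
  by rewrite mulrBr (mulrC l) mulKf// opprB.
rewrite normrN nmE ltcR nmM nmV mulrC ltr_pdivrMr ?nm_gt0//.
apply: (le_lt_trans H); rewrite expr2 mulrA ltr_pM2r ?nm_gt0//.
move: he; rewrite ltr_pdivlMr; last by lra.
by have := nm_ge0 h; nra.
Unshelve. all: by end_near. Qed.

Lemma qform_modular k a : ~~ odd k -> qforms k (a : nat -> complex RR) ->
  modular_form_with k (qform_fun a) a.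
Proof.
move=> ek ak; have [aO aS] := ak.
have fE z : 0 < complex.Im z -> qform_fun a z = ev (a : nat -> complex RR) (qexp z).
  by rewrite /qform_fun => ->.
split.
- by move=> z /negP z0; rewrite /qform_fun (negbTE z0).
- move=> z z0.
  apply: dl_derivable; apply: dl_ext (dl_ev_qexp aO z0).
  exists (complex.Im z); split=> // h hz; rewrite fE//.
  exact: Im_gt0_near.
- move=> g; rewrite det2 => det z z0.
  have [n0 i0 E] := modular_at_SL2 ek ak det z0; rewrite [qform_fun a z]fE// -E.
  exact: fE.
- move=> z z0; rewrite fE//; apply/cvg_cv; apply: ev_cv => //; exact: nm_qexp_lt1.
Qed.

Lemma qform_fun_sum k n (b : 'I_n -> nat -> C) (c : 'I_n -> C) :
  (forall i, qforms k (b i : nat -> complex RR)) ->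
  qform_fun (\sum_i c i *: b i) = \sum_i c i *: qform_fun (b i).
Proof.
move=> bq; suff H : forall r : seq 'I_n,
    opd (\sum_(i <- r) c i *: b i : nat -> complex RR) /\
    qform_fun (\sum_(i <- r) c i *: b i) = \sum_(i <- r) c i *: qform_fun (b i) by have [] := H (index_enum 'I_n).
elim=> [|i r [IHo IH]].
  rewrite !big_nil; split; first by apply: (@opd_bounded _ _ 0) => n'; rewrite nm0.
  by apply/funext => z; rewrite /qform_fun; case: ifP => // _; exact: ev_coef0.
rewrite !big_cons; have bo : opd (fun m => c i * b i m : complex RR) by apply: opdZ; case: (bq i).
split; first exact: (opdD bo IHo).
apply/funext => z; rewrite -IH /qform_fun.
rewrite !fctE; case: ifP => z0; last by rewrite scaler0 addr0.
have zq := @nm_qexp_lt1 RR z z0.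
rewrite -[RHS]/(c i * ev (b i : nat -> complex RR) (qexp z) + ev _ (qexp z) : complex RR).
rewrite -(evZ _ _ zq); last by case: (bq i).
by rewrite -(evD bo IHo zq).
Qed.

Lemma qform_fun_eq0 a : opd (a : nat -> complex RR) -> qform_fun a = 0 -> a = 0.
Proof.
move=> aO a0; apply/funext => n.
apply: (@ev_coef_uniq _ (a : nat -> complex RR) (1 / 2)) => //; first by lra.
move=> q q12; have [|z [z0 <-]] := @qexp_surj _ q; first by rewrite q12; lra.
by have := congr1 (fun f : C -> C => f z) a0; rewrite /qform_fun z0.
Qed.

Lemma has_dim_modular_forms k : has_dim (modular_forms k) (dim_modular k).
Proof.
have [ok|ek] := boolP (odd k).
  rewrite /dim_modular ok; apply: has_dim0; last by move=> f [a]; exact: modular_form_odd.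
  exists 0; split=> [//|z _|g _ z _|z _]; first exact: derivable_cst.
    by rewrite -[LHS]/(0 : C) -[0 z]/(0 : C) mulr0.
  rewrite (_ : (fun N => _) = fun=> 0); first exact: cvg_cst.
  by apply/funext => N; rewrite big1// => i _; rewrite -[(0 : nat -> C) i]/(0 : C) mul0r.
have [b [bq bI bS]] := has_dim_qforms RR ek.
exists (fun i => qform_fun (b i)); split=> [i|c /=|f [a /modular_form_qform[aq ->]]].
- by exists (b i); exact: qform_modular.
- rewrite -(qform_fun_sum _ bq) => /qform_fun_eq0 h; apply: bI; apply: h.
  by have [] := lsub_sum c (lsub_qforms RR k) bq.
- have [c /subr0_eq aE] := bS _ aq; exists c => /=.
  by rewrite -(qform_fun_sum _ bq) -aE subrr.
Qed.

Lemma dimM_eq k : dimM k = dim_modular k.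
Proof. exact: dimension_eq (has_dim_modular_forms k). Qed.

End ModularForms.

(** * Symmetric powers of 2 x 2 matrices *)

Section SymmetricPower.
Variable A : comNzRingType.
Implicit Types (g h : 'M[A]_2) (p q : {poly A}).

(* Row i of rho n g lists the coefficients of
   (g00 X + g01 Y)^i (g10 X + g11 Y)^(n - i) at Y = 1. *)
Definition binary_row n g (i : nat) : {poly A} :=
  ((g 0 0)%:P * 'X + (g 0 1)%:P) ^+ i * ((g 1 0)%:P * 'X + (g 1 1)%:P) ^+ (n - i).

Definition rho n g : 'M[A]_n.+1 := \matrix_(i, j) (binary_row n g i)`_j.

(** The binary form of degree n dehomogenized to [p], evaluated at (x, y). *)
Definition hom_eval n p (x y : {poly A}) : {poly A} := \sum_(j < n.+1) (p`_j)%:P * (x ^+ j * y ^+ (n - j)).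

Lemma size_linM (a b : A) p n : (size p <= n)%N ->
  (size ((a%:P * 'X + b%:P) * p)%R <= n.+1)%N.
Proof.
move=> pn; apply/leq_sizeP => -[//|j] nj.
rewrite mulrDl -mulrA coefD !coefCM coefXM /= !nth_default ?mulr0 ?addr0//.
  exact: leq_trans pn (ltnW nj).
exact: leq_trans pn nj.
Qed.

Lemma size_binary_row n g i : (i <= n)%N -> (size (binary_row n g i) <= n.+1)%N.
Proof.
move=> in_; rewrite /binary_row -[in leqRHS](subnKC in_).
have H (a b : A) m q k : (size q <= k.+1)%N -> (size ((a%:P * 'X + b%:P) ^+ m * q)%R <= (m + k).+1)%N.
  move=> qk; elim: m => [|m IH]; first by rewrite expr0 mul1r.
  by rewrite exprS -mulrA addSn; exact: size_linM.
apply: (H); rewrite -[_ ^+ _]mulr1 -{2}[(n - i)%N]addn0.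
by apply: H; rewrite size_poly1.
Qed.

Lemma hom_eval_lin (a b : A) n p (x y : {poly A}) : (size p <= n.+1)%N ->
  hom_eval n.+1 ((a%:P * 'X + b%:P) * p) x y = (a%:P * x + b%:P * y) * hom_eval n p x y.
Proof.
move=> pn; rewrite /hom_eval [RHS]mulrDl.
under eq_bigr do rewrite mulrDl -mulrA coefD !coefCM coefXM polyCD [(_ + _) * _]mulrDl.
rewrite big_split/=; congr (_ + _).
  rewrite big_ord_recl /= mulr0 polyC0 mul0r add0r mulr_sumr; apply: eq_bigr => j _.
  rewrite /bump /= add1n /= polyCM exprS subSS; ring.
rewrite big_ord_recr /= nth_default// mulr0 polyC0 mul0r addr0 mulr_sumr.
apply: eq_bigr => j _; rewrite polyCM subSn ?exprS; last by rewrite -ltnS.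
ring.
Qed.

Lemma hom_eval_binary n g i (x y : {poly A}) : (i <= n)%N ->
  hom_eval n (binary_row n g i) x y =
  ((g 0 0)%:P * x + (g 0 1)%:P * y) ^+ i * ((g 1 0)%:P * x + (g 1 1)%:P * y) ^+ (n - i).
Proof.
move=> in_; rewrite /binary_row.
have H (a b : A) m q k : (size q <= k.+1)%N -> hom_eval (m + k) ((a%:P * 'X + b%:P) ^+ m * q) x y =
    (a%:P * x + b%:P * y) ^+ m * hom_eval k q x y /\
    (size ((a%:P * 'X + b%:P) ^+ m * q)%R <= (m + k).+1)%N.
  move=> qk; elim: m => [|m [IH IHs]]; first by rewrite !expr0 !mul1r.
  by rewrite addSn !exprS -!mulrA hom_eval_lin// IH; split=> //; exact: size_linM.
have [E1 s1] := H (g 1 0) (g 1 1) (n - i)%N 1 0%N ltac:(by rewrite size_poly1).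
rewrite addn0 in E1 s1; rewrite mulr1 in E1 s1.
rewrite -[in LHS](subnKC in_) addKn; have [-> _] := H (g 0 0) (g 0 1) i _ _ s1.
by rewrite E1 /hom_eval big_ord1 coef1 /= !mulr1.
Qed.

Lemma mulmx2 g h a b : (g *m h) a b = g a 0 * h 0 b + g a 1 * h 1 b.
Proof. by rewrite mxE !big_ord_recl big_ord0 addr0; congr (_ + g _ _ * h _ _); apply/val_inj. Qed.

(** Substituting the two linear forms of [h] into the form of row i for [g] gives the form of row i
    for the product. *)
Lemma rhoM n g h : rho n (g *m h) = rho n g *m rho n h.
Proof.
apply/matrixP => i j; rewrite [LHS]mxE [RHS]mxE.
have in_ : (i <= n)%N by rewrite -ltnS.
transitivity (hom_eval n (binary_row n g i) ((h 0 0)%:P * 'X + (h 0 1)%:P)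
  ((h 1 0)%:P * 'X + (h 1 1)%:P))`_j.
  rewrite hom_eval_binary// /binary_row !mulmx2.
  by congr ((_ ^+ _ * _ ^+ _ : {poly A})`_j); rewrite !polyCD !polyCM; ring.
rewrite /hom_eval coef_sum; apply: eq_bigr => l _; rewrite coefCM !mxE.
by [].
Qed.

Lemma rho1 n : rho n 1%:M = 1%:M.
Proof.
apply/matrixP => i j; rewrite !mxE /binary_row !mxE /= polyC1 polyC0 mul1r addr0 mul0r add0r.
by rewrite expr1n mulr1 coefXn eq_sym.
Qed.

Lemma rho_row_scale n (x : 'I_2 -> A) g h (i j : 'I_n.+1) :
  (forall a b, g a b = x a * h a b) ->
  rho n g i j = x 0 ^+ i * x 1 ^+ (n - i) * rho n h i j.
Proof.
move=> gE; rewrite !mxE /binary_row !gE.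
have E a : (x a * h a 0)%:P * 'X + (x a * h a 1)%:P = (x a)%:P * ((h a 0)%:P * 'X + (h a 1)%:P).
  by rewrite !polyCM mulrDr mulrA.
by rewrite !E !exprMn mulrACA -!polyC_exp -polyCM coefCM.
Qed.

Lemma rho_scale n (c : A) g : rho n (c *: g) = c ^+ n *: rho n g.
Proof.
apply/matrixP => i j; rewrite (@rho_row_scale _ (fun=> c) _ g); last by move=> a b; rewrite mxE.
by rewrite -exprD subnKC ?[RHS]mxE// -ltnS.
Qed.

Lemma rho_rank1 n (x y : 'I_2 -> A) (g : 'M[A]_2) (i j : 'I_n.+1) :
  (forall a b, g a b = x a * y b) ->
  rho n g i j = x 0 ^+ i * x 1 ^+ (n - i) * (y 0 ^+ j * y 1 ^+ (n - j) *+ 'C(n, j)).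
Proof.
move=> gE; rewrite (@rho_row_scale _ x _ (\matrix_(a, b) y b)); last by move=> a b; rewrite gE mxE.
congr (_ * _); rewrite mxE /binary_row !mxE -exprD subnKC; last by rewrite -ltnS.
rewrite addrC exprDn coef_sum (bigD1 j)//= big1 ?addr0.
  by rewrite coefMn exprMn -!polyC_exp mulrA -polyCM coefCM coefXn eqxx mulr1 [_ * _ ^+ j]mulrC.
move=> l lj; rewrite coefMn exprMn -!polyC_exp mulrA -polyCM coefCM coefXn.
by rewrite [j == l :> nat]eq_sym [l == j :> nat](negbTE lj) mulr0 mul0rn.
Qed.

(** With these weights the entries are the coefficients of the n-th power of the bilinear form of
    [g]; transposing [g] exchanges its two sets of variables. *)
Lemma rho_tr n g (i j : 'I_n.+1) : rho n g i j *+ 'C(n, i) = rho n g^T j i *+ 'C(n, j).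
Proof.
pose L h : {poly {poly A}} := 'X * ((h 0 0)%:P * 'X + (h 0 1)%:P)%:P + ((h 1 0)%:P * 'X + (h 1 1)%:P)%:P.
have H h (k l : 'I_n.+1) : rho n h k l *+ 'C(n, k) = (L h ^+ n)`_k`_l.
  rewrite /L addrC exprDn coef_sum (bigD1 k)//= big1 ?addr0.
    by rewrite coefMn exprMn mulrCA -!polyC_exp -polyCM coefMC coefXn eqxx mul1r coefMn mxE mulrC.
  move=> m mk; rewrite coefMn exprMn mulrCA -!polyC_exp -polyCM coefMC coefXn.
  by rewrite [k == m :> nat]eq_sym [m == k :> nat](negbTE mk) mul0r mul0rn.
rewrite !H -coef_swapXY rmorphXn /=; congr ((_ ^+ _ : {poly {poly A}})`_j`_i).
have LE h : L h = (h 0 0)%:P%:P * ('X * 'Y) + (h 0 1)%:P%:P * 'X + ((h 1 0)%:P%:P * 'Y + (h 1 1)%:P%:P).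
  by rewrite /L !polyCD !polyCM; ring.
have swapC (c : A) : swapXY c%:P%:P = c%:P%:P by rewrite swapXY_polyC map_polyC.
rewrite !LE !mxE !(rmorphD, rmorphM) /= !swapC swapXY_X swapXY_Y; ring.
Qed.

End SymmetricPower.

Lemma map_rho (A B : comNzRingType) (f : {rmorphism A -> B}) n (g : 'M[A]_2) :
  map_mx f (rho n g) = rho n (map_mx f g).
Proof.
apply/matrixP => i j; rewrite !mxE -coef_map /binary_row.
by rewrite rmorphM !rmorphXn /= !rmorphD !rmorphM /= !map_polyX !map_polyC !mxE.
Qed.

(** * Dimensions from dual bases; symmetric matrices, products, idempotents *)

Lemma has_dim_coord (K : fieldType) (V : lmodType K) (S : set V) (I : finType) (J : {pred I})
    (b : I -> V) (f : I -> V -> K) :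
  (forall i, i \in J -> S (b i)) ->
  (forall i c u v, f i (c *: u + v) = c * f i u + f i v) ->
  (forall i j, i \in J -> j \in J -> f i (b j) = (i == j)%:R) ->
  (forall v, S v -> v = \sum_(i in J) f i v *: b i) -> has_dim S #|J|.
Proof.
move=> Sb fl fb Sf; exists (fun i => b (enum_val i)); split=> [i|c /= h i|v Sv].
- by apply: Sb; exact: enum_valP.
- have := congr1 (f (enum_val i)) h.
  rewrite (@lin_sum K V (GRing.regular K) _ (fl (enum_val i))) (bigD1 i)//= big1 ?addr0 => [|j ji].
    rewrite fb ?enum_valP// eqxx (@lin0 K V (GRing.regular K) _ (fl (enum_val i))).
    by rewrite -[_ *: _]/(c i * 1) mulr1.
  rewrite fb ?enum_valP// (inj_eq enum_val_inj) eq_sym (negbTE ji).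
  by rewrite -[_ *: _]/(c j * 0) mulr0.
- by exists (fun i => f (enum_val i) v) => /=; rewrite [X in X - _](Sf v Sv) big_enum_val subrr.
Qed.

Lemma card_ord_le p : #|[pred x : 'I_p * 'I_p | (x.1 <= x.2)%N]| = 'C(p.+1, 2).
Proof.
rewrite -sum1_card -(pair_big_dep xpredT (fun i j : 'I_p => (i <= j)%N) (fun _ _ => 1%N))/=.
rewrite (exchange_big_dep xpredT)//=.
transitivity (\sum_(j < p) j.+1)%N.
  apply: eq_bigr => j _; rewrite -[RHS]card_ord -sum1_card.
  by rewrite (big_ord_widen p (fun=> 1%N) (ltn_ord j)); apply: eq_bigl => i; rewrite ltnS.
by rewrite -bin2_sum big_nat_recl// add0n big_mkord.
Qed.

Lemma has_dim_symmetric (K : fieldType) p : has_dim [set M : 'M[K]_p | M^T = M] 'C(p.+1, 2).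
Proof.
rewrite -card_ord_le.
apply: (@has_dim_coord _ _ _ _ _ (fun x : 'I_p * 'I_p => \matrix_(i, j) ((i, j) \in [:: x; (x.2, x.1)])%:R)
   (fun x M => M x.1 x.2)).
- by move=> x _ /=; apply/matrixP => i j; rewrite !mxE !inE !xpair_eqE orbC [in LHS]andbC [X in _ || X]andbC.
- by move=> x c u v; rewrite !mxE.
- move=> [i j] [k l]; rewrite !inE mxE !inE /= !xpair_eqE => ij kl; congr (_%:R : K); congr nat_of_bool.
  apply/orP/idP => [[//|/andP[/eqP il /eqP jk]]|->]; last by left.
  by move: ij kl; rewrite il jk => lk kl; rewrite (_ : l = k) ?eqxx//; apply/val_inj/eqP; rewrite eqn_leq lk.
- move=> M Ms; apply/matrixP => i j; rewrite summxE.
  have Mij x y : M x y = M y x by rewrite -[in LHS]Ms mxE.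
  wlog ij : i j / (i <= j)%N => [H|].
    have [/H//|/ltnW/H E] := leqP i j; rewrite Mij E; apply: eq_bigr => -[k l] _.
    by rewrite !mxE; congr (_ * (_)%:R); rewrite !inE !xpair_eqE /= orbC [in LHS]andbC [X in _ || X]andbC.
  rewrite (bigD1 (i, j))//= !mxE !inE eqxx mulr1 big1 ?addr0// => -[k l]; rewrite !inE /= => /andP[kl].
  rewrite !mxE !inE !xpair_eqE /= [i == k]eq_sym [j == l]eq_sym => klij; rewrite (negbTE klij) /=.
  have [/andP[/eqP il /eqP jk]|_] := boolP ((i == l) && (j == k)); last by rewrite mulr0.
  case/negP: klij; have E : i = j by apply/val_inj/eqP; rewrite eqn_leq ij il jk kl.
  by rewrite -il -jk E !eqxx.
Qed.

Lemma lsub_prod (K : fieldType) (V W : lmodType K) (S : set V) (T : set W) :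
  lsub S -> lsub T -> lsub [set x : V * W | S x.1 /\ T x.2].
Proof.
move=> [S0 Sl] [T0 Tl].
by split=> // c u v [? ?] [? ?] /=; split; [exact: Sl|exact: Tl].
Qed.

Lemma has_dim_prod (K : fieldType) (V W : lmodType K) (S : set V) (T : set W) a b :
  lsub S -> lsub T -> has_dim S a -> has_dim T b ->
  has_dim [set x : V * W | S x.1 /\ T x.2] (a + b).
Proof.
move=> Sl Tl Sa Tb; have [S0 _] := Sl; have [T0 _] := Tl; rewrite addnC.
apply: (@rank_nullity _ _ _ (fun x : V * W => x.1)) => //; first exact: lsub_prod.
- rewrite (_ : mkset _ = [set x | exists2 w, T w & x = (0, w)]); last first.
    by apply/seteqP; split=> -[x y] /=; [move=> [[_ Ty] ->]; exists y|move=> [w Tw [-> ->]]].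
  apply: (@has_dim_inj _ _ _ (fun w : W => (0, w) : V * W)) => //.
  + by move=> c u v; rewrite -[RHS]/(c *: 0 + 0, c *: u + v) scaler0 addr0.
  + by move=> u _ [].
- rewrite (_ : mkset _ = S)//; apply/seteqP; split=> x /=; first by move=> [[u w] [Su _] ->].
  by move=> Sx; exists (x, 0).
Qed.

(** In a rank factorization A = C R, idempotence forces R C = 1, and the trace is cyclic. *)
Lemma rank_idem (F : fieldType) m (A : 'M[F]_m) : A *m A = A -> (\rank A)%:R = \tr A.
Proof.
move=> AA; rewrite -[in RHS](mulmx_base A) mxtrace_mulC.
suff -> : row_base A *m col_base A = 1%:M by rewrite mxtrace1.
apply: (row_free_inj (row_base_free A)); apply: (row_full_inj (col_base_full A)).
rewrite mul1mx mulmx_base -(mulmxA (row_base A)) mulmx_base mulmxA mulmx_base; exact: AA.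
Qed.

(** * The dimension of a space of period polynomials as a trace *)

Section Idempotent.
Variable F : fieldType.
Variables (n : nat) (S U P : 'M[F]_n.+1) (s : F).
Hypotheses (n2 : 2 != 0 :> F) (n3 : 3 != 0 :> F) (SS : S * S = 1) (PP : P * P = 1) (UUU : U * U * U = 1)
  (SP : S * P = P * S) (PUP : P * U * P = U * U) (ss : s * s = 1)
  (no_inv : forall k (Y : 'M[F]_(n.+1, k)), S *m Y = Y -> U *m Y = Y -> Y = 0).

(** For the images of the usual generators in a symmetric power: the period polynomials, as row
    vectors, on which the reflection [P] acts by the sign [s]. *)
Definition period_space : 'M[F]_n.+1 :=
  (kermx (1 + S) :&: (kermx (1 + U + U * U) :&: kermx (P - s%:M)))%MS.

(** The idempotents A, B and E project onto the subspaces S = -1, P = s, then 1 + U + U^2 = 0, P =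
    s, then P = s. The space sought is the intersection of the first two, and their sum is the
    third, so its rank is tr A + tr B - tr E. *)
Lemma rank_period_space :
  (\rank period_space)%:R = ((n.+1)%:R - \tr S + s * \tr P - s * \tr (S * P)) / 4
     - ((n.+1)%:R + 2 * \tr U + 3 * s * \tr P) / 6.
Proof.
pose Q : 'M[F]_n.+1 := 1 + s *: P; pose D : 'M[F]_n.+1 := 1 - S.
pose Z : 'M[F]_n.+1 := 1 + U + U * U; pose Y : 'M[F]_n.+1 := 3%:R *: 1 - Z.
have UUP : U * U * P = P * U by rewrite -PUP -mulrA PP mulr1.
have PUU : P * (U * U) = U * P by rewrite -PUP !mulrA PP mul1r.
have UZ : U * Z = Z by rewrite /Z !mulrDr mulr1 mulrA UUU addrC addrA.
have ZU : Z * U = Z by rewrite /Z !mulrDl mul1r UUU addrC addrA.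
have ZZ : Z * Z = 3%:R *: Z.
  by rewrite {1}/Z !mulrDl mul1r -mulrA !UZ scaler_nat -addrA -mulr2n -mulrS.
have ZP : Z * P = P * Z.
  rewrite /Z !mulrDl !mulrDr mul1r mulr1 UUP PUU -!addrA; congr (_ + _); exact: addrC.
have ZQ : Z * Q = Q * Z by rewrite /Q [Z * _]mulrDr [_ * Z]mulrDl mulr1 mul1r -scalerAr -scalerAl ZP.
have DQ : D * Q = Q * D.
  by rewrite /D /Q mulrBl mulrBr !mulr1 !mul1r !mulrDr !mulrDl !mul1r !mulr1 -!scalerAr -!scalerAl SP.
have DD : D * D = 2%:R *: D.
  rewrite {1}/D mulrBl mul1r [S * D]mulrBr mulr1 SS -/D scaler_nat mulr2n; congr (_ + _).
  exact: opprB.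
have QQ : Q * Q = 2%:R *: Q.
  by rewrite /Q mulrDl mulrDr !mulr1 mul1r -scalerAl mulrDr mulr1 -scalerAr PP scalerDr scalerA ss scale1r
   [s *: P + 1]addrC -mulr2n scaler_nat.
have YQ : Y * Q = Q * Y by rewrite /Y mulrBl mulrBr ZQ -scalerAl -scalerAr mul1r mulr1.
have YZ : Y * Z = 0 by rewrite /Y mulrBl -scalerAl mul1r ZZ subrr.
have YY : Y * Y = 3%:R *: Y by rewrite {2}/Y mulrBr YZ subr0 -scalerAr mulr1.
pose A : 'M[F]_n.+1 := 4^-1 *: (D * Q); pose B : 'M[F]_n.+1 := 6^-1 *: (Y * Q).
pose E : 'M[F]_n.+1 := 2^-1 *: Q.
have n4 : (4 != 0 :> F) by rewrite (natrM _ 2 2) mulf_neq0.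
have n6 : (6 != 0 :> F) by rewrite (natrM _ 2 3) mulf_neq0.
have AA : A * A = A.
  rewrite /A -scalerAl -scalerAr {1}DQ mulrA -[Q * D * D]mulrA DD -scalerAr -scalerAl -DQ -mulrA QQ.
  by rewrite -scalerAr !scalerA; congr (_ *: _); field; rewrite ?n2 ?n3 ?n4 ?n6.
have BB : B * B = B.
  rewrite /B -scalerAl -scalerAr {1}YQ mulrA -[Q * Y * Y]mulrA YY -scalerAr -scalerAl -YQ -mulrA QQ.
  by rewrite -scalerAr !scalerA; congr (_ *: _); field; rewrite ?n2 ?n3 ?n4 ?n6.
have EE : E * E = E.
  by rewrite /E -scalerAl -scalerAr QQ !scalerA; congr (_ *: _); field; rewrite ?n2 ?n3 ?n4 ?n6.
have QP : Q * (P - s%:M) = 0.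
  rewrite /Q -scalemx1 -[1%:M]/(1 : 'M[F]_n.+1) mulrDl mul1r -scalerAl !mulrBr PP -scalerAr mulr1 scalerBr scalerA ss scale1r.
  by rewrite addrC subrKA subrr.
have DS : D * (1 + S) = 0 by rewrite /D mulrBl mul1r mulrDr mulr1 SS [S + 1]addrC subrr.
have rW : \rank period_space = \rank (A :&: B)%MS.
  apply: eqmx_rank; apply/andP; split.
    have : (period_space <= period_space)%MS by [].
    rewrite {2}/period_space !sub_capmx => /and3P[/sub_kermxP WS /sub_kermxP WZ /sub_kermxP WP].
    have WD : period_space * D = 2%:R *: period_space.
      move: WS; rewrite -[_ *m _]/(_ * _) mulrDr mulr1 => /eqP; rewrite addrC addr_eq0 => /eqP WS.
      by rewrite /D mulrBr mulr1 WS opprK scaler_nat.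
    have WQ : period_space * Q = 2%:R *: period_space.
      move: WP; rewrite -[_ *m _]/(_ * _) mulrBr => /eqP; rewrite subr_eq0 => /eqP WP.
      rewrite /Q mulrDr mulr1 -scalerAr WP -scalemx1 -[1%:M]/(1 : 'M[F]_n.+1) -scalerAr mulr1 scalerA ss scale1r.
      by rewrite scaler_nat.
    have WY : period_space * Y = 3%:R *: period_space.
      by rewrite /Y mulrBr -scalerAr mulr1 [_ * Z]WZ subr0.
    apply/andP; split; apply/submxP; exists period_space; rewrite -[_ *m _]/(_ * _).
      by rewrite /A -scalerAr mulrA WD -scalerAl WQ !scalerA -[LHS]scale1r; congr (_ *: _); field; rewrite ?n2 ?n3 ?n4 ?n6.
    by rewrite /B -scalerAr mulrA WY -scalerAl WQ !scalerA -[LHS]scale1r; congr (_ *: _); field; rewrite ?n2 ?n3 ?n4 ?n6.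
  set X := (A :&: B)%MS.
  have XA : X *m A = X.
    by have /submxP[c ->] : (X <= A)%MS := capmxSl _ _; rewrite -mulmxA [A *m A]AA.
  have XB : X *m B = X.
    by have /submxP[c ->] : (X <= B)%MS := capmxSr _ _; rewrite -mulmxA [B *m B]BB.
  rewrite /period_space !sub_capmx; apply/and3P; split; apply/sub_kermxP.
  - rewrite -XA -mulmxA (_ : A *m (1 + S) = 0) ?mulmx0//.
    by rewrite -[_ *m _]/(_ * _) /A DQ -scalerAl -mulrA DS mulr0 scaler0.
  - rewrite -XB -mulmxA (_ : B *m _ = 0) ?mulmx0//.
    by rewrite -[_ *m _]/(_ * _) /B -/Z YQ -scalerAl -mulrA YZ mulr0 scaler0.
  - rewrite -XA -mulmxA (_ : A *m _ = 0) ?mulmx0//.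
    by rewrite -[_ *m _]/(_ * _) /A -scalerAl -mulrA QP mulr0 scaler0.
(* Columns killed by both A and B become, after multiplication by E, fixed by S and by U, hence
   vanish by [no_inv]. *)
have sumE : \rank (A + B)%MS = \rank E.
  apply: eqmx_rank; apply/andP; split.
    rewrite addsmx_sub; apply/andP; split; apply/submxP.
      by exists (2^-1 *: D); rewrite -[_ *m _]/(_ * _) /A /E -scalerAl -scalerAr scalerA; congr (_ *: _); field; rewrite ?n2 ?n3 ?n4 ?n6.
    by exists (3^-1 *: Y); rewrite -[_ *m _]/(_ * _) /B /E -scalerAl -scalerAr scalerA; congr (_ *: _); field; rewrite ?n2 ?n3 ?n4 ?n6.
  rewrite submxE; apply/eqP; set K := cokermx _.
  have [AK BK] : A *m K = 0 /\ B *m K = 0.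
    by have := mulmx_coker (A + B)%MS; split; apply/eqP; rewrite -submxE ?addsmxSl ?addsmxSr.
  have DE : D *m (E *m K) = 0.
    rewrite mulmxA (_ : D *m E = 2%:R *: A); first by rewrite -scalemxAl AK scaler0.
    by rewrite -[_ *m _]/(_ * _) /A /E -scalerAr scalerA; congr (_ *: _); field; rewrite ?n2 ?n3 ?n4 ?n6.
  have YE : Y *m (E *m K) = 0.
    rewrite mulmxA (_ : Y *m E = 3%:R *: B); first by rewrite -scalemxAl BK scaler0.
    by rewrite -[_ *m _]/(_ * _) /B /E -scalerAr scalerA; congr (_ *: _); field; rewrite ?n2 ?n3 ?n4 ?n6.
  have ZE : Z *m (E *m K) = 3%:R *: (E *m K).
    move: YE; rewrite -[_ *m _]/(_ * _) /Y mulrBl -scalerAl mul1r => /eqP.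
    by rewrite subr_eq0 => /eqP H; exact: (esym H).
  apply: no_inv.
    by move: DE; rewrite -[_ *m _]/(_ * _) /D mulrBl mul1r => /eqP; rewrite subr_eq0 => /eqP H; exact: (esym H).
  apply: (@scalerI _ _ (3%:R : F)) => //.
  by rewrite -[RHS]ZE -UZ -[U * Z]/(U *m Z) -[in RHS]mulmxA ZE -scalemxAr.
have := mxrank_sum_cap A B; rewrite -rW sumE => /(congr1 (fun n => n%:R : F)).
rewrite !natrD (rank_idem AA) (rank_idem BB) (rank_idem EE) => H.
have tr1 : \tr (1 : 'M[F]_n.+1) = (n.+1)%:R by exact: mxtrace1.
have trC (X X' : 'M[F]_n.+1) : \tr (X * X') = \tr (X' * X) := mxtrace_mulC X X'.
have trZ : \tr Z = (n.+1)%:R + 2 * \tr U.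
  by rewrite /Z !mxtraceD tr1 -PUP -mulrA trC -mulrA PP mulr1; ring.
have trPU : \tr (P * U) = \tr P.
  have {2}-> : P = U * (P * U) by rewrite -UUP mulrA [U * _]mulrA UUU mul1r.
  by rewrite [RHS]trC -mulrA PUU trC.
have trZP : \tr (Z * P) = 3 * \tr P.
  rewrite /Z !mulrDl mul1r !mxtraceD UUP (trC U P) trPU; ring.
have trQ : \tr Q = (n.+1)%:R + s * \tr P.
  by rewrite /Q mxtraceD mxtraceZ tr1.
have trXQ (X : 'M[F]_n.+1) : \tr (X * Q) = \tr X + s * \tr (X * P).
  by rewrite /Q mulrDr mulr1 mxtraceD -scalerAr mxtraceZ.
have trA : \tr A = ((n.+1)%:R - \tr S + s * \tr P - s * \tr (S * P)) / 4.
  rewrite /A mxtraceZ trXQ /D mulrBl mul1r !raddfB /= tr1.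
  by field; rewrite ?n2 ?n3 ?n4 ?n6.
have trB : \tr B = \tr E - ((n.+1)%:R + 2 * \tr U + 3 * s * \tr P) / 6.
  rewrite /B /E !mxtraceZ trXQ /Y mulrBl -scalerAl mul1r !raddfB /= !mxtraceZ trQ tr1 trZ trZP.
  by field; rewrite ?n2 ?n3 ?n4 ?n6.
by move: H; rewrite trA trB => H; apply: (addrI (\tr E)); rewrite H; ring.
Qed.

End Idempotent.

(** * Symmetric matrices with rows in the period spaces *)

Section SymmetricPeriods.
Variables (F : fieldType) (n : nat) (S U P : 'M[F]_n.+1).
Hypotheses (n2 : 2 != 0 :> F) (PP : P * P = 1) (SP : S * P = P * S) (PUP : P * U * P = U * U).

Definition symmetric_periods : set 'M[F]_n.+1 :=
  [set M | [/\ M^T = M, M *m S = - M, M *m (1 + U + U * U) = 0 & P^T *m M *m P = M]].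

Lemma sub_period_space k s (X : 'M[F]_(k, n.+1)) :
  (X <= period_space S U P s)%MS = [&& X *m S == - X, X *m (1 + U + U * U) == 0 & X *m P == s *: X].
Proof.
rewrite /period_space !sub_capmx; congr [&& _, _ & _]; apply/sub_kermxP/eqP => //.
- by rewrite mulmxDr mulmx1 => /eqP; rewrite addrC addr_eq0 => /eqP.
- by move=> H; rewrite mulmxDr mulmx1 H subrr.
- by rewrite mulmxBr mul_mx_scalar => /eqP; rewrite subr_eq0 => /eqP.
- by move=> H; rewrite mulmxBr mul_mx_scalar H subrr.
Qed.

Lemma symmetric_row_space k (B : 'M[F]_(k, n.+1)) (M : 'M[F]_n.+1) :
  M^T = M -> (M <= B)%MS -> exists2 X : 'M[F]_k, X^T = X & M = B^T *m X *m B.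
Proof.
move=> Ms MB; have := mulmxKpV MB; move: (pinvmx B) => Q E.
exists (Q^T *m M *m Q); first by rewrite !trmx_mul trmxK Ms !mulmxA.
rewrite !mulmxA -trmx_mul.
have -> : (Q *m B)^T *m M = M by rewrite -[in LHS]Ms -trmx_mul mulmxA E.
by rewrite -mulmxA mulmxA E.
Qed.

(** Invariance under P on both sides removes the blocks mixing the two eigenspaces of P. What
    remains is one symmetric matrix for each sign, in coordinates with respect to [B1] and [B2]. *)
Lemma has_dim_symmetric_periods_base p1 p2 (B1 : 'M[F]_(p1, n.+1)) (B2 : 'M[F]_(p2, n.+1)) :
  row_free B1 -> row_free B2 -> (B1 :=: period_space S U P 1)%MS ->
  (B2 :=: period_space S U P (-1))%MS ->
  has_dim symmetric_periods ('C(p1.+1, 2) + 'C(p2.+1, 2)).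
Proof.
move=> /row_freeP[Q1 Q1E] /row_freeP[Q2 Q2E] B1E B2E.
have UP : (1 + U + U * U) * P = P * (1 + U + U * U).
  rewrite !mulrDl !mulrDr mul1r mulr1 -PUP !mulrA PP mul1r -!mulrA PP mulr1.
  by rewrite -!addrA; congr (_ + _); rewrite addrC.
have [B1S B1U B1P] : [/\ B1 *m S = - B1, B1 *m (1 + U + U * U) = 0 & B1 *m P = B1].
  have : (B1 <= period_space S U P 1)%MS by rewrite B1E.
  by rewrite sub_period_space scale1r => /and3P[/eqP ? /eqP ? /eqP ?].
have [B2S B2U B2P] : [/\ B2 *m S = - B2, B2 *m (1 + U + U * U) = 0 & B2 *m P = - B2].
  have : (B2 <= period_space S U P (-1))%MS by rewrite B2E.
  by rewrite sub_period_space scaleN1r => /and3P[/eqP ? /eqP ? /eqP ?].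
pose f (x : 'M[F]_p1 * 'M[F]_p2) : 'M[F]_n.+1 := B1^T *m x.1 *m B1 + B2^T *m x.2 *m B2.
have fl c u v : f (c *: u + v) = c *: f u + f v.
  by rewrite /f /= !mulmxDr !mulmxDl -!scalemxAr -!scalemxAl scalerDr addrACA.
have lsym m : lsub [set M : 'M[F]_m | M^T = M].
  by split=> [|c u v] /=; rewrite ?trmx0// => us vs; rewrite linearP /= us vs.
have fP x : f x *m P = B1^T *m x.1 *m B1 - B2^T *m x.2 *m B2.
  by rewrite /f mulmxDl -!(mulmxA _ _ P) B1P B2P mulmxN.
have fs x : x.1^T = x.1 -> x.2^T = x.2 -> (f x)^T = f x.
  by move=> x1 x2; rewrite /f linearD /= !trmx_mul !trmxK x1 x2 !mulmxA.
have -> : symmetric_periods = [set w | exists2 u, u.1^T = u.1 /\ u.2^T = u.2 & w = f u].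
  apply/seteqP; split=> [M [Ms MS MU MP]|_ [[X Y] [/= Xs Ys] ->]].
    have PM : P^T *m M = M *m P.
      by rewrite -[in RHS]MP -mulmxA [P *m P]PP mulmx1.
    have MPs : (M *m P)^T = M *m P by rewrite trmx_mul Ms.
    have MPS : M *m P *m S = - (M *m P) by rewrite -mulmxA -[P *m S]SP mulmxA MS mulNmx.
    have MPU : M *m P *m (1 + U + U * U) = 0 by rewrite -mulmxA -[P *m _]UP mulmxA MU mul0mx.
    have MPP : M *m P *m P = M by rewrite -mulmxA [P *m P]PP mulmx1.
    have [||X Xs XE] := @symmetric_row_space _ B1 (2^-1 *: (M + M *m P)).
    - by rewrite linearZ linearD /= MPs Ms.
    - rewrite B1E sub_period_space scale1r -!scalemxAl !mulmxDl MS MPS MU MPU MPP -opprD scalerN.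
      by rewrite addr0 scaler0 !eqxx /= [M + _]addrC.
    have [||Y Ys YE] := @symmetric_row_space _ B2 (2^-1 *: (M - M *m P)).
    - by rewrite linearZ linearB /= MPs Ms.
    - rewrite B2E sub_period_space scaleN1r -!scalemxAl !mulmxBl MS MPS MU MPU MPP -scalerN opprB.
      by rewrite subr0 scaler0 !eqxx /= opprK addrC !eqxx.
    exists (X, Y) => //; rewrite /f /= -XE -YE -scalerDr addrACA subrr addr0 -mulr2n -scaler_nat.
    by rewrite scalerA mulVf ?scale1r.
  split=> /=.
  - exact: fs.
  - by rewrite /f mulmxDl -!(mulmxA _ _ S) B1S B2S !mulmxN -opprD.
  - by rewrite /f mulmxDl -!(mulmxA _ _ (1 + _ + _)) B1U B2U !mulmx0 addr0.
  - rewrite -[f _ in LHS]fs// -trmx_mul fP linearB /= !trmx_mul !trmxK Xs Ys mulmxBl.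
    by rewrite -!mulmxA B1P B2P !mulmxN opprK !mulmxA.
apply: has_dim_inj => //.
- exact: (@has_dim_prod _ _ _ [set M : 'M[F]_p1 | M^T = M] [set M : 'M[F]_p2 | M^T = M] _ _
      (lsym _) (lsym _) (has_dim_symmetric _ _) (has_dim_symmetric _ _)).
- split=> [|c u v [us1 us2] [vs1 vs2]] /=; first by rewrite !trmx0.
  by rewrite !linearP /= us1 us2 vs1 vs2.
- move=> [X Y] [/= Xs Ys] f0.
  have g0 := fP (X, Y); rewrite f0 mul0mx /= in g0; rewrite /f /= in f0.
  have two0 (V : 'M[F]_n.+1) : V + V = 0 -> V = 0.
    by move=> /eqP; rewrite -mulr2n -scaler_nat scaler_eq0 (negbTE n2) => /eqP.
  have X0 : B1^T *m X *m B1 = 0.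
    by apply: two0; have := congr2 +%R f0 (esym g0); rewrite addr0 addrACA subrr addr0.
  have Y0 : B2^T *m Y *m B2 = 0 by move: f0; rewrite X0 add0r.
  have cancel p (B : 'M[F]_(p, n.+1)) Q Z : B *m Q = 1%:M -> B^T *m Z *m B = 0 -> Z = 0.
    move=> BQ /(congr1 (fun V => Q^T *m V *m Q)); rewrite mulmx0 mul0mx !mulmxA -trmx_mul BQ.
    by rewrite trmx1 mul1mx -mulmxA BQ mulmx1.
  by rewrite (cancel _ _ _ _ Q1E X0) (cancel _ _ _ _ Q2E Y0).
Qed.

Lemma has_dim_symmetric_periods :
  has_dim symmetric_periods
    ('C((\rank (period_space S U P 1)).+1, 2) + 'C((\rank (period_space S U P (-1))).+1, 2)).
Proof.
by apply: has_dim_symmetric_periods_base (row_base_free _) (row_base_free _) _ _; exact: eq_row_base.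
Qed.

End SymmetricPeriods.

Definition mx2 (A : nzRingType) (a b c d : A) : 'M[A]_2 :=
  \matrix_(i, j) if i == 0 then (if j == 0 then a else b) else (if j == 0 then c else d).

Lemma mul_mx2 (A : comNzRingType) (a b c d a' b' c' d' : A) :
  mx2 a b c d *m mx2 a' b' c' d' =
  mx2 (a * a' + b * c') (a * b' + b * d') (c * a' + d * c') (c * b' + d * d').
Proof. by apply/matrixP => i j; rewrite mulmx2 !mxE /=; do 2 case: ifP => _. Qed.

Lemma mx2N (A : comNzRingType) (a b c d : A) : mx2 (- a) (- b) (- c) (- d) = - 1 *: mx2 a b c d.
Proof. by apply/matrixP => i j; rewrite !mxE mulN1r; do 2 case: ifP => _. Qed.

Lemma mx2_id (A : comNzRingType) : mx2 1 0 0 1 = 1%:M :> 'M[A]_2.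
Proof. by apply/matrixP => -[[|[|//]] ?] [[|[|//]] ?]; rewrite !mxE. Qed.

Lemma eq_mx2 (A : nzRingType) (a b c d a' b' c' d' : A) :
  a = a' -> b = b' -> c = c' -> d = d' -> mx2 a b c d = mx2 a' b' c' d'.
Proof. by move=> -> -> -> ->. Qed.

(** The values at 0, -1, -2, ... agree, so [p] minus its value at 0 has more roots than its degree
    allows. *)
Lemma translation_invariant (p : {poly rat}) : p \Po ('X - 1) = p -> p = (p.[0])%:P.
Proof.
move=> pT; apply/eqP; rewrite -subr_eq0; set q := _ - _; apply/negPn/negP => q0.
have pn m : p.[- m%:R] = p.[0].
  elim: m => [|m IH]; first by rewrite oppr0.
  by rewrite -natr1 opprD -IH -[in RHS]pT horner_comp hornerXsubC.
suff : (size [seq - m%:R : rat | m <- iota 0 (size q)] < size q)%N by rewrite size_map size_iota ltnn.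
apply: max_poly_roots => //.
  by apply/allP => _ /mapP[m _ ->]; rewrite /root hornerD hornerN hornerC pn subrr.
by rewrite map_inj_uniq ?iota_uniq// => m m' /oppr_inj/eqP; rewrite eqr_nat => /eqP.
Qed.

(** The two symmetric blocks have sizes p and p - 1; this is the origin of the square of dim M_k. *)
Lemma square_bin p : ('C(p.+1, 2) + 'C(p, 2))%N = (p ^ 2)%N.
Proof. by elim: p => // p IH; move: IH; rewrite !binS !bin1 !bin0; nia. Qed.

(** * Period polynomials of even degree and dim M_k *)

Section RhoPeriods.
Variable n : nat.
Hypotheses (n_even : ~~ odd n) (n_gt0 : (0 < n)%N).

Local Notation rho := (@rho rat n).
(** [S] and [U], of orders 4 and 3, generate SL_2(Z); [w] and [eps] have determinant -1. As [n] is
    even, the scalar -1 acts trivially, so the images satisfy the relations of PGL_2(Z). *)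
Local Notation S := (mx2 0 (-1) 1 0 : 'M[rat]_2).
Local Notation U := (mx2 (-1) (-1) 1 0 : 'M[rat]_2).
Local Notation w := (mx2 0 1 1 0 : 'M[rat]_2).
Local Notation eps := (mx2 1 0 0 (-1) : 'M[rat]_2).

Lemma rhoN g : rho (- 1 *: g) = rho g.
Proof. by rewrite rho_scale -signr_odd (negbTE n_even) scale1r. Qed.

Lemma rho_anti (i j : 'I_n.+1) : rho w i j = (j == n - i :> nat)%N%:R.
Proof.
rewrite !mxE /binary_row !mxE /= polyC0 polyC1 mul0r add0r mul1r addr0 expr1n mul1r coefXn.
by [].
Qed.

Lemma rho_diag (i j : 'I_n.+1) : rho eps i j = (-1) ^+ i * (i == j)%:R.
Proof.
rewrite !mxE /binary_row !mxE /= polyC0 polyC1 mul0r add0r mul1r addr0.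
rewrite -polyC_exp coefMC coefXn; have in_ : (i <= n)%N by rewrite -ltnS.
have -> : (-1) ^+ (n - i) = (-1) ^+ i :> rat by rewrite -signr_odd oddB// (negbTE n_even) signr_odd.
by rewrite mulrC eq_sym.
Qed.

Lemma rho_S (i j : 'I_n.+1) : rho S i j = (-1) ^+ i * (j == n - i :> nat)%N%:R.
Proof.
rewrite !mxE /binary_row !mxE /= polyC0 polyC1 mul0r add0r mul1r addr0.
by rewrite -polyC_exp coefCM coefXn.
Qed.

Lemma sum_middle (F : nat -> rat) : \sum_(i < n.+1) F i * (i == n - i :> nat)%N%:R = F n./2.
Proof.
have nE : n = (n./2 + n./2)%N by rewrite addnn even_halfK.
have h : (n./2 < n.+1)%N by rewrite ltnS {2}nE leq_addr.
rewrite (bigD1 (Ordinal h))//= big1 ?addr0 => [|i].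
  by rewrite (_ : (_ == _)%N = true) ?mulr1//; apply/eqP; lia.
rewrite -val_eqE /= => ih; rewrite (_ : (_ == _)%N = false) ?mulr0//.
by apply/negP => /eqP; move: ih; lia.
Qed.

Lemma trace_w : \tr (rho w) = 1.
Proof.
rewrite /mxtrace -[RHS](sum_middle (fun=> 1)); apply: eq_bigr => i _.
by rewrite rho_anti mul1r.
Qed.

Lemma trace_S : \tr (rho S) = (-1) ^+ n./2.
Proof.
rewrite /mxtrace -[RHS](sum_middle (fun i => (-1) ^+ i)); apply: eq_bigr => i _.
by rewrite rho_S.
Qed.

Lemma trace_eps : \tr (rho eps) = 1.
Proof.
rewrite /mxtrace; under eq_bigr do rewrite rho_diag eqxx mulr1.
have : forall m, \sum_(i < m.*2.+1) (-1) ^+ i = 1 :> rat.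
  elim=> [|m IH]; first by rewrite big_ord1.
  rewrite doubleS 2!big_ord_recr /= IH -(signr_odd _ m.*2.+1) -(signr_odd _ m.*2.+2) /= odd_double.
  by rewrite expr1 expr0 addrK.
by move=> /(_ n./2); rewrite even_halfK.
Qed.

(* the value at 1/2 of the Chebyshev polynomial U_m of the second kind *)
Definition chebyshev m : rat := \sum_(i < m.+1) (-1) ^+ (m - i) * 'C(i, m - i)%:R.

Lemma chebyshevS m : chebyshev m.+2 = chebyshev m.+1 - chebyshev m.
Proof.
rewrite /chebyshev big_ord_recl bin0n /= mulr0 add0r.
rewrite big_ord_recr [X in _ = X - _]big_ord_recr /= !/bump /= !add1n !subnn !bin0.
rewrite -addrAC -sumrB; congr (_ + _); apply: eq_bigr => i _; rewrite add1n.
have im : (i <= m)%N by rewrite -ltnS.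
rewrite !subSS !(subSn im) binS natrD mulrDr exprS; ring.
Qed.

Lemma chebyshev6 m : chebyshev (m + 6) = chebyshev m.
Proof. by rewrite !addnS addn0 !chebyshevS; ring. Qed.

(** In the n-th symmetric power, a matrix of determinant 1 and trace t has trace U_n(t / 2). Here t
    = -1, and the sign drops out for even n. *)
Lemma trace_U : \tr (rho U) = chebyshev n.
Proof.
rewrite /mxtrace /chebyshev; apply: eq_bigr => i _.
rewrite !mxE /binary_row !mxE /= polyC0 polyC1 addr0 mul1r.
have in_ : (i <= n)%N by rewrite -ltnS.
have -> : (-1)%:P * 'X + (-1)%:P = (-1)%:P * ('X + 1) :> {poly rat} by rewrite mulrDr mulr1.
rewrite exprMn -polyC_exp -mulrA coefCM coefMXn.
have -> : (-1) ^+ (n - i) = (-1) ^+ i :> rat by rewrite -signr_odd oddB// (negbTE n_even) signr_odd.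
congr (_ * _); case: ltnP => ini; first by rewrite bin_small.
rewrite addrC exprDn coef_sum.
have h : (i - (n - i) < i.+1)%N by rewrite ltnS leq_subr.
rewrite (bigD1 (Ordinal h))//= big1 ?addr0 => [|j]; rewrite coefMn expr1n mul1r coefXn.
  by rewrite eqxx -bin_sub ?leq_subr// subKn.
by rewrite -val_eqE eq_sym /= => /negbTE ->; rewrite mul0rn.
Qed.

Lemma rho_involution g : g *m g = 1%:M \/ g *m g = - 1 *: 1%:M -> rho g *m rho g = 1%:M.
Proof. by rewrite -rhoM => -[->|->]; rewrite ?rhoN rho1. Qed.

Lemma rho_SS : rho S *m rho S = 1%:M.
Proof.
by apply: rho_involution; right; rewrite -mx2_id -mx2N mul_mx2; apply: eq_mx2; ring.
Qed.

(** S and U yield a translation, so each row is a constant polynomial; S carries its constant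
    coefficient to the top coefficient, which is 0 because n > 0. *)
Lemma rho_no_invariant k (r : 'M[rat]_(k, n.+1)) : r *m rho S = r -> r *m rho U = r -> r = 0.
Proof.
move=> rS rU; have rT : r *m rho (mx2 1 (-1) 0 1) = r.
  have TS : mx2 1 (-1) 0 1 *m S = U by rewrite mul_mx2; apply: eq_mx2; ring.
  by rewrite -[LHS]mulmx1 -rho_SS mulmxA -(mulmxA r) -rhoM TS rU rS.
have r0 a (j : 'I_n.+1) : j != ord0 -> r a j = 0.
  pose p := \poly_(i < n.+1) r a (inord i).
  have pE (i : 'I_n.+1) : p`_i = r a i by rewrite coef_poly ltn_ord inord_val.
  move=> j0; rewrite -pE (_ : p = (p.[0])%:P) ?coefC -?val_eqE ?(negbTE j0)//.
    by move: j0; rewrite -val_eqE /= => /negbTE ->.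
  apply: translation_invariant; apply/polyP => i.
  have -> : p \Po ('X - 1) = \sum_(l < n.+1) r a l *: binary_row n (mx2 1 (-1) 0 1) l.
    rewrite /p poly_def raddf_sum /=; apply: eq_bigr => l _.
    rewrite comp_polyZ comp_Xn_poly inord_val /binary_row !mxE /= polyC1 polyC0 mul0r add0r expr1n.
    by rewrite mulr1 mul1r polyCN polyC1.
  have [ni|in_] := ltnP n i.
    rewrite [RHS]nth_default; last exact: leq_trans (size_poly _ _) ni.
    rewrite coef_sum big1// => l _; rewrite coefZ nth_default ?mulr0//.
    by apply: leq_trans (size_binary_row _ _) ni; rewrite -ltnS.
  have -> : p`_i = r a (Ordinal (in_ : (i < n.+1)%N)) by rewrite -pE.
  rewrite -[in RHS]rT mxE coef_sum.
  by apply: eq_bigr => l _; rewrite coefZ mxE.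
apply/matrixP => a j; rewrite [RHS]mxE; have [->|/r0//] := eqVneq j ord0.
have := r0 a ord_max; rewrite -val_eqE -lt0n => /(_ n_gt0) <-.
rewrite -[in RHS]rS mxE (bigD1 ord0)//= big1 ?addr0 => [|i i0].
  by rewrite rho_S subn0 eqxx expr0 !mulr1.
by rewrite r0// mul0r.
Qed.

(** Transposes enter because [period_space] has matrices acting on rows from the right, whereas the
    conditions on M multiply by [rho] from the left. *)
Lemma rho_tr_relations (S' := (rho S)^T) (U' := (rho U)^T) (w' := (rho w)^T) :
  [/\ S' * S' = 1, w' * w' = 1, U' * U' * U' = 1, S' * w' = w' * S' & w' * U' * w' = U' * U'].
Proof.
have ring_mul (X Y : 'M[rat]_n.+1) : X^T * Y^T = (Y *m X)^T by rewrite trmx_mul.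
have ww : w *m w = 1%:M by rewrite -mx2_id mul_mx2; apply: eq_mx2; ring.
rewrite !ring_mul; split.
- by rewrite rho_SS trmx1.
- by rewrite rho_involution ?trmx1//; left.
- rewrite -!rhoM !mul_mx2 (_ : mx2 _ _ _ _ = 1%:M) ?rho1 ?trmx1//.
  by rewrite -mx2_id; apply: eq_mx2; ring.
- rewrite -!rhoM -[in LHS]rhoN; congr (rho _)^T.
  by rewrite !mul_mx2 -mx2N; apply: eq_mx2; ring.
- rewrite -!rhoM; congr (rho _)^T.
  by rewrite !mul_mx2; apply: eq_mx2; ring.
Qed.

Lemma rank_rho_period (s : rat) : s * s = 1 ->
  (\rank (period_space (rho S)^T (rho U)^T (rho w)^T s))%:R =
  (n.+1)%:R / 12 - (-1) ^+ n./2 / 4 - chebyshev n / 3 - s / 2.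
Proof.
move=> ss; have [SS ww UUU Sw wUw] := rho_tr_relations.
have wS : w *m S = eps by rewrite mul_mx2; apply: eq_mx2; ring.
rewrite rank_period_space//.
  have -> : (rho S)^T * (rho w)^T = (rho eps)^T by rewrite -wS rhoM trmx_mul.
  by rewrite !mxtrace_tr trace_S trace_U trace_w trace_eps; field.
move=> k Y SY UY; apply: trmx_inj; rewrite trmx0; apply: rho_no_invariant.
  by rewrite -[in RHS]SY trmx_mul trmxK.
by rewrite -[in RHS]UY trmx_mul trmxK.
Qed.

(** Both sides grow by 1 when m grows by 6, that is, when the weight grows by 12; six values remain
    to be compared. *)
Lemma dim_modular_chebyshev m : (dim_modular m.*2.+2)%:R =
  (m.*2.+1)%:R / 12 - (-1) ^+ m / 4 - chebyshev m.*2 / 3 + 1 / 2 :> rat.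
Proof.
have [l lm] := ubnP m; elim: l m lm => // l IH m lm.
have [m6|m6] := ltnP m 6.
  have c0 : chebyshev 0 = 1 by rewrite /chebyshev big_ord1.
  have c1 : chebyshev 1 = 1 by rewrite /chebyshev !big_ord_recl big_ord0.
  have c2 : chebyshev 2 = 0 by rewrite chebyshevS c0 c1 subrr.
  have c3 : chebyshev 3 = -1 by rewrite chebyshevS c1 c2 sub0r.
  have c4 : chebyshev 4 = -1 by rewrite chebyshevS c2 c3 subr0.
  have c6 : chebyshev 6 = 1 by rewrite (chebyshev6 0).
  have c8 : chebyshev 8 = 0 by rewrite (chebyshev6 2).
  have c10 : chebyshev 10 = -1 by rewrite (chebyshev6 4).
  case: m m6 {lm} => [|[|[|[|[|[|//]]]]]] _.
  - by rewrite -[chebyshev _]/(chebyshev 0) c0.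
  - by rewrite -[chebyshev _]/(chebyshev 2) c2.
  - by rewrite -[chebyshev _]/(chebyshev 4) c4.
  - by rewrite -[chebyshev _]/(chebyshev 6) c6.
  - by rewrite -[chebyshev _]/(chebyshev 8) c8.
  - by rewrite -[chebyshev _]/(chebyshev 10) c10.
have [q mq] : exists q, m = (q + 6)%N by exists (m - 6)%N; lia.
rewrite mq in lm m6 *; have E := IH q ltac:(lia).
have dE j : ~~ odd j -> dim_modular (j + 12) = (dim_modular j).+1.
  by move=> oj; rewrite /dim_modular oddD (negbTE oj) /= modnDr divnDr ?dvdnn// addnAC addn1.
have -> : (q + 6).*2 = (q.*2 + 6 + 6)%N by lia.
rewrite !chebyshev6 (_ : (_ + _).+2 = (q.*2.+2 + 12)%N); last by lia.
rewrite dE; last by rewrite /= odd_double.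
rewrite -natr1 E exprD (_ : (_ + _).+1 = (q.*2.+1 + 12)%N); last by lia.
by rewrite natrD; field.
Qed.

Lemma has_dim_rho_periods :
  has_dim [set M : 'M[rat]_n.+1 | [/\ M^T = M, rho eps *m M *m rho eps = M, rho S *m M = - M &
     M + rho U *m M + rho (U *m U) *m M = 0]] (dim_modular n.+2 ^ 2).
Proof.
have dm := dim_modular_chebyshev n./2; rewrite even_halfK// in dm.
have p1 : \rank (period_space (rho S)^T (rho U)^T (rho w)^T (-1)) = dim_modular n.+2.
  apply/eqP; rewrite -(eqr_nat rat) rank_rho_period; last by ring.
  by rewrite dm; apply/eqP; field.
have p0 : (\rank (period_space (rho S)^T (rho U)^T (rho w)^T 1)).+1 = dim_modular n.+2.
  apply/eqP; rewrite -(eqr_nat rat) -natr1 rank_rho_period; last by ring.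
  by rewrite dm; apply/eqP; field.
(* Since eps S = - w, invariance under w amounts to invariance under eps once S M = - M is known. *)
have wE : rho w = rho eps *m rho S.
  by rewrite -rhoM -[LHS]rhoN; congr rho; rewrite -mx2N mul_mx2; apply: eq_mx2; ring.
have eT : (rho eps)^T = rho eps.
  apply/matrixP => i j; rewrite mxE !rho_diag eq_sym; case: eqP => [->//|_]; by rewrite !mulr0.
have := @has_dim_symmetric_periods rat n (rho S)^T (rho U)^T (rho w)^T.
rewrite p1 p0 addnC square_bin => H.
rewrite (_ : mkset _ = symmetric_periods (rho S)^T (rho U)^T (rho w)^T).
  by have [_ ww _ Sw wUw] := rho_tr_relations; exact: H.
have UUE (M : 'M[rat]_n.+1) : M^T = M -> (M *m (1 + (rho U)^T + (rho U)^T * (rho U)^T))^T =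
    M + rho U *m M + rho (U *m U) *m M.
  move=> Ms; rewrite -[_ * _]trmx_mul -rhoM !mulmxDr mulmx1 !linearD /= !trmx_mul !trmxK Ms.
  by [].
have wMw (M : 'M[rat]_n.+1) : M^T = M -> rho S *m M = - M ->
    ((rho w)^T)^T *m M *m (rho w)^T = rho eps *m M *m rho eps.
  move=> Ms SM; have wM : rho w *m M = - (rho eps *m M) by rewrite wE -mulmxA SM mulmxN.
  rewrite trmxK wM mulNmx -[M in LHS]Ms -!mulmxA -trmx_mul wM linearN /= trmx_mul Ms eT.
  by rewrite mulmxN opprK mulmxA.
apply/seteqP; split=> M [Ms].
  move=> ME MS MU; split=> //.
  - by rewrite -[M in LHS]Ms -trmx_mul MS linearN /= Ms.
  - by apply: trmx_inj; rewrite UUE// trmx0.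
  - by rewrite wMw.
move=> MS MU MP; have SM : rho S *m M = - M.
  by rewrite -[M in LHS]Ms -[rho S]trmxK -trmx_mul MS linearN /= Ms.
split=> //; first by rewrite -wMw.
by rewrite -UUE// MU trmx0.
Qed.

End RhoPeriods.

(** * Depth 2 polynomials as forms in a 2 x 2 matrix *)

Section BiSymmetric.
Local Notation P := (mpoly (2 + 2) rat).
Local Notation u1 := (uvar (ord0 : 'I_2)).
Local Notation u2 := (uvar (ord_max : 'I_2)).
Local Notation v1 := (vvar (ord0 : 'I_2)).
Local Notation v2 := (vvar (ord_max : 'I_2)).
Implicit Types (F G : P).

Definition letters4 (T : Type) (a b c d : T) (i : 'I_(2 + 2)) : T :=
  match fintype.split i with
  | inl j => if j == ord0 then a else b
  | inr j => if j == ord0 then c else d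
  end.

(** A general target ring covers substitutions of polynomials, the generic point of the quadric, and
    rational points. *)
Definition eval4 (A : comNzRingType) (f : {rmorphism rat -> A}) (a b c d : A) : P -> A :=
  mmap f (letters4 a b c d).

HB.instance Definition _ A f a b c d := GRing.RMorphism.on (@eval4 A f a b c d).

Lemma eval4_vars (A : comNzRingType) f (a b c d : A) :
  [/\ eval4 f a b c d u1 = a, eval4 f a b c d u2 = b, eval4 f a b c d v1 = c & eval4 f a b c d v2 = d].
Proof.
rewrite /eval4 /uvar /vvar !mmapX !mmap1U /letters4.
have L (j : 'I_2) : fintype.split (lshift 2 j) = inl j := unsplitK (inl _ j).
have R (j : 'I_2) : fintype.split (rshift 2 j) = inr j := unsplitK (inr _ j).
by rewrite !L !R.
Qed.

Definition sub4 : P -> P -> P -> P -> P -> P := eval4 (@mpolyC _ _).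

HB.instance Definition _ a b c d := GRing.RMorphism.on (sub4 a b c d).

Definition homogeneous4 N F := F \is ishomog1 N (@mdeg (2 + 2)).

Lemma homogeneous4_vars : [/\ homogeneous4 1 u1, homogeneous4 1 u2, homogeneous4 1 v1 & homogeneous4 1 v2].
Proof. by rewrite /homogeneous4 !dhomogX /= !mdeg1. Qed.

Lemma mpolyX4 (m : multinom (2 + 2)) : mpolyX rat m =
  u1 ^+ m (lshift 2 ord0) * u2 ^+ m (lshift 2 ord_max) *
  (v1 ^+ m (rshift 2 ord0) * v2 ^+ m (rshift 2 ord_max)).
Proof.
rewrite mpolyXE_id big_split_ord /= !big_ord_recl !big_ord0 !mulr1.
by congr (_ * _ ^+ m _ * (_ * _ ^+ m _)); rewrite /uvar /vvar; (congr (mpolyX _ (mnm1 _)) || idtac); apply/val_inj.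
Qed.

(** Minus the determinant of [Z4], and also the factor by which [bm_delta] multiplies in depth 2. *)
Definition det4 : P := u1 * v1 + u2 * v2.
Definition Z4 : 'M[P]_2 := mx2 v2 v1 u1 (- u2).
Definition mon4 p q r s : P := v2 ^+ p * v1 ^+ q * (u1 ^+ r * (- u2) ^+ s).

Lemma homogeneous4M N N' F G : homogeneous4 N F -> homogeneous4 N' G -> homogeneous4 (N + N') (F * G).
Proof. exact: dhomogM. Qed.

Lemma homogeneous4X N F k : homogeneous4 N F -> homogeneous4 (N * k) (F ^+ k).
Proof. exact: dhomogMn. Qed.

Lemma homogeneous_mon4 p q r s : homogeneous4 (p + q + (r + s)) (mon4 p q r s).
Proof.
have [hu1 hu2 hv1 hv2] := homogeneous4_vars.
have X F k : homogeneous4 1 F -> homogeneous4 k (F ^+ k) by move=> /(homogeneous4X k); rewrite mul1n.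
by do 2?apply: homogeneous4M; apply: X => //; rewrite /homogeneous4 rpredN.
Qed.

(** Equal row and column degrees in the entries of [Z4] mean that powers of v2 (- u2) are traded for
    powers of v1 u1, and these two products differ by - det4. *)
Lemma mon4_mod_det K p q r s p' q' r' s' : (p + q + (r + s) = K.+2)%N ->
  (p + q = p' + q')%N -> (p + r = p' + r')%N -> (q + s = q' + s')%N ->
  exists2 G, homogeneous4 K G & mon4 p q r s - mon4 p' q' r' s' = det4 * G.
Proof.
wlog pp : p q r s p' q' r' s' / (p' <= p)%N => [H|] dE e1 e2 e3.
  have [pp|/ltnW pp] := leqP p' p; first exact: H.
  have [||||G hG E] := H p' q' r' s' p q r s pp; try lia.
  by exists (- G); [rewrite /homogeneous4 rpredN|rewrite mulrN -E opprB].
have [t pE] : exists t, p = (p' + t)%N by exists (p - p')%N; lia.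
have [qE rE sE] : [/\ q' = q + t, r' = r + t & s = s' + t]%N by split; lia.
rewrite pE qE rE sE in dE *.
exists (- (mon4 p' q r s' * \sum_(i < t) (v2 * - u2) ^+ (t.-1 - i) * (v1 * u1) ^+ i)).
  rewrite /homogeneous4 rpredN.
  case: t => [|t] in pE qE rE sE dE *; first by rewrite big_ord0 mulr0 rpred0.
  rewrite (_ : K = (p' + q + (r + s')) + 2 * t)%N; last lia.
  apply: homogeneous4M; first exact: homogeneous_mon4.
  apply: rpred_sum => i _; have [hu1 hu2 hv1 hv2] := homogeneous4_vars.
  rewrite (_ : 2 * t = 2 * (t - i) + 2 * i)%N; last by rewrite -mulnDr subnK// -ltnS.
  apply: homogeneous4M; apply: homogeneous4X; apply: (@homogeneous4M 1 1) => //.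
  by rewrite /homogeneous4 rpredN.
have := subrXX (v2 * - u2) (v1 * u1) t; rewrite /mon4 !exprMn !exprD => E.
transitivity (v2 ^+ p' * v1 ^+ q * (u1 ^+ r * (- u2) ^+ s') * (v2 ^+ t * (- u2) ^+ t - v1 ^+ t * u1 ^+ t)).
  by ring.
rewrite E /det4; ring.
Qed.

(* a generic point of the quadric det4 = - det Z4 = 0, up to a scalar *)
Definition rank1_eval : P -> {poly {poly rat}} :=
  eval4 (polyC \o polyC : {rmorphism _ -> _}) ('X%:P) (-1) 'X ('X * 'X%:P).

HB.instance Definition _ := GRing.RMorphism.on rank1_eval.

Lemma rank1_vars : [/\ rank1_eval u1 = 'X%:P, rank1_eval u2 = -1, rank1_eval v1 = 'X &
  rank1_eval v2 = 'X * 'X%:P].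
Proof. exact: eval4_vars. Qed.

Lemma rank1_det4 : rank1_eval det4 = 0.
Proof.
rewrite /det4 rmorphD !rmorphM /=; have [-> -> -> ->] := rank1_vars.
by ring.
Qed.

Lemma rank1_mon4 p q r s : rank1_eval (mon4 p q r s) = 'X^(p + q) * ('X ^+ (p + r))%:P.
Proof.
rewrite /mon4 !rmorphM /= !rmorphXn rmorphN /=; have [-> -> -> ->] := rank1_vars.
by rewrite opprK expr1n mulr1 exprMn !exprD; ring.
Qed.

(** The representative modulo [det4] with degree i in the first row and j in the first column of
    [Z4]; by truncated subtraction one off-diagonal exponent is 0. *)
Definition nf4 N i j : P := mon4 (minn i j) (i - j) (j - i) (N - i - (j - i)).

Definition rank1_lift N (q : {poly {poly rat}}) : P :=
  \sum_(i < N.+1) \sum_(j < N.+1) q`_i`_j *: nf4 N i j.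

Lemma rank1_liftP N c (q q' : {poly {poly rat}}) :
  rank1_lift N (c%:P *: q + q') = c *: rank1_lift N q + rank1_lift N q'.
Proof.
rewrite /rank1_lift scaler_sumr -big_split; apply: eq_bigr => i _ /=.
rewrite scaler_sumr -big_split; apply: eq_bigr => j _ /=.
by rewrite coefD coefZ coefD coefCM scalerDl scalerA.
Qed.

Lemma rank1_evalZ (c : rat) F : rank1_eval (c *: F) = c%:P *: rank1_eval F.
Proof. by rewrite /rank1_eval /eval4 mmapZ /= mul_polyC. Qed.

Lemma rank1_lift_monomial N i j : (i <= N)%N -> (j <= N)%N ->
  rank1_lift N ('X^i * ('X^j)%:P) = nf4 N i j.
Proof.
move=> iN jN; rewrite /rank1_lift (bigD1 (Ordinal (iN : (i < N.+1)%N)))//= [X in _ + X]big1 => [|i' i'i].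
  rewrite (bigD1 (Ordinal (jN : (j < N.+1)%N)))//= big1 => [|j' j'j].
    by rewrite coefMC !coefXn !eqxx mul1r coefXn eqxx scale1r !addr0.
  rewrite -val_eqE /= in j'j.
  by rewrite coefMC !coefXn eqxx mul1r coefXn (negbTE j'j) scale0r.
rewrite -val_eqE /= in i'i.
by rewrite big1// => j' _; rewrite coefMC coefXn (negbTE i'i) mul0r coef0 scale0r.
Qed.

(** Reducing each monomial to its normal form shows that a form is determined modulo [det4] by its
    restriction to the quadric, with a quotient of degree K. *)
Lemma rank1_section K F : homogeneous4 K.+2 F ->
  exists2 G, homogeneous4 K G & F = rank1_lift K.+2 (rank1_eval F) + det4 * G.
Proof.
move=> /dhomogP Fh; rewrite [F]mpolyE.
have := Fh; elim: (msupp F) => [|m s IH] sh.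
  exists 0; first exact: rpred0.
  rewrite big_nil rmorph0 mulr0 addr0 /rank1_lift big1// => i _.
  by rewrite big1// => j _; rewrite !coef0 scale0r.
have [|G Gh GE] := IH; first by move=> m' ms; apply: sh; rewrite inE ms orbT.
set p := m (rshift 2 ord_max); set q := m (rshift 2 ord0); set r := m (lshift 2 ord0).
set t := m (lshift 2 ord_max).
have mE : mpolyX rat m = (-1) ^+ t *: mon4 p q r t.
  rewrite mpolyX4 /mon4 -scaleN1r exprZn -!scalerAr scalerA -exprMn mulrNN mulr1 expr1n scale1r.
  by rewrite -/p -/q -/r -/t; ring.
have pqrt : (p + q + (r + t))%N = K.+2.
  transitivity (mdeg m); last by apply: sh; exact: mem_head.
  rewrite mdegE big_split_ord /= !big_ord_recl !big_ord0 !addn0.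
  have -> : lshift 2 (lift ord0 ord0) = lshift 2 (ord_max : 'I_2) by apply: ord_inj.
  have -> : rshift 2 (lift ord0 ord0) = rshift 2 (ord_max : 'I_2) by apply: ord_inj.
  by rewrite /p /q /r /t; lia.
have [||||G' G'h G'E] := @mon4_mod_det K p q r t (minn (p + q) (p + r)) (p + q - (p + r))
    (p + r - (p + q)) (K.+2 - (p + q) - (p + r - (p + q))); try lia.
exists (mcoeff m F *: ((-1) ^+ t *: G') + G).
  by apply: rpredD => //; do 2 apply: rpredZ.
rewrite big_cons rmorphD /= rank1_evalZ rank1_liftP {1}GE mE rank1_evalZ.
rewrite -[_ *: rank1_eval (mon4 _ _ _ _)]addr0 rank1_liftP rank1_mon4 rank1_lift_monomial; try lia.
have -> : rank1_lift K.+2 0 = 0.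
  by rewrite /rank1_lift big1// => i _; rewrite big1// => j _; rewrite !coef0 scale0r.
rewrite addr0 mulrDr -!scalerAr -G'E /nf4 !scalerBr.
ring.
Qed.

Section Form.
Variable n : nat.
Local Notation toP := (map_mx (@mpolyC (2 + 2) rat)).

Definition binom_mx : 'M[rat]_n.+1 := diag_mx (\row_i ('C(n, i))%:R).

Definition trace_form (M : 'M[rat]_n.+1) : P := \tr (toP (M *m binom_mx) *m rho n Z4).

Lemma trace_formP c M M' : trace_form (c *: M + M') = c *: trace_form M + trace_form M'.
Proof.
rewrite /trace_form mulmxDl map_mxD mulmxDl mxtraceD -scalemxAl map_mxZ -scalemxAl mxtraceZ.
by rewrite mul_mpolyC.
Qed.

Lemma homogeneous_trace_form M : homogeneous4 n (trace_form M).
Proof.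
have [hu1 hu2 hv1 hv2] := homogeneous4_vars.
pose h d (q : {poly P}) := forall j, homogeneous4 d q`_j.
have hlin d (a b : P) q : homogeneous4 1 a -> homogeneous4 1 b -> h d q -> h d.+1 ((a%:P * 'X + b%:P) * q).
  move=> ha hb hq j; rewrite mulrDl coefD -mulrA !coefCM coefXM -add1n.
  apply: rpredD; last exact: homogeneous4M.
  apply: homogeneous4M => //; case: (j == 0)%N => //; exact: rpred0.
have hpow d (a b : P) q k : homogeneous4 1 a -> homogeneous4 1 b -> h d q ->
    h (k + d)%N ((a%:P * 'X + b%:P) ^+ k * q).
  move=> ha hb hq; elim: k => [|k IH]; first by rewrite mul1r.
  by rewrite exprS -mulrA addSn; exact: hlin.
apply: rpred_sum => i _; rewrite mxE; apply: rpred_sum => j _; rewrite mxE mul_mpolyC.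
apply: rpredZ; change (homogeneous4 n (rho n Z4 j i)); rewrite mxE /binary_row.
have jn : (j <= n)%N by rewrite -ltnS.
rewrite -[n in homogeneous4 n](subnKC jn); apply: (hpow); rewrite ?mxE//=.
rewrite -[_ ^+ (n - j)]mulr1 -[X in h X _]addn0; apply: hpow; rewrite ?mxE//=.
  by rewrite /homogeneous4 rpredN.
by move=> l; rewrite coef1; case: (l == 0)%N; [exact: dhomog1|exact: rpred0].
Qed.

(** At a matrix of rank one all entries of [rho n] are monomials with different bidegrees, by
    [rho_rank1]. Each entry of M can thus be read off, up to a binomial factor from [binom_mx] and
    one from [rho]. *)
Lemma rank1_trace_form M (i j : 'I_n.+1) :
  (rank1_eval (trace_form M))`_j`_i = M i j * ('C(n, i))%:R * ('C(n, j))%:R.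
Proof.
have rC c : rank1_eval (mpolyC (2 + 2) c) = c%:P%:P by rewrite /rank1_eval /eval4 mmapC.
rewrite /trace_form /mxtrace rmorph_sum /= !coef_sum.
have E (a b : 'I_n.+1) : (rank1_eval (rho n Z4 b a))`_j`_i = (j == b)%:R * (i == a)%:R * ('C(n, a))%:R.
  have -> : rank1_eval (rho n Z4 b a) = map_mx rank1_eval (rho n Z4) b a by rewrite [RHS]mxE.
  pose x (k : 'I_2) : {poly {poly rat}} := if k == 0 then 'X else 1.
  pose y (k : 'I_2) : {poly {poly rat}} := if k == 0 then 'X%:P else 1.
  rewrite map_rho (@rho_rank1 _ _ x y).
    rewrite /x /y /= !expr1n !mulr1 mulrnAr !coefMn -polyC_exp coefMC coefXn mulr_natr.
    by rewrite -!val_eqE /=; congr (_ *+ _); case: (j == b :> nat); rewrite ?mul1r ?mul0r ?coefXn ?coef0.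
  move=> [[|[|//]] ?] [[|[|//]] ?]; rewrite !mxE /x /y /=; have [r1 r2 r3 r4] := rank1_vars.
  - by rewrite r4.
  - by rewrite r3 mulr1.
  - by rewrite r1 mul1r.
  - by rewrite rmorphN /= r2 opprK mulr1.
have {}E (a : 'I_n.+1) : (rank1_eval ((toP (M *m binom_mx) *m rho n Z4) a a))`_j`_i =
    (i == a)%:R * (M a j * ('C(n, a))%:R * ('C(n, j))%:R).
  rewrite mxE rmorph_sum /= !coef_sum (bigD1 j)//= big1 ?addr0 => [|b bj];
    rewrite rmorphM /= mxE rC !coefCM E ?eqxx mul_mx_diag !mxE; last first.
    by rewrite [j == b]eq_sym (negbTE bj) !mul0r mulr0.
  by rewrite -[true%:R]/(1 : rat) mul1r; ring.
rewrite (bigD1 i)//= big1 ?addr0 => [|a ai]; rewrite E.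
  by rewrite eqxx mul1r.
by rewrite eq_sym (negbTE ai) mul0r.
Qed.

(** Restriction to the quadric kills the right-hand side and determines M. This is the directness of
    the decomposition into trace forms and multiples of [det4]. *)
Lemma trace_form_inj M G : trace_form M = det4 * G -> M = 0 /\ G = 0.
Proof.
move=> E; have M0 : M = 0.
  apply/matrixP => i j; rewrite mxE.
  have := rank1_trace_form M i j; rewrite E rmorphM /= rank1_det4 mul0r !coef0 => /esym/eqP.
  have b0 (l : 'I_n.+1) : ('C(n, l))%:R != 0 :> rat by rewrite pnatr_eq0 -lt0n bin_gt0 -ltnS.
  by rewrite !mulf_eq0 !(negbTE (b0 _)) !orbF => /eqP.
split=> //; move: E; rewrite M0 (_ : trace_form 0 = 0); last first.
  by have := trace_formP 0 0 0; rewrite scale0r addr0 scale0r add0r; rewrite /trace_form mul0mx map_mx0 mul0mx mxtrace0.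
move=> /esym/eqP; rewrite mulf_eq0 => /orP[/eqP d0|/eqP//].
have := congr1 (eval4 (idfun : {rmorphism rat -> rat}) 1 0 1 0) d0.
rewrite /det4 rmorph0 rmorphD !rmorphM /=.
by have [-> -> -> ->] := eval4_vars (idfun : {rmorphism rat -> rat}) 1 0 1 0.
Qed.

Lemma sub4_vars a b c d : [/\ sub4 a b c d u1 = a, sub4 a b c d u2 = b, sub4 a b c d v1 = c &
  sub4 a b c d v2 = d].
Proof. exact: eval4_vars. Qed.

Lemma map_sub4 a b c d : map_mx (sub4 a b c d) Z4 = mx2 d c a (- b).
Proof.
have [r1 r2 r3 r4] := sub4_vars a b c d.
by apply/matrixP => [] [[|[|//]] ?] [[|[|//]] ?]; rewrite !mxE /= ?rmorphN /= ?r1 ?r2 ?r3 ?r4.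
Qed.

Lemma sub4_rho_trace a b c d M :
  sub4 a b c d (trace_form M) = \tr (toP (M *m binom_mx) *m rho n (mx2 d c a (- b))).
Proof.
have sC x : sub4 a b c d (mpolyC _ x) = mpolyC _ x by rewrite /sub4 /eval4 mmapC.
rewrite /trace_form -trace_map_mx map_mxM map_rho /= map_sub4.
by congr (\tr (_ *m _)); apply/matrixP => i j; rewrite !mxE sC.
Qed.

(** The substitutions that occur send [Z4] to eps Z4 h. The image of eps is diagonal, hence commutes
    with [binom_mx], and the trace is cyclic. *)
Lemma sub4_trace_form a b c d (h : 'M[rat]_2) M : ~~ odd n ->
  mx2 d c a (- b) = toP (mx2 1 0 0 (-1)) *m Z4 *m toP h ->
  sub4 a b c d (trace_form M) = trace_form (rho n h *m M *m rho n (mx2 1 0 0 (-1))).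
Proof.
move=> en E; rewrite sub4_rho_trace E !rhoM -!map_rho /trace_form.
rewrite mulmxA mxtrace_mulC !mulmxA -!map_mxM; congr (\tr (toP _ *m _)).
rewrite -!mulmxA; congr (_ *m (_ *m _)).
apply/matrixP => i j; rewrite mul_diag_mx mul_mx_diag [LHS]mxE [RHS]mxE rho_diag//.
by case: eqP => [->|_]; rewrite ?mxE ?mulr0 ?mul0r// mulrC.
Qed.

(** Exchanging u1 and v1 transposes [Z4]; the binomial weights are chosen such that, by [rho_tr],
    this transposes M. *)
Lemma sub4_trace_form_tr M : sub4 v1 u2 u1 v2 (trace_form M) = trace_form M^T.
Proof.
have E N (X : 'M[P]_n.+1) : \tr (toP (N *m binom_mx) *m X) =
    \sum_i \sum_j mpolyC _ (N i j) * (X j i *+ 'C(n, j)).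
  apply: eq_bigr => i _; rewrite mxE; apply: eq_bigr => j _.
  by rewrite mxE mul_mx_diag mxE mxE mpolyCM -mulrA; congr (_ * _); rewrite mpolyC_nat mulr_natl.
rewrite sub4_rho_trace.
rewrite (E M).
rewrite /trace_form.
rewrite (E M^T).
rewrite [LHS]exchange_big /=.
have -> : mx2 v2 u1 v1 (- u2) = Z4^T.
  by apply/matrixP => [] [[|[|//]] ?] [[|[|//]] ?]; rewrite !mxE.
apply: eq_bigr => i _; apply: eq_bigr => j _.
by rewrite rho_tr trmxK [M^T i j]mxE.
Qed.

End Form.

Lemma trace_form_section K F : homogeneous4 K.+2 F ->
  exists (M : 'M[rat]_K.+3) G, homogeneous4 K G /\ F = trace_form M + det4 * G.
Proof.
move=> Fh; pose M : 'M[rat]_K.+3 :=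
  \matrix_(i, j) ((rank1_eval F)`_j`_i / ('C(K.+2, i))%:R / ('C(K.+2, j))%:R).
have [G Gh GE] : exists2 G, homogeneous4 K G & F - trace_form M = det4 * G.
  have Dh : homogeneous4 K.+2 (F - trace_form M) by apply: rpredB => //; exact: homogeneous_trace_form.
  have [G Gh ->] := rank1_section Dh; exists G => //.
  rewrite /rank1_lift big1 ?add0r// => j _; rewrite big1// => i _.
  have b0 (l : 'I_K.+3) : ('C(K.+2, l))%:R != 0 :> rat by rewrite pnatr_eq0 -lt0n bin_gt0 -ltnS.
  rewrite rmorphB /= !coefB rank1_trace_form /M mxE.
  by rewrite (_ : _ - _ = 0) ?scale0r//; field; rewrite !b0.
by exists M, G; split=> //; rewrite -GE addrC subrK.
Qed.

(** Parity and the symmetry between u and v are imposed on the first letter only; antisymmetry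
    carries them over to the second. *)
Definition bracket_kernel N : set P := [set F | [/\ homogeneous4 N F, sub4 u2 u1 v2 v1 F = - F,
  sub4 (- u1) u2 (- v1) v2 F = F, sub4 v1 u2 u1 v2 F = F &
  F + sub4 (u1 + u2) u1 v2 (v1 - v2) F + sub4 u2 (u1 + u2) (v2 - v1) v1 F = 0]].

Lemma sub4P a b c d (x : rat) F G : sub4 a b c d (x *: F + G) = x *: sub4 a b c d F + sub4 a b c d G.
Proof. by rewrite rmorphD /= /sub4 /eval4 mmapZ mul_mpolyC. Qed.

Lemma add3ACA (V : zmodType) (a b c a' b' c' : V) :
  (a + a') + (b + b') + (c + c') = (a + b + c) + (a' + b' + c').
Proof. by rewrite [a + a' + (b + b')]addrACA [LHS]addrACA. Qed.

Lemma three_term_lin (K : pzRingType) (V : lmodType K) (x : K) (a b c a' b' c' : V) :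
  a + b + c = 0 -> a' + b' + c' = 0 -> (x *: a + a') + (x *: b + b') + (x *: c + c') = 0.
Proof. by move=> E E'; rewrite add3ACA -!scalerDr E E' scaler0 addr0. Qed.

Lemma lsub_bracket_kernel N : lsub (bracket_kernel N).
Proof.
split=> [|x F G [F0 F1 F2 F3 F4] [G0 G1 G2 G3 G4]]; split.
- exact: rpred0.
- by rewrite rmorph0 oppr0.
- exact: rmorph0.
- exact: rmorph0.
- by rewrite !rmorph0 !addr0.
- by apply: rpredD => //; exact: rpredZ.
- by rewrite sub4P F1 G1 opprD scalerN.
- by rewrite sub4P F2 G2.
- by rewrite sub4P F3 G3.
- rewrite (sub4P (u1 + u2) u1 v2 (v1 - v2) x F G) (sub4P u2 (u1 + u2) (v2 - v1) v1 x F G).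
  exact: three_term_lin F4 G4.
Qed.

Lemma bracket_kernel0 F : bracket_kernel 0 F -> F = 0.
Proof.
move=> [F0 FN _ _ _]; have FC : F = mpolyC _ (mcoeff mnm0 F).
  apply/mpolyP => m; rewrite mcoeffC; have [->|m0] := eqVneq m mnm0; first by rewrite mulr1.
  by rewrite mulr0; apply: dhomog_nemf_coeff F0 _; rewrite mdeg_eq0.
have : F = - F by rewrite -FN {2}FC /sub4 /eval4 mmapC.
by move/eqP; rewrite -addr_eq0 -mulr2n -scaler_nat scaler_eq0 pnatr_eq0 => /eqP.
Qed.

Lemma map_mx2 (A B : nzRingType) (f : {rmorphism A -> B}) a b c d :
  map_mx f (mx2 a b c d) = mx2 (f a) (f b) (f c) (f d).
Proof. by apply/matrixP => i j; rewrite !mxE; do 2 case: ifP. Qed.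

(** All substitutions involved fix [det4], and the decomposition is unique, so every condition
    splits into one on M and one on G. *)
Lemma bracket_kernel_step K (M : 'M[rat]_K.+3) G : ~~ odd K -> homogeneous4 K G ->
  bracket_kernel K.+2 (trace_form M + det4 * G) <->
  [/\ M^T = M, rho K.+2 (mx2 1 0 0 (-1)) *m M *m rho K.+2 (mx2 1 0 0 (-1)) = M,
      rho K.+2 (mx2 0 (-1) 1 0) *m M = - M &
      M + rho K.+2 (mx2 (-1) (-1) 1 0) *m M
        + rho K.+2 (mx2 (-1) (-1) 1 0 *m mx2 (-1) (-1) 1 0) *m M = 0] /\ bracket_kernel K G.
Proof.
move=> eK Gh; have eK2 : ~~ odd K.+2 by rewrite /= negbK.
have C1 : mpolyC (2 + 2) (1 : rat) = 1 by rewrite mpolyC1.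
have C0 : mpolyC (2 + 2) (0 : rat) = 0 by rewrite mpolyC0.
have CN : mpolyC (2 + 2) (-1 : rat) = -1 by rewrite mpolyCN mpolyC1.
have s1 : sub4 u2 u1 v2 v1 (trace_form M) =
    trace_form (rho K.+2 (mx2 0 1 1 0) *m M *m rho K.+2 (mx2 1 0 0 (-1))).
  apply: sub4_trace_form => //; rewrite !map_mx2 /= C0 C1 CN /Z4 !mul_mx2; apply: eq_mx2; ring.
have s2 : sub4 (- u1) u2 (- v1) v2 (trace_form M) =
    trace_form (rho K.+2 (mx2 1 0 0 (-1)) *m M *m rho K.+2 (mx2 1 0 0 (-1))).
  apply: sub4_trace_form => //; rewrite !map_mx2 /= C0 C1 CN /Z4 !mul_mx2; apply: eq_mx2; ring.
have s3 : sub4 (u1 + u2) u1 v2 (v1 - v2) (trace_form M) =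
    trace_form (rho K.+2 (mx2 (-1) 1 1 0) *m M *m rho K.+2 (mx2 1 0 0 (-1))).
  apply: sub4_trace_form => //; rewrite !map_mx2 /= C0 C1 CN /Z4 !mul_mx2; apply: eq_mx2; ring.
have s4 : sub4 u2 (u1 + u2) (v2 - v1) v1 (trace_form M) =
    trace_form (rho K.+2 (mx2 0 1 1 (-1)) *m M *m rho K.+2 (mx2 1 0 0 (-1))).
  apply: sub4_trace_form => //; rewrite !map_mx2 /= C0 C1 CN /Z4 !mul_mx2; apply: eq_mx2; ring.
have d4 a b c d : a * c + b * d = det4 -> sub4 a b c d det4 = det4.
  move=> E; rewrite /det4 rmorphD !rmorphM /=; have [-> -> -> ->] := sub4_vars a b c d; exact: E.
have fD (M1 M2 : 'M[rat]_K.+3) : trace_form (M1 + M2) = trace_form M1 + trace_form M2.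
  by rewrite -[M1]scale1r trace_formP !scale1r.
have f0 : trace_form (0 : 'M[rat]_K.+3) = 0.
  by have := fD 0 0; rewrite addr0 => /eqP; rewrite -subr_eq subrr eq_sym => /eqP.
have fN (M1 : 'M[rat]_K.+3) : trace_form (- M1) = - trace_form M1.
  by apply/eqP; rewrite -addr_eq0 -fD addNr f0.
have uniq (M1 M2 : 'M[rat]_K.+3) G1 G2 :
    trace_form M1 + det4 * G1 = trace_form M2 + det4 * G2 <-> M1 = M2 /\ G1 = G2.
  split=> [E|[-> ->]//].
  have [] := @trace_form_inj _ (M1 - M2) (G2 - G1).
    by rewrite fD fN mulrBr; apply/eqP; rewrite subr_eq addrAC eq_sym subr_eq addrC E addrC.
  by move=> /subr0_eq-> /subr0_eq->.
have e1 : sub4 u2 u1 v2 v1 (trace_form M + det4 * G) = - (trace_form M + det4 * G) <->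
    rho K.+2 (mx2 0 1 1 0) *m M *m rho K.+2 (mx2 1 0 0 (-1)) = - M /\ sub4 u2 u1 v2 v1 G = - G.
  by rewrite rmorphD rmorphM /= s1 d4 ?opprD -?fN -?mulrN; [exact: uniq|rewrite /det4; ring].
have e2 : sub4 (- u1) u2 (- v1) v2 (trace_form M + det4 * G) = trace_form M + det4 * G <->
    rho K.+2 (mx2 1 0 0 (-1)) *m M *m rho K.+2 (mx2 1 0 0 (-1)) = M /\ sub4 (- u1) u2 (- v1) v2 G = G.
  by rewrite rmorphD rmorphM /= s2 d4; [exact: uniq|rewrite /det4; ring].
have e3 : sub4 v1 u2 u1 v2 (trace_form M + det4 * G) = trace_form M + det4 * G <->
    M^T = M /\ sub4 v1 u2 u1 v2 G = G.
  by rewrite rmorphD rmorphM /= sub4_trace_form_tr d4; [exact: uniq|rewrite /det4; ring].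
have e4 : let a := sub4 (u1 + u2) u1 v2 (v1 - v2) in let b := sub4 u2 (u1 + u2) (v2 - v1) v1 in
    (trace_form M + det4 * G) + a (trace_form M + det4 * G) + b (trace_form M + det4 * G) = 0 <->
    M + rho K.+2 (mx2 (-1) 1 1 0) *m M *m rho K.+2 (mx2 1 0 0 (-1)) +
      rho K.+2 (mx2 0 1 1 (-1)) *m M *m rho K.+2 (mx2 1 0 0 (-1)) = 0 /\ G + a G + b G = 0.
  move=> a b; have da : a det4 = det4 by apply: d4; rewrite /det4; ring.
  have db : b det4 = det4 by apply: d4; rewrite /det4; ring.
  have -> : a (trace_form M + det4 * G) =
      trace_form (rho K.+2 (mx2 (-1) 1 1 0) *m M *m rho K.+2 (mx2 1 0 0 (-1))) + det4 * a G.
    by rewrite /a rmorphD rmorphM /= s3 -[sub4 _ _ _ _ det4]/(a det4) da.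
  have -> : b (trace_form M + det4 * G) =
      trace_form (rho K.+2 (mx2 0 1 1 (-1)) *m M *m rho K.+2 (mx2 1 0 0 (-1))) + det4 * b G.
    by rewrite /b rmorphD rmorphM /= s4 -[sub4 _ _ _ _ det4]/(b det4) db.
  have := uniq (M + rho K.+2 (mx2 (-1) 1 1 0) *m M *m rho K.+2 (mx2 1 0 0 (-1)) +
      rho K.+2 (mx2 0 1 1 (-1)) *m M *m rho K.+2 (mx2 1 0 0 (-1))) 0 (G + a G + b G) 0.
  by rewrite !fD f0 mulr0 addr0 !mulrDr add3ACA.
set E := rho K.+2 (mx2 1 0 0 (-1)) in e1 e2 e4 *.
have EE : E *m E = 1%:M.
  by apply: rho_involution => //; left; rewrite -mx2_id mul_mx2; apply: eq_mx2; ring.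
(* Invariance under eps on both sides moves the right factor eps to the left, where it turns the
   matrices into S, U and, up to sign, U^2. *)
have hE (g : 'M[rat]_2) : E *m M *m E = M -> rho K.+2 g *m M *m E = rho K.+2 (g *m mx2 1 0 0 (-1)) *m M.
  by move=> EME; rewrite -{1}EME rhoM -/E !mulmxA -(mulmxA _ E E) EE mulmx1.
have H1 : mx2 0 1 1 0 *m mx2 1 0 0 (-1) = mx2 0 (-1) 1 0 :> 'M[rat]_2.
  by rewrite mul_mx2; apply: eq_mx2; ring.
have H2 : mx2 (-1) 1 1 0 *m mx2 1 0 0 (-1) = mx2 (-1) (-1) 1 0 :> 'M[rat]_2.
  by rewrite mul_mx2; apply: eq_mx2; ring.
have H3 : rho K.+2 (mx2 0 1 1 (-1) *m mx2 1 0 0 (-1)) = rho K.+2 (mx2 (-1) (-1) 1 0 *m mx2 (-1) (-1) 1 0 : 'M[rat]_2).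
  by rewrite -[LHS]rhoN//; congr (rho _ _); rewrite !mul_mx2 -mx2N; apply: eq_mx2; ring.
have K1 := hE (mx2 0 1 1 0); have K2 := hE (mx2 (-1) 1 1 0); have K3 := hE (mx2 0 1 1 (-1)).
rewrite H1 in K1; rewrite H2 in K2; rewrite H3 in K3.
split=> [[_ /e1[M1 G1] /e2[M2 G2] /e3[M3 G3] /e4[M4 G4]]|].
  split; last by split.
  split; [exact: M3|exact: M2| |].
    by rewrite -(K1 M2); exact: M1.
  by rewrite -(K2 M2) -(K3 M2); exact: M4.
move=> [[M3 M2 M1 M4] [_ G1 G2 G3 G4]]; split.
- apply: rpredD; first exact: homogeneous_trace_form.
  have [hu1 hu2 hv1 hv2] := homogeneous4_vars.
  apply: (@homogeneous4M 2 K) Gh; apply: rpredD; [exact: (@homogeneous4M 1 1)|exact: (@homogeneous4M 1 1)].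
- by apply/e1; rewrite (K1 M2); split; [exact: M1|exact: G1].
- by apply/e2; split; [exact: M2|exact: G2].
- by apply/e3; split; [exact: M3|exact: G3].
- by apply/e4; rewrite (K2 M2) (K3 M2); split; [exact: M4|exact: G4].
Qed.

(** The index h stands for the degree 2 h. The new summand belongs to the degree N = 2 h' + 2 and is
    the square of dim M_(N+2). *)
Fixpoint dim_bracket_kernel h : nat :=
  if h is h'.+1 then (dim_modular h'.*2.+2.+2 ^ 2 + dim_bracket_kernel h')%N else 0.

Lemma has_dim_bracket_kernel h : has_dim (bracket_kernel h.*2) (dim_bracket_kernel h).
Proof.
elim: h => [|h IH]; first by apply: has_dim0; [case: (lsub_bracket_kernel 0)|exact: bracket_kernel0].
have eK : ~~ odd h.*2 by rewrite odd_double.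
rewrite doubleS /=.
have eK2 : ~~ odd h.*2.+2 by rewrite /= negbK.
have HM := has_dim_rho_periods eK2 (ltn0Sn _).
set SM := mkset _ in HM.
pose f (x : 'M[rat]_h.*2.+3 * P) := trace_form x.1 + det4 * x.2.
have fl c u v : f (c *: u + v) = c *: f u + f v.
  by rewrite /f /= trace_formP mulrDr -scalerAr scalerDr addrACA.
have SMl : lsub SM.
  split=> [|c M M' [a1 a2 a3 a4] [b1 b2 b3 b4]].
    by split; rewrite ?trmx0 ?mulmx0 ?mul0mx ?oppr0 ?addr0.
  split.
  - by rewrite linearP /= a1 b1.
  - by rewrite mulmxDr mulmxDl -!scalemxAr -!scalemxAl a2 b2.
  - by rewrite mulmxDr -scalemxAr a3 b3 scalerN opprD.
  - rewrite !mulmxDr -!scalemxAr.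
    exact: three_term_lin a4 b4.
have -> : bracket_kernel h.*2.+2 = [set w | exists2 u, SM u.1 /\ bracket_kernel h.*2 u.2 & w = f u].
  apply/seteqP; split=> [F FK|_ [[M G] [/= MS GK] ->]]; last first.
    by apply/bracket_kernel_step => //; case: GK.
  have [Fh _ _ _ _] := FK; have [M [G [Gh FE]]] := trace_form_section Fh.
  have := FK; rewrite FE => /(bracket_kernel_step M eK Gh) [MS GK].
  by exists (M, G).
apply: (@has_dim_inj _ _ _ f fl [set x | SM x.1 /\ bracket_kernel h.*2 x.2]).
- exact: (@has_dim_prod _ _ _ SM (bracket_kernel h.*2) _ _ SMl (lsub_bracket_kernel _) HM IH).
- exact: lsub_prod SMl (lsub_bracket_kernel _).
- move=> [M G] _ /= E; have [] := @trace_form_inj _ M (- G).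
    by apply/eqP; rewrite mulrN -addr_eq0; apply/eqP; exact: E.
  by move=> -> /eqP; rewrite oppr_eq0 => /eqP->.
Qed.

End BiSymmetric.

(** * Spans of possibly infinite families and dimensions modulo a subspace *)

Section Span.
Variables (K : fieldType) (V : lmodType K) (T : Type).
Implicit Types (J : pred T) (g : T -> V).

Definition span_of J g : set V :=
  [set v | exists2 s : seq (K * T), all (fun a => J a.2) s & v = \sum_(a <- s) a.1 *: g a.2].

Lemma lsub_span J g : lsub (span_of J g).
Proof.
split=> [|c u v [s sJ ->] [t tJ ->]]; first by exists [::] => //; rewrite big_nil.
exists ([seq (c * a.1, a.2) | a <- s] ++ t); first by rewrite all_cat all_map sJ.
rewrite big_cat big_map scaler_sumr /=; congr (_ + _).
by apply: eq_bigr => a _; rewrite scalerA.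
Qed.

Lemma span_gen J g t : J t -> span_of J g (g t).
Proof. by move=> Jt; exists [:: (1, t)]; rewrite /= ?Jt// big_seq1 scale1r. Qed.

Lemma span_min J g (S : set V) : lsub S -> (forall t, J t -> S (g t)) -> span_of J g `<=` S.
Proof.
move=> [S0 Sl] Sg _ [s sJ ->]; elim: s sJ => [|a s IH] /=; first by rewrite big_nil.
by move=> /andP[Ja sJ]; rewrite big_cons; apply: Sl; [exact: Sg|exact: IH].
Qed.

End Span.

Lemma lsub_preim (K : fieldType) (V W : lmodType K) (h : V -> W) (S : set W) :
  (forall c u v, h (c *: u + v) = c *: h u + h v) -> lsub S -> lsub [set v | S (h v)].
Proof.
by move=> hl [S0 S1]; split=> [|c u v hu hv]; rewrite /= ?(lin0 hl)// hl; exact: S1.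
Qed.

Lemma span_bilinear (K : fieldType) (U V W : lmodType K) (T T' : Type) (J : pred T) (J' : pred T')
    (g : T -> U) (g' : T' -> V) (b : U -> V -> W) :
  (forall c u v w, b (c *: u + v) w = c *: b u w + b v w) ->
  (forall c u v w, b w (c *: u + v) = c *: b w u + b w v) ->
  forall u v, span_of J g u -> span_of J' g' v ->
  span_of (fun t => J t.1 && J' t.2) (fun t => b (g t.1) (g' t.2)) (b u v).
Proof.
move=> bl br u v Su Sv.
set S := span_of _ _; have lS : lsub S := lsub_span _ _.
apply: (span_min (lsub_preim (h := b^~ v) _ lS) _ Su) => [c u1 u2|t Jt]; first exact: bl.
apply: (span_min (lsub_preim (h := b (g t)) _ lS) _ Sv) => [c u1 u2|t' Jt']; first exact: br.
by apply: (span_gen (fun t => b (g t.1) (g' t.2)) (t := (t, t'))); rewrite /= Jt Jt'.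
Qed.

Lemma has_dim_span_of (K : fieldType) (V : lmodType K) (T : Type) (I : finType) (t : I -> T)
    (J : pred T) (g : T -> V) (f : T -> V -> K) :
  (forall i c u v, f i (c *: u + v) = c * f i u + f i v) ->
  (forall i j, J (t i) -> J (t j) -> f (t i) (g (t j)) = (i == j)%:R) ->
  (forall x, J x -> exists i, t i = x) -> has_dim (span_of J g) #|[pred i | J (t i)]|.
Proof.
move=> fl fg tJ; apply: (@has_dim_coord _ _ _ _ _ (g \o t) (f \o t)) => /=.
- by move=> i Ji; exact: span_gen.
- by move=> i c u v; exact: fl.
- by move=> i j Ji Jj; exact: fg.
have Tl : lsub [set v : V | v = \sum_(i in [pred i | J (t i)]) f (t i) v *: g (t i)].
  split=> [|c u v /= uE vE] /=.
    rewrite big1// => i _; have := fl (t i) (-1) 0 0.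
    by rewrite scaler0 addr0 mulN1r addNr => ->; rewrite scale0r.
  rewrite {1}uE {1}vE scaler_sumr -big_split /=; apply: eq_bigr => i _.
  by rewrite fl scalerDl scalerA.
apply: (span_min Tl) => x Jx /=; have [i ix] := tJ x Jx.
rewrite -ix (bigD1 i)/=; last by rewrite inE ix.
rewrite fg ?ix// eqxx scale1r big1 ?addr0// => j /andP[Jj ji].
by rewrite -ix fg ?ix// (negbTE ji) scale0r.
Qed.

(** This takes the place of the projection onto V / I: a linear map that kills I and, on S, detects
    membership in I. *)
Lemma has_dim_mod_map (K : fieldType) (V W : lmodType K) (I S : set V) (f : V -> W) n :
  (forall c u v, f (c *: u + v) = c *: f u + f v) -> lsub S ->
  (forall v, I v -> f v = 0) -> (forall v, S v -> f v = 0 -> I v) ->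
  has_dim [set w | exists2 v, S v & w = f v] n -> has_dim_mod I S n.
Proof.
move=> fl Sl If Sf [b [Tb bI bS]].
have /choice[c cP] : forall i, exists v, S v /\ b i = f v.
  by move=> i; have [v Sv vE] := Tb i; exists v.
exists c; split=> [i|a /If h|v Sv].
- by have [] := cP i.
- apply: bI => /=; rewrite -[RHS]h lin_sum//; apply: eq_bigr => i _.
  by have [_ ->] := cP i.
- have [a /subr0_eq aE] := bS (f v) (ex_intro2 _ _ v Sv erefl).
  exists a; apply: Sf.
    have [S0 S1] := Sl; rewrite addrC -scaleN1r; apply: S1 => //; apply: lsub_sum => // i.
    by have [] := cP i.
  rewrite linB// lin_sum// aE; apply/eqP; rewrite subr_eq0; apply/eqP.
  by apply: eq_bigr => i _; have [_ ->] := cP i.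
Qed.

(** * A truncated algebra receiving the enveloping algebra *)

Record bilinear (P1 P2 : lmodType rat) := Bilinear {
  bilinear_fun :> P1 -> P1 -> P2;
  bilinear_left : forall c u v w, bilinear_fun (c *: u + v) w = c *: bilinear_fun u w + bilinear_fun v w;
  bilinear_right : forall c u v w, bilinear_fun w (c *: u + v) = c *: bilinear_fun w u + bilinear_fun w v }.

(* The algebra Q + P1 + P2 in which P1 P2 = P2 P1 = P2 P2 = 0 and P1 is multiplied by b. *)
Definition truncated (P1 P2 : lmodType rat) (b : bilinear P1 P2) : Type := (rat * (P1 * P2))%type.

Section Truncated.
Variables (P1 P2 : lmodType rat) (b : bilinear P1 P2).

HB.instance Definition _ := GRing.Lmodule.copy (truncated b) (rat^o * (P1 * P2))%type.

Definition tr_one : truncated b := (1, (0, 0)).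
Definition tr_mul (x y : truncated b) : truncated b :=
  (x.1 * y.1, (x.1 *: y.2.1 + y.1 *: x.2.1, x.1 *: y.2.2 + b x.2.1 y.2.1 + y.1 *: x.2.2)).

Lemma bilinear0l u : b 0 u = 0.
Proof. exact: (lin0 (fun c u v => bilinear_left b c u v _)). Qed.
Lemma bilinear0r u : b u 0 = 0.
Proof. exact: (lin0 (fun c u v => bilinear_right b c u v _)). Qed.
Lemma bilinearZl c u v : b (c *: u) v = c *: b u v.
Proof. by rewrite -[c *: u]addr0 bilinear_left bilinear0l addr0. Qed.
Lemma bilinearZr c u v : b u (c *: v) = c *: b u v.
Proof. by rewrite -[c *: v]addr0 bilinear_right bilinear0r addr0. Qed.
Lemma bilinearDl u v w : b (u + v) w = b u w + b v w.
Proof. by rewrite -[u]scale1r bilinear_left !scale1r. Qed.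
Lemma bilinearDr u v w : b w (u + v) = b w u + b w v.
Proof. by rewrite -[u]scale1r bilinear_right !scale1r. Qed.

Fact tr_mulA : associative tr_mul.
Proof.
move=> [x [x1 x2]] [y [y1 y2]] [z [z1 z2]]; rewrite /tr_mul /=.
congr (_, (_, _)); first by rewrite mulrA.
  by rewrite !scalerDr !scalerA [z * y]mulrC [z * x]mulrC addrA.
rewrite bilinearDl bilinearDr !bilinearZl !bilinearZr !scalerDr !scalerA [z * y]mulrC [z * x]mulrC.
by rewrite -!addrA; congr (_ + (_ + _)); rewrite addrCA.
Qed.
Fact tr_mul1 : left_id tr_one tr_mul.
Proof. by move=> [x [x1 x2]]; rewrite /tr_mul /= mul1r !scale1r !scaler0 bilinear0l !addr0. Qed.
Fact tr_mulr1 : right_id tr_one tr_mul.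
Proof. by move=> [x [x1 x2]]; rewrite /tr_mul /= mulr1 !scale1r !scaler0 bilinear0r !add0r. Qed.
Fact tr_mulDl : left_distributive tr_mul +%R.
Proof.
move=> [x [x1 x2]] [y [y1 y2]] [z [z1 z2]]; rewrite /tr_mul /=.
congr (_, (_, _)); rewrite ?mulrDl// ?scalerDl ?scalerDr; first by rewrite addrACA.
by rewrite bilinearDl add3ACA.
Qed.
Fact tr_mulDr : right_distributive tr_mul +%R.
Proof.
move=> [x [x1 x2]] [y [y1 y2]] [z [z1 z2]]; rewrite /tr_mul /=.
congr (_, (_, _)); rewrite ?mulrDr// ?scalerDl ?scalerDr; first by rewrite addrACA.
by rewrite bilinearDr add3ACA.
Qed.
Fact tr_one_neq0 : tr_one != 0.
Proof. by apply/negP => /eqP/(congr1 fst)/eqP; rewrite oner_eq0. Qed.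

HB.instance Definition _ := GRing.Zmodule_isNzRing.Build (truncated b)
  tr_mulA tr_mul1 tr_mulr1 tr_mulDl tr_mulDr tr_one_neq0.

End Truncated.

Section EnvelopingMap.
Variables (L : lmodType rat) (bracket : L -> L -> L) (P1 P2 : lmodType rat) (b : bilinear P1 P2).
Variables (psi1 : L -> P1) (psi2 : L -> P2).
Hypotheses (l1 : forall c u v, psi1 (c *: u + v) = c *: psi1 u + psi1 v)
  (l2 : forall c u v, psi2 (c *: u + v) = c *: psi2 u + psi2 v)
  (br1 : forall u v, psi1 (bracket u v) = 0)
  (br2 : forall u v, psi2 (bracket u v) = b (psi1 u) (psi1 v) - b (psi1 v) (psi1 u)).

Definition tr_letter (x : L) : truncated b := (0, (psi1 x, psi2 x)).
Definition tr_scalar (c : rat) : truncated b := (c, (0, 0)).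
Definition tr_word (w : fmonom L) : truncated b := \prod_(x <- fmonom_val w) tr_letter x.

Lemma tr_scalar_morph : additive tr_scalar * multiplicative tr_scalar.
Proof.
split; first by move=> c d; rewrite /tr_scalar; congr (_, (_, _)); rewrite subr0.
by split=> // c d; congr (_, (_, _)); rewrite /= !scaler0 ?bilinear0l ?addr0.
Qed.

HB.instance Definition _ := GRing.isAdditive.Build rat (truncated b) tr_scalar tr_scalar_morph.1.
HB.instance Definition _ := GRing.isMultiplicative.Build rat (truncated b) tr_scalar tr_scalar_morph.2.

Lemma tr_word_morph : mmorphism tr_word.
Proof.
split; last by rewrite /tr_word fm1 big_nil.
by move=> w w'; rewrite /tr_word -big_cat fmM.
Qed.

HB.instance Definition _ := monalg.isMultiplicative.Build _ _ tr_word tr_word_morph.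

Definition tr_map : free_alg L -> truncated b := monalg.mmap tr_scalar tr_word.

Lemma tr_scalarE c (x : truncated b) : tr_scalar c * x = c *: x.
Proof.
case: x => [x [x1 x2]]; congr (_, (_, _)); rewrite /= ?scaler0 ?addr0//.
by rewrite bilinear0l addr0.
Qed.

Lemma tr_scalarC c (x : truncated b) : x * tr_scalar c = c *: x.
Proof.
case: x => [x [x1 x2]]; congr (_, (_, _)); rewrite /= ?scaler0 ?add0r//; first exact: mulrC.
by rewrite bilinear0r add0r.
Qed.

Lemma tr_map_comm : forall (g : free_alg L) m m', GRing.comm (tr_scalar (monalg.mcoeff m g)) (tr_word m').
Proof. by move=> g m m'; rewrite /GRing.comm tr_scalarE tr_scalarC. Qed.

Lemma tr_mapM p q : tr_map (p * q) = tr_map p * tr_map q.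
Proof. exact: (monalg.commr_mmap_is_multiplicative tr_map_comm).1. Qed.

Lemma tr_mapP c p q : tr_map (c *: p + q) = c *: tr_map p + tr_map q.
Proof. by rewrite /tr_map monalg.mmapD monalg.mmapZ tr_scalarE. Qed.

Lemma tr_map_letter x : tr_map (letter x) = tr_letter x.
Proof.
by rewrite /tr_map /letter monalg.mmapU tr_scalarE scale1r /tr_word fmuE big_seq1.
Qed.

Lemma tr_map_ideal p : enveloping_ideal bracket p -> tr_map p = 0.
Proof.
have lB (u v : free_alg L) : tr_map (u - v) = tr_map u - tr_map v := linB tr_mapP u v.
elim=> [c x y|x y|p' q' _ pE _ qE|p' q' r' _ qE].
- rewrite lB tr_mapP !tr_map_letter; apply/eqP; rewrite subr_eq0; apply/eqP.
  by rewrite /tr_letter l1 l2; congr (_, _); rewrite /= scaler0 addr0.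
- have M u v : tr_map (letter u * letter v) = tr_letter u * tr_letter v.
    by rewrite tr_mapM (tr_map_letter u) (tr_map_letter v).
  have E : tr_letter x * tr_letter y - tr_letter y * tr_letter x - tr_letter (bracket x y) = 0.
    apply/eqP; rewrite subr_eq0; apply/eqP.
    rewrite /tr_letter br1 br2; congr (_, (_, _)); rewrite /= ?mul0r ?subr0 ?scale0r ?addr0 ?subr0//.
    by rewrite !add0r.
  rewrite -[RHS]E (lB (letter x * letter y - letter y * letter x)) (lB (letter x * letter y)).
  exact: (congr2 (fun u v => u - v) (congr2 (fun u v => u - v) (M x y) (M y x)) (tr_map_letter _)).
- by rewrite -[p']scale1r tr_mapP pE qE scaler0 addr0.
- by rewrite 2!tr_mapM qE mulr0 mul0r.
Qed.

End EnvelopingMap.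

(** * The ari bracket in depths 1 and 2 *)

Section Brackets.
Local Notation P1 := (mpoly (1 + 1) rat).
Local Notation P := (mpoly (2 + 2) rat).
Local Notation u1 := (uvar (ord0 : 'I_2)).
Local Notation u2 := (uvar (ord_max : 'I_2)).
Local Notation v1 := (vvar (ord0 : 'I_2)).
Local Notation v2 := (vvar (ord_max : 'I_2)).
Local Notation u0 := (uvar (ord0 : 'I_1)).
Local Notation v0 := (vvar (ord0 : 'I_1)).

Definition sub2 n (a b : mpoly n rat) : P1 -> mpoly n rat :=
  mmap (@mpolyC n rat) (fun i : 'I_(1 + 1) => match fintype.split i with inl _ => a | inr _ => b end).

HB.instance Definition _ n a b := GRing.RMorphism.on (@sub2 n a b).

Lemma sub2_vars n (a b : mpoly n rat) : sub2 a b u0 = a /\ sub2 a b v0 = b.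
Proof.
rewrite /sub2 /uvar /vvar !mmapX !mmap1U.
by rewrite (unsplitK (inl _ (ord0 : 'I_1))) (unsplitK (inr _ (ord0 : 'I_1))).
Qed.

Lemma sub2P n (a b : mpoly n rat) (c : rat) p q : sub2 a b (c *: p + q) = c *: sub2 a b p + sub2 a b q.
Proof. by rewrite rmorphD /= /sub2 mmapZ mul_mpolyC. Qed.

Lemma bm_eval1 n (A : bimould) (x : mpoly n rat * mpoly n rat) :
  bm_eval A [:: x] = sub2 x.1 x.2 (A 1%N).
Proof.
rewrite /bm_eval /comp_mpoly /sub2; congr (mmap _ _ _); apply/funext => i.
by rewrite tnth_mktuple; case: fintype.split => j; rewrite (ord1 j).
Qed.

Lemma bm_eval_nil n (A : bimould) : A 0%N = 0 -> bm_eval A [::] = 0 :> mpoly n rat.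
Proof. exact: (@bm_eval0 n A [::]). Qed.

Lemma mu_at2 n (A B : bimould) (x y : mpoly n rat * mpoly n rat) : A 0%N = 0 -> B 0%N = 0 ->
  mu_at A B [:: x; y] = bm_eval A [:: x] * bm_eval B [:: y].
Proof.
move=> A0 B0; rewrite /mu_at !big_ord_recl big_ord0 /= !bm_eval_nil//.
by rewrite mul0r mulr0 add0r !addr0.
Qed.

Lemma arit_at2 n (A B : bimould) (x y : mpoly n rat * mpoly n rat) :
  arit_at B A [:: x; y] =
  bm_eval A [:: (y.1 + x.1, y.2)] * bm_eval B [:: (x.1, x.2 - y.2)] -
  bm_eval A [:: (x.1 + y.1, x.2)] * bm_eval B [:: (y.1, y.2 - x.2)].
Proof.
rewrite /arit_at; congr (_ - _).
  under eq_bigr do rewrite big_mkcond !big_ord_recl big_ord0 /= /bump /=.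
  by rewrite !big_ord_recl !big_ord0 /= /bump /= !addr0 !add0r /lceil /rfloor /usum /= big_seq1.
under eq_bigr do rewrite big_mkcond !big_ord_recl big_ord0 /= /bump /=.
by rewrite !big_ord_recl !big_ord0 /= /bump /= !addr0 !add0r /rceil /lfloor /usum /add_last_u /= big_seq1.
Qed.

Lemma arit_at1 n (A B : bimould) (x : mpoly n rat * mpoly n rat) : arit_at B A [:: x] = 0.
Proof.
rewrite /arit_at !big1 ?subr0// => i _; apply: big_pred0 => j; apply/negbTE/negP => /andP[].
  by have := ltn_ord j; rewrite /=; lia.
by have := ltn_ord j; rewrite /=; lia.
Qed.

Lemma gword2 : gword 2 = [:: (u1, v1); (u2, v2)].
Proof.
rewrite /gword; have -> : enum 'I_2 = [:: ord0; ord_max].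
  by apply: (inj_map val_inj); rewrite val_enum_ord.
by [].
Qed.

Definition tens (p q : P1) : P := sub2 u1 v1 p * sub2 u2 v2 q.
Definition cyclic_sum (F : P) : P :=
  F + sub4 (u1 + u2) u1 v2 (v1 - v2) F + sub4 u2 (u1 + u2) (v2 - v1) v1 F.

Lemma sub4_sub2 a b c d (x y : P) p :
  sub4 a b c d (sub2 x y p) = sub2 (sub4 a b c d x) (sub4 a b c d y) p.
Proof.
rewrite /sub2 /mmap rmorph_sum /=; apply: eq_bigr => m _.
rewrite rmorphM /= /mmap1 rmorph_prod /=; congr (_ * _); first by rewrite /sub4 /eval4 mmapC.
by apply: eq_bigr => i _; rewrite rmorphXn /=; case: fintype.split.
Qed.

Lemma sub4_tens a b c d p q : sub4 a b c d (tens p q) = sub2 a c p * sub2 b d q.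
Proof.
rewrite /tens rmorphM /= (sub4_sub2 a b c d u1 v1 p) (sub4_sub2 a b c d u2 v2 q).
by have [-> -> -> ->] := sub4_vars a b c d.
Qed.

Lemma sub4B a b c d F G : sub4 a b c d (F - G) = sub4 a b c d F - sub4 a b c d G.
Proof. exact: rmorphB. Qed.

Lemma cyclic_rearrange (A : comNzRingType) (p q r s p' q' r' s' c : A) :
  p * q - r * s - (p' * q' - r' * s') + c = c + (p * q - p' * q') + (s' * r' - s * r).
Proof. by ring. Qed.

(** [lu] gives the term without substitution; the first sums of the two [arit] combine to the
    substitution of order 3, the second sums to its square. *)
Lemma ari2 (A B : BARI) : bari_val (ari A B) 2 =
  cyclic_sum (tens (bari_val A 1%N) (bari_val B 1%N) - tens (bari_val B 1%N) (bari_val A 1%N)).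
Proof.
have A0 : bari_val A 0%N = 0 by case: A => A /= /bariP[].
have B0 : bari_val B 0%N = 0 by case: B => B /= /bariP[].
rewrite -[LHS]/(bm_arit B A 2 - bm_arit A B 2 + (bm_mu A B 2 - bm_mu B A 2)).
rewrite /bm_arit /bm_mu gword2 !arit_at2 !mu_at2// !bm_eval1 /=.
rewrite /cyclic_sum 2!sub4B 4!sub4_tens (addrC u2 u1).
exact: cyclic_rearrange.
Qed.

Lemma ari1 (A B : BARI) : bari_val (ari A B) 1 = 0.
Proof.
have A0 : bari_val A 0%N = 0 by case: A => A /= /bariP[].
have B0 : bari_val B 0%N = 0 by case: B => B /= /bariP[].
rewrite -[LHS]/(bm_arit B A 1%N - bm_arit A B 1%N + (bm_mu A B 1%N - bm_mu B A 1%N)).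
have gw : gword 1 = [:: (u0, v0)].
  by rewrite /gword (_ : enum 'I_1 = [:: ord0])//; apply: (inj_map val_inj); rewrite val_enum_ord.
rewrite /bm_arit /bm_mu gw !arit_at1 /mu_at /= !big_ord_recl !big_ord0 /=.
by rewrite !bm_eval_nil// !mul0r !mulr0 !addr0 !subr0 addr0.
Qed.

(** The pair (m, n) stands for the generator delta^m(xi_{2n+1,0}), of degree 2 m + 2 n; the depth
    adds 1 to its weight. *)
Definition gen1 (t : nat * nat) : P1 := (u0 * v0) ^+ t.1 * xi_poly t.2.
Definition weight1 (t : nat * nat) : nat := (t.1.*2 + t.2.*2).+1.

Lemma gen_in_bekma (t : nat * nat) : iter t.1 delta (xi t.2) \in bekma.
Proof. by apply/asboolP; exact: in_bekma_gen. Qed.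
Definition gen (t : nat * nat) : BEKMA := MkBEKMA (gen_in_bekma t).

Lemma gen_depth1 t : bari_val (bekma_val (gen t)) 1 = gen1 t.
Proof.
case: t => m n; rewrite /gen /= /gen1 /=; elim: m => [|m IH] /=; first by rewrite mul1r.
rewrite -[LHS]/((\sum_(i < 1) uvar i * vvar i) * bari_val (iter m delta (xi n)) 1).
by rewrite IH big_ord_recl big_ord0 addr0 exprS mulrA.
Qed.

Lemma gen_depth_ne t d : d <> 1%N -> bari_val (bekma_val (gen t)) d = 0.
Proof.
case: t => m n d1; rewrite /gen /=; elim: m => [|m IH] /=; first by case: d d1 => [|[]].
by rewrite -[LHS]/((\sum_(i < d) uvar i * vvar i) * bari_val (iter m delta (xi n)) d) IH mulr0.
Qed.

Lemma cyclic_sumP c F G : cyclic_sum (c *: F + G) = c *: cyclic_sum F + cyclic_sum G.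
Proof.
by rewrite /cyclic_sum (sub4P (u1 + u2) u1) (sub4P u2 (u1 + u2)) add3ACA !scalerDr.
Qed.

Lemma tensPl c p q r : tens (c *: p + q) r = c *: tens p r + tens q r.
Proof. by rewrite /tens sub2P mulrDl scalerAl. Qed.

Lemma tensPr c p q r : tens r (c *: p + q) = c *: tens r p + tens r q.
Proof. by rewrite /tens sub2P mulrDr scalerAr. Qed.

Definition bracket_poly p q : P := cyclic_sum (tens p q - tens q p).

Lemma bracket_polyPl c p q r : bracket_poly (c *: p + q) r = c *: bracket_poly p r + bracket_poly q r.
Proof.
rewrite /bracket_poly -cyclic_sumP tensPl tensPr; congr cyclic_sum.
by rewrite opprD addrACA scalerBr.
Qed.

Lemma bracket_polyPr c p q r : bracket_poly r (c *: p + q) = c *: bracket_poly r p + bracket_poly r q.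
Proof.
rewrite /bracket_poly -cyclic_sumP tensPl tensPr; congr cyclic_sum.
by rewrite opprD addrACA scalerBr.
Qed.

Lemma bari_valP (c : rat) (A B : BARI) d : bari_val (c *: A + B) d = c *: bari_val A d + bari_val B d.
Proof. by []. Qed.

Lemma bekma_valP (c : rat) (A B : BEKMA) : bekma_val (c *: A + B) = c *: bekma_val A + bekma_val B.
Proof. by []. Qed.

(** A bracket has no component of depth 1, and its component of depth 2 depends only on those of
    depth 1. Longer brackets therefore contribute nothing new here. *)
Lemma bekma_span M : in_bekma M -> span_of xpredT gen1 (bari_val M 1%N) /\
  span_of xpredT (fun t => bracket_poly (gen1 t.1) (gen1 t.2)) (bari_val M 2%N).
Proof.
have [L10 L1P] := lsub_span xpredT gen1.
have [L20 L2P] := lsub_span xpredT (fun t => bracket_poly (gen1 t.1) (gen1 t.2)).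
elim=> [m n||c A B _ [A1 A2] _ [B1 B2]|A B _ [A1 _] _ [B1 _]].
- split; first by rewrite -[iter _ _ _]/(bekma_val (gen (m, n))) gen_depth1; exact: span_gen.
  by rewrite -[iter _ _ _]/(bekma_val (gen (m, n))) gen_depth_ne.
- by split; [exact: L10|exact: L20].
- by rewrite 2!bari_valP; split; [exact: L1P|exact: L2P].
- rewrite ari1 ari2; split; first exact: L10.
  exact: (span_bilinear bracket_polyPl bracket_polyPr A1 B1).
Qed.

Lemma homogeneous_gen1 t : gen1 t \is ishomog1 (weight1 t).-1 (@mdeg (1 + 1)).
Proof.
case: t => m n; rewrite /gen1 /weight1 /=.
have hu : u0 \is ishomog1 1 (@mdeg (1 + 1)) by rewrite dhomogX /= mdeg1.
have hv : v0 \is ishomog1 1 (@mdeg (1 + 1)) by rewrite dhomogX /= mdeg1.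
apply: dhomogM.
  by rewrite -mul2n; apply: dhomogMn; exact: (dhomogM hu hv).
case: n => [|n]; first exact: dhomog1.
have X (x : P1) : x \is ishomog1 1 (@mdeg (1 + 1)) -> x ^+ (2 * n.+1) \is ishomog1 n.+1.*2 (@mdeg (1 + 1)).
  by move=> /(@dhomogMn _ _ _ _ _ (2 * n.+1)%N); rewrite mul1n mul2n.
by rewrite /xi_poly; apply: rpredD; exact: X.
Qed.

Lemma homogeneous_sub2 n (a b : mpoly n rat) d p : a \is ishomog1 1 (@mdeg n) ->
  b \is ishomog1 1 (@mdeg n) -> p \is ishomog1 d (@mdeg (1 + 1)) -> sub2 a b p \is ishomog1 d (@mdeg n).
Proof.
move=> ha hb /dhomogP hp; rewrite /sub2 /mmap big_seq; apply: rpred_sum => m /hp <-.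
rewrite mul_mpolyC; apply: rpredZ; rewrite /mmap1 big_split_ord /= !big_ord1.
rewrite (unsplitK (inl _ (ord0 : 'I_1))) (unsplitK (inr _ (ord0 : 'I_1))).
rewrite mdegE big_split_ord /= !big_ord1.
by apply: dhomogM; rewrite -[X in ishomog1 X]mul1n; exact: dhomogMn.
Qed.

End Brackets.

(** * The span of products of two generators *)

Section TensorSpace.
Local Notation P1 := (mpoly (1 + 1) rat).
Local Notation P := (mpoly (2 + 2) rat).
Local Notation u1 := (uvar (ord0 : 'I_2)).
Local Notation u2 := (uvar (ord_max : 'I_2)).
Local Notation v1 := (vvar (ord0 : 'I_2)).
Local Notation v2 := (vvar (ord_max : 'I_2)).
Local Notation u0 := (uvar (ord0 : 'I_1)).
Local Notation v0 := (vvar (ord0 : 'I_1)).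

Lemma sub4_comp a b c d a' b' c' d' (F : P) : sub4 a b c d (sub4 a' b' c' d' F) =
  sub4 (sub4 a b c d a') (sub4 a b c d b') (sub4 a b c d c') (sub4 a b c d d') F.
Proof.
rewrite {2 3}/sub4 /eval4 /mmap rmorph_sum /=; apply: eq_bigr => m _.
rewrite rmorphM /= /mmap1 rmorph_prod /=; congr (_ * _); first by rewrite /sub4 /eval4 mmapC.
apply: eq_bigr => i _; rewrite rmorphXn /=; congr (_ ^+ _).
by rewrite /letters4; case: fintype.split => j; case: ifP.
Qed.

Lemma sub2_comp n (x y : mpoly n rat) (x' y' : P1) p :
  sub2 x y (sub2 x' y' p) = sub2 (sub2 x y x') (sub2 x y y') p.
Proof.
rewrite {2}/sub2 {2}/sub2 /mmap rmorph_sum /=; apply: eq_bigr => m _.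
rewrite rmorphM /= /mmap1 rmorph_prod /=; congr (_ * _); first by rewrite /sub2 mmapC.
by apply: eq_bigr => i _; rewrite rmorphXn /=; case: fintype.split.
Qed.

Definition swapP1 : P1 -> P1 := sub2 v0 u0.
Definition evenP1 : P1 -> P1 := sub2 (- u0) (- v0).
HB.instance Definition _ := GRing.RMorphism.on swapP1.
HB.instance Definition _ := GRing.RMorphism.on evenP1.

Lemma tens_swapl p q : sub4 v1 u2 u1 v2 (tens p q) = tens (swapP1 p) q.
Proof.
rewrite sub4_tens /tens /swapP1 (sub2_comp u1 v1 v0 u0 p).
by have [-> ->] := sub2_vars u1 v1.
Qed.
Lemma tens_swapr p q : sub4 u1 v2 v1 u2 (tens p q) = tens p (swapP1 q).
Proof.
rewrite sub4_tens /tens /swapP1 (sub2_comp u2 v2 v0 u0 q).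
by have [-> ->] := sub2_vars u2 v2.
Qed.
Lemma tens_evenl p q : sub4 (- u1) u2 (- v1) v2 (tens p q) = tens (evenP1 p) q.
Proof.
rewrite sub4_tens /tens /evenP1 (sub2_comp u1 v1 (- u0) (- v0) p) 2!rmorphN /=.
by have [-> ->] := sub2_vars u1 v1.
Qed.
Lemma tens_evenr p q : sub4 u1 (- u2) v1 (- v2) (tens p q) = tens p (evenP1 q).
Proof.
rewrite sub4_tens /tens /evenP1 (sub2_comp u2 v2 (- u0) (- v0) q) 2!rmorphN /=.
by have [-> ->] := sub2_vars u2 v2.
Qed.
Lemma tens_swap p q : sub4 u2 u1 v2 v1 (tens p q) = tens q p.
Proof. by rewrite sub4_tens /tens mulrC. Qed.

Definition mono1 a c : P1 := u0 ^+ a * v0 ^+ c.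

Lemma sub2_mono1 n (x y : mpoly n rat) a c : sub2 x y (mono1 a c) = x ^+ a * y ^+ c.
Proof.
have [xE yE] := sub2_vars x y.
by rewrite /mono1 (rmorphM (sub2 x y)) (rmorphXn (sub2 x y)) (rmorphXn (sub2 x y) c) /= xE yE.
Qed.

Lemma swapP1_mono1 a c : swapP1 (mono1 a c) = mono1 c a.
Proof. by rewrite /swapP1 sub2_mono1 mulrC. Qed.

Lemma evenP1_mono1 a c : evenP1 (mono1 a c) = (-1) ^+ (a + c) *: mono1 a c.
Proof.
by rewrite /evenP1 sub2_mono1 -!scaleN1r !exprZn -scalerAl -scalerAr scalerA exprD.
Qed.

Lemma swapP1D p q : swapP1 (p + q) = swapP1 p + swapP1 q.
Proof. exact: rmorphD. Qed.

Lemma evenP1D p q : evenP1 (p + q) = evenP1 p + evenP1 q.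
Proof. exact: rmorphD. Qed.

Lemma gen1E t : gen1 t = if t.2 is 0 then mono1 t.1 t.1
  else mono1 (t.1 + t.2.*2) t.1 + mono1 t.1 (t.1 + t.2.*2).
Proof.
case: t => m n; rewrite /gen1 /mono1 exprMn /=; case: n => [|n]; first by rewrite mulr1.
by rewrite /xi_poly mul2n !exprD; ring.
Qed.

Lemma gen1_invariant t : swapP1 (gen1 t) = gen1 t /\ evenP1 (gen1 t) = gen1 t.
Proof.
case: t => m n; rewrite gen1E; case: n => [|n] /=.
  by rewrite swapP1_mono1 evenP1_mono1 [(m + m)%N]addnn -signr_odd odd_double scale1r.
have e : (-1) ^+ (m + n.+1.*2 + m) = 1 :> rat by rewrite -signr_odd (_ : odd _ = false) //; lia.
have e' : (-1) ^+ (m + (m + n.+1.*2)) = 1 :> rat by rewrite addnC.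
set x := (m + n.+1.*2)%N in e e' *.
rewrite (swapP1D (mono1 x m)) (swapP1_mono1 x m) (swapP1_mono1 m x).
rewrite (evenP1D (mono1 x m)) (evenP1_mono1 x m) (evenP1_mono1 m x) e e' 2!scale1r.
by rewrite [mono1 m x + _]addrC.
Qed.

(** The index of the generator in which u^a v^c occurs, when a + c is even. *)
Definition canon a c : nat * nat := (minn a c, (maxn a c - minn a c)./2).

Lemma mono1_average a c (S := fun p => p + swapP1 p) (E := fun p => p + evenP1 p) :
  exists2 x : rat, E (S (mono1 a c)) = x *: gen1 (canon a c) & odd (a + c) -> x = 0.
Proof.
have -> : E (S (mono1 a c)) = (1 + (-1) ^+ (a + c)) *: (mono1 a c + mono1 c a).
  rewrite /E /S (swapP1_mono1 a c) (evenP1D (mono1 a c)) (evenP1_mono1 a c) (evenP1_mono1 c a).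
  by rewrite (addnC c a) -scalerDr [RHS]scalerDl scale1r.
have [oac|eac] := boolP (odd (a + c)).
  by exists 0 => //; rewrite -signr_odd oac expr1 subrr !scale0r.
have [y yE] : exists y : rat, mono1 a c + mono1 c a = y *: gen1 (canon a c).
  rewrite /canon gen1E /=.
  have [ac|ca] := leqP a c.
    have cE : (a + ((c - a)./2).*2)%N = c by lia.
    case E2 : (c - a)./2 => [|h].
      (* For a = c the factor is 2 because [xi_poly 0] is 1 and not u^0 + v^0. *)
      exists 2%:R; rewrite (_ : c = a) ?scaler_nat -?mulr2n//; lia.
    by exists 1; rewrite -E2 cE scale1r addrC.
  have cE : (c + ((a - c)./2).*2)%N = a by lia.
  case E2 : (a - c)./2 => [|h].
    by exists 2%:R; rewrite (_ : c = a) ?scaler_nat -?mulr2n//; lia.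
  by exists 1; rewrite -E2 cE scale1r.
by exists ((1 + (-1) ^+ (a + c)) * y); rewrite ?yE ?scalerA// (negbTE eac).
Qed.

Definition pair_weight k : pred ((nat * nat) * (nat * nat)) :=
  fun t => (weight1 t.1 + weight1 t.2 == k)%N.

Definition tensor_space k : set P := span_of (pair_weight k) (fun t => tens (gen1 t.1) (gen1 t.2)).

(** The four operators 1 + (involution) multiply an invariant F by 2^4 = 16 and send every monomial
    to a multiple of a product of two generators. *)
Lemma average_in_tensor_space K (F : P) : homogeneous4 K F ->
  sub4 v1 u2 u1 v2 F = F -> sub4 u1 v2 v1 u2 F = F -> sub4 (- u1) u2 (- v1) v2 F = F ->
  sub4 u1 (- u2) v1 (- v2) F = F -> tensor_space K.+2 F.
Proof.
move=> /dhomogP Fh i1 i2 e1 e2.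
pose I1 F := F + sub4 v1 u2 u1 v2 F; pose I2 F := F + sub4 u1 v2 v1 u2 F.
pose E1 F := F + sub4 (- u1) u2 (- v1) v2 F; pose E2 F := F + sub4 u1 (- u2) v1 (- v2) F.
have lin (a b c d : P) (x : rat) (G H : P) : (x *: G + H) + sub4 a b c d (x *: G + H) =
    x *: (G + sub4 a b c d G) + (H + sub4 a b c d H).
  by rewrite (sub4P a b c d) addrACA scalerDr.
pose A F := E2 (E1 (I2 (I1 F))).
have Al c G H : A (c *: G + H) = c *: A G + A H.
  by rewrite /A /I1 lin /I2 lin /E1 lin /E2 lin.
have AF : A F = 16%:R *: F.
  have dbl c (a b x d : P) : sub4 a b x d F = F -> c *: F + sub4 a b x d (c *: F) = (c * 2) *: F.
    move=> E; rewrite -[c *: F]addr0 (sub4P a b x d) E rmorph0 !addr0 -scalerDl.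
    by rewrite mulr_natr mulr2n.
  have dbl1 (a b x d : P) : sub4 a b x d F = F -> F + sub4 a b x d F = (1 * 2) *: F.
    by move=> E; have := dbl 1 _ _ _ _ E; rewrite scale1r.
  rewrite /A /I1 (dbl1 _ _ _ _ i1) /I2 (dbl _ _ _ _ _ i2) /E1 (dbl _ _ _ _ _ e1) /E2 (dbl _ _ _ _ _ e2).
  by congr (_ *: _); ring.
have [T0 TP] := lsub_span (pair_weight K.+2) (fun t => tens (gen1 t.1) (gen1 t.2)).
have ATm m : mdeg m = K -> tensor_space K.+2 (A (mpolyX rat m)).
  move=> mK; rewrite mpolyX4.
  set a := m _; set b := m _; set c := m (rshift 2 ord0); set d := m _.
  have -> : u1 ^+ a * u2 ^+ b * (v1 ^+ c * v2 ^+ d) = tens (mono1 a c) (mono1 b d).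
    by rewrite /tens !sub2_mono1; ring.
  have abcd : (a + c + (b + d))%N = K.
    rewrite -mK mdegE big_split_ord /= !big_ord_recl !big_ord0 !addn0.
    have -> : lshift 2 (lift ord0 ord0) = lshift 2 (ord_max : 'I_2) by apply: ord_inj.
    have -> : rshift 2 (lift ord0 ord0) = rshift 2 (ord_max : 'I_2) by apply: ord_inj.
    by rewrite /a /b /c /d; lia.
  have Dl p p' q : tens p q + tens p' q = tens (p + p') q by rewrite /tens rmorphD mulrDl.
  have Dr p p' q : tens q p + tens q p' = tens q (p + p') by rewrite /tens rmorphD mulrDr.
  rewrite /A /I1 tens_swapl Dl /I2 tens_swapr Dr /E1 tens_evenl Dl /E2 tens_evenr Dr.
  have [x -> xo] := mono1_average a c; have [y -> yo] := mono1_average b d.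
  rewrite -[x *: _]addr0 tensPl -[y *: _]addr0 tensPr.
  have t0 p : tens p 0 = 0 by rewrite /tens rmorph0 mulr0.
  have t0l p : tens 0 p = 0 by rewrite /tens rmorph0 mul0r.
  rewrite t0 t0l !addr0 -[_ *: _]addr0.
  have [oac|eac] := boolP (odd (a + c)); first by rewrite xo// scale0r addr0.
  have [obd|ebd] := boolP (odd (b + d)); first by rewrite yo// scale0r scaler0 addr0.
  apply: (TP) => //; rewrite -[_ *: tens _ _]addr0; apply: (TP) => //.
  apply: (span_gen (fun t => tens (gen1 t.1) (gen1 t.2)) (t := (canon a c, canon b d))).
  by rewrite /pair_weight /canon /weight1 /=; apply/eqP; lia.
have FE : A F = \sum_(m <- msupp F) mcoeff m F *: A (mpolyX rat m).
  rewrite [in LHS](mpolyE F); elim: (msupp F) => [|m s IH].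
    by rewrite !big_nil (lin0 Al).
  by rewrite !big_cons Al IH.
have -> : F = 16%:R^-1 *: A F by rewrite AF scalerA mulVf// scale1r.
rewrite -[_ *: _]addr0; apply: (TP) => //; rewrite FE big_seq; elim/big_rec: _ => // m G ms GT.
by apply: (TP) => //; apply: ATm; exact: Fh.
Qed.

(** Conjugation with the exchange of the letters, under which F changes sign, gives the symmetries
    in the second letter. The weight exceeds the degree by the depth 2. *)
Lemma bracket_kernel_tensor K : bracket_kernel K =
  [set F | tensor_space K.+2 F /\ (sub4 u2 u1 v2 v1 F = - F /\ cyclic_sum F = 0)].
Proof.
apply/seteqP; split=> [F [Fh FN Fe Fi Fc]|F [FT [FN Fc]]].
  split; last by split.
  have cj a b c d : sub4 a b c d F = F ->
      sub4 (sub4 u2 u1 v2 v1 (sub4 a b c d u2)) (sub4 u2 u1 v2 v1 (sub4 a b c d u1))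
        (sub4 u2 u1 v2 v1 (sub4 a b c d v2)) (sub4 u2 u1 v2 v1 (sub4 a b c d v1)) F = F.
    move=> E; rewrite -sub4_comp -sub4_comp FN rmorphN /= E rmorphN /= FN.
    exact: opprK.
  apply: (average_in_tensor_space Fh Fi _ Fe).
    have := cj _ _ _ _ Fi; have [-> -> -> ->] := sub4_vars v1 u2 u1 v2.
    by have [-> -> -> ->] := sub4_vars u2 u1 v2 v1.
  have := cj _ _ _ _ Fe; have [-> -> -> ->] := sub4_vars (- u1) u2 (- v1) v2.
  by rewrite 2!rmorphN /=; have [-> -> -> ->] := sub4_vars u2 u1 v2 v1.
have L (a b c d : P) : lsub [set F : P | sub4 a b c d F = F].
  split=> [|x G H] /=; first exact: rmorph0.
  by rewrite (sub4P a b c d) => -> ->.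
have Lh : lsub [set F : P | homogeneous4 K F].
  split=> [|x G H Gh Hh] /=; first exact: rpred0.
  by apply: rpredD => //; exact: rpredZ.
split=> //.
- apply: (span_min Lh _ FT) => t /eqP tk /=.
  have [hu1 hu2 hv1 hv2] := homogeneous4_vars.
  rewrite (_ : K = (weight1 t.1).-1 + (weight1 t.2).-1)%N; last by move: tk; rewrite /weight1; lia.
  by apply: homogeneous4M; apply: homogeneous_sub2 => //; exact: homogeneous_gen1.
- apply: (span_min (L _ _ _ _) _ FT) => t _ /=.
  by rewrite tens_evenl; have [_ ->] := gen1_invariant t.1.
- apply: (span_min (L _ _ _ _) _ FT) => t _ /=.
  by rewrite tens_swapl; have [-> _] := gen1_invariant t.1.
Qed.

Definition mk4 a b c d : multinom (2 + 2) := Multinom (mktuple (letters4 a b c d)).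

Lemma mk4X a b c d : mpolyX rat (mk4 a b c d) = u1 ^+ a * u2 ^+ b * (v1 ^+ c * v2 ^+ d).
Proof.
rewrite mpolyX4 !multinomE !tnth_mktuple /letters4.
have L (j : 'I_2) : fintype.split (lshift 2 j) = inl j := unsplitK (inl _ j).
have R (j : 'I_2) : fintype.split (rshift 2 j) = inr j := unsplitK (inr _ j).
by rewrite !L !R.
Qed.

Lemma mk4_inj a b c d a' b' c' d' : (mk4 a b c d == mk4 a' b' c' d') =
  ((a, c) == (a', c')) && ((b, d) == (b', d')).
Proof.
apply/eqP/andP => [E|[/eqP[-> ->] /eqP[-> ->]]//].
have L (j : 'I_2) : fintype.split (lshift 2 j) = inl j := unsplitK (inl _ j).
have R (j : 'I_2) : fintype.split (rshift 2 j) = inr j := unsplitK (inr _ j).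
have H i := congr1 (fun m : multinom (2 + 2) => m i) E.
move: (H (lshift 2 ord0)) (H (lshift 2 ord_max)) (H (rshift 2 ord0)) (H (rshift 2 ord_max)).
by rewrite !multinomE !tnth_mktuple /letters4 !L !R /= => -> -> -> ->.
Qed.

Lemma tens_mono1 a b c d : tens (mono1 a c) (mono1 b d) = mpolyX rat (mk4 a b c d).
Proof. by rewrite mk4X /tens !sub2_mono1; ring. Qed.

(** In a product of two generators exactly one monomial has u-exponents at least the v-exponents in
    both letters, and its coefficient is 1; reading off these coefficients gives the dual basis. *)
Definition coord (t : (nat * nat) * (nat * nat)) (F : P) : rat :=
  mcoeff (mk4 (t.1.1 + t.1.2.*2) (t.2.1 + t.2.2.*2) t.1.1 t.2.1) F.

Lemma gen_exponents (p q m n : nat) :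
  [/\ ((p == m + n.*2) && (p == m))%N = (m == p) && (n == 0)%N,
      ((p + q.+1.*2 == m + n.*2) && (p == m))%N = (m == p) && (n == q.+1) &
      ((p == m + n.*2) && (p + q.+1.*2 == m))%N = false].
Proof. by split; lia. Qed.

Lemma coord_tens t s : coord t (tens (gen1 s.1) (gen1 s.2)) = (t == s)%:R.
Proof.
have A0 p m n : ((p == m + n.*2) && (p == m))%N = (m == p) && (n == 0)%N.
  by have [] := gen_exponents p 0 m n.
have A1 p q m n : ((p + q.+1.*2 == m + n.*2) && (p == m))%N = (m == p) && (n == q.+1).
  by have [] := gen_exponents p q m n.
have A2 p q m n : ((p == m + n.*2) && (p + q.+1.*2 == m))%N = false.
  by have [] := gen_exponents p q m n.
have Dl p p' q : tens (p + p') q = tens p q + tens p' q by rewrite /tens rmorphD mulrDl.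
have Dr p p' q : tens q (p + p') = tens q p + tens q p' by rewrite /tens rmorphD mulrDr.
have cm a b c d : coord t (mpolyX rat (mk4 a b c d)) =
    (((a, c) == (t.1.1 + t.1.2.*2, t.1.1)%N) && ((b, d) == (t.2.1 + t.2.2.*2, t.2.1)%N))%:R.
  by rewrite /coord mcoeffX mk4_inj.
have cD F G : coord t (F + G) = coord t F + coord t G by exact: mcoeffD.
case: t cm cD => [[m n] [m' n']] cm cD; case: s => [[p q] [p' q']]; rewrite !gen1E /=.
case: q => [|q]; case: q' => [|q'] /=; rewrite ?Dl ?Dr !tens_mono1 ?cD !cm /= -?natrD; congr (_%:R);
  rewrite !xpair_eqE ?A0 ?A1 ?A2 ?andbF ?andFb ?addn0 ?A1 //.
Qed.

End TensorSpace.

Lemma mulrB_split (A : nzRingType) (p q p' q' : A) : p * q - p' * q' = (p - p') * q + p' * (q - q').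
Proof. by rewrite mulrBl mulrBr subrKA. Qed.

Lemma mulr_scale_rat (A : lalgType rat) c (u v : A) : u * (c *: v) = c *: (u * v).
Proof. by apply: (rat_linear (f := fun x => u * x)) => x y; exact: mulrBr. Qed.

(** * Words in the generators span the enveloping algebra in depth at most 2 *)

Section LowDepth.
Variables (L : lmodType rat) (bracket : L -> L -> L) (homogeneous : nat -> nat -> set L).
Variables (T : Type) (wt : T -> nat) (g : T -> L).
Hypotheses (h0 : forall k x, homogeneous k 0 x -> x = 0)
  (h1 : forall k x, homogeneous k 1 x -> span_of (fun t => wt t == k) g x)
  (h2 : forall k x, homogeneous k 2 x ->
     span_of (fun t => wt t.1 + wt t.2 == k)%N (fun t => bracket (g t.1) (g t.2)) x).

Local Notation A := (free_alg L).
Local Notation I := (@enveloping_ideal L bracket).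
Implicit Types p q r : A.

Lemma ideal_left p q : I q -> I (p * q).
Proof. by move=> Iq; rewrite -[p * q]mulr1; exact: ideal_mul. Qed.

Lemma ideal_right q r : I q -> I (q * r).
Proof. by move=> Iq; rewrite -[q * r]mul1r mulrA; exact: ideal_mul. Qed.

Lemma ideal0 : I 0.
Proof. by rewrite -(mul0r (letter (1 *: (0 : L) + 0) - (1 *: letter 0 + letter 0))); apply: ideal_left; exact: letter_lin. Qed.

Lemma lsub_ideal : lsub I.
Proof.
split=> [|c p q Ip Iq]; first exact: ideal0.
apply: ideal_add Iq; rewrite -[p]mul1r scalerAl; exact: ideal_left.
Qed.

Definition mod_ideal (S : set A) : set A := [set p | exists2 q, S q & I (p - q)].

Lemma lsub_mod_ideal S : lsub S -> lsub (mod_ideal S).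
Proof.
have [I0 IP] := lsub_ideal; move=> [S0 SP].
split=> [|c p q [p' Sp Ip] [q' Sq Iq]]; first by exists 0; rewrite ?subr0.
exists (c *: p' + q'); first exact: SP.
by rewrite opprD addrACA -scalerBr; exact: IP.
Qed.

Lemma mod_ideal_sub S p : S p -> mod_ideal S p.
Proof. by move=> Sp; exists p; rewrite // subrr; exact: ideal0. Qed.

Lemma mod_ideal_congr S p q : I (p - q) -> mod_ideal S q -> mod_ideal S p.
Proof.
by move=> Ipq [r Sr Ir]; exists r => //; rewrite -(subrKA q); exact: ideal_add.
Qed.

Lemma mod_idealM (S S' S'' : set A) : (forall p q, S p -> S' q -> S'' (p * q)) ->
  forall p q, mod_ideal S p -> mod_ideal S' q -> mod_ideal S'' (p * q).
Proof.
move=> H p q [p' Sp Ip] [q' Sq Iq]; exists (p' * q'); first exact: H.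
rewrite (mulrB_split p q p' q'); apply: ideal_add.
  exact: ideal_right.
exact: ideal_left.
Qed.

Lemma letter_linear (S : set A) : lsub S -> lsub [set x : L | mod_ideal S (letter x)].
Proof.
move=> /lsub_mod_ideal[S0 SP]; split=> [|c x y Sx Sy] /=.
  apply: (mod_ideal_congr _ S0); rewrite subr0.
  have := letter_lin bracket (-1) (0 : L) 0; rewrite scaler0 addr0 scaleN1r addNr subr0; exact.
exact: (mod_ideal_congr (letter_lin bracket c x y) (SP _ _ _ Sx Sy)).
Qed.

Definition words0 k : set A := span_of (fun _ : unit => k == 0)%N (fun=> 1).
Definition words1 k : set A := span_of (fun t => wt t == k) (fun t => letter (g t)).
Definition words2 k : set A :=
  span_of (fun t => wt t.1 + wt t.2 == k)%N (fun t => letter (g t.1) * letter (g t.2)).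

Lemma spanM (U U' : Type) (J : pred U) (J' : pred U') (f : U -> A) (f' : U' -> A) (S : set A) :
  lsub S -> (forall t t', J t -> J' t' -> S (f t * f' t')) ->
  forall p q, span_of J f p -> span_of J' f' q -> S (p * q).
Proof.
move=> lS H p q Sp Sq.
have bl (c : rat) (u v w : A) : (c *: u + v) * w = c *: (u * w) + v * w by rewrite (mulrDl (c *: u) v w) (scalerAl c u w).
have br (c : rat) (u v w : A) : w * (c *: u + v) = c *: (w * u) + w * v by rewrite (mulrDr w (c *: u) v) (mulr_scale_rat c w u).
apply: (span_min lS _ (span_bilinear bl br Sp Sq)) => t /andP[]; exact: H.
Qed.

(** Nothing is claimed from depth 3 on, so that the statement is stable under products without
    restriction on the depth. *)
Definition low_words k d : set A :=
  match d with
  | 0 => mod_ideal (words0 k)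
  | 1 => mod_ideal (words1 k)
  | 2 => mod_ideal (words2 k)
  | _ => setT
  end.

Lemma lsub_low_words k d : lsub (low_words k d).
Proof. by case: d => [|[|[|d]]] //=; apply: lsub_mod_ideal; exact: lsub_span. Qed.

Lemma low_wordsM k d k' d' p q : low_words k d p -> low_words k' d' q ->
  low_words (k + k')%N (d + d')%N (p * q).
Proof.
have W0 : forall d', low_words k 0 p -> low_words k' d' q -> low_words (k + k')%N d' (p * q).
  move=> e; case: e => [|[|[|e]]] //=; apply: mod_idealM; apply: spanM; try exact: lsub_span.
  - move=> _ _ /eqP k0 /eqP k'0; rewrite mul1r.
    by apply: (span_gen (fun _ : unit => 1 : A) (t := tt)); rewrite k0 k'0.
  - move=> _ t /eqP k0 k't; rewrite mul1r.
    by apply: (span_gen (fun t => letter (g t))); rewrite k0.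
  - move=> _ t /eqP k0 k't; rewrite mul1r.
    by apply: (span_gen (fun t => letter (g t.1) * letter (g t.2))); rewrite k0.
case: d => [|[|[|d]]] // hp; first by move=> hq; exact: W0.
  case: d' => [|[|d']] //=; move: hp; rewrite /=; apply: mod_idealM; apply: spanM; try exact: lsub_span.
  - move=> t _ kt /eqP k'0.
    by rewrite mulr1 (_ : k + k' = k)%N ?k'0 ?addn0//; exact: (span_gen (fun t => letter (g t))).
  - move=> t t' /eqP kt /eqP kt'.
    by apply: (span_gen (fun t => letter (g t.1) * letter (g t.2)) (t := (t, t'))); rewrite /= kt kt'.
case: d' => [|d'] //=; move: hp; rewrite /=; apply: mod_idealM; apply: spanM; try exact: lsub_span.
move=> t _ kt /eqP k'0; rewrite mulr1.
by apply: (span_gen (fun t => letter (g t.1) * letter (g t.2))); rewrite k'0 addn0.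
Qed.

(** By [h2] a letter of depth 2 is a combination of brackets, each congruent to X Y - Y X; by [h0] a
    letter of depth 0 is the letter of 0. *)
Lemma graded_low_words k d p : enveloping_graded homogeneous k d p -> low_words k d p.
Proof.
elim=> {k d p} [|k d x hx|k d k' d' p q _ hp _ hq|k d|k d c p q _ hp _ hq].
- by apply: mod_ideal_sub; exact: (span_gen (fun _ : unit => 1 : A) (t := tt)).
- case: d hx => [|[|[|d]]] //= hx.
  + have [S0 _] := letter_linear (lsub_span (fun _ : unit => k == 0)%N (fun=> 1 : A)).
    by rewrite (h0 hx); exact: S0.
  + apply: (span_min (letter_linear (lsub_span _ _)) _ (h1 hx)) => t kt.
    by apply: mod_ideal_sub; exact: (span_gen (fun t => letter (g t))).
  + apply: (span_min (letter_linear (lsub_span _ _)) _ (h2 hx)) => t kt /=.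
    have [S0 SP] := lsub_span (fun t => wt t.1 + wt t.2 == k)%N (fun t => letter (g t.1) * letter (g t.2)).
    exists (letter (g t.1) * letter (g t.2) - letter (g t.2) * letter (g t.1)).
      rewrite addrC -scaleN1r; apply: SP.
        by apply: (span_gen (fun t => letter (g t.1) * letter (g t.2)) (t := (t.2, t.1))); rewrite /= addnC.
      exact: (span_gen (fun t => letter (g t.1) * letter (g t.2))).
    rewrite -opprB -scaleN1r -[_ *: _]addr0; have [I0 IP] := lsub_ideal; apply: IP => //.
    exact: letter_bracket.
- exact: low_wordsM.
- by have [] := lsub_low_words k d.
- by have [_ H] := lsub_low_words k d; exact: H.
Qed.

Lemma lsub_graded k d : lsub (enveloping_graded homogeneous k d).
Proof. by split=> [|c p q]; [exact: graded_zero|exact: graded_lin]. Qed.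

End LowDepth.

(** * Homogeneous elements of BEKMA in depths 1 and 2 *)

Section BekmaGenerators.
Local Notation P1 := (mpoly (1 + 1) rat).
Local Notation P := (mpoly (2 + 2) rat).

(** The projection to degree [e] fixes [v] and kills the generators of other degrees. *)
Lemma span_homogeneous n (T : Type) (g : T -> mpoly n rat) (deg : T -> nat) e v :
  (forall t, g t \is ishomog1 (deg t) (@mdeg n)) -> v \is ishomog1 e (@mdeg n) ->
  span_of xpredT g v -> span_of (fun t => deg t == e) g v.
Proof.
move=> gh vh Sv; rewrite -(pihomog_dE vh).
have pl (c : rat) (u w : mpoly n rat) : pihomog (@mdeg n) e (c *: u + w) = c *: pihomog (@mdeg n) e u + pihomog (@mdeg n) e w.
  exact: linearP.
have lS := lsub_span (fun t => deg t == e) g.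
apply: (span_min (lsub_preim pl lS) _ Sv) => t _ /=.
have [te|ne] := eqVneq (deg t) e.
  by rewrite (@pihomog_dE _ _ _ e); [apply: span_gen; rewrite te|rewrite -te; exact: gh].
by rewrite (pihomog_ne0 ne (gh t)); case: lS.
Qed.

Lemma bihomogeneous_dhomog k d (M : BARI) i : bihomogeneous k d M ->
  bari_val M i \is ishomog1 (k - i) (@mdeg (i + i)).
Proof. by move=> [_ Mk]; apply/dhomogP => m /Mk <-; rewrite addnK. Qed.

Lemma bihomogeneous_lt k d (M : BARI) i : bihomogeneous k d M -> (k < i)%N -> bari_val M i = 0.
Proof.
move=> [_ Mk] ki; apply/eqP; rewrite -msupp_eq0; apply/eqP.
case E : (msupp (bari_val M i)) => [//|m s]; have := Mk i m; rewrite E mem_head => /(_ isT); lia.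
Qed.

Lemma bekma_ext (A B : BEKMA) : (forall d, bari_val A d = bari_val B d) -> A = B.
Proof. by move=> AB; do 2 apply: val_inj; exact: bimouldP. Qed.

Definition concentrated d : set BEKMA := [set A | forall i, i <> d -> bari_val A i = 0].

Lemma lsub_concentrated d : lsub (concentrated d).
Proof.
split=> [|c A B hA hB] i id //.
by rewrite bekma_valP bari_valP hA// hB// scaler0 addr0.
Qed.

(** An element with a single component is determined by it, so a linear combination of polynomials
    lifts to BEKMA. *)
Lemma span_concentrated d (T : Type) (J : pred T) (X : T -> BEKMA) (A : BEKMA) :
  (forall t, concentrated d (X t)) -> concentrated d A ->
  span_of J (fun t => bari_val (X t) d) (bari_val A d) -> span_of J X A.
Proof.
move=> Xd Ad SA; have [L0 LP] := lsub_span J X; have [C0 CP] := lsub_concentrated d.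
suff [B [SB Bd BA]] : exists B : BEKMA, [/\ span_of J X B, concentrated d B & bari_val B d = bari_val A d].
  rewrite (_ : A = B)//; apply: bekma_ext => i; have [->//|/eqP id] := eqVneq i d.
  by rewrite Ad// Bd.
pose S := [set p | exists B : BEKMA, [/\ span_of J X B, concentrated d B & bari_val B d = p]].
suff SS : lsub S by apply: (span_min SS _ SA) => t Jt; exists (X t); split=> //; exact: span_gen.
split=> [|c p q [B [SB Bd <-]] [B' [SB' Bd' <-]]]; first by exists 0; split.
by exists (c *: B + B'); split=> //; [exact: LP|exact: CP].
Qed.

Lemma bm_eval_depth1 n (A B : bimould) (w w' : seq (mpoly n rat * mpoly n rat)) :
  (forall i, i <> 1%N -> A i = 0) -> (forall i, i <> 1%N -> B i = 0) ->
  (size w + size w' <> 2)%N -> bm_eval A w * bm_eval B w' = 0.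
Proof.
move=> A1 B1 ww'; have [w1|/eqP/A1/bm_eval0->] := eqVneq (size w) 1%N; last by rewrite mul0r.
by rewrite (bm_eval0 (B1 _ _)) ?mulr0// => w'1; rewrite w1 w'1 in ww'.
Qed.

Lemma ari_depth1 (A B : BARI) d : (forall i, i <> 1%N -> bari_val A i = 0) ->
  (forall i, i <> 1%N -> bari_val B i = 0) -> d <> 2 -> bari_val (ari A B) d = 0.
Proof.
case: A B => A Ab [B Bb] /= A1 B1 d2.
have mu0 (A' B' : bimould) : (forall i, i <> 1%N -> A' i = 0) ->
    (forall i, i <> 1%N -> B' i = 0) -> bm_mu A' B' d = 0.
  move=> A1' B1'; rewrite /bm_mu /mu_at size_gword big1// => j _.
  by apply: bm_eval_depth1 => //; rewrite -size_cat cat_take_drop size_gword.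
have arit0 (A' B' : bimould) : (forall i, i <> 1%N -> A' i = 0) ->
    (forall i, i <> 1%N -> B' i = 0) -> bm_arit B' A' d = 0.
  move=> A1' B1'; rewrite /bm_arit /arit_at size_gword.
  rewrite !big1 ?subr0// => i _; apply: big1 => j /andP[ij jd]; apply: bm_eval_depth1 => //.
    have jd' : (j <= size (gword d))%N by rewrite size_gword -ltnS.
    rewrite size_cat size_rceil size_sub_v size_block// size_drop size_gword.
    rewrite size_takel; last exact: leq_trans (ltnW jd) jd'.
    by move: jd jd'; rewrite size_gword; lia.
  have jd' : (j <= size (gword d))%N by rewrite size_gword ltnW.
  rewrite size_cat size_lceil size_sub_v size_block// size_drop size_gword.
  rewrite size_takel; last exact: leq_trans (ltnW ij) jd'.
  by move: ij jd; lia.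
rewrite -[LHS]/(bm_arit B A d - bm_arit A B d + (bm_mu A B d - bm_mu B A d)).
by rewrite !arit0// !mu0// !subrr addr0.
Qed.

Lemma homogeneous_bracket_poly t :
  bracket_poly (gen1 t.1) (gen1 t.2) \is ishomog1 ((weight1 t.1).-1 + (weight1 t.2).-1) (@mdeg (2 + 2)).
Proof.
have [hu1 hu2 hv1 hv2] := homogeneous4_vars.
have h1 := homogeneous_gen1 t.1; have h2 := homogeneous_gen1 t.2.
rewrite /bracket_poly /cyclic_sum 2!sub4B 4!sub4_tens.
have ht a b c d : a \is ishomog1 1 (@mdeg (2 + 2)) -> b \is ishomog1 1 (@mdeg (2 + 2)) ->
    c \is ishomog1 1 (@mdeg (2 + 2)) -> d \is ishomog1 1 (@mdeg (2 + 2)) ->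
    sub2 a b (gen1 t.1) * sub2 c d (gen1 t.2)
      - sub2 a b (gen1 t.2) * sub2 c d (gen1 t.1) \is ishomog1 ((weight1 t.1).-1 + (weight1 t.2).-1) (@mdeg (2 + 2)).
  move=> ha hb hc hd; apply: rpredB; first by apply: dhomogM; exact: homogeneous_sub2.
  by rewrite addnC; apply: dhomogM; exact: homogeneous_sub2.
apply: rpredD; first apply: rpredD; apply: ht => //; try exact: rpredD; exact: rpredB.
Qed.

Lemma bekma_gen_span k (M : BEKMA) : bihomogeneous k 1 M ->
  span_of (fun t => weight1 t == k) gen M.
Proof.
move=> Mk; have [Mc _] := Mk; have [S1 _] := bekma_span (asboolW (valP M)).
apply: (span_concentrated (d := 1%N)) => //; first by move=> t i; exact: gen_depth_ne.
rewrite (_ : (fun t => _) = gen1); last by apply/funext => t; rewrite gen_depth1.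
(* The weight 0 is set apart because of the truncated subtraction in [k - 1]. *)
have [k1|k1] := ltnP k 1; first by rewrite (bihomogeneous_lt Mk k1); case: (lsub_span (fun t => weight1 t == k) gen1).
rewrite (_ : (fun t => _) = (fun t => (weight1 t).-1 == (k - 1)%N)).
  exact: (span_homogeneous homogeneous_gen1 (bihomogeneous_dhomog 1 Mk) S1).
by apply/funext => t; rewrite /weight1; apply/eqP/eqP; lia.
Qed.

Lemma bekma_bracket_span k (M : BEKMA) : bihomogeneous k 2 M ->
  span_of (pair_weight k) (fun t => bekma_bracket (gen t.1) (gen t.2)) M.
Proof.
move=> Mk; have [Mc _] := Mk; have [_ S2] := bekma_span (asboolW (valP M)).
apply: (span_concentrated (d := 2%N)) => //.
  by move=> t i i2; apply: ari_depth1 => // j; exact: gen_depth_ne.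
rewrite (_ : (fun t => _) = (fun t => bracket_poly (gen1 t.1) (gen1 t.2))); last first.
  by apply/funext => t; rewrite [LHS]ari2 !gen_depth1.
have [k2|k2] := ltnP k 2.
  by rewrite (bihomogeneous_lt Mk k2); case: (lsub_span (pair_weight k) (fun t => bracket_poly (gen1 t.1) (gen1 t.2))).
rewrite (_ : pair_weight k = (fun t => (weight1 t.1).-1 + (weight1 t.2).-1 == (k - 2))%N).
  exact: (span_homogeneous homogeneous_bracket_poly (bihomogeneous_dhomog 2 Mk) S2).
by apply/funext => t; rewrite /pair_weight /weight1; apply/eqP/eqP; lia.
Qed.

Lemma bihomogeneous_depth0 k (M : BEKMA) : bihomogeneous k 0 M -> M = 0.
Proof.
move=> [Mc _]; apply: bekma_ext => -[|d]; last exact: Mc.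
by have /bariP[-> _] := valP (bekma_val M).
Qed.

End BekmaGenerators.

(** * Finite coordinates, and the rank of the symbol map *)

Section Coordinates.
Local Notation P1 := (mpoly (1 + 1) rat).
Local Notation P := (mpoly (2 + 2) rat).
Local Notation u1 := (uvar (ord0 : 'I_2)).
Local Notation u2 := (uvar (ord_max : 'I_2)).
Local Notation v1 := (vvar (ord0 : 'I_2)).
Local Notation v2 := (vvar (ord_max : 'I_2)).

(** Both indices of a generator of weight at most k are at most k, so finite types enumerate
    them. *)
Definition index1 k (i : 'I_k.+1 * 'I_k.+1) : nat * nat := (i.1 : nat, i.2 : nat).
Definition index2 k (i : ('I_k.+1 * 'I_k.+1) * ('I_k.+1 * 'I_k.+1)) := (index1 i.1, index1 i.2).

Lemma index1_inj k : injective (@index1 k).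
Proof. by move=> [i j] [i' j'] [/val_inj-> /val_inj->]. Qed.

Lemma index2_inj k : injective (@index2 k).
Proof. by move=> [i j] [i' j'] [/val_inj ? /val_inj ? /val_inj ? /val_inj ?]; congr (_, _); apply: index1_inj; congr (_, _); congr nat_of_ord. Qed.

Definition count1 k : nat := #|[pred i | weight1 (@index1 k i) == k]|.
Definition count2 k : nat := #|[pred i | pair_weight k (@index2 k i)]|.

Lemma index1P k t : (weight1 t <= k)%N -> exists i, @index1 k i = t.
Proof.
case: t => m n; rewrite /weight1 /= => tk.
have mk : (m < k.+1)%N by lia.
have nk : (n < k.+1)%N by lia.
by exists (Ordinal mk, Ordinal nk).
Qed.

Lemma index2P k t : pair_weight k t -> exists i, @index2 k i = t.
Proof.
case: t => t t'; rewrite /pair_weight /= => /eqP tk.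
have [i <-] : exists i, @index1 k i = t by apply: index1P; lia.
have [i' <-] : exists i, @index1 k i = t' by apply: index1P; lia.
by exists (i, i').
Qed.

Lemma coordP t c F G : coord t (c *: F + G) = c * coord t F + coord t G.
Proof. by rewrite /coord mcoeffD mcoeffZ. Qed.

Lemma has_dim_gen1_span k : has_dim (span_of (fun t => weight1 t == k) gen1) (count1 k).
Proof.
(* As 1 is the generator with index (0, 0), the coordinates of depth 2 also serve in depth 1. *)
apply: (has_dim_span_of (t := @index1 k) (f := fun t p => coord (t, (0, 0))%N (tens p 1))).
- by move=> i c u v; rewrite tensPl coordP.
- move=> i j _ _.
  have := coord_tens (index1 i, (0, 0))%N (index1 j, (0, 0))%N.
  by rewrite /= [gen1 (0, 0)%N]mulr1 expr0 => ->; rewrite xpair_eqE eqxx andbT (inj_eq (@index1_inj k)).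
- by move=> t /eqP tk; apply: index1P; rewrite tk.
Qed.

Lemma has_dim_tensor_space k : has_dim (tensor_space k) (count2 k).
Proof.
apply: (has_dim_span_of (t := @index2 k) (f := coord)).
- by move=> i c u v; exact: coordP.
- by move=> i j _ _; rewrite coord_tens (inj_eq (@index2_inj k)).
- exact: index2P.
Qed.

Definition dim_symbol_kernel k : nat := if odd k then 0%N else dim_bracket_kernel (k./2.-1).

Definition symbol F : P * P :=
  (F + sub4 u2 u1 v2 v1 F, 2%:R^-1 *: cyclic_sum (F - sub4 u2 u1 v2 v1 F)).

Lemma symbolP c F G : symbol (c *: F + G) = c *: symbol F + symbol G.
Proof.
congr (_, _); rewrite /= (sub4P u2 u1 v2 v1); first by rewrite addrACA scalerDr.
by rewrite opprD addrACA -scalerBr cyclic_sumP scalerDr !scalerA mulrC.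
Qed.

Lemma symbol_kernel F : symbol F = 0 <-> sub4 u2 u1 v2 v1 F = - F /\ cyclic_sum F = 0.
Proof.
have half (G : P) : 2%:R^-1 *: cyclic_sum (G + G) = cyclic_sum G.
  have := cyclic_sumP 1 G G; rewrite !(@scale1r rat P) => ->.
  by rewrite -mulr2n -scaler_nat scalerA mulVf// scale1r.
split=> [Z|[E1 E2]].
  have E1 : F + sub4 u2 u1 v2 v1 F = 0 := congr1 fst Z.
  have E2 : 2%:R^-1 *: cyclic_sum (F - sub4 u2 u1 v2 v1 F) = 0 := congr1 snd Z.
  have E : sub4 u2 u1 v2 v1 F = - F := esym (addr0_eq E1).
  split; first exact: E.
  by rewrite -(half F); move: E2; rewrite E opprK.
rewrite /symbol E1 subrr opprK; apply: (congr1 (pair 0)).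
exact: (etrans (half F) E2).
Qed.

Lemma has_dim_symbol_kernel k :
  has_dim [set F | tensor_space k F /\ symbol F = 0] (dim_symbol_kernel k).
Proof.
have T0 : tensor_space k 0 by case: (lsub_span (pair_weight k) (fun t => tens (gen1 t.1) (gen1 t.2))).
have S0 : symbol 0 = 0 := lin0 symbolP.
have triv : (forall t, ~~ pair_weight k t) -> has_dim [set F | tensor_space k F /\ symbol F = 0] 0.
  move=> J0; apply: has_dim0 => // F [[s sJ ->] _]; case: s sJ => [|a s] /=; first by rewrite big_nil.
  by rewrite (negbTE (J0 _)).
rewrite /dim_symbol_kernel; case: ifP => [ok|ek].
  by apply: triv => t; rewrite /pair_weight /weight1; apply/eqP; lia.
have [k0|k0] := eqVneq k 0%N; first by rewrite [in X in has_dim _ X]k0; apply: triv => t; rewrite /pair_weight /weight1; apply/eqP; lia.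
have kE : k = ((k./2.-1).*2).+2 by lia.
have := has_dim_bracket_kernel (k./2.-1); rewrite bracket_kernel_tensor -kE.
by congr has_dim; apply/seteqP; split=> F [TF] /symbol_kernel.
Qed.

Lemma has_dim_symbol_image k : exists2 n, has_dim [set w | exists2 F, tensor_space k F & w = symbol F] n
  & count2 k = (dim_symbol_kernel k + n)%N.
Proof.
exact: (has_dim_im symbolP (lsub_span _ _) (has_dim_tensor_space k) (has_dim_symbol_kernel k)).
Qed.

End Coordinates.

Lemma combination_step (V : lmodType rat) (c : rat) (a b d a' b' d' e : V) :
  c *: a + a' - (c *: b + b') - e = c *: (a - b - d) + (a' - b' - d') - (e - (c *: d + d')).
Proof.
rewrite opprB [RHS]addrA; congr (_ - e); rewrite addrACA -scalerDr !subrK.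
by rewrite opprD addrACA -scalerBr.
Qed.

(** * The symbol of an element of the enveloping algebra; depth 1 *)

Section EnvelopingDimension.
Local Notation P1 := (mpoly (1 + 1) rat).
Local Notation P := (mpoly (2 + 2) rat).
Local Notation u1 := (uvar (ord0 : 'I_2)).
Local Notation u2 := (uvar (ord_max : 'I_2)).
Local Notation v1 := (vvar (ord0 : 'I_2)).
Local Notation v2 := (vvar (ord_max : 'I_2)).
Local Notation A := (free_alg BEKMA).
Local Notation I := (enveloping_ideal bekma_bracket).
Local Notation U := (enveloping_graded (fun k d (M : BEKMA) => bihomogeneous k d M)).

Definition symbol_mul (p q : P1) : P * P := symbol (tens p q).

Lemma symbol_mulPl c p q r : symbol_mul (c *: p + q) r = c *: symbol_mul p r + symbol_mul q r.
Proof. by rewrite /symbol_mul tensPl symbolP. Qed.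
Lemma symbol_mulPr c p q r : symbol_mul r (c *: p + q) = c *: symbol_mul r p + symbol_mul r q.
Proof. by rewrite /symbol_mul tensPr symbolP. Qed.

Definition symbol_bilinear := Bilinear symbol_mulPl symbol_mulPr.

Definition part1 (M : BEKMA) : P1 := bari_val M 1.
(** A single letter has no symmetric part; its component of depth 2 belongs to the bracket part of
    the symbol. *)
Definition part2 (M : BEKMA) : P * P := (0, bari_val M 2).

Lemma part1P c M N : part1 (c *: M + N) = c *: part1 M + part1 N.
Proof. by []. Qed.
Lemma part2P c M N : part2 (c *: M + N) = c *: part2 M + part2 N.
Proof.
have E : 0 = c *: 0 + 0 :> P by rewrite scaler0 addr0.
exact: (congr2 pair E erefl).
Qed.
Lemma part1_bracket M N : part1 (bekma_bracket M N) = 0.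
Proof. exact: ari1. Qed.
(** In the commutator the symmetric parts cancel and the two halves of the bracket add up. *)
Lemma part2_bracket M N : part2 (bekma_bracket M N) =
  symbol_bilinear (part1 M) (part1 N) - symbol_bilinear (part1 N) (part1 M).
Proof.
rewrite /= /symbol_mul /symbol 2!tens_swap; set F := tens _ _; set G := tens _ _.
have E1 : 0 = F + G - (G + F) :> P by rewrite [G + F]addrC subrr.
have E2 : bari_val (ari M N) 2 = 2%:R^-1 *: cyclic_sum (F - G) - 2%:R^-1 *: cyclic_sum (G - F).
  rewrite ari2 -/F -/G -[G - F]opprB; set X := F - G.
  have -> : cyclic_sum (- X) = - cyclic_sum X by rewrite -[- X]sub0r (linB cyclic_sumP) (lin0 cyclic_sumP) sub0r.
  by rewrite scalerN opprK -scalerDr -mulr2n -scaler_nat scalerA mulVf// scale1r.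
exact: (congr2 pair E1 E2).
Qed.

Definition symbol_map : A -> truncated symbol_bilinear := tr_map symbol_bilinear part1 part2.
Definition symbol1 (p : A) : P1 := (symbol_map p).2.1.
Definition symbol2 (p : A) : P * P := (symbol_map p).2.2.

Lemma symbol_mapP c p q : symbol_map (c *: p + q) = c *: symbol_map p + symbol_map q.
Proof. exact: tr_mapP. Qed.
Lemma symbol1P c p q : symbol1 (c *: p + q) = c *: symbol1 p + symbol1 q.
Proof. by rewrite /symbol1 symbol_mapP. Qed.
Lemma symbol2P c p q : symbol2 (c *: p + q) = c *: symbol2 p + symbol2 q.
Proof. by rewrite /symbol2 symbol_mapP. Qed.

Lemma symbol_map_letter M : symbol_map (letter M) = (0, (part1 M, part2 M)).
Proof. exact: tr_map_letter. Qed.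

Lemma symbol2_word M N : symbol2 (letter M * letter N) = symbol (tens (part1 M) (part1 N)).
Proof.
rewrite /symbol2 /symbol_map tr_mapM !tr_map_letter.
rewrite -[LHS]/(0 *: part2 N + symbol (tens (part1 M) (part1 N)) + 0 *: part2 M).
by rewrite !scale0r add0r addr0.
Qed.

Lemma symbol_map_ideal p : I p -> symbol_map p = 0.
Proof. exact: (tr_map_ideal part1P part2P part1_bracket part2_bracket). Qed.

Lemma letter_comb c p q M N : I (p - letter M) -> I (q - letter N) ->
  I (c *: p + q - letter (c *: M + N)).
Proof.
move=> IM IN; have [I0 IP] := lsub_ideal bekma_bracket.
have := combination_step c p 0 (letter M) q 0 (letter N) (letter (c *: M + N)).
rewrite !subr0 scaler0 addr0 subr0 => ->.
rewrite -[X in I (_ + _ - X)]scale1r addrC -scaleNr.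
exact: (IP (-1) _ _ (letter_lin bekma_bracket c M N) (IP c _ _ IM IN)).
Qed.

Lemma letter0 : I (letter 0).
Proof.
have := letter_lin bekma_bracket (-1) (0 : BEKMA) 0.
by rewrite scaler0 addr0 scaleN1r addNr subr0; exact.
Qed.

Definition letters1 (q : A) : Prop := exists2 M, concentrated 1 M & I (q - letter M).

Lemma words1_letter k q : words1 weight1 gen k q -> letters1 q.
Proof.
apply: span_min => [|t _].
  split=> [|c p r [M Mc IM] [N Nc IN]].
    exists 0; first by case: (lsub_concentrated 1).
    have [I0 IP] := lsub_ideal bekma_bracket.
    by rewrite sub0r -scaleN1r -[_ *: _]addr0; apply: (IP) => //; exact: letter0.
  exists (c *: M + N); last exact: (letter_comb c IM IN).
  by have [_ H] := lsub_concentrated 1; exact: H.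
exists (gen t); first by move=> i; exact: gen_depth_ne.
by rewrite subrr; exact: ideal0.
Qed.

Lemma low_words_graded k d p : U k d p -> low_words bekma_bracket weight1 gen k d p.
Proof.
exact: (graded_low_words bihomogeneous_depth0 bekma_gen_span bekma_bracket_span).
Qed.

Lemma gen_bihomogeneous t : bihomogeneous (weight1 t) 1 (gen t).
Proof.
split=> [i|i]; first exact: gen_depth_ne.
have [->|/eqP i1] := eqVneq i 1%N; last by move=> m; rewrite gen_depth_ne// msupp0.
by move=> m; rewrite gen_depth1 => /(dhomogP _ _ _ (homogeneous_gen1 t)) ->; rewrite addn1.
Qed.

Lemma symbol1_gen t : symbol1 (letter (gen t)) = gen1 t.
Proof. by rewrite /symbol1 symbol_map_letter /part1 /= -gen_depth1. Qed.

(** Modulo the ideal an element of depth 1 is a single letter, and a letter concentrated in depth 1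
    is determined by its polynomial. *)
Lemma has_dim_U1 k : has_dim_U_BEKMA k 1 (count1 k).
Proof.
have lU := lsub_graded (fun k d (M : BEKMA) => bihomogeneous k d M) k 1.
apply: (has_dim_mod_map symbol1P lU) => [p Ip|p Up p0|].
- by rewrite /symbol1 symbol_map_ideal.
- have [q Wq Iq] := low_words_graded Up; have [M Mc IM] := words1_letter Wq.
  have IpM : I (p - letter M) by rewrite -(subrKA q); exact: ideal_add.
  suff M0 : M = 0.
    by rewrite -[p](subrK (letter M)); apply: ideal_add => //; rewrite M0; exact: letter0.
  apply: bekma_ext => i; have [->|/eqP i1] := eqVneq i 1%N; last by rewrite Mc.
  have := congr1 (fun x => x.2.1) (symbol_map_ideal IpM).
  rewrite (linB symbol_mapP) -[LHS]/(symbol1 p - symbol1 (letter M)) p0 sub0r.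
  by rewrite /symbol1 symbol_map_letter => /(congr1 (fun x => - x)); rewrite opprK oppr0.
- rewrite (_ : [set _ | _] = span_of (fun t => weight1 t == k) gen1); first exact: has_dim_gen1_span.
  apply/seteqP; split=> [_ [p Up ->]|w].
    have [q Wq Iq] := low_words_graded Up.
    have -> : symbol1 p = symbol1 q.
      apply/eqP; rewrite -subr_eq0 -(linB symbol1P); apply/eqP.
      by rewrite /symbol1 symbol_map_ideal.
    apply: (span_min (lsub_preim symbol1P (lsub_span _ _)) _ Wq) => t tk /=.
    by rewrite symbol1_gen; exact: span_gen.
  apply: (span_min (lsub_im symbol1P lU)) => t /eqP tk.
  by exists (letter (gen t)); [rewrite -tk; apply: graded_letter; exact: gen_bihomogeneous|rewrite symbol1_gen].
Qed.

End EnvelopingDimension.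

(** * Depth 2 of the enveloping algebra *)

Section EnvelopingDimension2.
Local Notation P1 := (mpoly (1 + 1) rat).
Local Notation P := (mpoly (2 + 2) rat).
Local Notation u1 := (uvar (ord0 : 'I_2)).
Local Notation u2 := (uvar (ord_max : 'I_2)).
Local Notation v1 := (vvar (ord0 : 'I_2)).
Local Notation v2 := (vvar (ord_max : 'I_2)).
Local Notation A := (free_alg BEKMA).
Local Notation I := (enveloping_ideal bekma_bracket).
Local Notation U := (enveloping_graded (fun k d (M : BEKMA) => bihomogeneous k d M)).
Local Notation swap F := (sub4 u2 u1 v2 v1 F).

Definition gen_word t : A := letter (gen t.1) * letter (gen t.2).

(** On [tensor_space k], the linear lift from polynomials back to words of two generators. Defining
    it by coordinates makes it independent of how F is written as a combination. *)
Definition lift_word k (F : P) : A :=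
  \sum_(i : ('I_k.+1 * 'I_k.+1) * ('I_k.+1 * 'I_k.+1)) coord (index2 i) F *: gen_word (index2 i).

Lemma lift_wordP k c F G : lift_word k (c *: F + G) = c *: lift_word k F + lift_word k G.
Proof.
rewrite /lift_word scaler_sumr -big_split /=; apply: eq_bigr => i _.
by rewrite coordP scalerDl scalerA.
Qed.

Lemma lift_word_tens k t : pair_weight k t -> lift_word k (tens (gen1 t.1) (gen1 t.2)) = gen_word t.
Proof.
move=> tk; have [i it] := index2P tk.
rewrite /lift_word (bigD1 i) //= coord_tens it eqxx scale1r big1 ?addr0 // => j ji.
by rewrite coord_tens -it (inj_eq (@index2_inj k)) (negbTE ji) scale0r.
Qed.

(** Besides the polynomial F of a combination q of words, this keeps the element M of BEKMA to which
    q minus q with exchanged letters is congruent; all clauses are linear in q. *)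
Definition symbol_lift k (q : A) : Prop := exists (F : P) (M : BEKMA),
  [/\ q = lift_word k F, concentrated 2 M, I (lift_word k F - lift_word k (swap F) - letter M)
    & symbol2 q = (F + swap F, 2%:R^-1 *: bari_val M 2)].

Lemma words2_symbol_lift k q : words2 weight1 gen k q -> symbol_lift k q.
Proof.
apply: span_min => [|t tk].
  split=> [|c p r [F [M [pE Mc IM sp]]] [G [N [rE Nc IN sr]]]].
    have H0 : lift_word k 0 = 0 := lin0 (@lift_wordP k).
    have S0 : swap 0 = 0 := lin0 (sub4P u2 u1 v2 v1).
    exists 0, 0; rewrite S0 H0; split=> //.
      rewrite subr0 sub0r -scaleN1r -[_ *: _]addr0.
      have [I0 IP] := lsub_ideal bekma_bracket; exact: (IP _ _ _ letter0 I0).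
    rewrite (lin0 symbol2P); have E1 : 0 = 0 + 0 :> P by rewrite addr0.
    have E2 : 0 = 2%:R^-1 *: 0 :> P by rewrite scaler0.
    exact: (congr2 pair E1 E2).
  exists (c *: F + G), (c *: M + N); split.
  - by rewrite pE rE lift_wordP.
  - by have [_ H] := lsub_concentrated 2; exact: H.
  - rewrite (sub4P u2 u1 v2 v1) 2!lift_wordP opprD addrACA -scalerBr.
    exact: (letter_comb c IM IN).
  - rewrite symbol2P sp sr (sub4P u2 u1 v2 v1) bekma_valP bari_valP.
    have E1 : c *: (F + swap F) + (G + swap G) = c *: F + G + (c *: swap F + swap G).
      by rewrite scalerDr addrACA.
    have E2 : c *: (2%:R^-1 *: bari_val M 2) + 2%:R^-1 *: bari_val N 2 =
        2%:R^-1 *: (c *: bari_val M 2 + bari_val N 2).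
      by rewrite scalerDr !scalerA mulrC.
    exact: (congr2 pair E1 E2).
exists (tens (gen1 t.1) (gen1 t.2)), (bekma_bracket (gen t.1) (gen t.2)).
rewrite tens_swap lift_word_tens //.
rewrite (lift_word_tens (t := (t.2, t.1))); last by rewrite /pair_weight /= addnC.
split=> //.
- by move=> i i2; apply: ari_depth1 => // j; exact: gen_depth_ne.
- exact: letter_bracket.
- rewrite symbol2_word /symbol /part1 2!gen_depth1 tens_swap.
  by rewrite [bari_val _ 2]ari2 2!gen_depth1.
Qed.

(** If the symbol vanishes, then F is antisymmetric and M = 0, so 2 q is congruent to the letter of
    0. *)
Lemma symbol2_kernel k q : words2 weight1 gen k q -> symbol2 q = 0 -> I q.
Proof.
move=> /words2_symbol_lift[F [M [qE Mc IM sq]]] q0; rewrite sq in q0.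
have E1 : F + swap F = 0 := congr1 fst q0.
have E2 : 2%:R^-1 *: bari_val M 2 = 0 := congr1 snd q0.
have M0 : M = 0.
  apply: bekma_ext => i; have [->|/eqP i2] := eqVneq i 2%N; last by rewrite Mc.
  have := congr1 (fun x => 2%:R *: x) E2.
  by rewrite scalerA mulfV// scale1r scaler0.
have [I0 IP] := lsub_ideal bekma_bracket.
have S : lift_word k (swap F) = - lift_word k F.
  have -> : swap F = - F := esym (addr0_eq E1).
  by rewrite -scaleN1r -[_ *: F]addr0 lift_wordP (lin0 (@lift_wordP k)) addr0 scaleN1r.
have I2 : I (q + q).
  have -> : q + q = 1 *: (lift_word k F - lift_word k (swap F) - letter M) + letter 0.
    by rewrite S M0 scale1r subrK opprK qE.
  by apply: (IP 1 _ _ IM); exact: letter0.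
have -> : q = 2%:R^-1 *: (q + q) + 0.
  by rewrite addr0 -mulr2n -scaler_nat scalerA mulVf// scale1r.
exact: (IP _ _ _ I2 I0).
Qed.

Lemma gen_word_graded t k : pair_weight k t -> U k 2 (gen_word t).
Proof.
move=> /eqP <-.
apply: (@graded_mul _ (fun k d (M : BEKMA) => bihomogeneous k d M) _ 1 _ 1);
  by apply: graded_letter; exact: gen_bihomogeneous.
Qed.

Lemma symbol2_gen_word t : symbol2 (gen_word t) = symbol (tens (gen1 t.1) (gen1 t.2)).
Proof. by rewrite symbol2_word /part1 2!gen_depth1. Qed.

Lemma has_dim_U2 k : exists2 n, has_dim_U_BEKMA k 2 n & count2 k = (dim_symbol_kernel k + n)%N.
Proof.
have [n Wn nE] := has_dim_symbol_image k; exists n => //.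
have lU := lsub_graded (fun k d (M : BEKMA) => bihomogeneous k d M) k 2.
have congr_ideal p q : I (p - q) -> symbol2 p = symbol2 q.
  move=> Ipq; apply/eqP; rewrite -subr_eq0 -(linB symbol2P); apply/eqP.
  by rewrite /symbol2 symbol_map_ideal.
apply: (has_dim_mod_map symbol2P lU) => [p Ip|p Up p0|].
- by rewrite /symbol2 symbol_map_ideal.
- have [q Wq Iq] := low_words_graded Up.
  rewrite -[p](subrK q); apply: ideal_add => //; apply: (symbol2_kernel Wq).
  by rewrite -(congr_ideal _ _ Iq).
- rewrite (_ : [set _ | _] = [set w | exists2 F, tensor_space k F & w = symbol F]) //.
  apply/seteqP; split=> [_ [p Up ->]|_ [F TF ->]].
    have [q Wq Iq] := low_words_graded Up; rewrite /= (congr_ideal _ _ Iq).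
    have lT := lsub_im symbolP (lsub_span (pair_weight k) (fun t => tens (gen1 t.1) (gen1 t.2))).
    apply: (span_min (lsub_preim symbol2P lT) _ Wq) => t tk.
    by exists (tens (gen1 t.1) (gen1 t.2)); [exact: (span_gen (fun t => tens (gen1 t.1) (gen1 t.2)))|exact: symbol2_gen_word].
  apply: (span_min (lsub_preim symbolP (lsub_im symbol2P lU)) _ TF) => t tk.
  by exists (gen_word t); [exact: gen_word_graded|rewrite symbol2_gen_word].
Qed.

End EnvelopingDimension2.

(** * Coefficients of the generating series *)

Section Coefficients.

Definition psmono (p n : nat) : pseries := fun k d => ((k == p) && (d == n))%N%:R.

Lemma psmulC F G : psmul F G = psmul G F.
Proof.
apply/funext => k; apply/funext => d; rewrite /psmul (reindex_inj rev_ord_inj) /=.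
apply: eq_bigr => i _; rewrite (reindex_inj rev_ord_inj) /=; apply: eq_bigr => j _.
by rewrite !subSS !subKn -1?ltnS// mulrC.
Qed.

Lemma psmul_mono p n G k d :
  psmul (psmono p n) G k d = if (p <= k)%N && (n <= d)%N then G (k - p)%N (d - n)%N else 0.
Proof.
rewrite /psmul /psmono; case: ifP => [/andP[pk nd]|H].
  rewrite -ltnS in pk; rewrite -ltnS in nd.
  rewrite (bigD1 (Ordinal pk)) //= (bigD1 (Ordinal nd)) //= !eqxx mul1r.
  rewrite !big1 ?addr0 // => [i|j] ne; last by rewrite -val_eqE /= in ne; rewrite (negbTE ne) mul0r.
  by rewrite big1 // => j _; rewrite -val_eqE /= in ne; rewrite (negbTE ne) mul0r.
rewrite big1 // => i _; rewrite big1 // => j _.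
case: andP => [[/eqP ip /eqP jn]|]; last by rewrite mul0r.
have := ltn_ord i; have := ltn_ord j; rewrite ip jn !ltnS => nd pk.
by rewrite pk nd in H.
Qed.

Lemma psexp_mono p n m : psexp (psmono p n) m = psmono (p * m)%N (n * m)%N.
Proof.
elim: m => [|m IH]; first by rewrite !muln0.
rewrite -[LHS]/(psmul (psmono p n) (psexp (psmono p n) m)) IH.
apply/funext => k; apply/funext => d; rewrite psmul_mono /psmono !mulnS.
have E a b x : (a <= x)%N -> (x - a == b)%N = (x == a + b)%N by lia.
case: ifP => [/andP[pk nd]|H]; first by rewrite !E.
by case: eqP => [kE|] //; case: eqP => [dE|] //; move: H; rewrite kE dE !leq_addr.
Qed.

Lemma serD_coef k d : serD k d = (~~ odd k && (d == 0))%N%:R.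
Proof.
have V : psmul (1 - psexp psx 2)%PS serD = psone by apply: psmulV; rewrite -[psx]/(psmono 1 0) psexp_mono.
have R k' d' : serD k' d' - (if (2 <= k')%N then serD (k' - 2)%N d' else 0) = ((k' == 0) && (d' == 0))%N%:R.
  rewrite -[RHS](congr1 (fun F : pseries => F k' d') V).
  rewrite -[psx]/(psmono 1 0) psexp_mono /psmul.
  have -> : \sum_(i < k'.+1) \sum_(j < d'.+1)
      ((1 - psmono (1 * 2) (0 * 2))%PS i j * serD (k' - i)%N (d' - j)%N) =
      psmul (psmono 0 0) serD k' d' - psmul (psmono 2 0) serD k' d'.
    rewrite /psmul -sumrB; apply: eq_bigr => i _; rewrite -sumrB; apply: eq_bigr => j _.
    by rewrite -mulrBl.
  by rewrite !psmul_mono !leq0n !andbT !subn0.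
elim/ltn_ind: k => k IH; have := R k d.
case: k IH => [|[|k]] IH /=; rewrite ?subr0 ?andbF //.
by move=> /eqP; rewrite subr_eq add0r subn2 => /eqP->; rewrite IH // negbK.
Qed.

Lemma serO1_coef k d : serO1 k d = (odd k && (d == 0))%N%:R.
Proof.
rewrite /serO1 -[psx]/(psmono 1 0) psmul_mono andbT subn0.
by case: k => [|k] //=; rewrite subn1 serD_coef.
Qed.

Lemma psmul_depth0 F G k : psmul F G k 0 = \sum_(i < k.+1) F i 0%N * G (k - i)%N 0%N.
Proof. by apply: eq_bigr => i _; rewrite big_ord1. Qed.

Definition count_depth1 k : nat := if odd k then k./2.+1 else 0.

Lemma sum_even n : (\sum_(i < n.+1) ~~ odd i = n./2.+1)%N.
Proof.
elim/ltn_ind: n => -[|[|n]] IH; rewrite 1?big_ord1 1?[LHS]big_ord_recr ?big_ord1 //.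
by rewrite /= big_ord_recr /= IH //; case: odd; rewrite /= ?addn0 ?addn1.
Qed.

Lemma serDO1_depth0 k : psmul serD serO1 k 0 = (count_depth1 k)%:Z.
Proof.
rewrite psmul_depth0 /count_depth1.
have E (i : 'I_k.+1) : serD i 0%N * serO1 (k - i)%N 0%N = ((odd k && ~~ odd i) : nat)%:R.
  rewrite serD_coef serO1_coef !andbT -natrM mulnb; congr (_%:R); congr nat_of_bool.
  by rewrite oddB -1?ltnS //; case: (odd i); rewrite /= ?andbF // addbF andbT.
rewrite (eq_bigr _ (fun i _ => E i)) -natr_sum natz; congr Posz.
case: (odd k) => /=; first exact: sum_even.
by rewrite big1.
Qed.

Lemma serDO1_depth1 k : psmul serD serO1 k 1 = 0.
Proof.
rewrite /psmul big1 // => i _; rewrite !big_ord_recl big_ord0 serD_coef serO1_coef /= andbF mulr0 add0r.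
by rewrite serD_coef andbF mul0r addr0.
Qed.

(** The factor 1 / (1 - x^2) means a recursion in steps of two, the one that defines
    [dim_bracket_kernel]; odd weights contribute 0. *)
Lemma serDM2_depth0 k : psmul serD serM2 k 0 = (dim_symbol_kernel k)%:Z.
Proof.
rewrite psmul_depth0.
have step n : \sum_(i < n.+3) serD i 0%N * serM2 (n.+2 - i)%N 0%N =
    serM2 n.+2 0%N + \sum_(i < n.+1) serD i 0%N * serM2 (n - i)%N 0%N.
  rewrite [LHS]big_ord_recl [X in _ + X = _]big_ord_recl !serD_coef /= mul1r mul0r add0r subn0; congr (_ + _).
  by apply: eq_bigr => i _; rewrite !serD_coef /= negbK.
elim/ltn_ind: k => -[|[|k]] IH.
- by rewrite big_ord1 /serM2 mulr0.
- by rewrite !big_ord_recl big_ord0 /serM2 !mulr0.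
rewrite step IH // /serM2 dimM_eq /dim_symbol_kernel /= negbK andbT.
case: ifP => [k4|]; last by case: k {IH} => [|[|k]].
case: ifP => ok; first by rewrite /dim_modular /= negbK ok.
have kE : k = ((k./2.-1).*2).+2 by lia.
rewrite -PoszD; congr Posz; rewrite {1}kE.
have -> : k./2 = (k./2.-1).+1 by lia.
by [].
Qed.

Let denom : pseries := (1 - serD * serO1 * psy + serD * serM2 * psy ^+ 2 - serD * psx * serS * psy ^+ 3)%PS.

Lemma denomE k d : denom k d = ((k == 0) && (d == 0))%N%:R
  - (if (1 <= d)%N then psmul serD serO1 k (d - 1)%N else 0)
  + (if (2 <= d)%N then psmul serD serM2 k (d - 2)%N else 0)
  - (if (3 <= d)%N then psmul (psmul serD psx) serS k (d - 3)%N else 0).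
Proof.
have Y : psy = psmono 0 1 by [].
have M G n : psmul G (psexp psy n) k d = if (n <= d)%N then G k (d - n)%N else 0.
  by rewrite Y psexp_mono psmulC psmul_mono mul0n mul1n subn0.
rewrite /denom /psadd /psopp !M; congr (_ - _ + _ - _).
by rewrite Y psmulC psmul_mono /= subn0.
Qed.

Lemma denom0 k : denom k 0 = (k == 0)%N%:R.
Proof. by rewrite denomE /= !subr0 ?addr0 andbT. Qed.

Lemma denom1 k : denom k 1 = - (count_depth1 k)%:Z.
Proof. by rewrite denomE /= andbF sub0r subr0 addr0 serDO1_depth0. Qed.

Lemma denom2 k : denom k 2 = (dim_symbol_kernel k)%:Z.
Proof. by rewrite denomE /= andbF subr0 serDO1_depth1 subrr add0r serDM2_depth0. Qed.

Lemma sum_delta (f : nat -> int) k : \sum_(i < k.+1) (i == 0 :> nat)%N%:R * f i = f 0%N.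
Proof. by rewrite big_ord_recl /= mul1r big1 ?addr0 // => i _; rewrite mul0r. Qed.

(** The coefficients of y^0, y^1 and y^2 are solved for successively from this identity rather than
    from the geometric series that defines the inverse. *)
Lemma e_coef_convolution k d : \sum_(i < k.+1) \sum_(j < d.+1) denom i j * e_coef (k - i)%N (d - j)%N =
  ((k == 0) && (d == 0))%N%:R.
Proof.
have V : psmul denom e_coef = psone by apply: psmulV; exact: denom0.
exact: (congr1 (fun F : pseries => F k d) V).
Qed.

Lemma e_coef0 k : e_coef k 0 = (k == 0)%N%:R.
Proof.
have := e_coef_convolution k 0; rewrite andbT => <-.
rewrite -{1}[k]subn0 -(sum_delta (fun i => e_coef (k - i)%N 0%N) k).
by apply: eq_bigr => i _; rewrite big_ord1 denom0.
Qed.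

Lemma sum_delta_rev (f : nat -> int) k : \sum_(i < k.+1) f i * (k - i == 0)%N%:R = f k.
Proof.
rewrite big_ord_recr /= subnn mulr1 big1 ?add0r // => i _.
by rewrite subn_eq0 leqNgt ltn_ord mulr0.
Qed.

Lemma e_coef1 k : e_coef k 1 = (count_depth1 k)%:Z.
Proof.
have := e_coef_convolution k 1; rewrite andbF.
under eq_bigr => i _ do rewrite !big_ord_recl big_ord0 /= denom0 denom1 subn0 subnn e_coef0 addr0.
rewrite big_split /= (sum_delta (fun i => e_coef (k - i)%N 1%N)) subn0.
rewrite (sum_delta_rev (fun i => - (count_depth1 i)%:Z)) => /eqP.
by rewrite subr_eq0 => /eqP.
Qed.

Lemma e_coef2 k : e_coef k 2 =
  (\sum_(i < k.+1) count_depth1 i * count_depth1 (k - i))%N%:Z - (dim_symbol_kernel k)%:Z.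
Proof.
have := e_coef_convolution k 2; rewrite andbF.
under eq_bigr => i _ do rewrite !big_ord_recl big_ord0 /= denom0 denom1 denom2 subn0 subnn subn1 e_coef0 e_coef1 addr0.
rewrite big_split /= (sum_delta (fun i => e_coef (k - i)%N 2%N)) subn0 big_split /=.
rewrite (sum_delta_rev (fun i => (dim_symbol_kernel i)%:Z)) => /eqP.
rewrite addr_eq0 => /eqP->; rewrite opprD; congr (_ - _).
rewrite -sumrN -[RHS]natz natr_sum; apply: eq_bigr => i _.
by rewrite mulNr opprK natrM !natz.
Qed.

(** For odd k, each m up to [k./2] admits exactly one n. The bound K is separate from k since
    [count2_eq] needs all weights up to a given one over the same index type. *)
Lemma card_weight1 K k : (k <= K)%N -> #|[pred i | weight1 (@index1 K i) == k]| = count_depth1 k.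
Proof.
move=> kK; rewrite -sum1_card big_mkcond /=.
rewrite -(pair_bigA _ (fun m n : 'I_K.+1 => if weight1 (m : nat, n : nat) == k then 1 else 0)%N) /=.
have inner (m : 'I_K.+1) : (\sum_(n < K.+1) (if weight1 (m : nat, n : nat) == k then 1 else 0) = (odd k && (m.*2 < k)))%N.
  case: andP => [[ok mk]|H] /=.
    have nK : (k./2 - m < K.+1)%N by lia.
    rewrite (bigD1 (Ordinal nK)) //= {1}/weight1 /= (_ : _ == k)%N; last by apply/eqP; lia.
    rewrite big1 // => n; rewrite -val_eqE /= /weight1 /= => /eqP nn.
    by case: eqP => // E; exfalso; apply: nn; lia.
  rewrite big1 // => n _; rewrite /weight1 /=; case: eqP => // E; exfalso; apply: H; split; lia.
rewrite (eq_bigr _ (fun m _ => inner m)) /count_depth1; case: ifP => ok; last by rewrite big1.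
have h : (k./2.+1 <= K.+1)%N by lia.
rewrite -[RHS]card_ord -sum1_card (big_ord_widen K.+1 (fun=> 1%N) h) [RHS]big_mkcond /=.
by apply: eq_bigr => m _; rewrite ltnS (_ : (m.*2 < k) = (m <= k./2))%N; [case: leqP|lia].
Qed.

Lemma count1_eq k : count1 k = count_depth1 k.
Proof. exact: card_weight1. Qed.

Lemma count2_eq k : count2 k = (\sum_(j < k.+1) count_depth1 j * count_depth1 (k - j))%N.
Proof.
have E (j : 'I_k.+1) : (count_depth1 j * count_depth1 (k - j) =
    \sum_(i : 'I_k.+1 * 'I_k.+1) \sum_(i' : 'I_k.+1 * 'I_k.+1)
      ((weight1 (index1 i) == j) && (weight1 (index1 i') == k - j)))%N.
  rewrite -(@card_weight1 k) -1?ltnS // -(@card_weight1 k) ?leq_subr //.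
  rewrite -!sum1_card !big_mkcond big_distrl /=; apply: eq_bigr => i _.
  by rewrite [X in (_ * X)%N]big_mkcond big_distrr /=; apply: eq_bigr => i' _; rewrite !inE; case: eqP; case: eqP.
rewrite (eq_bigr _ (fun j _ => E j)) exchange_big /= /count2 -sum1_card big_mkcond /=.
rewrite -(pair_bigA _ (fun i i' : 'I_k.+1 * 'I_k.+1 => if pair_weight k (index1 i, index1 i') then 1 else 0)%N) /=.
apply: eq_bigr => i _; rewrite exchange_big /=; apply: eq_bigr => i' _.
rewrite /pair_weight /=; case: eqP => [wE|wE].
  have wk : (weight1 (index1 i) < k.+1)%N by lia.
  rewrite (bigD1 (Ordinal wk)) //= eqxx (_ : _ == _ - _)%N; last by apply/eqP; lia.
  by rewrite big1 // => j; rewrite -val_eqE /= eq_sym => /negbTE->.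
rewrite big1 // => j _; case: eqP => // wj; case: eqP => // wj'; exfalso.
by have := ltn_ord j; lia.
Qed.

End Coefficients.

Theorem theorem1p6 (k d : nat) (hd : d = 1%N \/ d = 2%N) :
  exists2 n : nat, has_dim_U_BEKMA k d n & n%:Z = e_coef k d.
Proof.
case: hd => ->; first by exists (count1 k); [exact: has_dim_U1|rewrite count1_eq e_coef1].
have [n Un nE] := has_dim_U2 k; exists n => //.
by rewrite e_coef2 -count2_eq nE PoszD addrAC subrr add0r.
Qed.
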